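(* Let $\Omega$ be a bounded open subset in $\mathbb{R}^n$ whose boundary $\Sigma=\partial\overline{\Omega}$ is a star-shaped hypersurface. Then $\Sigma$ is static regular in $\mathbb{R}^n\setminus\Omega$.
   Context: $n\ge3$, $\alpha\in(0,1)$, $q\in(\frac{n-2}{2},n-2)$; $\bar g$ is the Euclidean metric on $\mathbb{R}^n$; $\Sigma$ is a connected embedded smooth hypersurface. Star-shaped means star-shaped with respect to some point $x_0$ (which may be taken as the origin): $\bar g(x-x_0,\nu)>0$ for all $x\in\Sigma$, with $\nu$ the unit normal pointing away from $\Omega$, so that the dilations of $\Sigma$ about $x_0$ form a smooth foliation near $\Sigma$. For $s\in\mathbb{R}$, $C^{k,\alpha}_{-s}(\mathbb{R}^n\setminus\Omega)$ is the set of $C^{k,\alpha}_{\mathrm{loc}}$ functions with finite norm $\sum_{|I|\le k}\sup_x(1+|x|)^{|I|+s}|\partial^If(x)|+\sum_{|I|=k}\sup_{0<|x-y|\le|x|/2}(1+|x|)^{\alpha+|I|+s}\frac{|\partial^If(x)-\partial^If(y)|}{|x-y|^\alpha}$, $x,y\in\mathbb{R}^n\setminus\Omega$; tensors or pairs belong to it if all Cartesian components do. For a metric $g$ on $\mathbb{R}^n\setminus\Omega$, $\nu_g$ is the unit normal on $\Sigma$ pointing away from $\Omega$; $h^\intercal$ is the restriction of a $(0,2)$-tensor $h$ to the tangent bundle of $\Sigma$; $A_g=\frac12(L_{\nu_g}g)^\intercal$, $H_g=\mathrm{div}_\Sigma\nu_g$. $D\mathrm{Ric}|_{\bar g}(h)$,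 $DH|_{\bar g}(h)$, $DA|_{\bar g}(h)$ denote the derivatives at $s=0$ of $\mathrm{Ric}_{\bar g+sh}$, $H_{\bar g+sh}$, $A_{\bar g+sh}$. $\Sigma$ is static regular in $\mathbb{R}^n\setminus\Omega$ if for every symmetric $(0,2)$-tensor $h$ and scalar function $v$ with $(h,v)\in C^{2,\alpha}_{-q}(\mathbb{R}^n\setminus\Omega)$ satisfying $D\mathrm{Ric}|_{\bar g}(h)-\nabla^2_{\bar g}v=0$ and $\Delta_{\bar g}v=0$ in $\mathbb{R}^n\setminus\Omega$, and $h^\intercal=0$ and $DH|_{\bar g}(h)=0$ on $\Sigma$, one has $DA|_{\bar g}(h)=0$ on $\Sigma$. *)

(* Defs.v *)
From HB Require Import structures.
From mathcomp Require Import all_boot all_order all_algebra.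
From mathcomp Require Import all_classical all_reals all_analysis.

Set Implicit Arguments.
Unset Strict Implicit.
Unset Printing Implicit Defensive.

Import Order.TTheory GRing.Theory Num.Theory.
Import numFieldNormedType.Exports.

Local Open Scope classical_set_scope.
Local Open Scope ring_scope.

(* MathComp-Analysis.  Points and vectors of R^n are row vectors; their library
   norm `|x| is the sup norm, so the Euclidean length is [enorm].  A
   (0,2)-tensor field is a matrix-valued function, given by its Cartesian
   components.  Functions are total; for those living on a set E (in practice
   the complement of Omega) only the values on E matter. *)

Section Calculus.
Variables (R : realType) (n : nat).
Local Notation Rn := 'rV[R]_n.
Implicit Types (E : set Rn) (f : Rn -> R) (x : Rn).

Definition form (M : 'M[R]_n) (X Y : Rn) : R := (X *m M *m Y^T) 0 0.

Definition enorm x : R := Num.sqrt (\sum_i x 0 i ^+ 2).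

Definition basis_vec (i : 'I_n) : Rn := delta_mx 0 i.

Definition frontier E : set Rn := closure E `\` E°.

(* i-th partial derivative of a function on E: the ordinary one in the interior
   of E, its limit from the interior elsewhere. *)
Definition pd E (i : 'I_n) f x : R :=
  if `[< E° x >] then 'D_(basis_vec i) f x
  else lim ('D_(basis_vec i) f y @[y --> within E° (nbhs x)]).

(* C^k up to the boundary: the partial derivatives of order at most k exist in
   the interior of E and extend continuously to E. *)
Fixpoint Ck E (k : nat) f : Prop :=
  {within E, continuous f} /\
  match k with
  | 0 => True
  | k'.+1 => forall i, (forall x, E° x -> derivable f x (basis_vec i)) /\
                       Ck E k' (pd E i f)
  end.

Definition multi_index (k : nat) := {ffun 'I_n -> 'I_k.+1}.

Definition mi_order k (I : multi_index k) : nat := (\sum_i I i)%N.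

Definition pdI E k (I : multi_index k) f : Rn -> R :=
  foldr (fun i u => iter (I i) (pd E i) u) f (enum 'I_n).

Definition Ck_holder_loc E (k : nat) (alpha : R) f : Prop :=
  Ck E k f /\
  forall I : multi_index k, mi_order I = k -> forall x, E x ->
    exists (C : R) (U : set Rn), nbhs x U /\
      forall y z, U y -> U z -> E y -> E z ->
        `|pdI E I f y - pdI E I f z| <= C * enorm (y - z) `^ alpha.

Local Open Scope ereal_scope.

Definition holder_norm E (k : nat) (alpha s : R) f : \bar R :=
  \sum_(I : multi_index k | (mi_order I <= k)%N)
    ereal_sup [set ((1 + enorm x) `^ ((mi_order I)%:R + s)
                     * `|pdI E I f x|)%R%:E | x in E]
  + \sum_(I : multi_index k | mi_order I == k)
    ereal_sup [set ((1 + enorm z.1) `^ (alpha + (mi_order I)%:R + s)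
                     * (`|pdI E I f z.1 - pdI E I f z.2|
                        / enorm (z.1 - z.2) `^ alpha))%R%:E
              | z in [set z : Rn * Rn | [/\ E z.1, E z.2
                  & (0 < enorm (z.1 - z.2) <= enorm z.1 / 2)%R]]].

Local Close Scope ereal_scope.

(* The space C^{k,alpha}_{-s}(E). *)
Definition holder_space E (k : nat) (alpha s : R) f : Prop :=
  Ck_holder_loc E k alpha f /\ (holder_norm E k alpha s f < +oo)%E.

End Calculus.

Section Geometry.
Variables (R : realType) (n : nat).
Local Notation Rn := 'rV[R]_n.
Local Notation tensor := (Rn -> 'M[R]_n).
Implicit Types (E S Omega : set Rn) (g h : tensor) (v : Rn -> R) (p x X Y : Rn).

Definition ebar : tensor := fun=> 1%:M.

(* [christoffel E g k i j x] is Gamma^k_{ij}. *)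
Definition christoffel E g (k i j : 'I_n) x : R :=
  2^-1 * \sum_l invmx (g x) k l *
    (pd E i (fun y => g y j l) x + pd E j (fun y => g y i l) x
     - pd E l (fun y => g y i j) x).

Definition ricci E g (i j : 'I_n) x : R :=
  \sum_k (pd E k (christoffel E g k i j) x - pd E j (christoffel E g k i k) x)
  + \sum_k \sum_l
      (christoffel E g k k l x * christoffel E g l i j x
       - christoffel E g k j l x * christoffel E g l i k x).

Definition hess E v (i j : 'I_n) x : R := pd E i (pd E j v) x.

Definition laplace E v x : R := \sum_i hess E v i i x.

Definition smooth_hypersurface S : Prop :=
  forall p, S p -> exists (U : set Rn) (phi : Rn -> R),
    [/\ open U /\ U p,
        forall k, Ck U k phi,
        forall x, U x -> exists i, 'D_(basis_vec R i) phi x != 0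
      & S `&` U = [set x | U x /\ phi x = 0] ].

Definition tangent S p X : Prop :=
  exists gam : R -> Rn,
    [/\ gam 0 = p, \forall t \near 0, S (gam t) & is_derive (0 : R) 1 gam X].

Definition is_unit_normal Omega S g p (N : Rn) : Prop :=
  [/\ form (g p) N N = 1,
      forall X, tangent S p X -> form (g p) N X = 0
    & \forall t \near (0 : R)^'+, ~ Omega (p + t *: N)].

Definition unit_normal Omega S g p : Rn :=
  xget 0 [set N | is_unit_normal Omega S g p N].

Definition star_shaped Omega S : Prop :=
  exists x0, forall x, S x ->
    0 < form (ebar x) (x - x0) (unit_normal Omega S ebar x).

(* A vector field around p that agrees with the unit normal on S.  Restricted
   to tangent vectors, the first derivatives at p used in [second_ff] and
   [mean_curv] do not depend on the choice. *)
Definition normal_ext Omega S g p : Rn -> Rn :=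
  xget (fun=> 0) [set V : Rn -> Rn | differentiable V p /\
    \forall x \near p, S x -> V x = unit_normal Omega S g x].

Definition lie E (V : Rn -> Rn) g x : 'M[R]_n :=
  \matrix_(i, j) \sum_k
    (V x 0 k * pd E k (fun y => g y i j) x
     + 'D_(basis_vec R i) V x 0 k * g x k j
     + 'D_(basis_vec R j) V x 0 k * g x i k).

Definition nabla E g (V : Rn -> Rn) (i k : 'I_n) x : R :=
  'D_(basis_vec R i) V x 0 k + \sum_l christoffel E g k i l x * V x 0 l.

Definition second_ff Omega S g p X Y : R :=
  2^-1 * form (lie (~` Omega) (normal_ext Omega S g p) g p) X Y.

(* div_S of the unit normal nu: the trace of the covariant derivative against
   g^{-1} - nu (x) nu, which is the inverse of the induced metric on S. *)
Definition mean_curv Omega S g p : R :=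
  let V := normal_ext Omega S g p in
  \sum_i \sum_j \sum_k (invmx (g p) i j - V p 0 i * V p 0 j) *
     g p j k * nabla (~` Omega) g V i k p.

(* Derivatives at the Euclidean metric in the direction h. *)
Definition ebar_var h (s : R) : tensor := fun x => ebar x + s *: h x.

Definition DRic E h (i j : 'I_n) x : R :=
  derive1 (fun s : R => ricci E (ebar_var h s) i j x : R) 0.

Definition DH Omega S h p : R :=
  derive1 (fun s : R => mean_curv Omega S (ebar_var h s) p : R) 0.

Definition DA Omega S h p X Y : R :=
  derive1 (fun s : R => second_ff Omega S (ebar_var h s) p X Y : R) 0.

Definition static_regular Omega S (alpha q : R) : Prop :=
  let E := ~` Omega in
  forall h v,
    (forall x, E x -> (h x)^T = h x) ->
    (forall i j, holder_space E 2 alpha q (fun x => h x i j)) ->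
    holder_space E 2 alpha q v ->
    (forall x i j, E x -> DRic E h i j x - hess E v i j x = 0) ->
    (forall x, E x -> laplace E v x = 0) ->
    (forall p X Y, S p -> tangent S p X -> tangent S p Y ->
       form (h p) X Y = 0) ->
    (forall p, S p -> DH Omega S h p = 0) ->
    forall p X Y, S p -> tangent S p X -> tangent S p Y ->
      DA Omega S h p X Y = 0.

End Geometry.

(* Main.v *)
Require Import Defs.
From HB Require Import structures.
From mathcomp Require Import all_boot all_order all_algebra.
From mathcomp Require Import all_classical all_reals all_analysis.
From mathcomp Require Import ring lra zify.

Set Implicit Arguments.
Unset Strict Implicit.
Unset Printing Implicit Defensive.

Import Order.TTheory GRing.Theory Num.Theory.
Import numFieldNormedType.Exports.

Local Open Scope classical_set_scope.
Local Open Scope ring_scope.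

(** The proof is a Pohozaev identity in a gauge adapted to the boundary.  Let
   [rho] be the gauge function of [Omega] about the star centre [x0]: it is
   1-homogeneous about [x0], smooth off [x0], and [Sigma] is [rho = 1].  Put
   [X = x - x0] and [N = d rho], so that [N.X = 1] on [Sigma].  Subtracting from
   [h] the Lie derivative of the flat metric along [Z = (rho - 1) W], for the [W]
   with [h = N (x) W + W (x) N] on [Sigma], preserves the linearised equations
   and makes [h] vanish on [Sigma], where then [d h = N (x) m].  In terms of [m],
   [DA h] is [|N| / 2] times the tangential part of [m], and [DH h = 0] says that
   this part is trace-free.  The equations for [(h, v)] are the Euler-Lagrange
   equations of a quadratic Lagrangian that dilations about [x0] rescale, which
   yields a divergence-free Noether current.  Its flux at infinity vanishes since
   [q > (n - 2) / 2], and its flux density through [Sigma] is a negative multiple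
   of the squared norm of the tangential part of [m]; hence [m] has no tangential
   part.

   Integrals are replaced by a positive linear functional on compactly supported
   continuous functions that annihilates partial derivatives (an ultralimit of
   lattice sums), and boundary fluxes are read off from the layers
   [1 + e < rho < 1 + 2 e]. *)

(** * Iterated differentiability on open sets *)

(** The regularity of [h] shapes the argument. As [h] is C^2 up to [Sigma], the gauge field [Z] is
    C^2 and the reduced tensor only C^1, so the divergence of its current is not a classical object.
    The conservation law is therefore tested against a cutoff, and only the gauge field is
    mollified: the Lie derivative of the flat metric along any C^3 field solves the linearised
    equations, so the approximation spoils no equation, and the current involves at most two
    derivatives of the field. The gauge change is confined to a shell near [Sigma], which keeps the
    decay of [h] at infinity. The weight (n - 2) / 2 is the one for which the Lagrangian, quadratic
    in first derivatives, scales like a density. The current is O(|x|^(- 1 - 2 q)); against spheres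
    of area |x|^(n - 1) this gives the threshold for [q]. The boundary values of [v] are free: its
    terms in the flux cancel because m has tangential trace zero. Star-shapedness provides [rho],
    and the positivity of N.X fixes the sign of the flux. *)

Section Calculus.
Variables (R : realType) (n : nat).
Local Notation Rn := 'rV[R]_n.
Local Notation e_ i := (basis_vec R i).
Local Notation D i f := (fun x => 'D_(basis_vec R i) f x).
Implicit Types (f g : Rn -> R) (x y v : Rn) (U V : set Rn) (k : nat) (i j : 'I_n).

(** Derivatives here are the ordinary ones, not [pd]. Every clause concerns full neighbourhoods of
    the points of [U], so the class restricts to subsets and glues over unions by plain induction;
    for open [U] it is C^k in the usual sense. *)
Inductive CO U : nat -> (Rn -> R) -> Prop :=
| CO_0 f : (forall x, U x -> {for x, continuous f}) -> CO U 0 f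
| CO_S k f : (forall x, U x -> {for x, continuous f}) ->
    (forall i x, U x -> derivable f x (e_ i)) -> (forall i, CO U k (D i f)) ->
    CO U k.+1 f.

Lemma CO_cont U k f x : CO U k f -> U x -> {for x, continuous f}.
Proof. by case=> [g h|m g h _ _] /h. Qed.

Lemma CO_derivable U k f i x : CO U k.+1 f -> U x -> derivable f x (e_ i).
Proof. by move=> h; inversion h; auto. Qed.

Lemma CO_D U k f i : CO U k.+1 f -> CO U k (D i f).
Proof. by move=> h; inversion h. Qed.

Lemma CO_P U k f : CO U k f <-> (forall x, U x -> {for x, continuous f}) /\
  match k with
  | 0 => True
  | k'.+1 => forall i, (forall x, U x -> derivable f x (e_ i)) /\ CO U k' (D i f)
  end.
Proof.
case: k => [|k]; split=> [h|[cf h]].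
- by split=> // x; exact: CO_cont h.
- exact: CO_0.
- split=> [x|i]; first exact: CO_cont h.
  by split=> [x|]; [exact: CO_derivable h|exact: CO_D h].
- by apply: CO_S => // i; [exact: (h i).1|exact: (h i).2].
Qed.

Lemma CO_sub U V k f : V `<=` U -> CO U k f -> CO V k f.
Proof.
move=> VU; elim: k f => [|k ih] f /CO_P[cf hf]; apply/CO_P; first by split=> // x /VU/cf.
split=> [x /VU/cf//|i]; split=> [x /VU xU|]; first exact: (hf i).1.
exact/ih/(hf i).2.
Qed.

Lemma CO_setU U V k f : CO U k f -> CO V k f -> CO (U `|` V) k f.
Proof.
elim: k f => [|k ih] f /CO_P[cU hU] /CO_P[cV hV]; apply/CO_P.
  by split=> // x [/cU|/cV].
split=> [x [/cU|/cV]//|i]; split=> [x [?|?]|]; [exact: (hU i).1|exact: (hV i).1|].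
by apply: ih; [exact: (hU i).2|exact: (hV i).2].
Qed.

Lemma CO_leS U k f : CO U k.+1 f -> CO U k f.
Proof.
elim: k f => [|k ih] f /CO_P[cf hf]; apply/CO_P; first by split.
by split=> // i; split; [exact: (hf i).1|exact/ih/(hf i).2].
Qed.

Lemma CO_le U k m f : (m <= k)%N -> CO U k f -> CO U m f.
Proof.
move=> /subnK <-; elim: (k - m)%N => [//|j ih]; rewrite addSn.
by move=> /CO_leS.
Qed.

Lemma derivable_congr U f g x v : open U -> U x -> (forall y, U y -> f y = g y) ->
  derivable f x v -> derivable g x v.
Proof.
move=> oU Ux fg; have [->|v0] := eqVneq v 0; first by move=> _; exact: derivable0.
apply: near_eq_derivable => //; near=> y; apply: fg; near: y.
exact: open_nbhs_nbhs.
Unshelve. all: by end_near. Qed.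

Lemma derive_congr U f g x v : open U -> U x -> (forall y, U y -> f y = g y) ->
  'D_v f x = 'D_v g x.
Proof.
move=> oU Ux fg; have [->|v0] := eqVneq v 0; first by rewrite !derive0.
apply: near_eq_derive => //; near=> y; apply: fg; near: y.
exact: open_nbhs_nbhs.
Unshelve. all: by end_near. Qed.

Lemma cont_congr U f g x : open U -> U x -> (forall y, U y -> f y = g y) ->
  {for x, continuous f} -> {for x, continuous g}.
Proof.
move=> oU Ux fg; rewrite /continuous_at /prop_for -(fg x Ux) => cf.
have E : \forall y \near x, f y = g y.
  near=> y; apply: fg; near: y; exact: open_nbhs_nbhs.
exact: (cvg_trans (near_eq_cvg E) cf).
Unshelve. all: by end_near. Qed.

Lemma CO_congr U k f g : open U -> (forall y, U y -> f y = g y) ->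
  CO U k f -> CO U k g.
Proof.
move=> oU; elim: k f g => [|k ih] f g fg /CO_P[cf hf]; apply/CO_P.
  by split=> // x Ux; exact: (cont_congr oU Ux fg (cf _ Ux)).
split=> [x Ux|i]; first exact: (cont_congr oU Ux fg (cf _ Ux)).
split=> [x Ux|]; first exact: (derivable_congr oU Ux fg ((hf i).1 _ Ux)).
by apply: ih (hf i).2 => y Uy; exact: derive_congr oU Uy fg.
Qed.

Lemma CO_cst U k c : open U -> CO U k (fun=> c).
Proof.
move=> oU; elim: k c => [|k ih] c; apply/CO_P; first by split=> // x _; exact: cst_continuous.
split=> [x _|i]; first exact: cst_continuous.
split=> [x _|]; first exact: derivable_cst.
by apply: CO_congr (ih 0) => // y _; rewrite derive_cst.
Qed.

Lemma CO_add U k f g : open U -> CO U k f -> CO U k g ->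
  CO U k (fun x => f x + g x).
Proof.
move=> oU; elim: k f g => [|k ih] f g /CO_P[cf hf] /CO_P[cg hg]; apply/CO_P.
  by split=> // x Ux; apply: continuousD; [exact: cf|exact: cg].
split=> [x Ux|i]; first by apply: continuousD; [exact: cf|exact: cg].
split=> [x Ux|].
  by apply: derivableD; [exact: (hf i).1|exact: (hg i).1].
apply: CO_congr (ih _ _ (hf i).2 (hg i).2) => // y Uy.
by rewrite [RHS]deriveD //; [exact: (hf i).1|exact: (hg i).1].
Qed.

Lemma CO_mul U k f g : open U -> CO U k f -> CO U k g ->
  CO U k (fun x => f x * g x).
Proof.
move=> oU; elim: k f g => [|k ih] f g hf hg; apply/CO_P.
  by split=> // x Ux; apply: continuousM; [exact: CO_cont hf _|exact: CO_cont hg _].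
split=> [x Ux|i].
  by apply: continuousM; [exact: CO_cont hf _|exact: CO_cont hg _].
have df x : U x -> derivable f x (e_ i) by exact: CO_derivable hf.
have dg x : U x -> derivable g x (e_ i) by exact: CO_derivable hg.
split=> [x Ux|]; first by apply: derivableM; [exact: df|exact: dg].
apply: CO_congr (CO_add oU (ih _ _ (CO_leS hf) (CO_D i hg))
                           (ih _ _ (CO_leS hg) (CO_D i hf))) => // y Uy.
by rewrite [RHS]deriveM //; [exact: df|exact: dg].
Qed.

Lemma CO_inv U k f : open U -> (forall x, U x -> f x != 0) -> CO U k f ->
  CO U k (fun x => (f x)^-1).
Proof.
move=> oU f0; elim: k => [|k ih] hf; apply/CO_P.
  by split=> // x Ux; apply: continuousV; [exact: f0|exact: CO_cont hf _].
split=> [x Ux|i]; first by apply: continuousV; [exact: f0|exact: CO_cont hf _].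
have df x : U x -> derivable f x (e_ i) by exact: CO_derivable hf.
split=> [x Ux|]; first by apply: derivableV; [exact: f0|exact: df].
have h1 := ih (CO_leS hf).
apply: CO_congr (CO_mul oU (CO_mul oU (CO_cst k (-1) oU) (CO_mul oU h1 h1))
                           (CO_D i hf)) => // y Uy.
rewrite [RHS]deriveV; [|exact: f0|exact: df].
by rewrite mulN1r -expr2 /GRing.scale /= -?exprVn.
Qed.

Lemma is_derive_coord i x v : is_derive x v (fun y : Rn => y 0 i : R) (v 0 i).
Proof.
have dm : derivable (@id Rn) x v by exact: derivable_id.
have h := (derivable_mxP _ _ _).1 dm 0 i.
apply: DeriveDef => //.
have := derive_mx dm; rewrite derive_id => /matrixP/(_ 0 i).
by rewrite mxE => <-.
Qed.

Lemma CO_coord U k i : open U -> CO U k (fun x : Rn => x 0 i).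
Proof.
move=> oU; have c x : {for x, continuous (fun y : Rn => y 0 i : R)}.
  by apply: differentiable_continuous; exact: differentiable_coord.
apply/CO_P; case: k => [|k]; first by split=> // x _; exact: c.
split=> [x _|j]; first exact: c.
split=> [x _|]; first exact: (@ex_derive _ _ _ _ _ _ _ (is_derive_coord i x _)).
apply: CO_congr (CO_cst k (basis_vec R j 0 i) oU) => // y _.
by rewrite (@derive_val _ _ _ _ _ _ _ (is_derive_coord i y _)).
Qed.

Lemma CO_sum U k I (r : seq I) (P : pred I) (F : I -> Rn -> R) : open U ->
  (forall a, P a -> CO U k (F a)) -> CO U k (fun x => \sum_(i <- r | P i) F i x).
Proof.
move=> oU h; elim: r => [|a r ih].
  by apply: CO_congr (CO_cst k 0 oU) => // y _; rewrite big_nil.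
case Pa: (P a); last by apply: CO_congr ih => // y _; rewrite big_cons Pa.
by apply: CO_congr (CO_add oU (h _ Pa) ih) => // y _; rewrite big_cons Pa.
Qed.

(** The mean value theorem for t -> f (x + t v), with [c] of either sign because coordinate
    increments have no preferred sign. *)
Lemma line_mvt f x v (c : R) :
  (forall t, `|t| <= `|c| -> derivable f (x + t *: v) v) ->
  exists2 t, `|t| <= `|c| & f (x + c *: v) - f x = c * 'D_v f (x + t *: v).
Proof.
move=> df.
pose G (t : R) := f (x + t *: v).
have dG (t : R) : `|t| <= `|c| -> is_derive t (1 : R) G ('D_v f (x + t *: v)).
  move=> /df dft; have E : (fun h : R => h^-1 *: ((G \o shift t) (h *: (1 : R)) - G t))
     = (fun h : R => h^-1 *: ((f \o shift (x + t *: v)) (h *: v) - f (x + t *: v))).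
    apply/funext => h; rewrite /G /= /shift /= scaler1 scalerDl.
    by congr (_ *: (f _ - _)); rewrite [LHS]addrCA.
  by apply: DeriveDef; rewrite /derivable ?/derive E.
have cG (a b : R) : (forall t, t \in `[a, b] -> `|t| <= `|c|) ->
    {within `[a, b], continuous G}.
  move=> h; apply: continuous_in_subspaceT => t; rewrite inE /= => /h/dG H.
  apply/differentiable_continuous/derivable1_diffP; exact: ex_derive.
have fxE : f x = G 0 by rewrite /G scale0r addr0.
have fcE : f (x + c *: v) = G c by [].
have [c0|c0] := leP 0 c.
- have hb t : t \in `[0, c] -> `|t| <= `|c|.
    by rewrite in_itv /= => /andP[t0 tc]; rewrite !ger0_norm.
  have [t tI E] := MVT_segment c0
    (fun t tI => dG t (hb _ (subset_itv_oo_cc tI))) (cG 0 c hb).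
  by exists t; [exact: hb|rewrite fxE fcE E subr0 mulrC].
- have hb t : t \in `[c, 0] -> `|t| <= `|c|.
    by rewrite in_itv /= => /andP[ct t0]; rewrite !ler0_norm ?lerN2 // ltW.
  have [t tI E] := MVT_segment (ltW c0)
    (fun t tI => dG t (hb _ (subset_itv_oo_cc tI))) (cG c 0 hb).
  exists t; first exact: hb.
  by rewrite fxE fcE -opprB E sub0r mulrN opprK mulrC.
Qed.

End Calculus.

Section Differentiability.
Variables (R : realType) (n : nat).
Local Notation Rn := 'rV[R]_n.
Local Notation e_ i := (basis_vec R i).
Local Notation D i f := (fun x => 'D_(basis_vec R i) f x).
Implicit Types (f g : Rn -> R) (x y v : Rn) (U V : set Rn) (k : nat) (i j : 'I_n).

Lemma normr_coord_le x i : `|x 0 i| <= `|x|.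
Proof.
rewrite [leRHS]/Num.Def.normr /= mx_normrE.
exact: (le_bigmax _ (fun j : 'I_1 * 'I_n => `|x j.1 j.2|) (0, i)).
Qed.

Lemma norm_rV_le x (c : R) : 0 <= c -> (forall i, `|x 0 i| <= c) -> `|x| <= c.
Proof.
move=> c0 h; rewrite [leLHS]/Num.Def.normr /= mx_normrE; apply: bigmax_le => // -[i j] _ /=.
by rewrite ord1.
Qed.

Lemma norm_rV_lt x (c : R) : 0 < c -> (forall i, `|x 0 i| < c) -> `|x| < c.
Proof.
move=> c0 h; rewrite [ltLHS]/Num.Def.normr /= mx_normrE; apply: bigmax_lt => // -[i j] _ /=.
by rewrite ord1.
Qed.

Lemma basis_vecE i j : (e_ i) 0 j = (i == j)%:R :> R.
Proof. by rewrite mxE eqxx eq_sym. Qed.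

Lemma norm_basis_vec i : `|e_ i| <= 1.
Proof.
by apply: norm_rV_le => // j; rewrite basis_vecE; case: eqP; rewrite ?normr1 ?normr0.
Qed.

Lemma sum_basis_vec (F : 'I_n -> R) i : \sum_j F j * (e_ i) 0 j = F i.
Proof.
rewrite (bigD1 i) //= basis_vecE eqxx mulr1 big1 ?addr0 // => j ji.
by rewrite basis_vecE eq_sym (negbTE ji) mulr0.
Qed.

Lemma open_ballP U x : open U -> U x ->
  exists2 d : R, 0 < d & forall y, `|y - x| < d -> U y.
Proof.
move=> oU Ux; have /nbhs_ballP[d d0 h] : nbhs x U by exact: open_nbhs_nbhs.
by exists d => // y yx; apply: h; rewrite -ball_normE /ball_ /= distrC.
Qed.

Lemma cont_epsP (f : Rn -> R) x : {for x, continuous f} <->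
  forall e : R, 0 < e -> exists2 d : R, 0 < d &
    forall y, `|y - x| < d -> `|f y - f x| <= e.
Proof.
split=> [cf e e0|h].
  have /cvgrPdist_le/(_ _ e0)/nbhs_ballP[d d0 hd] : f y @[y --> x] --> f x by [].
  exists d => // y yx; rewrite distrC; apply: hd.
  by rewrite -ball_normE /ball_ /= distrC.
suff : f y @[y --> x] --> f x by [].
apply/(@cvgrPdist_le _ _ _ _ (nbhs_filter x)) => e e0; have [d d0 hd] := h _ e0.
apply/nbhs_ballP; exists d => // y; rewrite -ball_normE /ball_ /= distrC => yx.
by rewrite distrC; exact: hd.
Qed.

Lemma fin_radius (I : finType) (Q : I -> R -> Prop) :
  (forall (a : I) (d d' : R), 0 < d' <= d -> Q a d -> Q a d') ->
  (forall a, exists2 d : R, 0 < d & Q a d) ->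
  exists2 d : R, 0 < d & forall a, Q a d.
Proof.
move=> mono h; have [F hF] := choice (fun a => (exists2P _ _).1 (h a)).
exists (\big[Num.min/1]_(i : I) F i).
  by elim/big_ind : _ => // [a b|i _]; rewrite ?lt_min => *; rewrite ?(hF _).1 //; apply/andP.
move=> i; apply: mono (hF i).2; rewrite bigmin_le_cond //; first last.
rewrite andbT.
by elim/big_ind : _ => // [a b|j _]; rewrite ?lt_min => *; rewrite ?(hF _).1 //; apply/andP.
Qed.

Definition prefix (m : nat) y : Rn := \row_i (if (i < m)%N then y 0 i else 0).

(** Moving from x to x + y one coordinate at a time, along the vectors [prefix j y], reduces the
    estimate to n one-dimensional mean value theorems, at points where each partial derivative is
    within e / (n + 1) of its value at x. *)
Lemma CO1_est U f x : open U -> U x -> CO U 1 f ->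
  forall e : R, 0 < e -> exists2 d : R, 0 < d & forall y, `|y| < d ->
    `|f (x + y) - f x - \sum_i D i f x * y 0 i| <= e * `|y|.
Proof.
move=> oU Ux hf e e0; have [d0 d00 hU] := open_ballP oU Ux.
pose e1 : R := e / n.+1%:R.
have e10 : 0 < e1 by rewrite divr_gt0.
have [d1 d10 hd1] : exists2 d : R, 0 < d & forall i y, `|y - x| < d ->
    `|D i f y - D i f x| <= e1.
  apply: (@fin_radius _ (fun i d => forall y, `|y - x| < d -> `|D i f y - D i f x| <= e1)).
    by move=> i a b /andP[_ ba] h y /lt_le_trans/(_ ba)/h.
  move=> i; apply: (cont_epsP _ _).1 => //.
  exact: CO_cont (CO_D i hf) Ux.
have sh (a b : Rn) : x + a + b - x = a + b.
  by rewrite -[x + a + b]addrA [_ - x]addrC addKr.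
exists (Num.min d0 d1); first by rewrite lt_min d00.
move=> y; rewrite lt_min => /andP[yd0 yd1].
have step (j : 'I_n) : `|f (x + prefix j.+1 y) - f (x + prefix j y) - D j f x * y 0 j|
    <= e1 * `|y|.
  have E : prefix j.+1 y = prefix j y + y 0 j *: e_ j.
    apply/rowP => i; rewrite !mxE eqxx /= ltnS leq_eqVlt.
    case: (eqVneq i j) => [->|ij]; first by rewrite eqxx ltnn add0r mulr1.
    rewrite eqE /= in ij; rewrite (negbTE ij) /=; case: ltnP => _;
      by rewrite mulr0 addr0.
  have nz (t : R) : `|t| <= `|y 0 j| -> `|prefix j y + t *: e_ j| <= `|y|.
    move=> ty; apply: norm_rV_le => // i; rewrite !mxE eqxx /=.
    case: (eqVneq i j) => [->|ij].
      by rewrite ltnn add0r mulr1 (le_trans ty) // normr_coord_le.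
    by rewrite mulr0 addr0; case: ifP => _; rewrite ?normr0 // normr_coord_le.
  have inU (t : R) : `|t| <= `|y 0 j| -> U (x + prefix j y + t *: e_ j).
    by move=> /nz ty; apply: hU; rewrite sh (le_lt_trans ty).
  have [t ty E2] := @line_mvt R n f (x + prefix j y) (e_ j) (y 0 j)
    (fun t ty => CO_derivable hf (inU t ty)).
  rewrite E addrA E2 mulrC -mulrBl normrM; apply: ler_pM => //.
    by apply: hd1; rewrite sh (le_lt_trans (nz _ ty)).
  exact: normr_coord_le.
have p0 : prefix 0 y = 0 by apply/rowP => i; rewrite !mxE.
have pn : prefix n y = y by apply/rowP => i; rewrite !mxE ltn_ord.
have -> : f (x + y) - f x - \sum_i D i f x * y 0 i =
    \sum_(j < n) (f (x + prefix j.+1 y) - f (x + prefix j y) - D j f x * y 0 j).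
  rewrite sumrB; congr (_ - _).
  rewrite -(big_mkord xpredT (fun j : nat => f (x + prefix j.+1 y) - f (x + prefix j y))).
  by rewrite telescope_sumr // pn p0 addr0.
apply: (le_trans (ler_norm_sum _ _ _)).
apply: (@le_trans _ _ (\sum_(j < n) e1 * `|y|)); first by apply: ler_sum.
rewrite sumr_const card_ord -mulr_natl mulrA ler_wpM2r // /e1 mulrCA.
by rewrite -[leRHS]mulr1 ler_pM2l // ler_pdivrMr // mul1r ler_nat.
Qed.

(** The hypothesis is the little-o condition with an explicit candidate for the differential. It
    also serves functions whose partial derivatives are not known beforehand: the exit time of a
    ray, and [f \o prj] at a boundary point. *)
Lemma differentiable_est f x (a : 'I_n -> R) :
  (forall e : R, 0 < e -> exists2 d : R, 0 < d & forall y, `|y| < d ->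
    `|f (x + y) - f x - \sum_i a i * y 0 i| <= e * `|y|) ->
  differentiable f x /\ forall v, 'd f x v = \sum_i a i * v 0 i.
Proof.
move=> h; pose L v : R := \sum_i a i * v 0 i.
have lin_L : linear L.
  move=> c u w; rewrite /L /GRing.scale /= mulr_sumr -big_split /=.
  by apply: eq_bigr => i _; rewrite !mxE mulrDr mulrCA.
pose Llin : {linear Rn -> R} := HB.pack L (GRing.isLinear.Build _ _ _ _ _ lin_L).
have cL : continuous Llin.
  move=> v; apply: (@CO_cont R n setT 0 _ v) => //.
  apply: CO_sum; first exact: openT.
  by move=> i _; apply: CO_mul; [exact: openT|exact/CO_cst/openT|exact/CO_coord/openT].
have E : f \o shift x = cst (f x : R^o) + Llin +o_ (0 : Rn) id.
  apply/eqaddoP => e e0; have [d d0 hd] := h _ e0.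
  apply/nbhs_ballP; exists d => // y; rewrite -ball_normE /ball_ /= sub0r normrN => yd.
  have := hd _ yd; rewrite [x + y]addrC.
  by rewrite !fctE /= opprD addrA.
have dE := diff_unique cL E.
split=> [|v]; last by rewrite dE.
by apply/diff_locallyP; rewrite dE.
Qed.

Lemma CO_differentiable U k f x : open U -> U x -> CO U k.+1 f ->
  differentiable f x.
Proof.
by move=> oU Ux hf; case: (differentiable_est (CO1_est oU Ux (CO_le (ltn0Sn k) hf))).
Qed.

Lemma row_sum_basis v : v = \sum_i v 0 i *: e_ i.
Proof. exact: row_sum_delta. Qed.

Lemma diff_sum f x v : differentiable f x ->
  'd f x v = \sum_i D i f x * v 0 i.
Proof.
move=> df; rewrite {1}(row_sum_basis v) linear_sum; apply: eq_bigr => i _.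
by rewrite linearZ /= -deriveE // mulrC.
Qed.

Lemma derive_sum_coord f x v : differentiable f x ->
  'D_v f x = \sum_i D i f x * v 0 i.
Proof. by move=> df; rewrite deriveE // diff_sum. Qed.

Lemma derive_line (V W : normedModType R) (f : V -> W) (x v : V) :
  'D_v f x = 'D_1 (fun h : R => f (h *: v + x)) (0 : R).
Proof.
rewrite /derive; set g1 := fun h => h^-1 *: _; set g2 := fun h => h^-1 *: _.
suff -> : g1 = g2 by [].
by rewrite funeqE /g1 /g2 => h /=; rewrite addr0 scale0r add0r [_%:A]mulr1.
Qed.

(** Only the directional derivative of [Y] is assumed. Restricted to the line through x along v, [Y]
    is a curve, for which derivable and differentiable coincide, and the chain rule for
    differentials applies. *)
Lemma is_derive_comp (V : normedModType R) f (Y : V -> Rn) (x v : V) (dY : Rn) :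
  differentiable f (Y x) -> is_derive x v Y dY ->
  is_derive x v (f \o Y) (\sum_i D i f (Y x) * dY 0 i).
Proof.
move=> df [dYx dYE].
pose c (h : R) := Y (h *: v + x).
have cE : c 0 = Y x by rewrite /c scale0r add0r.
have dc : differentiable c 0.
  exact: ((@derivable1_diffP R Rn c 0).1 ((@derivable1P R V Rn Y x v).1 dYx)).
have dc1 : 'd c 0 1 = dY by rewrite -(deriveE _ dc) -dYE (derive_line Y).
have dfc : differentiable (f \o c) 0.
  by apply: differentiable_comp => //; rewrite cE.
apply: DeriveDef; first exact/derivable1P/derivable1_diffP.
rewrite -(diff_sum _ df) -dc1 -cE -[RHS]/(('d f (c 0) \o 'd c 0) 1).
have dfcE : differentiable f (c 0) by rewrite cE.
by rewrite -(diff_comp dc dfcE) -(deriveE _ dfc) derive_line.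
Qed.

End Differentiability.

(** * Chain rule, symmetry of second derivatives, truncated powers *)

Section ChainSchwarz.
Variables (R : realType) (n : nat).
Local Notation Rn := 'rV[R]_n.
Local Notation e_ i := (basis_vec R i).
Local Notation D i f := (fun x => 'D_(basis_vec R i) f x).
Implicit Types (f g : Rn -> R) (x y v : Rn) (U V : set Rn) (k : nat) (i j : 'I_n).

Lemma cont_rVP (Y : Rn -> Rn) x :
  (forall i, {for x, continuous (fun y => Y y 0 i)}) <->
  (forall e : R, 0 < e -> exists2 d : R, 0 < d &
    forall y, `|y - x| < d -> `|Y y - Y x| <= e).
Proof.
split=> [h e e0|h i].
- have [d d0 hd] : exists2 d : R, 0 < d & forall i y, `|y - x| < d ->
     `|Y y 0 i - Y x 0 i| <= e.
    apply: (@fin_radius _ _ (fun i d => forall y, `|y - x| < d -> `|Y y 0 i - Y x 0 i| <= e)).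
      by move=> i a b /andP[_ ba] hi y /lt_le_trans/(_ ba)/hi.
    by move=> i; apply: (cont_epsP _ _).1.
  exists d => // y /hd hy; apply: norm_rV_le; first exact: ltW.
  by move=> i; rewrite !mxE.
- apply/cont_epsP => e e0; have [d d0 hd] := h _ e0; exists d => // y /hd.
  by apply: le_trans; have := normr_coord_le (Y y - Y x) i; rewrite !mxE.
Qed.

Lemma cont_comp f (Y : Rn -> Rn) x :
  (forall i, {for x, continuous (fun y => Y y 0 i)}) ->
  {for Y x, continuous f} -> {for x, continuous (f \o Y)}.
Proof.
move=> /cont_rVP cY /cont_epsP cf; apply/cont_epsP => e /cf[d d0 hd].
have [d1 d10 hd1] := cY (d / 2) (divr_gt0 d0 (ltr0Sn _ _)).
exists d1 => // y /hd1 Yy; apply: hd; apply: le_lt_trans Yy _.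
by rewrite ltr_pdivrMr // ltr_pMr // ltr1n.
Qed.

Lemma is_derive_rV (V : normedModType R) (Y : V -> Rn) (x v : V) (d : 'I_n -> R) :
  (forall j, is_derive x v (fun y : V => Y y 0 j) (d j)) ->
  is_derive x v Y (\row_j d j).
Proof.
move=> h; have dY : derivable Y x v.
  by apply/derivable_mxP => i j; rewrite ord1; exact: (@ex_derive _ _ _ _ _ _ _ (h j)).
apply: DeriveDef => //; rewrite derive_mx //; apply/rowP => j.
by rewrite !mxE; exact: (@derive_val _ _ _ _ _ _ _ (h j)).
Qed.

Lemma is_derive_CO U k f i x : CO U k.+1 f -> U x -> is_derive x (e_ i) f (D i f x).
Proof. by move=> hf Ux; apply: DeriveDef => //; exact: CO_derivable hf Ux. Qed.

Lemma CO_is_derive_comp U V k f (Y : Rn -> Rn) i x : open V -> U x ->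
  (forall x, U x -> V (Y x)) -> CO V k.+1 f ->
  (forall j, CO U k.+1 (fun y => Y y 0 j)) ->
  is_derive x (e_ i) (f \o Y) (\sum_j D j f (Y x) * D i (fun y => Y y 0 j) x).
Proof.
move=> oV Ux UV hf hY.
have dY := @is_derive_rV Rn Y x (e_ i) _ (fun j => is_derive_CO i (hY j) Ux).
have := is_derive_comp (CO_differentiable oV (UV _ Ux) hf) dY.
by move=> H; apply: (is_derive_eq H); apply: eq_bigr => j _; rewrite mxE.
Qed.

Lemma CO_comp U V k f (Y : Rn -> Rn) : open U -> open V ->
  (forall x, U x -> V (Y x)) -> CO V k f ->
  (forall j, CO U k (fun y => Y y 0 j)) -> CO U k (f \o Y).
Proof.
move=> oU oV UV; elim: k f => [|k ih] f hf hY; apply/CO_P.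
  split=> // x Ux; apply: cont_comp; last exact: CO_cont hf (UV _ Ux).
  by move=> i; exact: CO_cont (hY i) Ux.
split=> [x Ux|i].
  apply: cont_comp; last exact: CO_cont hf (UV _ Ux).
  by move=> i; exact: CO_cont (hY i) Ux.
have dfY x (Ux : U x) := CO_is_derive_comp i oV Ux UV hf hY.
split=> [x Ux|]; first exact: (@ex_derive _ _ _ _ _ _ _ (dfY x Ux)).
apply: (@CO_congr _ _ U k (fun x => \sum_j D j f (Y x) * D i (fun y => Y y 0 j) x)) => //.
  by move=> y Uy; rewrite (@derive_val _ _ _ _ _ _ _ (dfY y Uy)).
apply: CO_sum => // j _; apply: CO_mul => //; last exact: CO_D (hY j).
by apply: (ih (D j f) (CO_D j hf)) => j'; exact: CO_leS.
Qed.

Lemma is_derive_comp1 (V : normedModType R) (g : R -> R) (f : V -> R) (x v : V) (dg df : R) :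
  is_derive (f x) (1 : R) g dg -> is_derive x v f df ->
  is_derive x v (g \o f) (dg * df).
Proof.
move=> [dg1 dgE] [dfx dfE].
pose c (h : R) := f (h *: v + x).
have cE : c 0 = f x by rewrite /c scale0r add0r.
have dc : derivable c 0 1 := (@derivable1P R V R f x v).1 dfx.
have dgc : derivable g (c 0) 1 by rewrite cE; exact: dg1.
apply: DeriveDef.
  apply/derivable1P; suff : derivable (g \o c) 0 1 by [].
  apply/derivable1_diffP/differentiable_comp; first exact: (derivable1_diffP _ _).1 dc.
  exact: (derivable1_diffP _ _).1 dgc.
rewrite (derive_line (g \o f)) -derive1E.
rewrite [LHS](derive1_comp dc dgc) cE !derive1E dgE; congr (_ * _).
by rewrite -dfE [RHS]derive_line.
Qed.

(** The mean value theorem in direction i for f (y + t e_j) - f y, then in direction j for D_i f,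
    turns the second difference into t^2 times D_j D_i f at a nearby point. The second difference is
    symmetric in i and j, whence [schwarz]. *)
Lemma schwarz_aux U f x i j : open U -> U x -> CO U 2 f ->
  forall e : R, 0 < e -> exists2 d : R, 0 < d & forall t, 0 < t < d ->
  `|(f (x + t *: e_ i + t *: e_ j) - f (x + t *: e_ i)
     - (f (x + t *: e_ j) - f x)) - t ^+ 2 * D j (D i f) x| <= e * t ^+ 2.
Proof.
move=> oU Ux hf e e0; have [d0 d00 hU] := open_ballP oU Ux.
have hji : {for x, continuous (D j (D i f))} by exact: CO_cont (CO_D j (CO_D i hf)) Ux.
have [d1 d10 hd1] := (cont_epsP _ _).1 hji _ e0.
exists (Num.min d0 d1 / 2); first by rewrite divr_gt0 // lt_min d00.
move=> t /andP[t0]; rewrite ltr_pdivlMr // lt_min => /andP[td0 td1].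
have nrm (a b : R) : `|a| <= `|t| -> `|b| <= `|t| -> `|a *: e_ i + b *: e_ j| <= t * 2.
  move=> ha hb; rewrite (le_trans (ler_normD _ _)) // !normrZ mulr_natr mulr2n.
  rewrite (gtr0_norm t0) in ha hb.
  by apply: lerD; rewrite -[leRHS]mulr1 ler_pM // norm_basis_vec.
have sh (a b : Rn) : x + a + b - x = a + b.
  by rewrite -[x + a + b]addrA [_ - x]addrC addKr.
have inU (a b : R) : `|a| <= `|t| -> `|b| <= `|t| -> U (x + a *: e_ i + b *: e_ j).
  by move=> ha hb; apply: hU; rewrite sh (le_lt_trans (nrm _ _ ha hb)).
have inU0 (a : R) : `|a| <= `|t| -> U (x + a *: e_ i).
  by move=> ha; have := inU a 0 ha; rewrite scale0r addr0; apply; rewrite normr0.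
pose g y := f (y + t *: e_ j) - f y.
have dsh (y : Rn) : U (y + t *: e_ j) ->
    is_derive y (e_ i) (fun y => f (y + t *: e_ j)) (D i f (y + t *: e_ j)).
  move=> Uy; have df := is_derive_CO i hf Uy.
  have E : (fun h : R => h^-1 *: (((fun y => f (y + t *: e_ j)) \o shift y) (h *: e_ i)
      - f (y + t *: e_ j))) = (fun h : R => h^-1 *: ((f \o shift (y + t *: e_ j)) (h *: e_ i)
      - f (y + t *: e_ j))).
    by apply/funext => h /=; rewrite addrA.
  by case: df => [dd de]; apply: DeriveDef; rewrite /derivable ?/derive E.
have dg (s : R) : `|s| <= `|t| -> is_derive (x + s *: e_ i) (e_ i) g
    (D i f (x + s *: e_ i + t *: e_ j) - D i f (x + s *: e_ i)).
  move=> hs; apply: is_deriveB; first by apply: dsh; exact: inU.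
  by apply: is_derive_CO hf _; exact: inU0.
have [s hs E1] := @line_mvt R n g x (e_ i) t
  (fun s hs => @ex_derive _ _ _ _ _ _ _ (dg s hs)).
have [r hr E2] := @line_mvt R n (D i f) (x + s *: e_ i) (e_ j) t
  (fun r hr => CO_derivable (CO_D i hf) (inU s r hs hr)).
rewrite (_ : _ - (_ - f x) = g (x + t *: e_ i) - g x) //.
rewrite E1 (@derive_val _ _ _ _ _ _ _ (dg s hs)) E2 mulrA -expr2 -mulrBr.
rewrite normrM ger0_norm ?sqr_ge0 // mulrC ler_wpM2r ?sqr_ge0 //.
by apply: hd1; rewrite sh (le_lt_trans (nrm _ _ hs hr)).
Qed.

Lemma schwarz_arith (a b c d p q u e : R) :
  `|a - b - (c - d) - u * p| <= e / 2 * u ->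
  `|a - c - (b - d) - u * q| <= e / 2 * u -> `|u * p - u * q| <= u * e.
Proof.
by rewrite !ler_norml => /andP[? ?] /andP[? ?]; apply/andP; split; nra.
Qed.

Lemma schwarz U f x i j : open U -> U x -> CO U 2 f ->
  D j (D i f) x = D i (D j f) x.
Proof.
move=> oU Ux hf; apply/eqP; rewrite -subr_eq0 -normr_eq0; apply/eqP.
apply: le_anti; rewrite normr_ge0 andbT; apply/ler_addgt0Pr => e e0; rewrite add0r.
have e20 : 0 < e / 2 by rewrite divr_gt0.
have [d d0 hd] := schwarz_aux i j oU Ux hf e20.
have [d' d'0 hd'] := schwarz_aux j i oU Ux hf e20.
pose t := Num.min d d' / 2.
have m0 : 0 < Num.min d d' by rewrite lt_min d0.
have t0 : 0 < t by rewrite divr_gt0.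
have tm : t < Num.min d d' by rewrite ltr_pdivrMr // ltr_pMr // ltr1n.
move: tm; rewrite lt_min => /andP[td td'].
have := hd t; rewrite t0 td => /(_ isT) h1.
have := hd' t; rewrite t0 td' => /(_ isT) h2.
have t20 : 0 < t ^+ 2 by rewrite exprn_gt0.
rewrite -(ler_pM2l t20) -{1}(gtr0_norm t20) -normrM mulrBr.
have E : f (x + t *: e_ i + t *: e_ j) = f (x + t *: e_ j + t *: e_ i) by rewrite addrAC.
by rewrite -E in h2; exact: schwarz_arith h1 h2.
Qed.

(** A truncated power, of class C^(k-1) for k > 0. All bumps, steps and weights below are built from
    it, with k chosen according to the number of derivatives taken. *)
Definition pospow k (t : R) : R := Num.max t 0 ^+ k.

Lemma pospow_ge0 k t : 0 <= pospow k t.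
Proof. by rewrite exprn_ge0 // le_max lexx orbT. Qed.

Lemma pospow_pos k t : 0 <= t -> pospow k t = t ^+ k.
Proof. by move=> t0; rewrite /pospow max_l. Qed.

Lemma pospow_neg k t : t <= 0 -> pospow k.+1 t = 0.
Proof. by move=> t0; rewrite /pospow max_r // expr0n. Qed.

Lemma pospow_cont k : continuous (pospow k).
Proof.
move=> t; rewrite /pospow.
have c1 : {for t, continuous (fun t : R => Num.max t 0)}.
  by apply: continuous_max => //; exact: cst_continuous.
elim: k => [|k ih]; first by under eq_fun do rewrite expr0; exact: cvg_cst.
have -> : (fun t : R => Num.max t 0 ^+ k.+1) =
    (fun t : R => Num.max t 0) \* (fun t : R => Num.max t 0 ^+ k).
  by apply/funext => s; rewrite exprS.
exact: (@continuousM R R _ _ t c1 ih).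
Qed.

Lemma is_derive_pospow k (t : R) : is_derive t (1 : R) (pospow k.+2) (k.+2%:R * pospow k.+1 t).
Proof.
have dX : is_derive t (1 : R) (fun t : R => t ^+ k.+2) (k.+2%:R * t ^+ k.+1).
  apply: DeriveDef; first exact: exprn_derivable.
  by rewrite exp_derive /GRing.scale /= mulr1.
have [t0|t0|->] := ltgtP t 0.
- rewrite pospow_neg ?mulr0; last exact: ltW.
  apply: near_eq_is_derive (is_derive_cst 0 t 1).
  near=> s; rewrite /cst pospow_neg //; near: s; exact: lt_le_nbhsl.
- rewrite pospow_pos; last exact: ltW.
  apply: near_eq_is_derive dX; near=> s.
  rewrite pospow_pos //; near: s; exact: lt_le_nbhsr.
- rewrite pospow_neg // mulr0.
  have L : (fun h : R => h^-1 *: ((pospow k.+2 \o shift 0) (h *: (1 : R)) - pospow k.+2 0)) @ 0^' --> (0 : R).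
    apply/cvgrPdist_le => e e0; near=> h.
    rewrite /= sub0r normrN [in pospow _ 0]pospow_neg // subr0 addr0 [_%:A]mulr1.
    have h1 : `|h| <= 1 by near: h; apply: dnbhs0_le.
    have he : `|h| <= e by near: h; apply: dnbhs0_le.
    have h0 : h != 0 by near: h; exact: nbhs_dnbhs_neq.
    have : `|pospow k.+2 h| <= `|h| ^+ k.+2.
      rewrite /pospow normrX lerXn2r ?nnegrE //.
      by case: (leP h 0) => // _; rewrite normr0.
    move=> H; rewrite normrM normfV ler_pdivrMl ?normr_gt0 // (le_trans H) //.
    rewrite exprS ler_wpM2l // (le_trans _ he) // exprS -[leRHS]mulr1 ler_wpM2l //.
    exact: exprn_ile1.
  by apply: DeriveDef; [exact: (cvgP _ L)|exact: cvg_lim L].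
Unshelve. all: by end_near. Qed.

Lemma CO_pospow U k m f : open U -> (m < k)%N -> CO U m f ->
  CO U m (fun x => pospow k (f x)).
Proof.
move=> oU; have c0 g x l : {for x, continuous g} -> {for x, continuous (fun x => pospow l (g x))}.
  by move=> cg; apply: (continuous_comp cg); exact: pospow_cont.
elim: m k f => [|m ih] [//|[//|k]] f mk hf; apply/CO_P.
- by split=> // x Ux; apply: c0; exact: CO_cont hf Ux.
- by split=> // x Ux; apply: c0; exact: CO_cont hf Ux.
split=> [x Ux|i]; first by apply: c0; exact: CO_cont hf Ux.
have dd x (Ux : U x) := is_derive_comp1 (is_derive_pospow k (f x)) (is_derive_CO i hf Ux).
split=> [x Ux|]; first exact: (@ex_derive _ _ _ _ _ _ _ (dd x Ux)).
apply: CO_congr (CO_mul oU (CO_mul oU (CO_cst m k.+2%:R oU) (ih k.+1 f _ (CO_leS hf))) (CO_D i hf)) => //.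
by move=> y Uy; rewrite (@derive_val _ _ _ _ _ _ _ (dd y Uy)).
Qed.

End ChainSchwarz.

Section DeriveRules.
Variables (R : realType) (V : normedModType R) (x u : V).
Implicit Types (f g : V -> R).
Notation isD f d := (is_derive x u f d).

Lemma isD_add f g (df dg : R) : isD f df -> isD g dg ->
  isD (fun y => f y + g y) (df + dg).
Proof. by move=> h1 h2; exact: (is_deriveD h1 h2). Qed.

Lemma isD_sub f g (df dg : R) : isD f df -> isD g dg ->
  isD (fun y => f y - g y) (df - dg).
Proof. by move=> h1 h2; exact: (is_deriveB h1 h2). Qed.

Lemma isD_mul f g (df dg : R) : isD f df -> isD g dg ->
  isD (fun y => f y * g y) (df * g x + f x * dg).
Proof.
move=> h1 h2; have h := is_deriveM h1 h2; apply: (is_derive_eq h).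
by rewrite /GRing.scale /= addrC [g x * _]mulrC.
Qed.

Lemma isD_scale (r : R) f (df : R) : isD f df -> isD (fun y => r * f y) (r * df).
Proof. by move=> h; exact: (is_deriveZ r h). Qed.

Lemma isD_sum (n : nat) (F : 'I_n -> V -> R) (dF : 'I_n -> R) : (forall i, isD (F i) (dF i)) ->
  isD (fun y => \sum_i F i y) (\sum_i dF i).
Proof.
move=> h; have := is_derive_sum h; congr is_derive.
by apply/funext => y; rewrite fct_sumE.
Qed.

End DeriveRules.

(** * Lattice sums and a positive functional *)

Section LatticeSums.
Variables (R : realType) (n : nat).
Local Notation Rn := 'rV[R]_n.
Local Notation e_ i := (basis_vec R i).
Local Notation D i f := (fun x => 'D_(basis_vec R i) f x).
Implicit Types (f g : Rn -> R) (x y v : Rn) (U V K : set Rn) (k : nat) (i j : 'I_n).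

(** A Lebesgue number argument: a radius good on a neighbourhood of each point becomes one radius
    for all of [K], by the near-covering form of compactness applied to the filter of small positive
    radii. *)
Lemma compact_unif K (Q : Rn -> R -> Prop) : compact K ->
  (forall x (d d' : R), 0 < d' <= d -> Q x d -> Q x d') ->
  (forall x, K x -> exists2 d : R, 0 < d & forall x', `|x' - x| < d -> K x' -> Q x' d) ->
  exists2 d : R, 0 < d & forall x, K x -> Q x d.
Proof.
move=> cK mono h.
have nc : near_covering_within K by apply/near_covering_withinP/compact_near_coveringP.
have FF : Filter (0 : R)^'+ by typeclasses eauto.
have H := nc R ((0 : R)^'+) (fun d x => Q x d) FF.
have : \forall d \near (0 : R)^'+, K `<=` (fun x => Q x d).
  apply: H => x Kx; have [d d0 hd] := h x Kx.
  exists ([set x' | `|x' - x| < d], [set e : R | 0 < e <= d]) => /=.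
    split.
      apply/nbhs_ballP; exists d => // y; rewrite -ball_normE /ball_ /= distrC //.
    near=> e; apply/andP; split; near: e; first exact: nbhs_right_gt.
    exact: nbhs_right_le.
  move=> [x' e] /= [xx' ed] Kx'; exact: mono ed (hd _ xx' Kx').
move=> Hn.
near (0 : R)^'+ => d.
exists d; first by near: d; exact: nbhs_right_gt.
by near: d.
Unshelve. all: by end_near. Qed.

Definition bsupp (r : nat) f := forall x, r%:R < `|x| -> f x = 0.

Definition cpt f := (forall x, {for x, continuous f}) /\ exists r, bsupp r f.

Lemma bsupp_le (r s : nat) f : (r <= s)%N -> bsupp r f -> bsupp s f.
Proof. by move=> rs h x; move=> sx; apply: h; apply: le_lt_trans sx; rewrite ler_nat. Qed.

Lemma compact_ball0 (r : R) : compact [set x : Rn | `|x| <= r].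
Proof.
apply: bounded_closed_compact.
  by exists r; split; [exact: num_real|move=> M rM x /= xr; exact: le_trans xr (ltW rM)].
have -> : [set x : Rn | `|x| <= r] = (fun x : Rn => `|x|) @^-1` [set t : R | t <= r] by [].
apply: closed_comp; last exact: closed_le.
by move=> x _; exact: norm_continuous.
Qed.

Lemma cont_compact_bounded K f : compact K -> (forall x, K x -> {for x, continuous f}) ->
  exists2 C : R, 0 <= C & forall x, K x -> `|f x| <= C.
Proof.
move=> cK cf; have [d d0 hd] : exists2 d : R, 0 < d & forall x, K x -> `|f x| <= d^-1.
  apply: (compact_unif cK (Q := fun x d => `|f x| <= d^-1)).
    move=> x d d' /andP[d'0 dd] /le_trans; apply.
    by rewrite lef_pV2 // posrE // (lt_le_trans d'0).
  move=> x Kx; have [d d0 hd] := (cont_epsP _ _).1 (cf x Kx) 1 ltr01.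
  have c0 : 0 < `|f x| + 1 by rewrite ltr_wpDl.
  exists (Num.min d (`|f x| + 1)^-1); first by rewrite lt_min d0 invr_gt0.
  move=> x'; rewrite lt_min => /andP[/hd h _] _.
  apply: (@le_trans _ _ (`|f x| + 1)).
    have := ler_normD (f x) (f x' - f x); rewrite addrCA subrr addr0.
    by move=> /le_trans; apply; rewrite lerD2l.
  by rewrite -[leLHS]invrK lef_pV2 ?posrE ?invr_gt0 ?lt_min ?d0 ?invr_gt0 // ge_min lexx orbT.
by exists d^-1 => //; rewrite invr_ge0 ltW.
Qed.

Lemma cont_compact_unif K f : compact K -> (forall x, K x -> {for x, continuous f}) ->
  forall e : R, 0 < e -> exists2 d : R, 0 < d &
    forall x, K x -> forall y, `|y - x| < d -> `|f y - f x| <= e.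
Proof.
move=> cK cf e e0.
apply: (compact_unif cK (Q := fun x d => forall y, `|y - x| < d -> `|f y - f x| <= e)).
  by move=> x d d' /andP[_ dd] h y /lt_le_trans/(_ dd)/h.
move=> x Kx; have [d d0 hd] := (cont_epsP _ _).1 (cf x Kx) (e / 2) (divr_gt0 e0 (ltr0Sn _ _)).
exists (d / 2) => [|x' xx' _ y yx']; first by rewrite divr_gt0.
have h1 : `|f x' - f x| <= e / 2.
  by apply: hd; rewrite (lt_le_trans xx') // ler_pdivrMr // ler_pMr // ler1n.
have h2 : `|f y - f x| <= e / 2.
  apply: hd; rewrite -(subrKA x') (splitr d) (le_lt_trans (ler_normD _ _)) //.
  exact: ltrD.
rewrite -(subrKA (f x)) (le_trans (ler_normD _ _)) // (splitr e) lerD //.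
by rewrite distrC.
Qed.

Lemma cpt_bounded f : cpt f -> exists2 C : R, 0 <= C & forall x, `|f x| <= C.
Proof.
move=> [cf [r fr]]; have [C C0 hC] := cont_compact_bounded (@compact_ball0 r%:R) (fun x _ => cf x).
exists C => // x; have [xr|rx] := leP `|x| r%:R; first exact: hC.
by rewrite fr // normr0.
Qed.

Lemma cpt_unif f : cpt f -> forall e : R, 0 < e -> exists2 d : R, 0 < d &
  forall x y, `|y - x| < d -> `|f y - f x| <= e.
Proof.
move=> [cf [r fr]] e e0.
have [d d0 hd] := cont_compact_unif (@compact_ball0 r%:R) (fun x _ => cf x) e0.
exists d => // x y xy; have [xr|rx] := leP `|x| r%:R; first exact: hd.
have [yr|ry] := leP `|y| r%:R; first by rewrite distrC; apply: hd => //; rewrite distrC.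
by rewrite !fr // subrr normr0 ltW.
Qed.

(** The grid of mesh 1/N in the cube [-N, N]^n: in each coordinate the indices 0, ..., 2 N^2 run
    from -N to N. As N grows the mesh shrinks while the cube exhausts the space, and [lsum] is the
    Riemann sum. *)
Definition lat (N : nat) (k : {ffun 'I_n -> 'I_(N * N * 2).+1}) : Rn :=
  \row_i ((k i)%:R / N%:R - N%:R).

Definition lsum (N : nat) f : R := (N%:R ^+ n)^-1 * \sum_k f (@lat N k).

Lemma lsumD N f g : lsum N (fun x => f x + g x) = lsum N f + lsum N g.
Proof. by rewrite /lsum big_split mulrDr. Qed.

Lemma lsumZ N (c : R) f : lsum N (fun x => c * f x) = c * lsum N f.
Proof. by rewrite /lsum -mulr_sumr mulrCA. Qed.

Lemma ler_lsum N f g : (forall x, f x <= g x) -> lsum N f <= lsum N g.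
Proof. by move=> fg; rewrite ler_wpM2l ?invr_ge0 ?exprn_ge0 // ler_sum. Qed.

Lemma sum_prod_indicator (m : nat) (P : 'I_n -> pred 'I_m) :
  \sum_(k : {ffun 'I_n -> 'I_m}) \prod_i (P i (k i))%:R = \prod_i #|P i|%:R :> R.
Proof.
rewrite -(bigA_distr_bigA (fun i a => (P i a)%:R : R)); apply: eq_bigr => i _.
rewrite -sum1_card natr_sum (bigID (P i)) /= addrC big1 ?add0r.
  by apply: eq_bigr => a Pa; rewrite Pa.
by move=> a /negbTE ->.
Qed.

Lemma lat_count_le (N r : nat) : (0 < N)%N ->
  (#|[pred a : 'I_(N * N * 2).+1 | (`|a%:R / N%:R - N%:R| <= r%:R :> R)%R]| <= r * N * 2 + 1)%N.
Proof.
move=> N0; have N0' : 0 < N%:R :> R by rewrite ltr0n.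
set P := [pred a | _].
rewrite cardE -(size_map val) -(size_iota (N * N - r * N) (r * N * 2 + 1)).
apply: uniq_leq_size; first by rewrite map_inj_uniq ?enum_uniq //; exact: val_inj.
move=> b /mapP[a]; rewrite mem_enum inE => aP -> {b}.
have : `|a%:R - (N * N)%:R| <= (r * N)%:R :> R.
  have E : (a%:R - (N * N)%:R = (a%:R / N%:R - N%:R) * N%:R :> R).
    by rewrite mulrBl divfK ?gt_eqF // natrM.
  by rewrite E normrM [X in _ * X]gtr0_norm // natrM ler_pM2r.
rewrite ler_norml => /andP[h1 h2].
have h1' : (N * N <= a + r * N)%N by rewrite -(ler_nat R) natrD; lra.
have h2' : (a <= N * N + r * N)%N by rewrite -(ler_nat R) natrD; lra.
have mem_aux (u w b : nat) : (u <= b + w)%N -> (b <= u + w)%N ->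
    b \in iota (u - w) (w * 2 + 1) by rewrite mem_iota; lia.
exact: mem_aux.
Qed.

(** Each coordinate admits at most 2 r N + 1 <= 3 r N grid values in [-r, r], and the factor N^n is
    divided out. *)
Lemma lsum_bound (N r : nat) f (C : R) : (0 < N)%N -> (0 < r)%N ->
  (forall x, `|f x| <= C) -> bsupp r f ->
  `|lsum N f| <= C * (3 * r)%:R ^+ n.
Proof.
move=> N0 r0 fC fr; have N0' : 0 < N%:R :> R by rewrite ltr0n.
have C0 : 0 <= C by apply: le_trans (fC 0).
pose P := [pred a : 'I_(N * N * 2).+1 | `|a%:R / N%:R - N%:R| <= r%:R :> R].
have fle (k : {ffun 'I_n -> 'I_(N * N * 2).+1}) : `|f (@lat N k)| <= C * \prod_i (P (k i))%:R.
  have [[i Pi]|h] := pselect (exists i, ~~ P (k i)).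
    rewrite fr ?normr0.
      by rewrite mulr_ge0 // prodr_ge0.
    move: Pi; rewrite inE -ltNge => /lt_le_trans; apply.
    by have := normr_coord_le (@lat N k) i; rewrite mxE.
  rewrite big1 ?mulr1 // => i _.
  by have -> : P (k i) = true by apply/negP => /negP Pi; apply: h; exists i.
rewrite /lsum normrM ger0_norm ?invr_ge0 ?exprn_ge0 // ler_pdivrMl ?exprn_gt0 //.
apply: (le_trans (ler_norm_sum _ _ _)).
apply: (@le_trans _ _ (\sum_(k : {ffun 'I_n -> 'I_(N * N * 2).+1}) C * \prod_i (P (k i))%:R)).
  by apply: ler_sum => k _; exact: fle.
rewrite -mulr_sumr (sum_prod_indicator (fun _ => P)) mulrCA ler_wpM2l // -exprMn.
rewrite prodr_const card_ord lerXn2r ?nnegrE ?mulr_ge0 //.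
rewrite -natrM ler_nat (leq_trans (lat_count_le r N0)) //.
nia.
Qed.

Lemma lat_count_ge (N : nat) (p d : R) : (0 < N)%N -> 0 < d -> 2 / d <= N%:R ->
  `|p| + d <= N%:R ->
  d / 2 * N%:R <= #|[pred a : 'I_(N * N * 2).+1 | `|a%:R / N%:R - N%:R - p| < d]|%:R.
Proof.
move=> N0 d0 Nd Np; have N0' : 0 < N%:R :> R by rewrite ltr0n.
set P := [pred a | _].
have dN : 2 <= d * N%:R by rewrite mulrC -ler_pdivrMr.
(* In units of the mesh, p sits at [u]. The t + 1 consecutive indices from [a0] on lie within d N of
   it, and t + 1 > d N - 1 >= d N / 2 since d N >= 2. *)
pose u : R := (N%:R + p) * N%:R.
have u0 : 0 <= u.
  rewrite mulr_ge0 // -lerBlDr sub0r (le_trans _ Np) // (le_trans (ler_norm _)) //.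
  by rewrite normrN lerDl ltW.
pose a0 := Num.trunc u; have /andP[a1 a2] : a0%:R <= u < a0.+1%:R by exact: truncn_itv.
pose t := Num.trunc (d * N%:R - 1).
have dN1 : 0 <= d * N%:R - 1 by lra.
have /andP[t1 t2] : t%:R <= d * N%:R - 1 < t.+1%:R by exact: truncn_itv.
have : d / 2 * N%:R <= t.+1%:R by move: t2; rewrite -natr1; nra.
move=> /le_trans; apply; rewrite ler_nat.
rewrite cardE -(size_map val) -(size_iota a0 t.+1).
apply: uniq_leq_size; first exact: iota_uniq.
move=> b; rewrite mem_iota => /andP[b1 b2].
have b1' : a0%:R <= b%:R :> R by rewrite ler_nat.
have b2' : b%:R <= a0%:R + t%:R :> R by rewrite -natrD ler_nat -ltnS -addnS.
have bu : `|b%:R - u| < d * N%:R.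
  by rewrite ltr_norml; move: a2; rewrite -natr1 => a2; apply/andP; split; lra.
have bm : (b < (N * N * 2).+1)%N.
  rewrite ltnS -(ler_nat R) !natrM.
  move: bu Np; rewrite ltr_norml /u => /andP[_ bu] Np; have := ler_norm p; nra.
apply/mapP; exists (Ordinal bm) => //; rewrite mem_enum inE /=.
rewrite -(ltr_pM2r N0') -[X in _ * X < _]gtr0_norm // -normrM.
suff -> : (b%:R / N%:R - N%:R - p) * N%:R = b%:R - u by [].
by rewrite /u mulrDl !mulrBl divfK ?gt_eqF //; ring.
Qed.

Lemma lsum_pos (N : nat) f p (c d : R) : (0 < N)%N -> 0 < d -> 2 / d <= N%:R ->
  `|p| + d <= N%:R -> 0 <= c -> (forall x, 0 <= f x) ->
  (forall x, `|x - p| < d -> c <= f x) -> c * (d / 2) ^+ n <= lsum N f.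
Proof.
move=> N0 d0 Nd Np c0 f0 fc; have N0' : 0 < N%:R :> R by rewrite ltr0n.
pose P i := [pred a : 'I_(N * N * 2).+1 | `|a%:R / N%:R - N%:R - p 0 i| < d].
have fle (k : {ffun 'I_n -> 'I_(N * N * 2).+1}) : c * \prod_i (P i (k i))%:R <= f (@lat N k).
  have [[i Pi]|h] := pselect (exists i, ~~ P i (k i)).
    rewrite (bigD1 i) //.
    have -> : (P i (k i))%:R = 0 :> R by rewrite (negbTE Pi).
    by rewrite /= mul0r mulr0.
  rewrite big1 ?mulr1 => [|i _].
    apply: fc; apply: norm_rV_lt => // i; rewrite !mxE.
    by have : P i (k i) by apply/negP => /negP Pi; apply: h; exists i.
  by have -> : P i (k i) = true by apply/negP => /negP Pi; apply: h; exists i.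
rewrite /lsum mulrC ler_pdivlMl ?exprn_gt0 //.
apply: (@le_trans _ _ (\sum_(k : {ffun 'I_n -> 'I_(N * N * 2).+1}) c * \prod_i (P i (k i))%:R)); last first.
  by apply: ler_sum => k _; exact: fle.
rewrite -mulr_sumr (sum_prod_indicator (fun i => P i)) mulrA [_ * c]mulrC ler_wpM2l //.
rewrite mulrC -exprMn -[X in _ ^+ X]card_ord -prodr_const; apply: ler_prod => i _.
apply/andP; split; first by rewrite mulr_ge0 // divr_ge0 // ltW.
apply: lat_count_ge => //.
by apply: le_trans Np; rewrite lerD2r normr_coord_le.
Qed.

(** A shift by one mesh width permutes the grid cyclically in coordinate i. The index that wraps
    around only meets points with i-th coordinate at least N in absolute value, where [f]
    vanishes. *)
Lemma lsum_shift (N r : nat) f i : (r < N)%N -> bsupp r f ->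
  lsum N (fun x => f (x + N%:R^-1 *: e_ i)) = lsum N f.
Proof.
move=> rN fr; have N0 : (0 < N)%N by exact: leq_ltn_trans rN.
have N0' : N%:R != 0 :> R by rewrite pnatr_eq0 -lt0n.
rewrite /lsum; congr (_ * _).
pose m := N * N * 2.
pose sh (k : {ffun 'I_n -> 'I_m.+1}) := [ffun j => if j == i then ordS (k j) else k j].
pose sh' (k : {ffun 'I_n -> 'I_m.+1}) := [ffun j => if j == i then ord_pred (k j) else k j].
have shK : cancel sh sh'.
  by move=> k; apply/ffunP => j; rewrite !ffunE; case: eqP => //; rewrite ordSK.
have sh'K : cancel sh' sh.
  by move=> k; apply/ffunP => j; rewrite !ffunE; case: eqP => //; rewrite ord_predK.
rewrite [RHS](reindex sh); last by exists sh' => k _; [exact: shK|exact: sh'K].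
apply: eq_bigr => k _; have [km|km] := eqVneq (k i : nat) m.
- have c0 (y : Rn) : N%:R <= `|y 0 i| -> f y = 0.
    move=> yi; apply: fr; apply: lt_le_trans (normr_coord_le y i).
    by apply: lt_le_trans yi; rewrite ltr_nat.
  rewrite !c0 //.
    rewrite !mxE ffunE eqxx /= km modnn mul0r sub0r normrN ger0_norm //.
  rewrite !mxE !eqxx /= km mulr1 /m !natrM.
  have -> : N%:R * N%:R * 2 / N%:R - N%:R + N%:R^-1 = N%:R + N%:R^-1 :> R by field.
  by rewrite ger0_norm ?addr_ge0 ?invr_ge0 // lerDl invr_ge0.
- congr f; apply/rowP => j; rewrite !mxE ffunE eqxx /= eq_sym.
  case: eqP => [<-|_]; last by rewrite mulr0 addr0.
  have kl : ((k i).+1 < m.+1)%N by rewrite ltnS ltn_neqAle km -ltnS ltn_ord.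
  have -> : (ordS (k i) : nat) = (k i).+1 by rewrite /= modn_small.
  by rewrite -natr1 mulrDl mulr1 mul1r addrAC.
Qed.

End LatticeSums.

(** * The functional as a limit of lattice sums along an ultrafilter *)

Section Integral.
Variables (R : realType) (n : nat).
Local Notation Rn := 'rV[R]_n.
Local Notation e_ i := (basis_vec R i).
Local Notation D i f := (fun x => 'D_(basis_vec R i) f x).
Implicit Types (f g : Rn -> R) (x y v : Rn) (U V K : set Rn) (k : nat) (i j : 'I_n).

(** [int_D] plays the part of the divergence theorem. [int_bound] records the growth r^n of volumes,
    which decides whether the flux at infinity vanishes; [int_pos] makes the functional strictly
    positive on a bump. Nothing is said about values outside [cpt]. *)
Record is_integral (Lam : (Rn -> R) -> R) : Prop := IsIntegral {
  intD : forall f g, cpt f -> cpt g -> Lam (fun x => f x + g x) = Lam f + Lam g;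
  intZ : forall (c : R) f, cpt f -> Lam (fun x => c * f x) = c * Lam f;
  int_le : forall f g, cpt f -> cpt g -> (forall x, f x <= g x) -> Lam f <= Lam g;
  int_D : forall f i, CO setT 1 f -> (exists r, bsupp r f) -> Lam (D i f) = 0;
  int_bound : forall f (C : R) r, cpt f -> (0 < r)%N -> (forall x, `|f x| <= C) ->
    bsupp r f -> `|Lam f| <= C * (3 * r)%:R ^+ n;
  int_pos : forall f p, cpt f -> (forall x, 0 <= f x) -> 0 < f p -> 0 < Lam f }.

Lemma bsupp_D r f i : bsupp r f -> bsupp r (D i f).
Proof.
move=> fr x rx; pose U : set Rn := [set y | r%:R < `|y|].
have oU : open U.
  have -> : U = (fun x : Rn => `|x|) @^-1` [set t : R | r%:R < t] by [].
  by apply: open_comp; [move=> y _; exact: norm_continuous|exact: open_gt].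
by rewrite (@derive_congr _ _ U f (fun=> 0)) // derive_cst.
Qed.

Lemma cpt_D f i : CO setT 1 f -> (exists r, bsupp r f) -> cpt (D i f).
Proof.
move=> hf [r fr]; split; last by exists r; exact: bsupp_D.
by move=> x; exact: CO_cont (CO_D i hf) _.
Qed.

Lemma cptD f g : cpt f -> cpt g -> cpt (fun x => f x + g x).
Proof.
move=> [cf [r fr]] [cg [s gs]]; split; first by move=> x; apply: continuousD.
exists (maxn r s) => x xm; rewrite (bsupp_le (leq_maxl r s) fr) //.
by rewrite (bsupp_le (leq_maxr r s) gs) // addr0.
Qed.

Lemma cptM f g : cpt f -> (forall x, {for x, continuous g}) -> cpt (fun x => g x * f x).
Proof.
move=> [cf [r fr]] cg; split; first by move=> x; apply: continuousM.
by exists r => x /fr ->; rewrite mulr0.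
Qed.

Lemma cptZ (c : R) f : cpt f -> cpt (fun x => c * f x).
Proof. by move=> hf; apply: cptM => // x; exact: cst_continuous. Qed.

(** The difference quotient at mesh scale has lattice sum zero by [lsum_shift] and is uniformly
    close to D_i f by the mean value theorem. The radius r + 1 accommodates the support of the
    quotient. *)
Lemma lsum_D f i : CO setT 1 f -> (exists r, bsupp r f) ->
  forall e : R, 0 < e -> \forall N \near \oo, `|lsum N (D i f)| <= e.
Proof.
move=> hf [r fr] e e0.
have cD := cpt_D i hf (ex_intro _ r fr).
have c0 : 0 < (3 * r.+1)%:R ^+ n :> R by rewrite exprn_gt0 // ltr0n.
have e10 : 0 < e / (3 * r.+1)%:R ^+ n by rewrite divr_gt0.
have [d d0 hd] := cpt_unif cD e10.
near=> N.
have Nr : (r.+1 < N)%N by near: N; exact: nbhs_infty_gt.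
have N0 : (0 < N)%N by exact: leq_ltn_trans Nr.
have N0' : 0 < N%:R :> R by rewrite ltr0n.
have Nd : N%:R^-1 < d.
  rewrite invf_plt ?posrE //; near: N; exact: nbhs_infty_gtr.
pose q x := N%:R * f (x + N%:R^-1 *: e_ i) + - N%:R * f x.
have q0 : lsum N q = 0.
  rewrite lsumD !lsumZ (lsum_shift i _ fr) ?mulNr ?subrr //.
  exact: ltn_trans Nr.
have -> : lsum N (D i f) = lsum N (fun x => D i f x + -1 * q x).
  by rewrite lsumD lsumZ q0 mulr0 addr0.
have -> : e = e / (3 * r.+1)%:R ^+ n * (3 * r.+1)%:R ^+ n by rewrite divfK // gt_eqF.
apply: lsum_bound => //.
- move=> x; have [t ht E] := @line_mvt R n f x (e_ i) N%:R^-1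
    (fun t _ => CO_derivable hf (I : setT (x + t *: e_ i))).
  have -> : q x = D i f (x + t *: e_ i).
    by rewrite /q mulNr -mulrBr E mulVKf ?gt_eqF.
  rewrite mulN1r distrC.
  apply: hd; rewrite addrAC subrr add0r normrZ (le_lt_trans _ Nd) //.
  rewrite [X in _ <= X]ger0_norm ?invr_ge0 // in ht.
  by rewrite -[leRHS]mulr1 ler_pM // norm_basis_vec.
- move=> x rx; rewrite (bsupp_D i (bsupp_le (leqnSn r) fr)) // add0r /q.
  have xr : r%:R < `|x| by apply: le_lt_trans rx; rewrite ler_nat.
  rewrite (fr x) // mulr0 addr0 fr ?mulr0 //.
  have h1 : `|x| <= `|x + N%:R^-1 *: e_ i| + N%:R^-1.
    rewrite -[X in `|X| <= _](addrK (N%:R^-1 *: e_ i)) (le_trans (ler_normB _ _)) //.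
    rewrite lerD2l normrZ ger0_norm ?invr_ge0 // -[leRHS]mulr1 ler_wpM2l ?invr_ge0 //.
    exact: norm_basis_vec.
  have h2 : N%:R^-1 <= 1 :> R by rewrite invf_le1 // ler1n.
  by move: rx; rewrite -natr1; lra.
Unshelve. all: by end_near. Qed.

(** For each [cpt] function the lattice sums eventually stay in a segment, so compactness makes them
    converge along any ultrafilter. One that refines the filter at infinity inherits all eventual
    estimates. *)
Lemma integral_exists : exists Lam, is_integral Lam.
Proof.
have [G [GU sG]] := ultraFilterLemma (eventually_filter : ProperFilter \oo).
have PG : ProperFilter G by exact: ultra_proper.
have cvgG f : cpt f -> cvg (lsum N f @[N --> G]).
  move=> cf; have [C C0 fC] := cpt_bounded cf; have [_ [r fr]] := cf.
  pose M := C * (3 * r.+1)%:R ^+ n.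
  have bnd : G [set N | lsum N f \in `[- M, M]].
    apply: sG; near=> N; rewrite /= in_itv /= -ler_norml.
    apply: lsum_bound => //; last exact: bsupp_le fr.
    by near: N; exact: nbhs_infty_gt.
  have [p [_ clp]] := @segment_compact R (- M) M (lsum N f @[N --> G]) _ bnd.
  apply/cvg_ex; exists p => A /= Ap.
  have [//|GnA] := in_ultra_setVsetC [set N | A (lsum N f)] GU.
  have [y [/= nAy Ay]] := clp (~` A) A GnA Ap.
  by [].
have cvgL f : cpt f -> lsum N f @[N --> G] --> lim (lsum N f @[N --> G]) by exact: cvgG.
exists (fun f => lim (lsum N f @[N --> G])); split.
- move=> f g hf hg; apply/cvg_lim => //.
  under eq_fun do rewrite lsumD.
  by apply: cvgD; exact: cvgL.
- move=> c f hf; apply/cvg_lim => //.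
  under eq_fun do rewrite lsumZ.
  by apply: cvgM; [exact: cvg_cst|exact: cvgL].
- move=> f g hf hg fg; apply: ler_lim; [exact: cvgG|exact: cvgG|].
  by near=> N; exact: ler_lsum.
- move=> f i hf fr; apply/cvg_lim => //; apply/cvgrPdist_le => e e0.
  by apply: sG; apply: filterS (lsum_D i hf fr e0) => N; rewrite sub0r normrN.
- move=> f C r hf r0 fC fr.
  have b : \forall N \near G, `|lsum N f| <= C * (3 * r)%:R ^+ n.
    by apply: sG; near=> N; apply: lsum_bound => //; near: N; exact: nbhs_infty_gt.
  rewrite ler_norml; apply/andP; split.
    by apply: limr_ge; [exact: cvgG|apply: filterS b => N; rewrite ler_norml => /andP[]].
  by apply: limr_le; [exact: cvgG|apply: filterS b => N; rewrite ler_norml => /andP[]].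
- move=> f p hf f0 fp.
  have [d d0 hd] := (cont_epsP _ _).1 (hf.1 p) (f p / 2) (divr_gt0 fp (ltr0Sn _ _)).
  apply: (@lt_le_trans _ _ (f p / 2 * (d / 2) ^+ n)).
    by rewrite mulr_gt0 ?exprn_gt0 // divr_gt0.
  apply: limr_ge; first exact: cvgG.
  apply: sG; near=> N; apply: (@lsum_pos _ _ N f p (f p / 2) d) => //.
  + by near: N; exact: nbhs_infty_gt.
  + by near: N; exact: nbhs_infty_ger.
  + by near: N; exact: nbhs_infty_ger.
  + by rewrite divr_ge0 // ltW.
  + move=> x /hd; rewrite ler_norml => /andP[+ _]; lra.
Unshelve. all: by end_near. Qed.

End Integral.

(** * Mollification *)

Section Mollification.
Variables (R : realType) (n : nat).
Local Notation Rn := 'rV[R]_n.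
Local Notation e_ i := (basis_vec R i).
Local Notation D i f := (fun x => 'D_(basis_vec R i) f x).
Implicit Types (f g phi : Rn -> R) (x y v : Rn) (U V K : set Rn) (k : nat) (i j : 'I_n).
Variables (Lam : (Rn -> R) -> R) (LamP : is_integral Lam).

Definition conv g phi x := Lam (fun y => g y * phi (x - y)).

Lemma cont_reflect phi x y : {for x - y, continuous phi} ->
  {for y, continuous (fun y => phi (x - y))}.
Proof.
move=> /cont_epsP cp; apply/cont_epsP => e /cp[d d0 hd]; exists d => // z zy.
by apply: hd; rewrite opprB addrC addrA subrK distrC.
Qed.

Lemma CO_cpt f : CO setT 0 f -> (exists r, bsupp r f) -> cpt f.
Proof. by move=> cf fr; split=> // x; exact: CO_cont cf _. Qed.

Lemma cpt_translate phi x : cpt phi -> cpt (fun y => phi (x - y)).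
Proof.
move=> [cp [r pr]]; split; first by move=> y; exact: cont_reflect.
exists (Num.bound `|x| + r)%N => y h; apply: pr.
have h1 : `|x| < (Num.bound `|x|)%:R by rewrite archi_boundP.
have h2 : `|y| <= `|x - y| + `|x|.
  by rewrite -[X in `|X| <= _](subKr x) (le_trans (ler_normB _ _)) // addrC.
by move: h; rewrite natrD; lra.
Qed.

Lemma cpt_conv g phi x : (forall x, {for x, continuous g}) -> cpt phi ->
  cpt (fun y => g y * phi (x - y)).
Proof. by move=> cg cp; apply: cptM => //; exact: cpt_translate. Qed.

Lemma conv_small g (C : R) (s : nat) (e : R) (psi : Rn -> R) :
  (forall x, {for x, continuous g}) -> (forall x, `|g x| <= C) -> (0 < s)%N ->
  (forall x, {for x, continuous psi}) -> (forall x, `|psi x| <= e) -> bsupp s psi ->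
  `|Lam (fun y => g y * psi y)| <= C * e * (3 * s)%:R ^+ n.
Proof.
move=> cg gC s0 cpsi psie spsi; apply: (int_bound LamP) => //.
- by apply: cptM => //; split => //; exists s.
- by move=> x; rewrite normrM ler_pM.
- by move=> x /spsi ->; rewrite mulr0.
Qed.

Lemma Lam_sub f g : cpt f -> cpt g -> Lam (fun x => f x - g x) = Lam f - Lam g.
Proof.
move=> hf hg; have -> : (fun x => f x - g x) = (fun x => f x + -1 * g x).
  by apply/funext => x; rewrite mulN1r.
by rewrite (intD LamP) ?(intZ LamP) ?mulN1r //; exact: cptZ.
Qed.

Lemma conv_cont g (C : R) phi x : (forall x, {for x, continuous g}) ->
  (forall x, `|g x| <= C) -> cpt phi -> {for x, continuous (conv g phi)}.
Proof.
move=> cg gC cp; apply/cont_epsP => e e0.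
have C0 : 0 <= C by apply: le_trans (gC 0).
have [_ [r pr]] := cp.
(* All functions y -> phi (z - y) with |z - x| < 1 are supported in the ball of radius [s]; the
   extra 1 in r + 1 pays for |z - x|. *)
pose s := (Num.bound `|x| + r.+1)%N.
have s0 : (0 < s)%N by rewrite /s addnS.
pose M := (C + 1) * (3 * s)%:R ^+ n.
have M0 : 0 < M by rewrite mulr_gt0 ?exprn_gt0 ?ltr_wpDl ?ltr0n // muln_gt0.
have [d d0 hd] := cpt_unif cp (divr_gt0 e0 M0).
exists (Num.min d 1); first by rewrite lt_min d0 ltr01.
move=> z; rewrite lt_min => /andP[zd z1].
rewrite /conv -Lam_sub; [|exact: cpt_conv|exact: cpt_conv].
have -> : (fun y => g y * phi (z - y) - g y * phi (x - y)) =
  (fun y => g y * (phi (z - y) - phi (x - y))) by apply/funext => y; rewrite mulrBr.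
have hb : `|x| < (Num.bound `|x|)%:R by rewrite archi_boundP.
apply: (@le_trans _ _ (C * (e / M) * (3 * s)%:R ^+ n)).
  apply: conv_small => //.
  - by move=> y; apply: continuousB; apply: cont_reflect; exact: cp.1.
  - by move=> y; apply: hd; rewrite opprB subrKA.
  - move=> y; rewrite /s natrD => ys.
    have h1 : `|y| <= `|x - y| + `|x|.
      by rewrite -[X in `|X| <= _](subKr x) (le_trans (ler_normB _ _)) // addrC.
    have h2 : `|x - y| <= `|z - y| + `|z - x|.
      have -> : x - y = (z - y) - (z - x) by rewrite opprB [RHS]addrC subrKA.
      exact: ler_normB.
    by rewrite !pr ?subrr //; move: ys; rewrite -natr1; lra.
have -> : C * (e / M) * (3 * s)%:R ^+ n = e * (C / (C + 1)).
  rewrite /M; field; rewrite !gt_eqF ?ltr_wpDl ?exprn_gt0 ?ltr0n ?muln_gt0 //.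
by rewrite -[leRHS]mulr1 ler_pM2l // ler_pdivrMr ?ltr_wpDl // mul1r lerDl.
Qed.

Lemma conv_is_derive g (C : R) phi x i : (forall x, {for x, continuous g}) ->
  (forall x, `|g x| <= C) -> CO setT 1 phi -> (exists r, bsupp r phi) ->
  is_derive x (e_ i) (conv g phi) (conv g (D i phi) x).
Proof.
move=> cg gC hp rp.
have cp : cpt phi by split => // y; exact: CO_cont hp _.
have cDp := cpt_D i hp rp.
have C0 : 0 <= C by apply: le_trans (gC 0).
have [r pr] := rp.
pose s := (Num.bound `|x| + r.+1)%N.
have s0 : (0 < s)%N by rewrite /s addnS.
pose M := (C + 1) * (3 * s)%:R ^+ n.
have M0 : 0 < M by rewrite mulr_gt0 ?exprn_gt0 ?ltr_wpDl ?ltr0n // muln_gt0.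
have hb : `|x| < (Num.bound `|x|)%:R by rewrite archi_boundP.
suff L : (fun h : R => h^-1 *: ((conv g phi \o shift x) (h *: e_ i) - conv g phi x)) @ 0^'
    --> (conv g (D i phi) x : R).
  by apply: DeriveDef; [exact: (cvgP _ L)|exact: cvg_lim L].
apply/cvgrPdist_le => e e0.
have [d d0 hd] := cpt_unif cDp (divr_gt0 e0 M0).
near=> h.
have hd' : `|h| < d by near: h; exact: dnbhs0_lt.
have h1 : `|h| < 1 by near: h; exact: dnbhs0_lt.
have h0 : h != 0 by near: h; exact: nbhs_dnbhs_neq.
rewrite /= /conv -Lam_sub; [|exact: cpt_conv|exact: cpt_conv].
rewrite [_ *: _](_ : _ = Lam (fun y => h^-1 * (g y * phi (h *: e_ i + x - y) - g y * phi (x - y)))); last first.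
  rewrite (intZ LamP) //.
  have := cptD (cpt_conv (h *: e_ i + x) cg cp) (cptZ (-1) (cpt_conv x cg cp)).
  by congr cpt; apply/funext => y; rewrite mulN1r.
rewrite -Lam_sub; first last.
- apply: cptZ; have := cptD (cpt_conv (h *: e_ i + x) cg cp) (cptZ (-1) (cpt_conv x cg cp)).
  by congr cpt; apply/funext => y; rewrite mulN1r.
- exact: (@cpt_conv g (D i phi) x).
set F := (X in Lam X).
have -> : F = (fun y => g y * (D i phi (x - y) - h^-1 * (phi (h *: e_ i + x - y) - phi (x - y)))).
  by apply/funext => y; rewrite /F; ring.
apply: (@le_trans _ _ (C * (e / M) * (3 * s)%:R ^+ n)).
  apply: conv_small => //.
  - move=> y; apply: continuousB; first by apply: (@cont_reflect (D i phi)); exact: cDp.1.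
    apply: continuousM; first exact: cst_continuous.
    by apply: continuousB; apply: cont_reflect; exact: cp.1.
  - move=> y; have [t ht E] := @line_mvt R n phi (x - y) (e_ i) h
      (fun t _ => CO_derivable hp (I : setT (x - y + t *: e_ i))).
    rewrite -addrA [_ *: _ + _]addrC E mulKf // distrC; apply: hd.
    rewrite addrAC subrr add0r normrZ (le_lt_trans _ hd') //.
    by rewrite -[leRHS]mulr1 ler_pM // norm_basis_vec.
  - move=> y; rewrite /s natrD => ys.
    have k1 : `|y| <= `|x - y| + `|x|.
      by rewrite -[X in `|X| <= _](subKr x) (le_trans (ler_normB _ _)) // addrC.
    have k2 : `|x - y| <= `|h *: e_ i + x - y| + `|h|.
      have -> : x - y = (h *: e_ i + x - y) - h *: e_ i by rewrite addrAC [_ + x]addrC addrK.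
      rewrite (le_trans (ler_normB _ _)) // lerD2l normrZ.
      by rewrite -[leRHS]mulr1 ler_pM // norm_basis_vec.
    rewrite !pr; [|by move: ys; rewrite -natr1; lra|by move: ys; rewrite -natr1; lra].
    by rewrite subrr mulr0 subr0 (bsupp_D i pr) //; move: ys; rewrite -natr1; lra.
have -> : C * (e / M) * (3 * s)%:R ^+ n = e * (C / (C + 1)).
  rewrite /M; field; rewrite !gt_eqF ?ltr_wpDl ?exprn_gt0 ?ltr0n ?muln_gt0 //.
by rewrite -[leRHS]mulr1 ler_pM2l // ler_pdivrMr ?ltr_wpDl // mul1r lerDl.
Unshelve. all: by end_near. Qed.

Lemma is_derive_reflect phi x y i : derivable phi (x - y) (e_ i) ->
  is_derive y (e_ i) (fun y => phi (x - y)) (- D i phi (x - y)).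
Proof.
move=> dp; have Y : is_derive y (e_ i) (fun y : Rn => x - y) (0 - e_ i) by apply: is_deriveB.
have c1 : is_derive (0 : R) 1 (fun t : R => phi (t *: e_ i + (x - y))) (D i phi (x - y)).
  apply: DeriveDef; first exact: (@derivable1P R Rn R phi (x - y) (e_ i)).1 dp.
  by rewrite -(derive_line phi).
have c0 : is_derive (0 : R) 1 (fun t : R => - t) (-1) by apply: is_deriveN.
have c1' : is_derive (- 0 : R) 1 (fun t : R => phi (t *: e_ i + (x - y))) (D i phi (x - y)).
  by rewrite oppr0.
have H := @is_derive_comp1 R R _ (fun t : R => - t) 0 1 _ _ c1' c0.
have E : (fun t : R => phi (t *: e_ i + (x - y))) \o (fun t : R => - t) =
    (fun t : R => phi (x - (t *: e_ i + y))).
  by apply/funext => t /=; rewrite scaleNr opprD [_ + (x - y)]addrC -addrA [- y + _]addrC.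
rewrite E in H; case: H => H1 H2; apply: DeriveDef.
  exact: (@derivable1P R Rn R (fun y => phi (x - y)) y (e_ i)).2 H1.
by rewrite derive_line H2 mulrN1.
Qed.

(** Integration by parts: [Lam] annihilates the derivative in y of g(y) phi(x - y). *)
Lemma conv_D g phi x i : CO setT 1 g -> (exists r, bsupp r g) ->
  CO setT 1 phi -> (exists r, bsupp r phi) ->
  conv g (D i phi) x = conv (D i g) phi x.
Proof.
move=> hg rg hp rp.
have cg := CO_cpt (CO_leS hg) rg; have cp := CO_cpt (CO_leS hp) rp.
have cDg := cpt_D i hg rg; have cDp := cpt_D i hp rp.
pose F y := g y * phi (x - y).
have dr y : is_derive y (e_ i) (fun y => phi (x - y)) (- D i phi (x - y)).
  by apply: is_derive_reflect; exact: CO_derivable hp _.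
have CO1r : CO setT 1 (fun y => phi (x - y)).
  apply/CO_P.
  split=> [y _|j]; first by apply: cont_reflect; exact: cp.1.
  split=> [y _|].
    apply: (@ex_derive _ _ _ _ _ _ _ (is_derive_reflect _)).
    exact: CO_derivable hp _.
  apply/CO_P; split=> // y _.
  have -> : D j (fun y => phi (x - y)) = (fun y => -1 * D j phi (x - y)).
    apply/funext => z; rewrite mulN1r.
    apply: (@derive_val _ _ _ _ _ _ _ (is_derive_reflect _)).
    exact: CO_derivable hp _.
  apply: continuousM; first exact: cst_continuous.
  by apply: (@cont_reflect (D j phi)); exact: CO_cont (CO_D j hp) _.
have hF : CO setT 1 F by apply: CO_mul => //; exact: openT.
have rF : exists r, bsupp r F.
  by have [r gr] := rg; exists r => y /gr; rewrite /F => ->; rewrite mul0r.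
have := int_D LamP i hF rF.
have -> : D i F = (fun y => D i g y * phi (x - y) - g y * D i phi (x - y)).
  apply/funext => y; rewrite /F [LHS]deriveM //.
  - rewrite (@derive_val _ _ _ _ _ _ _ (dr y)) /GRing.scale /= mulrN addrC.
    by rewrite mulrC.
  - exact: CO_derivable hg _.
rewrite Lam_sub; [|apply: (@cpt_conv (D i g) phi x) => //; exact: cDg.1|apply: (@cpt_conv g (D i phi) x) => //; exact: cg.1].
by rewrite /conv => /subr0_eq.
Qed.

(** All derivatives but one are moved onto [g] by [conv_D], and the last one falls on the C^1
    kernel; so one convolution gains exactly one order, which is what takes a gauge field from C^2
    to C^3. *)
Lemma CO_conv m g phi : CO setT m g -> (exists r, bsupp r g) ->
  CO setT 1 phi -> (exists r, bsupp r phi) -> CO setT m.+1 (conv g phi).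
Proof.
move=> + + hp rp; have cp := CO_cpt (CO_leS hp) rp.
elim: m g => [|m ih] g hg rg; apply/CO_P.
  have cg := CO_cpt hg rg; have [C _ gC] := cpt_bounded cg.
  split=> [x _|i]; first exact: conv_cont cg.1 gC cp.
  split=> [x _|]; first exact: (@ex_derive _ _ _ _ _ _ _ (conv_is_derive x i cg.1 gC hp rp)).
  apply/CO_P; split=> // x _.
  have -> : D i (conv g phi) = conv g (D i phi).
    by apply/funext => y; apply: (@derive_val _ _ _ _ _ _ _ (conv_is_derive y i cg.1 gC hp rp)).
  apply: conv_cont cg.1 gC _; exact: cpt_D.
have cg := CO_cpt (CO_le (leq0n _) hg) rg; have [C _ gC] := cpt_bounded cg.
split=> [x _|i]; first exact: conv_cont cg.1 gC cp.
split=> [x _|]; first exact: (@ex_derive _ _ _ _ _ _ _ (conv_is_derive x i cg.1 gC hp rp)).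
have -> : D i (conv g phi) = conv (D i g) phi.
  apply/funext => y; rewrite -conv_D //; last exact: CO_le hg.
  exact: (@derive_val _ _ _ _ _ _ _ (conv_is_derive y i cg.1 gC hp rp)).
apply: ih; first exact: CO_D.
by have [r gr] := rg; exists r; exact: bsupp_D.
Qed.

Lemma D_conv g phi x i : CO setT 1 g -> (exists r, bsupp r g) ->
  CO setT 1 phi -> (exists r, bsupp r phi) ->
  D i (conv g phi) x = conv (D i g) phi x.
Proof.
move=> hg rg hp rp; rewrite -conv_D //.
have cg := CO_cpt (CO_leS hg) rg; have [C _ gC] := cpt_bounded cg.
exact: (@derive_val _ _ _ _ _ _ _ (conv_is_derive x i cg.1 gC hp rp)).
Qed.

(** Translation invariance is not among the axioms of [is_integral]. It follows for C^1 functions: z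
    -> Lam (phi (z - .)) has zero partial derivatives by [int_D], hence is constant along the
    segment from 0 to x. *)
Lemma Lam_translate phi x : CO setT 1 phi -> (exists r, bsupp r phi) ->
  Lam (fun y => phi (x - y)) = Lam (fun y => phi (- y)).
Proof.
move=> hp rp; have cp := CO_cpt (CO_leS hp) rp.
have c1 (z : Rn) : {for z, continuous (fun _ : Rn => 1 : R)} by exact: cst_continuous.
have b1 (z : Rn) : `|(fun=> 1 : R) z| <= 1 by rewrite normr1.
pose c := conv (fun=> 1) phi.
have cE z : c z = Lam (fun y => phi (z - y)).
  by rewrite /c /conv; congr Lam; apply/funext => y; rewrite mul1r.
have dc z i : is_derive z (e_ i) c 0.
  have := conv_is_derive z i c1 b1 hp rp; congr is_derive.
  have hq : CO setT 1 (fun y => phi (z - y)).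
    apply/CO_P.
    split=> [y _|j]; first by apply: cont_reflect; exact: cp.1.
    split=> [y _|].
      apply: (@ex_derive _ _ _ _ _ _ _ (is_derive_reflect _)).
      exact: CO_derivable hp _.
    apply/CO_P; split=> // y _.
    have -> : D j (fun y => phi (z - y)) = (fun y => -1 * D j phi (z - y)).
      apply/funext => w; rewrite mulN1r.
      apply: (@derive_val _ _ _ _ _ _ _ (is_derive_reflect _)).
      exact: CO_derivable hp _.
    apply: continuousM; first exact: cst_continuous.
    by apply: (@cont_reflect (D j phi)); exact: CO_cont (CO_D j hp) _.
  have := int_D LamP i hq (cpt_translate z cp).2.
  have -> : D i (fun y => phi (z - y)) = (fun y => -1 * (1 * D i phi (z - y))).
    apply/funext => w; rewrite mulN1r mul1r.
    apply: (@derive_val _ _ _ _ _ _ _ (is_derive_reflect _)).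
    exact: CO_derivable hp _.
  rewrite (intZ LamP); last by apply: (@cpt_conv (fun=> 1) (D i phi)) => //; exact: cpt_D.
  by rewrite mulN1r => /eqP; rewrite oppr_eq0 => /eqP.
have hc : CO setT 1 c.
  apply/CO_P.
  split=> [z _|i]; first exact: conv_cont c1 b1 cp.
  split=> [z _|]; first exact: (@ex_derive _ _ _ _ _ _ _ (dc z i)).
  apply/CO_P; split=> // z _.
  have -> : D i c = (fun=> 0) by apply/funext => w; exact: (@derive_val _ _ _ _ _ _ _ (dc w i)).
  exact: cst_continuous.
have difc z : differentiable c z by apply: (CO_differentiable openT _ hc).
have [t _ E] := @line_mvt R n c 0 x 1 (fun t _ => diff_derivable (difc _)).
have : c x - c 0 = 0.
  move: E; rewrite add0r scale1r mul1r => ->.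
  rewrite derive_sum_coord // big1 // => i _.
  by rewrite (@derive_val _ _ _ _ _ _ _ (dc _ i)) mul0r.
move/subr0_eq; rewrite !cE => ->; congr Lam; apply/funext => y; by rewrite sub0r.
Qed.

(** A radial kernel, positive exactly on the Euclidean ball of radius |d| and of class C^1, the
    order that [CO_conv] asks of a kernel. *)
Definition bump (d : R) y : R := pospow 2 (d ^+ 2 - \sum_i y 0 i ^+ 2).

Lemma CO_bump d : CO setT 1 (bump d).
Proof.
apply: CO_pospow => //; first exact: openT.
apply: CO_congr (CO_add openT (CO_cst 1 (d ^+ 2) openT) (CO_mul openT (CO_cst 1 (-1) openT)
  (@CO_sum R n setT 1 _ (index_enum 'I_n) xpredT (fun i x => x 0 i * x 0 i) openT _))).
- exact: openT.
- by move=> y _; rewrite mulN1r; congr (_ - _); apply: eq_bigr => i _; rewrite expr2.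
- by move=> i _; apply: CO_mul; [exact: openT|exact/CO_coord/openT|exact/CO_coord/openT].
Qed.

Lemma bump_ge0 d y : 0 <= bump d y. Proof. exact: pospow_ge0. Qed.

Lemma bump_out d y : 0 <= d -> d <= `|y| -> bump d y = 0.
Proof.
move=> d0 dy; apply: pospow_neg; rewrite subr_le0.
rewrite leNgt; apply/negP => h.
have [d1|d1] := eqVneq d 0.
  by move: h; rewrite d1 expr0n /= ltNge sumr_ge0 // => i _; exact: sqr_ge0.
have dp : 0 < d by rewrite lt_neqAle eq_sym d1.
have : `|y| < d.
  apply: norm_rV_lt => // i; rewrite -(ltr_pXn2r (ltn0Sn 1)) ?nnegrE // real_normK ?num_real //.
  apply: le_lt_trans h; rewrite (bigD1 i) //= lerDl sumr_ge0 // => j _; exact: sqr_ge0.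
by rewrite ltNge dy.
Qed.

Lemma bump0 d : 0 < d -> 0 < bump d 0.
Proof.
move=> d0; rewrite /bump big1 ?subr0; last by move=> i _; rewrite mxE expr0n.
by rewrite pospow_pos ?exprn_gt0 // exprn_ge0 // ltW.
Qed.

(** By [Lam_translate] the mass of the translated kernel is independent of x, so one constant
    normalises the convolution to a weighted average of [g] over points within d of x. *)
Lemma conv_approx g (d e : R) : cpt g -> 0 < d <= 1 -> 0 <= e ->
  (forall x y, `|y - x| < d -> `|g y - g x| <= e) ->
  forall x, `|(Lam (fun y => bump d (- y)))^-1 * conv g (bump d) x - g x| <= e.
Proof.
move=> cg /andP[d0 d1] e0 hd x.
have rb : exists r, bsupp r (bump d).
  by exists 1%N => y y1; apply: bump_out; rewrite ?ltW // (le_lt_trans d1).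
have hb := CO_bump d.
have cb := CO_cpt (CO_leS hb) rb.
have E := Lam_translate x hb rb.
have c0 : 0 < Lam (fun y => bump d (- y)).
  apply: (int_pos LamP (p := 0)).
  - by have := cpt_translate 0 cb; congr cpt; apply/funext => y; rewrite sub0r.
  - by move=> y; exact: bump_ge0.
  - by rewrite oppr0; exact: bump0.
set c := Lam _ in c0 E *.
have -> : c^-1 * conv g (bump d) x - g x = c^-1 * (conv g (bump d) x - c * g x).
  by rewrite mulrBr mulKf ?gt_eqF.
rewrite normrM.
have -> : `|c^-1| = c^-1 by rewrite ger0_norm // invr_ge0 ltW.
rewrite ler_pdivrMl // -E -[X in `|_ - X|]mulrC.
rewrite -(intZ LamP); last exact: cpt_translate.
rewrite /conv -Lam_sub; [|by apply: cpt_conv => //; exact: cg.1|by apply: cptZ; exact: cpt_translate].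
have -> : (fun y => g y * bump d (x - y) - g x * bump d (x - y)) =
  (fun y => (g y - g x) * bump d (x - y)) by apply/funext => y; rewrite mulrBl.
have ct : cpt (fun y => (g y - g x) * bump d (x - y)).
  by apply: cpt_conv => // y; apply: continuousB; [exact: cg.1|exact: cst_continuous].
have bd y : `|(g y - g x) * bump d (x - y)| <= e * bump d (x - y).
  rewrite normrM [X in _ * X <= _]ger0_norm ?bump_ge0 //.
  have [xy|xy] := ltP `|y - x| d; first by rewrite ler_wpM2r ?bump_ge0 // hd.
  by rewrite bump_out ?mulr0 //; [exact: ltW|rewrite distrC].
rewrite mulrC -!(intZ LamP); [|exact: cpt_translate].
rewrite ler_norml; apply/andP; split.
  rewrite -mulN1r -(intZ LamP); last by apply: cptZ; exact: cpt_translate.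
  apply: (int_le LamP) => //; first by do 2 apply: cptZ; exact: cpt_translate.
  by move=> y; have := bd y; rewrite ler_norml mulN1r => /andP[].
apply: (int_le LamP) => //; first by apply: cptZ; exact: cpt_translate.
by move=> y; have := bd y; rewrite ler_norml => /andP[].
Qed.

(** Derivatives up to order two pass onto [f] under the convolution, so a single radius [d], from
    the uniform continuity of all of them, controls the approximation in C^2. *)
Lemma C2_approx f (e : R) : CO setT 2 f -> (exists r, bsupp r f) -> 0 < e ->
  exists f', [/\ CO setT 3 f', forall x, `|f' x - f x| <= e,
    forall i x, `|D i f' x - D i f x| <= e
    & forall i j x, `|D j (D i f') x - D j (D i f) x| <= e].
Proof.
move=> hf rf e0.
have rD g i : (exists r, bsupp r g) -> exists r, bsupp r (D i g).
  by move=> [r gr]; exists r; exact: bsupp_D.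
have uc g : CO setT 0 g -> (exists r, bsupp r g) -> exists2 d : R, 0 < d &
    forall x y, `|y - x| < d -> `|g y - g x| <= e.
  by move=> hg rg; apply: cpt_unif => //; exact: CO_cpt.
have mono g (d d' : R) : 0 < d' <= d -> (forall x y, `|y - x| < d -> `|g y - g x| <= e) ->
    forall x y, `|y - x| < d' -> `|g y - g x| <= e.
  by move=> /andP[_ dd] h x y /lt_le_trans/(_ dd)/h.
have [d0 d00 hd0] := uc _ (CO_le (leq0n _) hf) rf.
have [d1 d10 hd1] := fin_radius (Q := fun i d => forall x y, `|y - x| < d -> `|D i f y - D i f x| <= e)
  (fun i => mono (D i f)) (fun i => uc _ (CO_le (leq0n _) (CO_D i hf)) (rD _ i rf)).
have [d2 d20 hd2] := fin_radius (I := ('I_n * 'I_n)%type)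
  (Q := fun a d => forall x y, `|y - x| < d -> `|D a.2 (D a.1 f) y - D a.2 (D a.1 f) x| <= e)
  (fun a => mono (D a.2 (D a.1 f)))
  (fun a => uc _ (CO_D a.2 (CO_D a.1 hf)) (rD _ a.2 (rD _ a.1 rf))).
pose d := Num.min 1 (Num.min d0 (Num.min d1 d2)).
have dp : 0 < d by rewrite !lt_min ltr01 d00 d10.
have dl1 : d <= 1 by rewrite ge_min lexx.
have dl (a : R) : a \in [:: d0; d1; d2] -> d <= a.
  by rewrite !inE => /or3P[]/eqP->; rewrite !ge_min lexx ?orbT.
have rb : exists r, bsupp r (bump d).
  by exists 1%N => y y1; apply: bump_out; rewrite ?ltW // (le_lt_trans dl1).
have hb := CO_bump d.
pose c := (Lam (fun y => bump d (- y)))^-1.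
have DZ g i : CO setT 1 g -> D i (fun x => c * g x) = (fun x => c * D i g x).
  by move=> hg; apply/funext => x; exact: (deriveZ c (CO_derivable (i := i) hg _)).
have Dc g i : CO setT 1 g -> (exists r, bsupp r g) ->
    D i (fun x => c * conv g (bump d) x) = (fun x => c * conv (D i g) (bump d) x).
  move=> hg rg; rewrite DZ; first by apply/funext => x; rewrite D_conv.
  by apply: CO_conv => //; exact: CO_leS.
have Dcx g i x (hg : CO setT 1 g) (rg : exists r, bsupp r g) :=
  congr1 (fun F : Rn -> R => F x) (Dc g i hg rg).
have ap g : CO setT 0 g -> (exists r, bsupp r g) ->
    (forall x y, `|y - x| < d -> `|g y - g x| <= e) ->
    forall x, `|c * conv g (bump d) x - g x| <= e.
  by move=> hg rg h x; apply: conv_approx => //; [exact: CO_cpt|rewrite dp|exact: ltW].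
have hf1 : CO setT 1 f by exact: CO_le hf.
exists (fun x => c * conv f (bump d) x); split.
- by apply: CO_mul; [exact: openT|exact/CO_cst/openT|exact: CO_conv].
- apply: ap => //; first exact: CO_le hf.
  by apply: mono hd0; rewrite dp dl // !inE eqxx.
- move=> i x; rewrite Dcx //; apply: ap; [exact: CO_le (CO_D i hf)|exact: rD|].
  by apply: mono (hd1 i); rewrite dp dl // !inE eqxx orbT.
- move=> i j x; rewrite Dc // Dcx; [|exact: CO_D|exact: rD].
  apply: ap; [exact: CO_D (CO_D i hf)|exact/rD/rD|].
  by apply: mono (hd2 (i, j)); rewrite dp dl // !inE eqxx !orbT.
Qed.

End Mollification.

(** * The Noether current of dilations *)

Section CurrentAlgebra.
Variables (R : realType) (n : nat).
Implicit Types (i j a b : 'I_n).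
Variables (X : 'I_n -> R) (c : R) (p : 'I_n -> 'I_n -> 'I_n -> R) (V : 'I_n -> R).
Variables (q : 'I_n -> 'I_n -> 'I_n -> 'I_n -> R) (vv : 'I_n -> 'I_n -> R).
Variables (Dv T EV ED ET : 'I_n -> R) (k dD dT : 'I_n -> 'I_n -> R).
Variables (dk Eq : 'I_n -> 'I_n -> 'I_n -> R) (dw dL : 'I_n -> R) (w L : R).

Hypothesis qC : forall a b i j, q a b i j = q b a i j.
Hypothesis qsym : forall a b i j, q a b i j = q a b j i.
Hypothesis ksym : forall i j, k i j = k j i.
Hypothesis DvE : forall j, Dv j = \sum_i p i i j.
Hypothesis TE : forall a, T a = \sum_i p a i i.
Hypothesis dDE : forall a j, dD a j = \sum_i q a i i j.
Hypothesis dTE : forall a b, dT a b = \sum_i q a b i i.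
Hypothesis EqE : forall a i j, Eq a i j = \sum_b X b * q b a i j.
Hypothesis EDE : forall j, ED j = \sum_i Eq i i j.
Hypothesis ETE : forall a, ET a = \sum_i Eq a i i.
Hypothesis EVE : forall a, EV a = \sum_b X b * vv b a.
Hypothesis dkE : forall a i j, dk a i j = (1 + c) * p a i j + Eq a i j.
Hypothesis dwE : forall a, dw a = (1 + c) * V a + EV a.
Hypothesis cE : 2 * (1 + c) = n%:R.

Let dot (F G : 'I_n -> R) := \sum_j F j * G j.
Let dot3 (F G : 'I_n -> 'I_n -> 'I_n -> R) := \sum_a \sum_i \sum_j F a i j * G a i j.

Hypothesis LE : L = 2^-1 * dot Dv Dv - 4^-1 * dot3 p p - 2^-1 * dot Dv T + 4^-1 * dot T T
  - dot V Dv + dot V T.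
Hypothesis dLE : forall a, dL a = 2^-1 * dot (dD a) Dv + 2^-1 * dot Dv (dD a)
  - 2^-1 * dot3 (q a) p - 2^-1 * dot (dD a) T - 2^-1 * dot Dv (dT a) + 2^-1 * dot T (dT a)
  - dot (vv a) Dv - dot V (dD a) + dot (vv a) T + dot V (dT a).

Hypothesis E1 : forall i j,
  2^-1 * \sum_l (q l i j l + q l j i l - q l l i j - q j i l l) = vv i j.
Hypothesis E2 : \sum_i vv i i = 0.

Let dotC F G : dot F G = dot G F.
Proof. by apply: eq_bigr => j _; rewrite mulrC. Qed.

Let XdD j : \sum_a X a * dD a j = ED j.
Proof.
rewrite EDE; under eq_bigr do rewrite dDE mulr_sumr.
by rewrite exchange_big; apply: eq_bigr => i _; rewrite EqE.
Qed.

Let XdT j : \sum_a X a * dT a j = ET j.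
Proof.
rewrite ETE; under eq_bigr do rewrite dTE mulr_sumr.
by rewrite exchange_big; apply: eq_bigr => i _; rewrite EqE.
Qed.

Let XdEV j : \sum_a X a * vv a j = EV j. Proof. by rewrite EVE. Qed.

Let Xdot (F : 'I_n -> R) (G : 'I_n -> 'I_n -> R) (EG : 'I_n -> R) :
  (forall j, \sum_a X a * G a j = EG j) ->
  \sum_a X a * dot (G a) F = dot EG F.
Proof.
move=> h; under eq_bigr do rewrite mulr_sumr.
rewrite exchange_big; apply: eq_bigr => j _ /=; rewrite -h mulr_suml.
by apply: eq_bigr => a _; rewrite mulrA.
Qed.

Let Xdot3 : \sum_a X a * dot3 (q a) p = dot3 Eq p.
Proof.
under eq_bigr do rewrite mulr_sumr.
rewrite exchange_big; apply: eq_bigr => b _ /=.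
under eq_bigr do rewrite mulr_sumr.
rewrite exchange_big; apply: eq_bigr => i _ /=.
under eq_bigr do rewrite mulr_sumr.
rewrite exchange_big; apply: eq_bigr => j _ /=.
by rewrite EqE mulr_suml; apply: eq_bigr => a _; rewrite mulrA.
Qed.

Let XdL : \sum_a X a * dL a =
  dot Dv ED - 2^-1 * dot3 Eq p - 2^-1 * (dot ED T + dot Dv ET) + 2^-1 * dot T ET
  - (dot EV Dv + dot V ED) + (dot EV T + dot V ET).
Proof.
have -> : \sum_a X a * dL a = \sum_a (X a * dot (dD a) Dv) - 2^-1 * (\sum_a X a * dot3 (q a) p)
   - 2^-1 * (\sum_a X a * dot (dD a) T) - 2^-1 * (\sum_a X a * dot (dT a) Dv)
   + 2^-1 * (\sum_a X a * dot (dT a) T) - (\sum_a X a * dot (vv a) Dv)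
   - (\sum_a X a * dot (dD a) V) + (\sum_a X a * dot (vv a) T) + (\sum_a X a * dot (dT a) V).
  rewrite !mulr_sumr -!(sumrB, big_split); apply: eq_bigr => a _.
  rewrite dLE [dot Dv (dD a)]dotC [dot Dv (dT a)]dotC [dot T _]dotC ![dot V _]dotC /=.
  by field.
rewrite !(Xdot _ XdD) !(Xdot _ XdT) !(Xdot _ XdEV) Xdot3.
by rewrite [dot ED Dv]dotC [dot ET Dv]dotC [dot ET T]dotC [dot ED V]dotC [dot ET V]dotC; ring.
Qed.

Let E1' i j : 2^-1 * (dD i j + dD j i) - 2^-1 * (\sum_l q l l i j) - 2^-1 * dT i j = vv i j.
Proof.
rewrite -E1 !dDE dTE -!mulrBr -big_split -!sumrB /=; congr (_ * _).
apply: eq_bigr => l _; rewrite (qC i l l j) (qC j l l i) (qC i j l l).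
by rewrite (qsym l i l j) (qsym l j l i).
Qed.

(** The trace of the tensor equation, with v harmonic: the linearised scalar curvature, div div h -
    Laplacian of tr h, vanishes. *)
Let E3 : \sum_a dD a a = \sum_a dT a a.
Proof.
have E : \sum_i (2^-1 * (dD i i + dD i i) - 2^-1 * (\sum_l q l l i i) - 2^-1 * dT i i) = 0.
  by rewrite -[RHS]E2; apply: eq_bigr => i _; exact: E1'.
move: E; rewrite !sumrB -!mulr_sumr big_split /=.
have -> : \sum_i \sum_l q l l i i = \sum_a dT a a.
  by rewrite exchange_big; apply: eq_bigr => a _; rewrite dTE.
by move: (\sum_i dD i i) (\sum_i dT i i) => A B E; lra.
Qed.

Let S j := Dv j - 2^-1 * T j - V j.

Let dkS j : \sum_a dk a a j = (1 + c) * Dv j + ED j.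
Proof. by rewrite DvE EDE mulr_sumr -big_split; apply: eq_bigr => a _; rewrite dkE. Qed.

Let dkT a : \sum_i dk a i i = (1 + c) * T a + ET a.
Proof. by rewrite TE ETE mulr_sumr -big_split; apply: eq_bigr => i _; rewrite dkE. Qed.

(** The divergence of the current, with jets as independent variables: [p], [V] and [q], [vv] are
    the first and second derivatives of h and v, [Dv] is the divergence of h, [T] the gradient of
    its trace; [Eq], [ED], [ET], [EV] are derivatives along X, and a prefix [d] is a partial
    derivative. The equations remove the terms in k and w with second-order coefficients. What
    remains is (1 + c) times twice L, plus the derivative of L along X, minus the divergence of X L;
    these cancel by 2 (1 + c) = n. *)
Lemma div_current_algebra :
  \sum_a (\sum_j ((dD a j - 2^-1 * dT a j - vv a j) * k a j + S j * dk a a j)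
  - 2^-1 * (\sum_i \sum_j (q a a i j * k i j + p a i j * dk a i j))
  + ((2^-1 * dT a a - 2^-1 * dD a a + vv a a) * (\sum_i k i i)
     + (2^-1 * T a - 2^-1 * Dv a + V a) * (\sum_i dk a i i))
  + ((dT a a - dD a a) * w + (T a - Dv a) * dw a)
  - (L + X a * dL a)) = 0.
Proof.
pose K1 := \sum_a \sum_j (dD a j - 2^-1 * dT a j - vv a j) * k a j.
pose K2 := \sum_i \sum_j (\sum_a q a a i j) * k i j.
have t1 : \sum_a \sum_j ((dD a j - 2^-1 * dT a j - vv a j) * k a j + S j * dk a a j) =
  K1 + (1 + c) * dot S Dv + dot S ED.
  under eq_bigr do rewrite big_split /=.
  rewrite big_split /= -addrA; congr (_ + _).
  rewrite exchange_big /= /dot mulr_sumr -big_split /=; apply: eq_bigr => j _.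
  by rewrite -mulr_sumr dkS; ring.
have t2 : \sum_a \sum_i \sum_j (q a a i j * k i j + p a i j * dk a i j) =
  K2 + (1 + c) * dot3 p p + dot3 Eq p.
  rewrite /dot3 mulr_sumr -addrA -big_split /=.
  have -> : K2 = \sum_a \sum_i \sum_j q a a i j * k i j.
    rewrite [RHS]exchange_big; apply: eq_bigr => i _ /=.
    by rewrite [RHS]exchange_big; apply: eq_bigr => j _ /=; rewrite mulr_suml.
  rewrite -big_split; apply: eq_bigr => a _ /=.
  rewrite mulr_sumr -!big_split; apply: eq_bigr => i _ /=.
  rewrite mulr_sumr -!big_split; apply: eq_bigr => j _ /=.
  by rewrite dkE; ring.
have t3 : \sum_a (2^-1 * T a - 2^-1 * Dv a + V a) * (\sum_i dk a i i) =
  (1 + c) * (2^-1 * dot T T - 2^-1 * dot Dv T + dot V T)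
  + (2^-1 * dot T ET - 2^-1 * dot Dv ET + dot V ET).
  rewrite /dot !mulr_sumr -!(sumrB, big_split) /= mulr_sumr -big_split.
  by apply: eq_bigr => a _ /=; rewrite dkT; ring.
have t4 : \sum_a (T a - Dv a) * dw a =
  (1 + c) * (dot V T - dot V Dv) + (dot EV T - dot EV Dv).
  rewrite /dot -!sumrB mulr_sumr -big_split; apply: eq_bigr => a _ /=.
  by rewrite dwE; ring.
have t5 : \sum_a (dT a a - dD a a) * w = 0.
  by rewrite -mulr_suml sumrB E3 subrr mul0r.
have t6 : \sum_a (2^-1 * dT a a - 2^-1 * dD a a + vv a a) * (\sum_i k i i) = 0.
  by rewrite -mulr_suml big_split /= sumrB -!mulr_sumr E3 E2 subrr addr0 mul0r.
(* The second-order coefficients contracted with [k] form the linearised Ricci equation; the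
   symmetry of [k] allows the divergence term to be symmetrised first. *)
have t7 : K1 = 2^-1 * K2.
  have sk : \sum_a \sum_j dD a j * k a j = \sum_a \sum_j 2^-1 * (dD a j + dD j a) * k a j.
    have e : \sum_a \sum_j dD a j * k a j = \sum_a \sum_j dD j a * k a j.
      by rewrite exchange_big; apply: eq_bigr => a _; apply: eq_bigr => j _; rewrite ksym.
    have h2 (z : R) : z = 2^-1 * (z + z) by field.
    rewrite [LHS]h2 {2}e -big_split mulr_sumr; apply: eq_bigr => a _ /=.
    by rewrite -big_split mulr_sumr; apply: eq_bigr => j _ /=; ring.
  have -> : K1 = \sum_a \sum_j dD a j * k a j - \sum_a \sum_j (2^-1 * dT a j + vv a j) * k a j.
    rewrite -sumrB; apply: eq_bigr => a _; rewrite -sumrB; apply: eq_bigr => j _.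
    by ring.
  rewrite sk -sumrB mulr_sumr; apply: eq_bigr => a _.
  rewrite -sumrB mulr_sumr; apply: eq_bigr => j _.
  by rewrite -(E1' a j); ring.
rewrite !(sumrB, big_split) /= -!mulr_sumr t1 t2 t3 t4 t5 t6 t7 XdL sumr_const card_ord.
have -> : L *+ n = 2 * (1 + c) * L by rewrite -(mulr_natl L n) -cE.
rewrite LE.
have -> : dot S Dv = dot Dv Dv - 2^-1 * dot Dv T - dot V Dv.
  by rewrite /dot mulr_sumr -!sumrB; apply: eq_bigr => j _; rewrite /S; ring.
have -> : dot S ED = dot Dv ED - 2^-1 * dot ED T - dot V ED.
  by rewrite /dot mulr_sumr -!sumrB; apply: eq_bigr => j _; rewrite /S; ring.
by field.
Qed.

End CurrentAlgebra.

Section NoetherCurrent.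
Variables (R : realType) (n : nat).
Local Notation Rn := 'rV[R]_n.
Local Notation e_ i := (basis_vec R i).
Local Notation D i f := (fun x => 'D_(basis_vec R i) f x).
Implicit Types (f g : Rn -> R) (y : Rn) (i j a b : 'I_n).

Section Jets.
Variables (X : 'I_n -> R) (c : R) (h : 'I_n -> 'I_n -> R).
Variables (p : 'I_n -> 'I_n -> 'I_n -> R) (v : R) (V : 'I_n -> R).

(* 1-jets at a point: [h], [p b i j] for the b-th derivative of [h i j], [v], [V]
   for its gradient.  [jk] and [jw] are the variations of [h] and [v] under the
   dilation field [X] with weight [c], which is (n-2)/2 below; [jcur] is the
   Noether current of the Lagrangian [jlag]. *)
Definition jdiv j := \sum_i p i i j.
Definition jtr a := \sum_i p a i i.
Definition jk i j := \sum_b X b * p b i j + c * h i j.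
Definition jw := \sum_b X b * V b + c * v.
Definition jlag := 2^-1 * (\sum_j jdiv j * jdiv j) - 4^-1 * (\sum_a \sum_i \sum_j p a i j * p a i j)
  - 2^-1 * (\sum_j jdiv j * jtr j) + 4^-1 * (\sum_j jtr j * jtr j)
  - \sum_j V j * jdiv j + \sum_j V j * jtr j.
Definition jcur a := \sum_j (jdiv j - 2^-1 * jtr j - V j) * jk a j
  - 2^-1 * (\sum_i \sum_j p a i j * jk i j)
  + (2^-1 * jtr a - 2^-1 * jdiv a + V a) * (\sum_i jk i i)
  + (jtr a - jdiv a) * jw - X a * jlag.

End Jets.

Definition current (x0 : Rn) (c : R) (H : 'I_n -> 'I_n -> Rn -> R) (v : Rn -> R) a y : R :=
  jcur (fun b => (y - x0) 0 b) c (fun i j => H i j y) (fun b i j => D b (H i j) y)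
    (v y) (fun b => D b v y) a.

Variables (U : set Rn) (x x0 : Rn) (H : 'I_n -> 'I_n -> Rn -> R) (v : Rn -> R).
Variables (oU : open U) (Ux : U x).
Variables (hH : forall i j, CO U 2 (H i j)) (hv : CO U 2 v).
Variables (Hsym : forall i j y, U y -> H i j y = H j i y).

Variables (E1 : forall i j, 2^-1 * \sum_l (D l (D i (H j l)) x + D l (D j (H i l)) x
   - D l (D l (H i j)) x - D j (D i (H l l)) x) = D i (D j v) x).
Variables (E2 : \sum_i D i (D i v) x = 0).

(** The product rule writes the divergence in terms of jets, in the form of [div_current_algebra];
    Schwarz gives the symmetry of [q] in its derivative indices, [Hsym] that in its tensor
    indices. *)
Lemma div_current : \sum_a D a (current x0 ((n%:R - 2) / 2) H v a) x = 0.
Proof.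
set c := (n%:R - 2) / 2.
pose q a b i j := D a (D b (H i j)) x.
pose vv a b := D a (D b v) x.
pose X b := (x - x0) 0 b.
pose h i j := H i j x.
pose p b i j := D b (H i j) x.
pose V b := D b v x.
have dX a b : is_derive x (e_ a) (fun y => (y - x0) 0 b : R) ((a == b)%:R : R).
  have := isD_sub (is_derive_coord b x (e_ a)) (is_derive_cst (x0 0 b) x (e_ a)).
  rewrite basis_vecE subr0; congr is_derive.
  by apply/funext => y; rewrite !mxE.
have dH a i j : is_derive x (e_ a) (H i j) (p a i j) by exact: is_derive_CO (hH i j) Ux.
have dP a b i j : is_derive x (e_ a) (D b (H i j)) (q a b i j).
  exact: is_derive_CO (CO_D b (hH i j)) Ux.
have dv a : is_derive x (e_ a) v (V a) by exact: is_derive_CO hv Ux.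
have dV a b : is_derive x (e_ a) (D b v) (vv a b).
  exact: is_derive_CO (CO_D b hv) Ux.
have qC a b i j : q a b i j = q b a i j by exact: (schwarz _ _ oU Ux (hH i j)).
have vvC a b : vv a b = vv b a by exact: (schwarz _ _ oU Ux hv).
have Psym b i j y : U y -> D b (H i j) y = D b (H j i) y.
  by move=> Uy; apply: derive_congr oU Uy _ => z Uz; exact: Hsym.
have qsym a b i j : q a b i j = q a b j i.
  by apply: derive_congr oU Ux _ => z Uz; exact: Psym.
have sum_delta (F : 'I_n -> R) a : \sum_b (a == b)%:R * F b = F a.
  rewrite (bigD1 a) //= eqxx mul1r big1 ?addr0 // => b ba.
  by rewrite eq_sym (negbTE ba) mul0r.
have E1q i j : 2^-1 * \sum_l (q l i j l + q l j i l - q l l i j - q j i l l) = vv i j.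
  exact: E1.
have E2q : \sum_i vv i i = 0 by exact: E2.
clearbody q vv.
have hdiv a j := isD_sum (fun i => dP a i i j).
have htr a b := isD_sum (fun i => dP a b i i).
have hk a i j := isD_add (isD_sum (fun b => isD_mul (dX a b) (dP a b i j)))
  (isD_scale c (dH a i j)).
have hw a := isD_add (isD_sum (fun b => isD_mul (dX a b) (dV a b))) (isD_scale c (dv a)).
have hS a j := isD_sub (isD_sub (hdiv a j) (isD_scale 2^-1 (htr a j))) (dV a j).
have hL a := isD_add (isD_sub (isD_add (isD_sub (isD_sub
  (isD_scale 2^-1 (isD_sum (fun j => isD_mul (hdiv a j) (hdiv a j))))
  (isD_scale 4^-1 (isD_sum (fun b => isD_sum (fun i => isD_sum (fun j =>
     isD_mul (dP a b i j) (dP a b i j)))))))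
  (isD_scale 2^-1 (isD_sum (fun j => isD_mul (hdiv a j) (htr a j)))))
  (isD_scale 4^-1 (isD_sum (fun j => isD_mul (htr a j) (htr a j)))))
  (isD_sum (fun j => isD_mul (dV a j) (hdiv a j))))
  (isD_sum (fun j => isD_mul (dV a j) (htr a j))).
have hF a := isD_sub (isD_add (isD_add (isD_sub
  (isD_sum (fun j => isD_mul (hS a j) (hk a a j)))
  (isD_scale 2^-1 (isD_sum (fun i => isD_sum (fun j => isD_mul (dP a a i j) (hk a i j))))))
  (isD_mul (isD_add (isD_sub (isD_scale 2^-1 (htr a a)) (isD_scale 2^-1 (hdiv a a))) (dV a a))
           (isD_sum (fun i => hk a i i))))
  (isD_mul (isD_sub (htr a a) (hdiv a a)) (hw a)))
  (isD_mul (dX a a) (hL a)).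
have dF a : D a (current x0 c H v a) x = _ := @derive_val _ _ _ _ _ _ _ (hF a).
rewrite (eq_bigr _ (fun a _ => dF a)).
pose Eq a i j := \sum_b X b * q b a i j.
pose Dv j := \sum_i p i i j.
pose T a := \sum_i p a i i.
pose EV a := \sum_b X b * vv b a.
pose k i j := \sum_b X b * p b i j + c * h i j.
pose dD a j := \sum_i q a i i j.
pose dT a b := \sum_i q a b i i.
pose dot (F G : 'I_n -> R) := \sum_j F j * G j.
pose dot3 (F G : 'I_n -> 'I_n -> 'I_n -> R) := \sum_a \sum_i \sum_j F a i j * G a i j.
pose L := 2^-1 * dot Dv Dv - 4^-1 * dot3 p p - 2^-1 * dot Dv T + 4^-1 * dot T T
  - dot V Dv + dot V T.
pose dL a := 2^-1 * dot (dD a) Dv + 2^-1 * dot Dv (dD a)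
  - 2^-1 * dot3 (q a) p - 2^-1 * dot (dD a) T - 2^-1 * dot Dv (dT a) + 2^-1 * dot T (dT a)
  - dot (vv a) Dv - dot V (dD a) + dot (vv a) T + dot V (dT a).
have dkE a i j : \sum_b ((a == b)%:R * p b i j + X b * q a b i j) + c * p a i j
    = (1 + c) * p a i j + Eq a i j.
  rewrite big_split /= sum_delta /Eq (eq_bigr _ (fun b _ => congr1 _ (qC b a i j))); ring.
have dwE a : \sum_b ((a == b)%:R * V b + X b * vv a b) + c * V a = (1 + c) * V a + EV a.
  rewrite big_split /= sum_delta /EV (eq_bigr _ (fun b _ => congr1 _ (vvC b a))); ring.
have ksym i j : k i j = k j i.
  rewrite /k /h (Hsym _ _ Ux); congr (_ + _); apply: eq_bigr => b _.
  by rewrite /p (Psym _ _ _ _ Ux).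
have cE : 2 * (1 + c) = n%:R :> R by rewrite /c; field.
have := @div_current_algebra R n X c p V q vv Dv T EV (fun j => \sum_i Eq i i j)
  (fun a => \sum_i Eq a i i) k dD dT
  (fun a i j => \sum_b ((a == b)%:R * p b i j + X b * q a b i j) + c * p a i j) Eq
  (fun a => \sum_b ((a == b)%:R * V b + X b * vv a b) + c * V a) dL
  (\sum_b X b * V b + c * v x) L qC qsym ksym (fun=> erefl) (fun=> erefl)
  (fun _ _ => erefl) (fun _ _ => erefl) (fun _ _ _ => erefl) (fun=> erefl) (fun=> erefl)
  (fun=> erefl) dkE dwE cE erefl (fun=> erefl) E1q E2q.
move=> Z; rewrite -[RHS]Z; apply: eq_bigr => a _.
congr (_ - _); rewrite eqxx mul1r; congr (_ + _ * _).
rewrite /dL /dot /dot3.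
have s2 (F G : 'I_n -> R) : \sum_j (F j * G j + G j * F j) = 2 * \sum_j G j * F j.
  by rewrite mulr_sumr; apply: eq_bigr => j _; ring.
have -> : \sum_b \sum_i \sum_j (q a b i j * p b i j + p b i j * q a b i j) =
   2 * (\sum_b \sum_i \sum_j q a b i j * p b i j).
  rewrite mulr_sumr; apply: eq_bigr => b _; rewrite mulr_sumr; apply: eq_bigr => i _.
  by rewrite mulr_sumr; apply: eq_bigr => j _; ring.
rewrite !s2 !big_split /=.
have -> : \sum_j dD a j * Dv j = \sum_j Dv j * dD a j by apply: eq_bigr => j _; rewrite mulrC.
by field.
Qed.

End NoetherCurrent.

(** * Tangent vectors of a level set *)

Section LocalHypersurface.
Variables (R : realType) (n : nat).
Local Notation Rn := 'rV[R]_n.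
Local Notation e_ i := (basis_vec R i).
Local Notation D i f := (fun x => 'D_(basis_vec R i) f x).
Implicit Types (f g phi : Rn -> R) (x y z v w : Rn) (U V : set Rn) (k : nat) (i j : 'I_n).

Definition dotp x y : R := \sum_i x 0 i * y 0 i.

Lemma dotpC x y : dotp x y = dotp y x.
Proof. by apply: eq_bigr => i _; rewrite mulrC. Qed.

Lemma dotpDr x y z : dotp x (y + z) = dotp x y + dotp x z.
Proof. by rewrite -big_split; apply: eq_bigr => i _; rewrite mxE mulrDr. Qed.

Lemma dotpZr x (c : R) y : dotp x (c *: y) = c * dotp x y.
Proof. by rewrite mulr_sumr; apply: eq_bigr => i _; rewrite mxE mulrCA. Qed.

Lemma dotpBr x y z : dotp x (y - z) = dotp x y - dotp x z.
Proof. by rewrite -scaleN1r dotpDr dotpZr mulN1r. Qed.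

Lemma dotp_ge0 x : 0 <= dotp x x.
Proof. by apply: sumr_ge0 => i _; rewrite -expr2 sqr_ge0. Qed.

Lemma dotp_eq0 x : dotp x x = 0 -> x = 0.
Proof.
move=> /eqP; rewrite psumr_eq0 => [/allP h|i _]; last by rewrite -expr2 sqr_ge0.
apply/rowP => i; rewrite mxE; apply/eqP; rewrite -sqrf_eq0 expr2.
by have := h i (mem_index_enum _).
Qed.

Lemma dotp_gt0 x : x != 0 -> 0 < dotp x x.
Proof.
move=> x0; rewrite lt_neqAle dotp_ge0 andbT eq_sym.
by apply: contra x0 => /eqP/dotp_eq0/eqP.
Qed.

Lemma form_ebar x y z : Defs.form (ebar x) y z = dotp y z.
Proof.
by rewrite /Defs.form /ebar mulmx1 mxE; apply: eq_bigr => i _; rewrite !mxE.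
Qed.

Lemma pd_interior (E : set Rn) i f x : E° x -> pd E i f x = D i f x.
Proof. by move=> Ex; rewrite /pd asboolT. Qed.

Lemma within_openP U f : open U ->
  {within U, continuous f} <-> (forall x, U x -> {for x, continuous f}).
Proof.
move=> oU; rewrite continuous_open_subspace //; split=> h x; first by move=> Ux; apply: h; rewrite inE.
by rewrite inE; exact: h.
Qed.

Lemma Ck_CO U k f : open U -> Ck U k f -> CO U k f.
Proof.
move=> oU; elim: k f => [|k ih] f /= [cf hf]; apply/CO_P.
  by split=> //; exact/within_openP.
have iU : U° = U by exact/interior_id.
split=> [|i]; first exact/within_openP.
rewrite iU in hf; split; first exact: (hf i).1.
apply: CO_congr (ih _ (hf i).2) => // y Uy.
by rewrite pd_interior ?iU.
Qed.

Definition grad f x : Rn := \row_i D i f x.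

Lemma derive_grad f x v : differentiable f x -> 'D_v f x = dotp (grad f x) v.
Proof.
by move=> df; rewrite derive_sum_coord //; apply: eq_bigr => i _; rewrite mxE.
Qed.

(** Strict differentiability: the expansion uses the gradient at x but is uniform in the base point
    y. With the intermediate value theorem it stands in for the implicit function theorem below. *)
Lemma strict_diff U f x : open U -> U x -> CO U 1 f ->
  forall e : R, 0 < e -> exists2 r : R, 0 < r &
    (forall y, `|y - x| < r -> U y) /\
    (forall y w, `|y - x| < r -> `|y + w - x| < r ->
      `|f (y + w) - f y - dotp (grad f x) w| <= e * `|w|).
Proof.
move=> oU Ux hf e e0; have [d0 d00 hU] := open_ballP oU Ux.
pose e1 : R := e / n.+1%:R.
have e10 : 0 < e1 by rewrite divr_gt0.
have [d1 d10 hd1] : exists2 d : R, 0 < d & forall i y, `|y - x| < d ->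
    `|D i f y - D i f x| <= e1.
  apply: (@fin_radius _ _ (fun i d => forall y, `|y - x| < d -> `|D i f y - D i f x| <= e1)).
    by move=> i a b /andP[_ ba] h y /lt_le_trans/(_ ba)/h.
  move=> i; apply: (cont_epsP _ _).1 => //.
  exact: CO_cont (CO_D i hf) Ux.
(* Both endpoints lie within r of x, so |w| < 2 r and the whole segment stays within 3 r of x. *)
pose r := Num.min d0 d1 / 3.
have m0 : 0 < Num.min d0 d1 by rewrite lt_min d00.
have r0 : 0 < r by rewrite divr_gt0.
have r3 : 3 * r = Num.min d0 d1 by rewrite /r; field.
exists r => //; split.
  move=> y yr; apply: hU; apply: lt_le_trans yr _.
  rewrite (@le_trans _ _ (Num.min d0 d1)) //; last by rewrite ge_min lexx.
  by rewrite -r3; lra.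
move=> y w yr ywr.
have wr : `|w| < 2 * r.
  have -> : w = (y + w - x) - (y - x) by rewrite opprB addrA subrK addrC addKr.
  by apply: le_lt_trans (ler_normB _ _) _; lra.
have inb (t : R) : `|t| <= 1 -> `|y + t *: w - x| < Num.min d0 d1.
  move=> t1; rewrite -addrA addrCA addrC (le_lt_trans (ler_normD _ _)) //.
  rewrite -r3 normrZ.
  have : `|t| * `|w| <= `|w| by rewrite ler_piMl.
  by move: yr wr; lra.
have dfw (t : R) : `|t| <= 1 -> differentiable f (y + t *: w).
  move=> t1; apply: (CO_differentiable oU _ hf); apply: hU.
  by apply: lt_le_trans (inb t t1) _; rewrite ge_min lexx.
have dfw' (t : R) : `|t| <= `|1 : R| -> derivable f (y + t *: w) w.
  by rewrite normr1 => /dfw; exact: diff_derivable.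
have [t ht E] := @line_mvt R n f y w 1 dfw'.
rewrite scale1r mul1r in E; rewrite normr1 in ht.
rewrite E derive_grad; last exact: dfw.
rewrite dotpC [dotp (grad f x) _]dotpC -sumrB.
have -> : \sum_i (w 0 i * grad f (y + t *: w) 0 i - w 0 i * grad f x 0 i) =
  \sum_i w 0 i * (D i f (y + t *: w) - D i f x).
  by apply: eq_bigr => i _; rewrite !mxE mulrBr.
apply: (le_trans (ler_norm_sum _ _ _)).
apply: (@le_trans _ _ (\sum_(j < n) `|w| * e1)).
  apply: ler_sum => i _; rewrite normrM ler_pM // ?normr_coord_le //.
  by apply: hd1; apply: lt_le_trans (inb t ht) _; rewrite ge_min lexx orbT.
rewrite sumr_const card_ord -mulr_natl mulrCA /e1 [n%:R * _]mulrC -mulrA [leRHS]mulrC.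
rewrite ler_wpM2l // ler_piMr //; first exact: ltW.
by rewrite mulrC ler_pdivrMr // mul1r ler_nat.
Qed.

(** On a segment that misses the frontier, [Om] and its closure have the same trace, which is thus
    open and closed in a connected set. *)
Lemma segment_avoids (Om : set Rn) y z : open Om ->
  (forall t : R, 0 <= t <= 1 -> ~ frontier Om (y + t *: (z - y))) -> Om y -> Om z.
Proof.
move=> oOm avoid Omy.
have iOm : Om° = Om by exact/interior_id.
pose c (t : R) := y + t *: (z - y).
pose C := c @` `[0, 1]%classic.
have conC : connected C.
  apply: connected_continuous_connected; first exact: segment_connected.
  apply: continuous_subspaceT => t; apply: cvgD; first exact: cvg_cst.
  by apply: cvgZr_tmp; exact: cvg_id.
have E : C `&` Om = C `&` closure Om.
  apply/seteqP; split=> x [Cx Ox]; split=> //; first exact: subset_closure.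
  have [t tI tE] := Cx; apply: contrapT => nOx; apply: (avoid t).
    by move: tI; rewrite /= in_itv.
  by rewrite -/(c t) tE; split=> //; rewrite iOm.
have /(_ _ _ _)Ceq : C `&` Om !=set0 -> (exists2 A, open A & C `&` Om = C `&` A) ->
    (exists2 A, closed A & C `&` Om = C `&` A) -> C `&` Om = C := conC (C `&` Om).
have c0 : C y.
  by exists 0; rewrite /= ?in_itv /= ?lexx ?ler01 // /c scale0r addr0.
have c1 : C z.
  by exists 1; rewrite /= ?in_itv /= ?lexx ?ler01 // /c scale1r addrC subrK.
rewrite -Ceq in c1; first by case: c1.
- by exists y.
- by exists Om.
- by exists (closure Om); [exact: closed_closure|exact: E].
Qed.

(** The curve is p + t X + s(t) grad phi. For small t the function phi changes sign along the
    gradient between s = - e |t| and s = e |t|, so the intermediate value theorem places a point of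
    [S] there; it remains to choose s(t) = o(t) by one function. *)
Lemma tangent_level S U phi p X : open U -> U p -> CO U 1 phi ->
  S `&` U = [set x | U x /\ phi x = 0] -> S p -> grad phi p != 0 ->
  dotp (grad phi p) X = 0 -> tangent S p X.
Proof.
move=> oU Up hphi SU Sp g0 gX.
set G := grad phi p.
have phip : phi p = 0 by have : (S `&` U) p by []; rewrite SU => -[].
pose a := dotp G G; have a0 : 0 < a by exact: dotp_gt0.
have G0 : 0 < `|G| by rewrite normr_gt0.
have key (e : R) : 0 < e -> exists2 d : R, 0 < d & forall t : R, `|t| < d ->
    exists s : R, `|s| <= e * `|t| /\ S (p + t *: X + s *: G).
  move=> e0.
  pose M := `|X| + e * `|G|.
  have M0 : 0 < M by rewrite ltr_wpDl // mulr_gt0.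
  (* The expansion error is then at most e |t| a / 2, half of the value e |t| a that the linear term
     takes at s = e |t|. *)
  pose eta := e * a / 2 / M.
  have eta0 : 0 < eta by rewrite !divr_gt0 // mulr_gt0.
  have [r r0 [rU hr]] := strict_diff oU Up hphi eta0.
  exists (r / M); first by rewrite divr_gt0.
  move=> t td.
  have [t0|t0] := eqVneq t 0.
    by exists 0; rewrite t0 !normr0 mulr0; split=> //; rewrite !scale0r !addr0.
  have t0' : 0 < `|t| by rewrite normr_gt0.
  have wn (s : R) : `|s| <= e * `|t| -> `|t *: X + s *: G| <= `|t| * M.
    move=> hs; rewrite (le_trans (ler_normD _ _)) // !normrZ /M mulrDr.
    by rewrite lerD2l mulrCA mulrA ler_wpM2r // mulrC.
  have tM : `|t| * M < r by rewrite -ltr_pdivlMr.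
  have est (s : R) : `|s| <= e * `|t| ->
      `|phi (p + t *: X + s *: G) - s * a| <= eta * (`|t| * M).
    move=> hs; have h := hr p (t *: X + s *: G).
    rewrite subrr normr0 in h; have {}h := h r0.
    rewrite addrAC subrr add0r in h; have {}h := h (le_lt_trans (wn s hs) tM).
    rewrite phip subr0 dotpDr !dotpZr gX mulr0 add0r -/a addrA in h.
    by apply: (le_trans h); rewrite ler_pM2l //; exact: wn.
  have etaE : eta * (`|t| * M) = e * `|t| * a / 2 by rewrite /eta; field; rewrite gt_eqF.
  pose f (s : R) := phi (p + t *: X + s *: G).
  have eT : 0 < e * `|t| by rewrite mulr_gt0.
  have f1 : f (e * `|t|) > 0.
    have := est (e * `|t|); rewrite gtr0_norm // lexx => /(_ isT).
    rewrite etaE ler_norml -/(f _) => /andP[+ _].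
    have : 0 < e * `|t| * a by rewrite mulr_gt0.
    by clear SU; move: (f _) => F; lra.
  have f2 : f (- (e * `|t|)) < 0.
    have := est (- (e * `|t|)); rewrite normrN gtr0_norm // lexx => /(_ isT).
    rewrite etaE ler_norml -/(f _) => /andP[_ +].
    have : 0 < e * `|t| * a by rewrite mulr_gt0.
    by clear SU; move: (f _) => F; lra.
  have inU (s : R) : `|s| <= e * `|t| -> U (p + t *: X + s *: G).
    move=> hs; apply: rU; rewrite -[p + _ + _]addrA [_ - p]addrC addKr.
    exact: le_lt_trans (wn s hs) tM.
  have cf : {within `[- (e * `|t|), e * `|t|], continuous f}.
    apply: continuous_in_subspaceT => s; rewrite inE /= in_itv /= -ler_norml => hs.
    apply: (continuous_comp (f := fun s : R => p + t *: X + s *: G)).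
      by apply: cvgD; [exact: cvg_cst|apply: cvgZr_tmp; exact: cvg_id].
    exact: CO_cont hphi (inU s hs).
  have le1 : - (e * `|t|) <= e * `|t| by lra.
  have mid : Num.min (f (- (e * `|t|))) (f (e * `|t|)) <= 0 <=
      Num.max (f (- (e * `|t|))) (f (e * `|t|)).
    by rewrite ge_min le_max (ltW f2) (ltW f1) orbT.
  have [s] := IVT le1 cf mid.
  rewrite in_itv /= -ler_norml => hs fs; exists s; split=> //.
  have : [set x | U x /\ phi x = 0] (p + t *: X + s *: G) by split => //; exact: inU.
  by rewrite -SU => -[].
(* The correction must not depend on e. A choice within t^2 of the least possible |s| is below e |t|
   for every e once t is small enough, as t^2 = o(t). *)
pose I t := [set r : R | exists s : R, `|s| = r /\ S (p + t *: X + s *: G)].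
have ex t : exists s : R, I t !=set0 -> `|s| <= inf (I t) + t ^+ 2 /\ S (p + t *: X + s *: G).
  have [In|In] := pselect (I t !=set0); last by exists 0.
  have [t0|t0] := eqVneq t 0.
    exists 0 => _; rewrite t0 normr0 expr0n addr0 !scale0r !addr0; split=> //.
    apply: lb_le_inf; first by exists 0; exists 0; rewrite normr0 !scale0r !addr0.
    by move=> _ [s [<- _]].
  have hi : has_inf (I t) by split=> //; exists 0 => _ [s [<- _]].
  have t20 : 0 < t ^+ 2 by rewrite exprn_even_gt0.
  have [_ [s [<- Ss]] sl] := inf_adherent t20 hi.
  by exists s => _; split=> //; exact: ltW.
have [sg hsg] := choice ex.
have small (e : R) : 0 < e -> exists2 d : R, 0 < d & forall t, `|t| < d ->
    `|sg t| <= e * `|t| /\ S (p + t *: X + sg t *: G).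
  move=> e0; have e20 : 0 < e / 2 by rewrite divr_gt0.
  have [d d0 hd] := key _ e20.
  exists (Num.min d (e / 2)); first by rewrite lt_min d0.
  move=> t; rewrite lt_min => /andP[td te].
  have [s [hs Ss]] := hd t td.
  have In : I t !=set0 by exists `|s|, s.
  have [h1 h2] := hsg t In; split=> //.
  have : inf (I t) <= `|s| by apply: ge_inf; [exists 0 => _ [u [<- _]]|exists s].
  have : t ^+ 2 <= e / 2 * `|t|.
    by rewrite -real_normK ?num_real // expr2 ler_wpM2r // ltW.
  by move: h1 hs; lra.
have sg0 : sg 0 = 0.
  have [d d0 hd] := small 1 ltr01.
  have := hd 0; rewrite normr0 mulr0 => /(_ d0)[+ _].
  by rewrite normr_le0 => /eqP.
exists (fun t => p + t *: X + sg t *: G); split.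
- by rewrite sg0 !scale0r !addr0.
- have [d d0 hd] := small 1 ltr01.
  apply/nbhs_ballP; exists d => // t; rewrite -ball_normE /ball_ /= sub0r normrN => td.
  exact: (hd t td).2.
- have ds : is_derive (0 : R) 1 (fun t : R => sg t *: G) (0 : Rn).
    have L : (fun h : R => h^-1 *: (((fun t : R => sg t *: G) \o shift 0) (h *: (1 : R)) - sg 0 *: G))
        @ 0^' --> (0 : Rn).
      apply/cvgrPdist_le => e e0.
      have [d d0 hd] := small (e / `|G|) (divr_gt0 e0 G0).
      near=> h.
      have hd' : `|h| < d by near: h; exact: dnbhs0_lt.
      have h0 : h != 0 by near: h; exact: nbhs_dnbhs_neq.
      rewrite /= sub0r normrN sg0 scale0r subr0 addr0 [_%:A]mulr1 !normrZ normfV.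
      rewrite ler_pdivrMl ?normr_gt0 // -ler_pdivlMr //.
      by have [+ _] := hd h hd'; rewrite mulrC mulrA.
    by apply: DeriveDef; [exact: (cvgP _ L)|exact: cvg_lim L].
  have dX : is_derive (0 : R) 1 (fun t : R => p + t *: X) X.
    have h := is_deriveD (is_derive_cst p (0 : R) 1) (_ : is_derive (0 : R) 1 (fun t : R => t *: X) X).
    rewrite add0r in h; apply: h.
    have df : is_diff (0 : R) (fun t : R => t *: X) (fun t : R => t *: X) by apply: is_diff_scalel.
    apply: DeriveDef; first exact: diff_derivable.
    by rewrite deriveE // diff_val scale1r.
  by have h := is_deriveD dX ds; rewrite addr0 in h.
Unshelve. all: by end_near. Qed.

End LocalHypersurface.

(** * The gauge of a star-shaped domain *)

Section StarShaped.
Variables (R : realType) (n : nat).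
Local Notation Rn := 'rV[R]_n.
Local Notation e_ i := (basis_vec R i).
Local Notation D i f := (fun x => 'D_(basis_vec R i) f x).
Implicit Types (f g phi : Rn -> R) (x y z v w p : Rn) (U V : set Rn) (k : nat) (i j : 'I_n).
Variables (Omega Sigma : set Rn) (x0 : Rn).
Variables (oOm : open Omega) (bOm : bounded_set Omega) (SE : Sigma = frontier Omega).
Variables (smS : smooth_hypersurface Sigma).
Variables (star : forall x, Sigma x ->
  0 < dotp (x - x0) (unit_normal Omega Sigma (@ebar R n) x)).

Let ext := ~` closure Omega.

Let iOm : Omega° = Omega. Proof. exact/interior_id. Qed.

Let trichotomy x : [\/ Omega x, Sigma x | ext x].
Proof.
have [Ox|Ox] := pselect (Omega x); first by constructor 1.
have [cx|cx] := pselect (closure Omega x); last by constructor 3.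
by constructor 2; rewrite SE; split=> //; rewrite iOm.
Qed.

Let Sigma_notin x : Sigma x -> ~ Omega x.
Proof. by rewrite SE => -[_]; rewrite iOm. Qed.

Let Sigma_closure x : Sigma x -> closure Omega x.
Proof. by rewrite SE => -[]. Qed.

Let Omega_next x : Omega x -> ~ ext x.
Proof. by move=> Ox; apply; exact: subset_closure. Qed.

Let Sigma_next x : Sigma x -> ~ ext x.
Proof. by move=> Sx; apply; exact: Sigma_closure. Qed.

(** The part of the unit normal orthogonal to grad phi is tangent by [tangent_level], hence
    orthogonal to the normal, hence zero. So the normal is a multiple of grad phi, and rescaling phi
    makes it the gradient at p. *)
Lemma star_defining p : Sigma p -> exists U psi nu,
  [/\ open U /\ U p, forall k, CO U k psi, Sigma `&` U = [set x | U x /\ psi x = 0],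
      grad psi p = nu /\ 0 < dotp nu (p - x0)
    & nu = unit_normal Omega Sigma (@ebar R n) p /\
      is_unit_normal Omega Sigma (@ebar R n) p nu].
Proof.
move=> Sp; have [U [phi [[oU Up] sm gr SU]]] := smS Sp.
set nu := unit_normal Omega Sigma (@ebar R n) p.
have sp : 0 < dotp (p - x0) nu by exact: star.
(* Without a unit normal at p, [unit_normal] would be its default value 0, whose pairing with p - x0
   is not positive. *)
have Nu : is_unit_normal Omega Sigma (@ebar R n) p nu.
  apply: contrapT => H; move: sp; rewrite /nu /unit_normal.
  have [[N HN]|HN] := pselect (exists N, is_unit_normal Omega Sigma (@ebar R n) p N).
    by case: H; apply: (@xgetPex _ 0); exists N.
  rewrite xgetPN; last by move=> N HN'; apply: HN; exists N.
  by rewrite -[X in dotp _ X](scale0r 0) dotpZr mul0r ltxx.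
have hphi k : CO U k phi by apply: Ck_CO.
pose g := grad phi p.
have g0 : g != 0.
  have [i gi] := gr p Up; apply/eqP => gE; move: gi.
  by have := congr1 (fun A : Rn => A 0 i) gE; rewrite !mxE => ->; rewrite eqxx.
have a0 : 0 < dotp g g by exact: dotp_gt0.
have [n1 n2 n3] := Nu; rewrite form_ebar in n1.
pose lam := dotp nu g / dotp g g.
have gX : dotp g (nu - lam *: g) = 0.
  by rewrite dotpBr dotpZr /lam divfK ?gt_eqF // dotpC subrr.
have nuE : nu = lam *: g.
  apply/eqP; rewrite -subr_eq0; apply/eqP/dotp_eq0.
  have tX := tangent_level oU Up (hphi 1%N) SU Sp g0 gX.
  have := n2 _ tX; rewrite form_ebar => nX.
  by rewrite dotpBr dotpZr dotpC nX [dotp _ g]dotpC gX mulr0 subrr.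
have lam0 : lam != 0.
  apply/eqP => l0; move: n1; rewrite nuE l0 scale0r -[X in dotp _ X](scale0r 0) dotpZr mul0r.
  by move/eqP; rewrite eq_sym oner_eq0.
exists U, (fun x => lam * phi x), nu; split=> //.
- by move=> k; apply: CO_mul => //; exact: CO_cst.
- rewrite SU; apply/seteqP; split=> x /= [Ux h]; split=> //; first by rewrite h mulr0.
  by apply/eqP; move/eqP: h; rewrite mulf_eq0 (negbTE lam0).
- split; last by rewrite dotpC.
  rewrite nuE; apply/rowP => i; rewrite !mxE.
  exact: (deriveZ lam (CO_derivable (i := i) (hphi 1%N) Up)).
Qed.

Let seg y z : (forall t : R, 0 <= t <= 1 -> ~ Sigma (y + t *: (z - y))) ->
  Omega y -> Omega z.
Proof. by move=> h; apply: segment_avoids => // t /h; rewrite SE. Qed.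

(** Near p the sets psi > 0 and psi < 0 miss [Sigma], so membership in Omega propagates along
    segments in each. The normal direction is outside Omega by definition and lies with p - x0 on
    the side psi > 0. Omega accumulates at p, so it has points on one side; the side psi > 0 is
    excluded, hence they lie on the other, which contains p - t (p - x0). *)
Lemma crossing p : Sigma p -> exists2 t0 : R, 0 < t0 & forall t, 0 < t < t0 ->
  ext (p + t *: (p - x0)) /\ Omega (p - t *: (p - x0)).
Proof.
move=> Sp; have [U [psi [nu [[oU Up] hpsi SU [gnu nue] [_ [nu1 nu2 nu3]]]]]] := star_defining Sp.
rewrite form_ebar in nu1.
set e := p - x0 in nue *.
set a := dotp nu e in nue.
have psi0 : psi p = 0 by have : (Sigma `&` U) p by []; rewrite SU => -[].
pose M := Num.max 1 (Num.max `|nu| `|e|).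
have M0 : 0 < M by rewrite lt_max ltr01.
have Mnu : `|nu| <= M by rewrite !le_max lexx !orbT.
have Me : `|e| <= M by rewrite !le_max lexx !orbT.
pose b := Num.min 1 a.
have b0 : 0 < b by rewrite lt_min ltr01.
have b1 : b <= 1 by rewrite ge_min lexx.
have ba : b <= a by rewrite ge_min lexx orbT.
(* Along t (nu + s (e - nu)) the linear part of psi is at least t b and the displacement at most t
   M, so the error is at most a quarter of the gain. *)
pose eta := b / (4 * M).
have eta0 : 0 < eta by rewrite divr_gt0 // mulr_gt0.
have etaM : eta * M = b / 4 by rewrite /eta; field; rewrite gt_eqF.
have [r r0 [rU hr]] := strict_diff oU Up (hpsi 1%N) eta0.
rewrite gnu in hr.
have notS y : `|y - p| < r -> psi y != 0 -> ~ Sigma y.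
  move=> yr py Sy; have : (Sigma `&` U) y by split=> //; exact: rU.
  by rewrite SU => -[_ /eqP]; rewrite (negbTE py).
have pp : `|p - p| < r by rewrite subrr normr0.
have est0 w : `|w| < r -> `|psi (p + w) - dotp nu w| <= eta * `|w|.
  move=> wr; have := hr p w pp; rewrite psi0 subr0 [_ + w - p]addrAC subrr add0r.
  exact.
(* Every direction between [nu] and [e] leaves the level set at the same rate. *)
have up (s t : R) : 0 <= s <= 1 -> 0 < t -> t * M < r ->
    0 < psi (p + t *: (nu + s *: (e - nu))) /\ `|t *: (nu + s *: (e - nu))| < r.
  move=> /andP[s0 s1] t0 tM.
  have wn : `|nu + s *: (e - nu)| <= M.
    have -> : nu + s *: (e - nu) = (1 - s) *: nu + s *: e.
      by rewrite scalerBl scale1r scalerBr addrA addrAC.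
    rewrite (le_trans (ler_normD _ _)) // !normrZ (ger0_norm s0) ger0_norm ?subr_ge0 //.
    have h1 : (1 - s) * `|nu| <= (1 - s) * M by rewrite ler_wpM2l // subr_ge0.
    have h2 : s * `|e| <= s * M by rewrite ler_wpM2l.
    by move: h1 h2; rewrite mulrBl mul1r; lra.
  have tw : `|t *: (nu + s *: (e - nu))| <= t * M.
    by rewrite normrZ gtr0_norm // ler_pM2l.
  split; last exact: le_lt_trans tw tM.
  have := est0 _ (le_lt_trans tw tM); rewrite dotpZr dotpDr dotpZr dotpBr nu1 -/a.
  have : eta * `|t *: (nu + s *: (e - nu))| <= t * (b / 4).
    by rewrite -etaM mulrCA ler_pM2l.
  have : t * b <= t * (1 + s * (a - 1)) by rewrite ler_pM2l //; nra.
  have : 0 < t * b by rewrite mulr_gt0.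
  by rewrite ler_norml => ? ? ? /andP[+ _]; clear SU; lra.
have [t1 t10 ht1] : exists2 t1 : R, 0 < t1 & forall t, 0 < t < t1 -> ~ Omega (p + t *: nu).
  have [t1 t10 ht1] := nu3; exists t1 => // t /andP[t0 tt1]; apply: ht1 => //=.
  by rewrite sub0r normrN gtr0_norm.
have out t : 0 < t -> t * M < r -> t < t1 -> ext (p + t *: e).
  move=> t0 tM tt1.
  have nO : ~ Omega (p + t *: e).
    move=> Oe; apply: (ht1 t); first by rewrite t0.
    apply: seg Oe => s /andP[s0 s1].
    have s01 : 0 <= 1 - s <= 1 by apply/andP; split; lra.
    have [h1 h2] := up (1 - s) t s01 t0 tM.
    have E : p + t *: e + s *: (p + t *: nu - (p + t *: e)) = p + t *: (nu + (1 - s) *: (e - nu)).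
      by apply/rowP => i; rewrite !mxE; ring.
    rewrite E; apply: notS; last by rewrite gt_eqF.
    by rewrite [_ - p]addrC addKr.
  have nS : ~ Sigma (p + t *: e).
    have i01 : 0 <= (1 : R) <= 1 by rewrite ler01 lexx.
    have [h1 h2] := up 1 t i01 t0 tM; rewrite scale1r [nu + _]addrC subrK in h1 h2.
    by apply: notS; [rewrite [_ - p]addrC addKr|rewrite gt_eqF].
  by have [//|//|] := trichotomy (p + t *: e).
exists (Num.min (r / M) t1 / 2); first by rewrite divr_gt0 // lt_min t10 divr_gt0.
move=> t /andP[t0]; rewrite ltr_pdivlMr // lt_min => /andP[tM tt1].
have tM' : 2 * t * M < r by rewrite -ltr_pdivlMr // mulrC.
have tM1 : t * M < r.
  by apply: le_lt_trans tM'; rewrite -mulrA ler_peMl ?ler1n // mulr_ge0 // ltW.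
have oext : ext (p + t *: e) by apply: out => //; lra.
split=> //.
(* A point of Omega near p lies on the negative side and is joined to p - t e. *)
pose d := Num.min (t * b / 4 / (n%:R * M + eta + 1)) (r - t * M).
have K0 : 0 < n%:R * M + eta + 1.
  by apply: ltr_wpDl => //; apply: addr_ge0; [apply: mulr_ge0 => //|]; exact: ltW.
have d0 : 0 < d by rewrite lt_min subr_gt0 tM1 divr_gt0 // divr_gt0 // mulr_gt0.
have [y [Oy yp]] : Omega `&` [set y | `|y - p| < d] !=set0.
  apply: (Sigma_closure Sp); apply/nbhs_ballP; exists d => // y.
  by rewrite -ball_normE /ball_ /= distrC.
have ypr : `|y - p| < r - t * M by apply: lt_le_trans yp _; rewrite ge_min lexx orbT.
have ypd : `|y - p| * (n%:R * M + eta + 1) < t * b / 4.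
  by rewrite -ltr_pdivlMr //; apply: lt_le_trans yp _; rewrite ge_min lexx.
have tm0 : 0 <= t * M by rewrite mulr_ge0 // ltW.
have yr : `|y - p| < r by apply: lt_le_trans ypr _; rewrite gerBl.
have dnu : `|dotp nu (y - p)| <= n%:R * M * `|y - p|.
  rewrite (le_trans (ler_norm_sum _ _ _)) // (@le_trans _ _ (\sum_(i < n) M * `|y - p|)) //.
    apply: ler_sum => i _; rewrite normrM ler_pM ?normr_coord_le //.
    exact: le_trans (normr_coord_le _ _) Mnu.
  by rewrite sumr_const card_ord -[_ *+ n]mulr_natl mulrA.
have py0 : psi y != 0.
  apply/eqP => py; have : [set x | U x /\ psi x = 0] y by split=> //; exact: rU.
  by rewrite -SU => -[/Sigma_notin].
have tse (s : R) : `|s| <= 1 -> `|s * t| * `|e| <= t * M.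
  move=> s1; rewrite normrM (gtr0_norm t0); apply: ler_pM => //; first by rewrite mulr_ge0 // ltW.
  by rewrite ler_piMl // ltW.
have line (sg s u : R) : `|sg| = 1 -> 0 <= s <= 1 -> 0 <= u <= 1 ->
   `|y - p + (sg * s * t) *: e - u *: (y - p)| < r.
  move=> sg1 /andP[s0 s1] /andP[u0 u1].
  have -> : y - p + (sg * s * t) *: e - u *: (y - p) =
    (1 - u) *: (y - p) + (sg * s * t) *: e by rewrite scalerBl scale1r addrAC.
  rewrite (le_lt_trans (ler_normD _ _)) // (normrZ (1 - u)) (normrZ (sg * s * t)).
  have h1 : `|1 - u| * `|y - p| <= `|y - p|.
    by rewrite ler_piMl // ger0_norm ?subr_ge0 // gerBl.
  have h2 : `|sg * s * t| * `|e| <= t * M by apply: tse; rewrite normrM sg1 mul1r ger0_norm.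
  by move: ypr h1 h2; lra.
(* [sg] is the sign of [psi y]; both pieces of the path stay on that side. *)
have path (sg : R) : `|sg| = 1 -> sg * sg = 1 -> 0 < sg * psi y -> Omega (p + (sg * t) *: e).
  move=> sg1 sgsg py.
  have O1 : Omega (y + (sg * t) *: e).
    apply: seg Oy => s /andP[s0 s1]; rewrite [y + _ - y]addrC addKr scalerA.
    have ln : `|y + (s * (sg * t)) *: e - p| < r.
      have := line sg s 0 sg1; rewrite s0 s1 lexx ler01 => /(_ isT isT).
      by rewrite scale0r subr0 addrAC [s * _]mulrCA mulrA.
    apply: notS => //.
    have h := hr y ((s * (sg * t)) *: e) yr ln.
    rewrite dotpZr -/a normrZ in h.
    have k1 : eta * (`|s * (sg * t)| * `|e|) <= s * t * (b / 4).
      rewrite -etaM normrM (ger0_norm s0) normrM sg1 mul1r (gtr0_norm t0).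
      by rewrite [leRHS]mulrCA ler_pM2l // ler_wpM2l // mulr_ge0 // ltW.
    have k2 : s * t * b <= s * t * a by rewrite ler_wpM2l // mulr_ge0 // ltW.
    have k3 : 0 <= s * t * b by rewrite !mulr_ge0 // ltW.
    suff : 0 < sg * psi (y + (s * (sg * t)) *: e).
      by apply: contraTN => /eqP ->; rewrite mulr0 ltxx.
    have k4 : `|sg * psi (y + (s * (sg * t)) *: e) - sg * psi y - s * t * a| <= s * t * (b / 4).
      apply: le_trans k1; apply: le_trans h.
      have -> : sg * psi (y + (s * (sg * t)) *: e) - sg * psi y - s * t * a =
        sg * (psi (y + (s * (sg * t)) *: e) - psi y - s * (sg * t) * a).
        by rewrite !mulrBr; congr (_ - _); rewrite -[LHS]mul1r -sgsg; ring.
      by rewrite normrM sg1 mul1r.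
    by move: k4; rewrite ler_norml => /andP[k5 _]; move: k5 k2 k3 py; clear SU; lra.
  apply: seg O1 => u /andP[u0 u1].
  have E : y + (sg * t) *: e + u *: (p + (sg * t) *: e - (y + (sg * t) *: e)) =
     p + (y - p + (sg * t) *: e - u *: (y - p)).
    by apply/rowP => i; rewrite !mxE; ring.
  have ln := line sg 1 u sg1; rewrite ler01 lexx u0 u1 mulr1 in ln; have {}ln := ln isT isT.
  rewrite E; apply: notS; first by rewrite [_ - p]addrC addKr.
  suff : 0 < sg * psi (p + (y - p + (sg * t) *: e - u *: (y - p))).
    by apply: contraTN => /eqP ->; rewrite mulr0 ltxx.
  have h := est0 _ ln.
  set w := y - p + _ - _ in h *.
  have wE : w = (1 - u) *: (y - p) + (sg * t) *: e.
    by rewrite /w scalerBl scale1r addrAC.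
  have wn : `|w| <= `|y - p| + t * M.
    rewrite wE (le_trans (ler_normD _ _)) // (normrZ (1 - u)) (normrZ (sg * t)) lerD //.
      by rewrite ler_piMl // ger0_norm ?subr_ge0 // gerBl.
    by apply: tse; rewrite sg1.
  have k1 : `|sg * psi (p + w) - t * a - sg * (1 - u) * dotp nu (y - p)| <= eta * `|w|.
    have dw : dotp nu w = (1 - u) * dotp nu (y - p) + sg * t * a.
      by rewrite wE (dotpDr nu ((1 - u) *: _)) (dotpZr nu (1 - u)) (dotpZr nu (sg * t)).
    apply: le_trans h; rewrite dw; set q := psi _.
    have -> : sg * q - t * a - sg * (1 - u) * dotp nu (y - p) =
        sg * (q - ((1 - u) * dotp nu (y - p) + sg * t * a)).
      by rewrite -[t * a]mul1r -{1}sgsg; ring.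
    by rewrite normrM sg1 mul1r.
  have k2 : `|sg * (1 - u) * dotp nu (y - p)| <= n%:R * M * `|y - p|.
    rewrite !normrM sg1 mul1r; apply: le_trans dnu.
    by rewrite ler_piMl // ger0_norm ?subr_ge0 // gerBl.
  have k3 : eta * `|w| <= eta * `|y - p| + t * (b / 4).
    by rewrite -etaM [t * _]mulrCA -mulrDr ler_pM2l.
  have k4 : t * b <= t * a by rewrite ler_pM2l.
  have k5 : 0 < t * b by rewrite mulr_gt0.
  have k6 : 0 <= `|y - p| by [].
  move: k1 k2; rewrite !ler_norml => /andP[k1 _] /andP[k2 _].
  by move: k1 k2 k3 k4 k5 k6 ypd; clear SU; lra.
have [pyp|pyp|pyp] := ltgtP (psi y) 0; last by rewrite pyp eqxx in py0.
- have := path (-1); rewrite normrN normr1 mulrNN mulr1 mulN1r oppr_gt0 mulN1r scaleNr.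
  exact.
- have := path 1; rewrite normr1 !mul1r => /(_ erefl erefl pyp) Oe.
  by case: (Omega_next Oe).
Qed.

End StarShaped.

(** * Rays from the star centre and the gauge function *)

Section Gauge.
Variables (R : realType) (n : nat).
Local Notation Rn := 'rV[R]_n.
Local Notation e_ i := (basis_vec R i).
Local Notation D i f := (fun x => 'D_(basis_vec R i) f x).
Implicit Types (f g phi rho : Rn -> R) (x y z v w p : Rn) (U V : set Rn) (k : nat) (i j : 'I_n).

Lemma CO_local V k f : (forall x, V x -> exists W : set Rn, [/\ open W, W x & CO W k f]) -> CO V k f.
Proof.
elim: k f => [|k ih] f h; apply/CO_P.
  by split=> // x /h[W [_ Wx hf]]; exact: CO_cont hf Wx.
split=> [x /h[W [_ Wx hf]]|i]; first exact: CO_cont hf Wx.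
split=> [x /h[W [_ Wx hf]]|]; first exact: CO_derivable hf Wx.
by apply: ih => x /h[W [oW Wx hf]]; exists W; split=> //; exact: CO_D.
Qed.

Lemma gradE f x i : grad f x 0 i = D i f x.
Proof. by rewrite mxE. Qed.

Lemma cont_sum (I : Type) (r : seq I) (F : I -> Rn -> R) x :
  (forall a, {for x, continuous (F a)}) -> {for x, continuous (fun y => \sum_(a <- r) F a y)}.
Proof.
move=> h; elim: r => [|a r ih].
  have -> : (fun y => \sum_(a <- [::]) F a y) = fun=> 0 by apply/funext => y; rewrite big_nil.
  exact: cst_continuous.
have -> : (fun y => \sum_(b <- a :: r) F b y) = fun y => F a y + \sum_(b <- r) F b y.
  by apply/funext => y; rewrite big_cons.
exact: continuousD (h a) ih.
Qed.

Lemma open_punctured x0 : open (~` [set x0] : set Rn).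
Proof. by apply: closed_openC; apply: accessible_closed_set1; apply: hausdorff_accessible; exact: norm_hausdorff. Qed.

Let lip_arith (A d q Y S G : R) : d * A <= d * A / 2 + q * (2 * S * Y) + 2 * S * (G * Y) ->
  d * (A / 2) <= (2 * S * q + 2 * S * G) * Y.
Proof. by lra. Qed.

Let half_arith (a b e y A : R) : a <= e * A / 2 * y -> b <= e * A / 2 * y -> a + b <= e * y * A.
Proof. by lra. Qed.

Record gauge (Omega Sigma : set Rn) x0 rho : Prop := Gauge {
  gauge_CO : forall k, CO (~` [set x0]) k rho;
  gauge_in : forall x, Omega x <-> rho x < 1;
  gauge_on : forall x, Sigma x <-> rho x = 1;
  gauge_hom : forall x (t : R), 0 < t -> rho (x0 + t *: (x - x0)) = t * rho x;
  gauge_bound : exists2 M : R, 0 < M & forall x, `|x - x0| <= M * rho x;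
  gauge_center : rho x0 = 0 }.

Variables (Omega Sigma : set Rn) (x0 : Rn).
Variables (oOm : open Omega) (bOm : bounded_set Omega) (SE : Sigma = frontier Omega).
Variables (smS : smooth_hypersurface Sigma).
Variables (star : forall x, Sigma x ->
  0 < dotp (x - x0) (unit_normal Omega Sigma (@ebar R n) x)).
Variables (Sigma0 : Sigma !=set0).

Let ext := ~` closure Omega.

Let iOm : Omega° = Omega. Proof. exact/interior_id. Qed.

Let trichotomy x : [\/ Omega x, Sigma x | ext x].
Proof.
have [Ox|Ox] := pselect (Omega x); first by constructor 1.
have [cx|cx] := pselect (closure Omega x); last by constructor 3.
by constructor 2; rewrite SE; split=> //; rewrite iOm.
Qed.

Let Sigma_notin x : Sigma x -> ~ Omega x.
Proof. by rewrite SE => -[_]; rewrite iOm. Qed.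

Let Sigma_next x : Sigma x -> ~ ext x.
Proof. by rewrite SE => -[h _]; apply. Qed.

Let ext_notin x : ext x -> ~ Omega x.
Proof. by move=> h Ox; apply: h; exact: subset_closure. Qed.

Let Sigma_center : ~ Sigma x0.
Proof.
move=> /star; rewrite subrr dotpC.
by rewrite -[X in dotp _ X](scale0r 0) dotpZr mul0r ltxx.
Qed.

Let ray_cont (th : Rn) : continuous (fun t : R => x0 + t *: th).
Proof. by move=> t; apply: cvgD; [exact: cvg_cst|apply: cvgZr_tmp; exact: cvg_id]. Qed.

Let ray_open (A : set Rn) (th : Rn) (t : R) : open A -> A (x0 + t *: th) ->
  exists2 d : R, 0 < d & forall u, `|u - t| < d -> A (x0 + u *: th).
Proof.
move=> oA At.
have oB : open ((fun u : R => x0 + u *: th) @^-1` A).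
  by apply: open_comp => // u _; exact: ray_cont.
have /nbhs_ballP[d d0 hd] := open_nbhs_nbhs (conj oB At).
exists d => // u ud; apply: (hd u).
by rewrite -ball_normE /ball_ /= distrC.
Qed.

Let crossing_ray (th : Rn) (t : R) : 0 < t -> Sigma (x0 + t *: th) ->
  exists2 d : R, 0 < d < t & forall u, (t < u < t + d -> ext (x0 + u *: th)) /\
    (t - d < u < t -> Omega (x0 + u *: th)).
Proof.
move=> t0 St; have [t1 t10 h] := crossing oOm SE smS star St.
have E (c : R) : x0 + t *: th + c *: (x0 + t *: th - x0) = x0 + ((1 + c) * t) *: th.
  by apply/rowP => i; rewrite !mxE; ring.
have t12 : 0 < Num.min t1 2^-1 by rewrite lt_min t10 /= invr_gt0.
have m2 : Num.min t1 2^-1 <= 2^-1 by rewrite ge_min lexx orbT.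
have m1 : Num.min t1 2^-1 <= t1 by rewrite ge_min lexx.
exists (Num.min t1 2^-1 * t); first by rewrite mulr_gt0 //= gtr_pMl //; lra.
move=> u; split=> /andP[ut1 ut2].
- have [|+ _] := h (u / t - 1).
    apply/andP; split; first by rewrite subr_gt0 ltr_pdivlMr // mul1r.
    apply: lt_le_trans m1; rewrite ltrBlDr ltr_pdivrMr // mulrDl mul1r addrC; lra.
  by rewrite E; have -> : (1 + (u / t - 1)) * t = u by field; rewrite gt_eqF.
- have [|_ +] := h (1 - u / t).
    apply/andP; split; first by rewrite subr_gt0 ltr_pdivrMr // mul1r.
    apply: lt_le_trans m1; rewrite ltrBlDr -ltrBlDl ltr_pdivlMr // mulrBl mul1r; lra.
  by rewrite -scaleNr E; have -> : (1 + - (1 - u / t)) * t = u by field; rewrite gt_eqF.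
Qed.

(** A ray that has left Omega never returns: at the last time before a return the ray would pass
    through [Sigma] into Omega, whereas [crossing_ray] says that beyond a point of [Sigma] it is in
    the open exterior. Nor can it touch [Sigma] later, as just before such a point it would be in
    Omega. *)
Let ray (th : Rn) (t1 t2 : R) : 0 <= t1 -> t1 < t2 -> ~ Omega (x0 + t1 *: th) ->
  ext (x0 + t2 *: th).
Proof.
move=> t10 t12 n1.
suff key t3 : t1 < t3 -> ~ Omega (x0 + t3 *: th).
  have [Oh|Sh|//] := trichotomy (x0 + t2 *: th); first by case: (key t2).
  have t20 : 0 < t2 by lra.
  have [d /andP[d0 dt] h] := crossing_ray t20 Sh.
  have [_ h2] := h (t2 - Num.min d (t2 - t1) / 2).
  have m0 : 0 < Num.min d (t2 - t1) by rewrite lt_min d0 subr_gt0.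
  have m1 : Num.min d (t2 - t1) <= d by rewrite ge_min lexx.
  have m2 : Num.min d (t2 - t1) <= t2 - t1 by rewrite ge_min lexx orbT.
  by case: (key (t2 - Num.min d (t2 - t1) / 2)); [lra|apply: h2; lra].
move=> t13 O3.
pose B := [set t : R | t1 <= t <= t3 /\ ~ Omega (x0 + t *: th)].
have hB : has_sup B.
  by split; [exists t1; split=> //; rewrite lexx ltW|exists t3 => t [/andP[]]].
pose m := sup B.
have m1 : t1 <= m by apply: (ub_le_sup hB.2); split=> //; rewrite lexx ltW.
have m3 : m <= t3 by apply: ge_sup; [exact: hB.1|move=> t [/andP[]]].
have nm : ~ Omega (x0 + m *: th).
  move=> Om; have [d d0 hd] := ray_open oOm Om.
  have [b [bI nb] mb] := sup_adherent d0 hB.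
  have : b <= m by apply: (ub_le_sup hB.2); split.
  move=> bm; apply: nb; apply: hd; move: bm; rewrite -/m in mb *.
  by rewrite ltr_norml => ?; apply/andP; split; lra.
have m3' : m < t3.
  by rewrite lt_neqAle m3 andbT; apply/eqP => E; apply: nm; rewrite E.
have after t : m < t -> t <= t3 -> Omega (x0 + t *: th).
  move=> mt tt3; apply: contrapT => nt.
  have : t <= m by apply: (ub_le_sup hB.2); split=> //; apply/andP; split => //; lra.
  by rewrite leNgt mt.
have Sm : Sigma (x0 + m *: th).
  have [//|//|em] := trichotomy (x0 + m *: th).
  have [d d0 hd] := ray_open (closed_openC (@closed_closure _ Omega)) em.
  have c0 : 0 < Num.min d (t3 - m) by rewrite lt_min d0 subr_gt0.
  have c1 : Num.min d (t3 - m) <= d by rewrite ge_min lexx.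
  have c2 : Num.min d (t3 - m) <= t3 - m by rewrite ge_min lexx orbT.
  case: (@ext_notin (x0 + (m + Num.min d (t3 - m) / 2) *: th)).
    by apply: hd; rewrite addrC addKr gtr0_norm ?divr_gt0 //; lra.
  by apply: after; lra.
have m0 : 0 < m.
  rewrite lt_neqAle (le_trans t10 m1) andbT; apply/eqP => E.
  by apply: Sigma_center; move: Sm; rewrite -E scale0r addr0.
have [d /andP[d0 dm] h] := crossing_ray m0 Sm.
have c0 : 0 < Num.min d (t3 - m) by rewrite lt_min d0 subr_gt0.
have c1 : Num.min d (t3 - m) <= d by rewrite ge_min lexx.
have c2 : Num.min d (t3 - m) <= t3 - m by rewrite ge_min lexx orbT.
have [h1 _] := h (m + Num.min d (t3 - m) / 2).
case: (@ext_notin (x0 + (m + Num.min d (t3 - m) / 2) *: th)).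
  by apply: h1; lra.
by apply: after; lra.
Qed.

(** Otherwise [ray], started at time 0, would put a point of [Sigma] in the open exterior. *)
Let center_in : Omega x0.
Proof.
have [p Sp] := Sigma0; apply: contrapT => h.
have /(ray (th := p - x0) (lexx 0) ltr01) : ~ Omega (x0 + 0 *: (p - x0)).
  by rewrite scale0r addr0.
by rewrite scale1r addrC subrK => /(Sigma_next Sp).
Qed.

Let B x := [set t : R | 0 <= t /\ Omega (x0 + t *: (x - x0))].
(** The exit time of the ray through x, in units of x - x0; the gauge function will be its
    inverse. *)
Let s x : R := sup (B x).

Let exitP x : x != x0 -> [/\ 0 < s x, Sigma (x0 + s x *: (x - x0)),
  forall t, 0 <= t -> t < s x -> Omega (x0 + t *: (x - x0))
  & forall t, s x < t -> ext (x0 + t *: (x - x0))].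
Proof.
move=> xx0.
have n0 : 0 < `|x - x0| by rewrite normr_gt0 subr_eq0.
have hB : has_sup (B x).
  split; first by exists 0; split=> //; rewrite scale0r addr0.
  have [M [_ hM]] := bOm.
  exists ((`|x0| + (M + 1)) / `|x - x0|) => t [t0 Ot].
  rewrite ler_pdivlMr // -[t]ger0_norm // -normrZ.
  have -> : t *: (x - x0) = - x0 + (x0 + t *: (x - x0)) by rewrite addKr.
  rewrite (le_trans (ler_normD _ _)) // normrN lerD2l.
  by apply: hM => //; rewrite ltrDl.
have s0 : 0 <= s x by apply: (ub_le_sup hB.2); split=> //; rewrite scale0r addr0.
have ns : ~ Omega (x0 + s x *: (x - x0)).
  move=> Os; have [d d0 hd] := ray_open oOm Os.
  have : s x + d / 2 <= s x.
    apply: (ub_le_sup hB.2); split; first by lra.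
    by apply: hd; rewrite addrC addKr gtr0_norm ?divr_gt0 //; lra.
  by lra.
have before t : 0 <= t -> t < s x -> Omega (x0 + t *: (x - x0)).
  move=> t0 ts; apply: contrapT => nt.
  have dt : 0 < s x - t by rewrite subr_gt0.
  have [b [b0 Ob]] := sup_adherent dt hB.
  by rewrite -/(s x) subKr => tb; case: (ext_notin (ray t0 tb nt)).
have after t : s x < t -> ext (x0 + t *: (x - x0)) by move=> st; exact: ray st ns.
have s0' : 0 < s x.
  rewrite lt_neqAle s0 andbT; apply/eqP => E.
  by apply: ns; rewrite -E scale0r addr0.
split=> //.
have [//|//|es] := trichotomy (x0 + s x *: (x - x0)).
have [d d0 hd] := ray_open (closed_openC (@closed_closure _ Omega)) es.
have c0 : 0 < Num.min d (s x) by rewrite lt_min d0.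
have c1 : Num.min d (s x) <= d by rewrite ge_min lexx.
have c2 : Num.min d (s x) <= s x by rewrite ge_min lexx orbT.
case: (@ext_notin (x0 + (s x - Num.min d (s x) / 2) *: (x - x0))).
  by apply: hd; rewrite [_ - s x]addrC addKr normrN gtr0_norm ?divr_gt0 //; lra.
by apply: before; lra.
Qed.

Let exit_unique x (t : R) : x != x0 -> 0 < t -> Sigma (x0 + t *: (x - x0)) -> s x = t.
Proof.
move=> xx0 t0 St; have [s0 Ss hb ha] := exitP xx0.
have [st|ts|//] := ltgtP (s x) t; first by case: (Sigma_next St); exact: ha.
by case: (Sigma_notin St); apply: hb => //; exact: ltW.
Qed.

(** Slightly before and slightly after its exit the ray is in the open sets Omega and [ext]; this
    persists for nearby directions and traps their exit times. *)
Let exit_cont x : x != x0 -> {for x, continuous s}.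
Proof.
move=> xx0; have [s0 Ss hb ha] := exitP xx0.
apply/cont_epsP => e e0.
pose e1 := Num.min e (s x / 2).
have e10 : 0 < e1 by rewrite lt_min e0 divr_gt0.
have e1e : e1 <= e by rewrite ge_min lexx.
have e1s : e1 <= s x / 2 by rewrite ge_min lexx orbT.
have ball (A : set Rn) (t : R) : open A -> A (x0 + t *: (x - x0)) ->
    exists2 d : R, 0 < d & forall y, `|y - x| < d -> A (x0 + t *: (y - x0)).
  move=> oA At; have [d d0 hd] := open_ballP oA At.
  have t1 : 0 < `|t| + 1 by rewrite ltr_wpDl.
  exists (d / (`|t| + 1)); first by rewrite divr_gt0.
  move=> y; rewrite ltr_pdivlMr // => yd; apply: hd.
  have -> : x0 + t *: (y - x0) - (x0 + t *: (x - x0)) = t *: (y - x).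
    by apply/rowP => i; rewrite !mxE; ring.
  by rewrite normrZ; apply: le_lt_trans yd; rewrite mulrC ler_wpM2l // lerDl.
have [d0 d00 h0] := open_ballP (@open_punctured x0) (elimN eqP xx0).
have p1 : 0 <= s x - e1 by lra.
have p2 : s x - e1 < s x by lra.
have p3 : s x < s x + e1 by lra.
have [d1 d10 h1] := ball _ (s x - e1) oOm (hb _ p1 p2).
have [d2 d20 h2] := ball _ (s x + e1) (closed_openC (@closed_closure _ Omega)) (ha _ p3).
exists (Num.min d0 (Num.min d1 d2)); first by rewrite !lt_min d00 d10.
move=> y; rewrite !lt_min => /and3P[/h0 /eqP y0 /h1 y1 /h2 y2].
have [sy0 Sy hby hay] := exitP y0.
have l1 : s x - e1 <= s y.
  by rewrite leNgt; apply/negP => /hay/ext_notin.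
have l2 : s y <= s x + e1.
  by rewrite leNgt; apply/negP => /hby h; case: (ext_notin y2); apply: h; lra.
by rewrite ler_norml; apply/andP; split; lra.
Qed.

(** The implicit function theorem for psi (x0 + s (x - x0)) = 0. Continuity of [s] makes the
    increment small enough for [strict_diff]; transversality of the ray then yields a Lipschitz
    bound, and the same expansion gives the differential. *)
Let exit_deriv U psi x : open U -> CO U 1 psi -> Sigma `&` U = [set x | U x /\ psi x = 0] ->
  x != x0 -> U (x0 + s x *: (x - x0)) -> dotp (grad psi (x0 + s x *: (x - x0))) (x - x0) != 0 ->
  forall i, is_derive x (e_ i) s (- s x * D i psi (x0 + s x *: (x - x0)) /
     dotp (grad psi (x0 + s x *: (x - x0))) (x - x0)).
Proof.
move=> oU hpsi SU xx0 UY A0 i.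
have [s0 Ss _ _] := exitP xx0.
set Y := x0 + s x *: (x - x0) in UY A0 *.
set a := dotp _ _ in A0 *.
have psiY : psi Y = 0 by have : (Sigma `&` U) Y by []; rewrite SU => -[].
have cs := (cont_epsP _ _).1 (exit_cont xx0).
pose K : R := `|x - x0| + 1.
have K0 : 0 < K by rewrite ltr_wpDl.
have Kx : `|x - x0| <= K by rewrite lerDl.
have a0 : 0 < `|a| by rewrite normr_gt0.
have [d0 d00 h0] := open_ballP (@open_punctured x0) (elimN eqP xx0).
(* first-order expansion of [psi (x0 + s y (y - x0)) = 0] *)
have est (eta : R) : 0 < eta -> exists2 d : R, 0 < d & forall y, `|y - x| < d ->
    `|(s y - s x) * a + s y * dotp (grad psi Y) (y - x)| <=
      eta * (`|s y - s x| * K + 2 * s x * `|y - x|).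
  move=> eta0; have [r r0 [rU hr]] := strict_diff oU UY hpsi eta0.
  pose e1 := Num.min (s x) (r / 2 / K).
  have e10 : 0 < e1 by rewrite lt_min s0 !divr_gt0.
  have [d1 d10 hd1] := cs _ e10.
  pose d := Num.min d0 (Num.min d1 (r / 2 / (2 * s x))).
  have d_0 : 0 < d by rewrite !lt_min d00 d10 !divr_gt0 // mulr_gt0.
  exists d => // y; rewrite !lt_min => /and3P[/h0/eqP y0 /hd1 y1 y2].
  have [sy0 Sy _ _] := exitP y0.
  have k1 : `|s y - s x| <= s x by apply: le_trans y1 _; rewrite ge_min lexx.
  have k2 : `|s y - s x| * K <= r / 2.
    by rewrite -ler_pdivlMr //; apply: le_trans y1 _; rewrite ge_min lexx orbT.
  have k3 : s y <= 2 * s x by move: k1; rewrite ler_norml => /andP[_]; lra.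
  have k4 : 2 * s x * `|y - x| < r / 2 by rewrite mulrC -ltr_pdivlMr // mulr_gt0.
  pose w := (s y - s x) *: (x - x0) + s y *: (y - x).
  have wE : Y + w = x0 + s y *: (y - x0).
    by apply/rowP => j; rewrite !mxE; ring.
  have wn : `|w| <= `|s y - s x| * K + 2 * s x * `|y - x|.
    rewrite (le_trans (ler_normD _ _)) // (normrZ (s y - s x)) (normrZ (s y)) lerD //.
      by rewrite ler_wpM2l.
    by rewrite ler_wpM2r // gtr0_norm.
  have wr : `|w| < r by lra.
  have Sw : psi (Y + w) = 0.
    have : (Sigma `&` U) (Y + w) by split; [rewrite wE|apply: rU; rewrite addrC addKr].
    by rewrite SU => -[].
  have := hr Y w; rewrite subrr normr0 [_ + w - _]addrC addKr Sw psiY subrr => /(_ r0 wr).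
  have dw : dotp (grad psi Y) w = (s y - s x) * a + s y * dotp (grad psi Y) (y - x).
    by rewrite /w (dotpDr _ ((s y - s x) *: _)) (dotpZr _ (s y - s x)) (dotpZr _ (s y)).
  rewrite sub0r normrN dw => h.
  by apply: le_trans h _; rewrite ler_pM2l.
have dn y : `|dotp (grad psi Y) y| <= n%:R * `|grad psi Y| * `|y|.
  rewrite (le_trans (ler_norm_sum _ _ _)) // (@le_trans _ _ (\sum_(i < n) `|grad psi Y| * `|y|)) //.
    by apply: ler_sum => j _; rewrite normrM ler_pM ?normr_coord_le.
  by rewrite sumr_const card_ord -[_ *+ n]mulr_natl mulrA.
pose G := n%:R * `|grad psi Y|.
have G0 : 0 <= G by rewrite mulr_ge0.
(* hence [s] is Lipschitz at [x] *)
pose L := (2 * s x * (`|a| / (2 * K)) + 2 * s x * G) / (`|a| / 2).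
have L0 : 0 <= L.
  by rewrite divr_ge0 ?divr_ge0 // addr_ge0 // !mulr_ge0 ?invr_ge0 ?mulr_ge0 // ltW.
have [d2 d20 lip] : exists2 d : R, 0 < d & forall y, `|y - x| < d -> `|s y - s x| <= L * `|y - x|.
  have eta0 : 0 < `|a| / (2 * K) by rewrite divr_gt0 // mulr_gt0.
  have [d d0' hd] := est _ eta0.
  have [d1 d10 hd1] := cs _ s0.
  exists (Num.min d d1); first by rewrite lt_min d0'.
  move=> y; rewrite lt_min => /andP[yd yd1].
  rewrite /L mulrAC ler_pdivlMr ?divr_gt0 //.
  have k1 := hd y yd; have k2 := hd1 y yd1.
  have k3 : `|s y| <= 2 * s x.
    by move: k2; rewrite !ler_norml => /andP[] *; apply/andP; split; lra.
  have k4 : `|s y * dotp (grad psi Y) (y - x)| <= 2 * s x * (G * `|y - x|).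
    by rewrite normrM ler_pM.
  have k5 : `|s y - s x| * `|a| <= `|a| / (2 * K) * (`|s y - s x| * K + 2 * s x * `|y - x|)
      + 2 * s x * (G * `|y - x|).
    rewrite -normrM -[X in `|X|](addrK (s y * dotp (grad psi Y) (y - x))).
    by rewrite (le_trans (ler_normB _ _)) // lerD.
  have k6 : `|a| / (2 * K) * (`|s y - s x| * K) = `|s y - s x| * `|a| / 2.
    by field; rewrite gt_eqF.
  by move: k5; rewrite mulrDr k6 /L; exact: lip_arith.
suff [df dE] : differentiable s x /\
    forall v, 'd s x v = \sum_i (- s x * D i psi Y / a) * v 0 i.
  apply: DeriveDef; first exact: diff_derivable.
  by rewrite deriveE // dE sum_basis_vec.
apply: differentiable_est => e e0.
pose M := L * K + 2 * s x.
have M0 : 0 < M by rewrite ltr_wpDl ?mulr_gt0 // mulr_ge0 // ltW.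
have eta0 : 0 < e * `|a| / 2 / M by rewrite !divr_gt0 // mulr_gt0.
have [d3 d30 hd3] := est _ eta0.
pose C := L * G + 1.
have C0 : 0 < C by rewrite ltr_wpDl // mulr_ge0.
exists (Num.min d2 (Num.min d3 (e * `|a| / 2 / C))).
  by rewrite !lt_min d20 d30 !divr_gt0 // mulr_gt0.
move=> y; rewrite !lt_min => /and3P[y2 y3 y4].
have yx : x + y - x = y by rewrite addrC addKr.
have := lip (x + y); have := hd3 (x + y); rewrite yx => /(_ y3) k1 /(_ y2) k2.
have -> : \sum_i - s x * D i psi Y / a * y 0 i = - s x * dotp (grad psi Y) y / a.
  rewrite /dotp mulr_sumr mulr_suml; apply: eq_bigr => j _; rewrite mxE; field.
  by [].
have -> : s (x + y) - s x - - s x * dotp (grad psi Y) y / a =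
   ((s (x + y) - s x) * a + s (x + y) * dotp (grad psi Y) y
     - (s (x + y) - s x) * dotp (grad psi Y) y) / a by field.
rewrite normrM normfV ler_pdivrMr //.
rewrite (le_trans (ler_normB _ _)) // normrM.
have k3 : `|s (x + y) - s x| * `|dotp (grad psi Y) y| <= e * `|a| / 2 * `|y|.
  apply: (@le_trans _ _ (L * `|y| * (G * `|y|))); first by rewrite ler_pM.
  have -> : L * `|y| * (G * `|y|) = L * G * `|y| * `|y| by ring.
  rewrite ler_wpM2r // (@le_trans _ _ (C * `|y|)) //; first by rewrite ler_wpM2r // lerDl.
  by rewrite mulrC -ler_pdivlMr // ltW.
have k4 : e * `|a| / 2 / M * (`|s (x + y) - s x| * K + 2 * s x * `|y|) <= e * `|a| / 2 * `|y|.
  have -> : e * `|a| / 2 * `|y| = e * `|a| / 2 / M * (M * `|y|) by field; rewrite gt_eqF.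
  apply: ler_wpM2l; first exact: ltW.
  have -> : M * `|y| = L * `|y| * K + 2 * s x * `|y| by rewrite /M; ring.
  by rewrite lerD2r ler_wpM2r // ltW.
exact: half_arith (le_trans k1 k4) k3.
Qed.

(** Bootstrap: the formula for D_i s is a quotient of expressions in [s], the coordinates and
    derivatives of psi along the exit point, so it is C^k when [s] is, and [s] is then C^(k+1). *)
Let exit_CO k : CO (~` [set x0]) k s.
Proof.
apply: CO_local => x /eqP xx0; have [s0 Sx _ _] := exitP xx0.
have [U [psi [nu [[oU UY] hpsi SU [gnu nue] _]]]] := star_defining smS star Sx.
pose A y := \sum_i D i psi (x0 + s y *: (y - x0)) * (y - x0) 0 i.
have AE y : A y = dotp (grad psi (x0 + s y *: (y - x0))) (y - x0).
  by apply: eq_bigr => i _; rewrite gradE.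
have V0 y (d : R) : (forall y, `|y - x| < d -> (~` [set x0]) y) -> `|y - x| < d -> y != x0.
  by move=> h /h/eqP.
have Ax : A x != 0.
  rewrite AE gnu; apply: lt0r_neq0; move: nue.
  by rewrite addrAC subrr add0r dotpZr pmulr_rgt0.
have [d0 d00 h0] := open_ballP (@open_punctured x0) (elimN eqP xx0).
have Ycont y : y != x0 -> forall j, {for y, continuous (fun y => (x0 + s y *: (y - x0)) 0 j)}.
  move=> yx0 j.
  have -> : (fun y : Rn => (x0 + s y *: (y - x0)) 0 j) = (fun y => x0 0 j + s y * (y 0 j - x0 0 j)).
    by apply/funext => z; rewrite !mxE.
  apply: continuousD; first exact: cst_continuous.
  apply: continuousM; first exact: exit_cont.
  by apply: continuousB; [exact: CO_cont (CO_coord 0 j openT) _|exact: cst_continuous].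
have [d1 d10 h1] : exists2 d : R, 0 < d & forall y, `|y - x| < d -> U (x0 + s y *: (y - x0)).
  have [dU dU0 hU] := open_ballP oU UY.
  have dU2 : 0 < dU / 2 by rewrite divr_gt0.
  have [d d_0 hd] := (cont_rVP _ _).1 (Ycont x xx0) _ dU2.
  by exists d => // y /hd h; apply: hU; apply: le_lt_trans h _; lra.
have Acont : {for x, continuous A}.
  apply: cont_sum => i; apply: continuousM.
    apply: (@cont_comp _ _ (D i psi) (fun y => x0 + s y *: (y - x0))); first exact: Ycont.
    exact: CO_cont (CO_D i (hpsi 1%N)) UY.
  have -> : (fun y : Rn => (y - x0) 0 i) = (fun y => y 0 i - x0 0 i) by apply/funext => z; rewrite !mxE.
  by apply: continuousB; [exact: CO_cont (CO_coord 0 i openT) _|exact: cst_continuous].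
have [d2 d20 h2] : exists2 d : R, 0 < d & forall y, `|y - x| < d -> A y != 0.
  have e0 : 0 < `|A x| / 2 by rewrite divr_gt0 // normr_gt0.
  have [d d_0 hd] := (cont_epsP _ _).1 Acont _ e0.
  exists d => // y /hd h; apply/eqP => E; move: h.
  by rewrite E sub0r normrN; move: e0; lra.
pose d := Num.min d0 (Num.min d1 d2).
have d_0 : 0 < d by rewrite !lt_min d00 d10.
pose W : set Rn := ball x d.
have WP y : W y -> [/\ y != x0, U (x0 + s y *: (y - x0)) & A y != 0].
  rewrite /W -ball_normE /ball_ /= distrC !lt_min => /and3P[y0 y1 y2].
  by split; [apply/eqP; exact: h0|exact: h1|exact: h2].
have oW : open W by exact: ball_open.
exists W; split=> //; first exact: ballxx.
have DW y i : W y -> is_derive y (e_ i) s (- s y * D i psi (x0 + s y *: (y - x0)) / A y).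
  move=> /WP[y0 yU yA]; rewrite AE; apply: (exit_deriv oU (hpsi 1%N) SU) => //.
  by rewrite -AE.
elim: k => [|k ih]; first by apply/CO_P; split=> // y /WP[y0 _ _]; exact: exit_cont.
apply/CO_P; split=> [y /WP[y0 _ _]|i]; first exact: exit_cont.
split=> [y Wy|]; first exact: (@ex_derive _ _ _ _ _ _ _ (DW y i Wy)).
have Bcoord j : CO W k (fun y => (y - x0) 0 j).
  apply: CO_congr (CO_add oW (CO_coord k j oW) (CO_cst k (- x0 0 j) oW)) => // y _.
  by rewrite !mxE.
have Ycoord j : CO W k (fun y => (x0 + s y *: (y - x0)) 0 j).
  apply: CO_congr (CO_add oW (CO_cst k (x0 0 j) oW) (CO_mul oW ih (Bcoord j))) => // y _.
  by rewrite !mxE.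
have Dcomp j : CO W k (fun y => D j psi (x0 + s y *: (y - x0))).
  apply: (@CO_comp _ _ _ _ _ (D j psi) (fun y => x0 + s y *: (y - x0)) oW oU) => //.
    by move=> y /WP[].
  exact: CO_D (hpsi k.+1).
have hA : CO W k A by apply: CO_sum => // j _; apply: CO_mul.
have hAV : CO W k (fun y => (A y)^-1) by apply: CO_inv => // y /WP[].
apply: CO_congr (CO_mul oW (CO_mul oW (CO_mul oW (CO_cst k (-1) oW) ih) (Dcomp i)) hAV) => // y Wy.
by rewrite (@derive_val _ _ _ _ _ _ _ (DW y i Wy)) mulN1r.
Qed.

Lemma gauge_exists : exists rho, gauge Omega Sigma x0 rho.
Proof.
pose rho x : R := (s x)^-1.
(* At the centre the set of admissible times is unbounded, so its supremum is 0 by convention, and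
   the inverse of 0 is 0: the defaults give the right value. *)
have rho0 : rho x0 = 0.
  rewrite /rho /s; suff -> : sup (B x0) = 0 by rewrite invr0.
  apply: sup_out => -[_ [M hM]]; have := hM (`|M| + 1); rewrite /B /= subrr scaler0 addr0.
  have h : 0 <= `|M| + 1 by rewrite addr_ge0.
  by move=> /(_ (conj h center_in)); have := ler_norm M; lra.
have inv1 x : x != x0 -> x0 + 1 *: (x - x0) = x by move=> _; rewrite scale1r addrC subrK.
have pos x : x != x0 -> 0 < rho x by move=> /exitP[s0 _ _ _]; rewrite invr_gt0.
have cases x : x != x0 -> [/\ rho x < 1 -> Omega x, rho x = 1 -> Sigma x & rho x > 1 -> ext x].
  move=> xx0; have [s0 Sx hb ha] := exitP xx0; rewrite /rho; split=> h.
  - rewrite -(inv1 x xx0); apply: hb => //.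
    by rewrite -[1]invr1 in h; rewrite ltf_pV2 ?posrE // in h.
  - by move: h => /(congr1 GRing.inv); rewrite invrK invr1 => h; move: Sx; rewrite h inv1.
  - rewrite -(inv1 x xx0); apply: ha.
    by rewrite -[1]invr1 in h; rewrite ltf_pV2 ?posrE // in h.
exists rho; split.
- move=> k; apply: CO_inv; [exact: open_punctured| |exact: exit_CO].
  by move=> x /eqP /exitP[s0 _ _ _]; rewrite gt_eqF.
- move=> x; have [->|xx0] := eqVneq x x0; first by rewrite rho0 ltr01; split.
  have [c1 c2 c3] := cases x xx0; split=> // Ox.
  have [//|/c3/ext_notin//|/c2/Sigma_notin//] := ltgtP (rho x) 1.
- move=> x; have [->|xx0] := eqVneq x x0.
    by rewrite rho0; split=> [//|/eqP]; rewrite eq_sym oner_eq0.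
  have [c1 c2 c3] := cases x xx0; split=> // Sx.
  by have [/c1/(Sigma_notin Sx)|/c3/(Sigma_next Sx)|] := ltgtP (rho x) 1.
- move=> x t t0; have [->|xx0] := eqVneq x x0.
    by rewrite subrr scaler0 addr0 rho0 mulr0.
  have [s0 Sx hb ha] := exitP xx0; rewrite /rho.
  rewrite (@exit_unique _ (s x / t)).
  + by rewrite invf_div.
  + by rewrite addrC -subr_eq0 addrK scaler_eq0 subr_eq0 negb_or xx0 gt_eqF.
  + by rewrite divr_gt0.
  + by rewrite [x0 + _ - x0]addrC addKr scalerA divfK ?gt_eqF.
- have [M [_ hM]] := bOm.
  pose K := `|M| + 1 + `|x0|.
  have K0 : 0 < K by rewrite ltr_wpDr // ltr_wpDl.
  exists K => // x; have [->|xx0] := eqVneq x x0; first by rewrite subrr normr0 rho0 mulr0.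
  have [s0 Sx hb ha] := exitP xx0; rewrite /rho ler_pdivlMr // mulrC.
  rewrite -[X in X * _](gtr0_norm s0) -normrZ.
  have -> : s x *: (x - x0) = (x0 + s x *: (x - x0)) - x0.
    by apply/rowP => i; rewrite !mxE; ring.
  rewrite (le_trans (ler_normB _ _)) // lerD2r.
  have cM : closed [set y : Rn | `|y| <= `|M| + 1].
    by apply: compact_closed; [exact: norm_hausdorff|exact: compact_ball0].
  have : closure Omega `<=` [set y : Rn | `|y| <= `|M| + 1].
    rewrite closureE; apply: smallest_sub => // y Oy; apply: hM => //.
    by have := ler_norm M; lra.
  by apply; have [//|//|] := trichotomy (x0 + s x *: (x - x0)); move: Sx; rewrite SE => -[].
- exact: rho0.
Qed.

End Gauge.

(** * Derivatives up to the boundary *)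

Section UpToBoundary.
Variables (R : realType) (n : nat).
Local Notation Rn := 'rV[R]_n.
Local Notation e_ i := (basis_vec R i).
Local Notation D i f := (fun x => 'D_(basis_vec R i) f x).
Implicit Types (f g phi : Rn -> R) (x y z v w p X Y : Rn) (U V : set Rn) (k : nat) (i j : 'I_n).
Variable E : set Rn.

Lemma withinP f : {within E, continuous f} <->
  (forall x, E x -> forall e : R, 0 < e -> exists2 d : R, 0 < d &
    forall y, E y -> `|y - x| < d -> `|f y - f x| <= e).
Proof.
split=> [/subspace_continuousP h x Ex e e0|h].
  have /cvgrPdist_le/(_ _ e0)/nbhs_ballP[d d0 hd] := h x Ex.
  exists d => // y Ey yx; rewrite distrC; apply: hd => //.
  by rewrite -ball_normE /ball_ /= distrC.
apply/subspace_continuousP => x Ex; apply/cvgrPdist_le => e e0.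
have [d d0 hd] := h x Ex e e0.
apply/nbhs_ballP; exists d => // y; rewrite -ball_normE /ball_ /= distrC => yx Ey.
by rewrite distrC; exact: hd.
Qed.

(* An inductive copy of [Ck]: unification never unfolds it. *)
Inductive UC : nat -> (Rn -> R) -> Prop :=
| UC_0 f : {within E, continuous f} -> UC 0 f
| UC_S k f : {within E, continuous f} ->
    (forall i x, E° x -> derivable f x (e_ i)) -> (forall i, UC k (pd E i f)) -> UC k.+1 f.

Lemma Ck_UC k f : Ck E k f -> UC k f.
Proof.
elim: k f => [|k ih] f /= [cf hf]; first exact: UC_0.
by apply: UC_S => // i; [exact: (hf i).1|apply: ih; exact: (hf i).2].
Qed.

Lemma UC_cont k f : UC k f -> {within E, continuous f}.
Proof. by case. Qed.

Lemma UC_pd k f i : UC k.+1 f -> UC k (pd E i f).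
Proof. by move=> h; inversion h. Qed.

Lemma UC_derivable k f i x : UC k.+1 f -> E° x -> derivable f x (e_ i).
Proof. by move=> h; inversion h; auto. Qed.

Lemma UC_leS k f : UC k.+1 f -> UC k f.
Proof.
elim: k f => [|k ih] f h; first by apply: UC_0; exact: UC_cont h.
apply: UC_S; [exact: UC_cont h|by move=> i x; exact: UC_derivable h|].
by move=> i; apply: ih; exact: UC_pd.
Qed.

Let oE : open E°. Proof. exact: open_interior. Qed.

Lemma UC_CO_interior k f : UC k f -> CO E° k f.
Proof.
elim: k f => [|k ih] f h.
  apply/CO_P; split=> // x Ex; have /subspace_continuousP/(_ x (interior_subset Ex)) := UC_cont h.
  by rewrite within_interior.
have h0 := ih _ (UC_leS h).
apply/CO_P; split=> [x Ex|i]; first exact: CO_cont h0 Ex.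
split=> [x Ex|]; first exact: UC_derivable h Ex.
by apply: CO_congr (ih _ (UC_pd i h)) => // y Ey; rewrite pd_interior.
Qed.

Hypothesis regE : forall x, E x -> forall d : R, 0 < d -> exists2 y, E° y & `|y - x| < d.

(** Interior points accumulate at every point of [E], so limits from the interior are unique: any
    continuous function extending the interior derivative computes [pd]. All rules for [pd] come
    from this. *)
Lemma pd_eq f g i : (forall x, E° x -> D i f x = g x) -> {within E, continuous g} ->
  forall x, E x -> pd E i f x = g x.
Proof.
move=> fg /withinP cg x Ex; rewrite /pd; case: asboolP => [|nEx]; first exact: fg.
have FF : ProperFilter (within E° (nbhs x)).
  apply: within_nbhs_proper => A /nbhs_ballP[d d0 hd].
  have [y Ey yx] := regE Ex d0; exists y; split=> //; apply: hd.
  by rewrite -ball_normE /ball_ /= distrC.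
apply: cvg_lim => //; apply/cvgrPdist_le => e e0.
have [d d0 hd] := cg x Ex e e0.
apply/nbhs_ballP; exists d => // y; rewrite -ball_normE /ball_ /= distrC => yx Ey.
by rewrite fg // distrC; apply: hd => //; exact: interior_subset.
Qed.

Lemma within_congr f g : (forall x, E x -> f x = g x) ->
  {within E, continuous f} -> {within E, continuous g}.
Proof.
move=> fg /withinP h; apply/withinP => x Ex e e0; have [d d0 hd] := h x Ex e e0.
by exists d => // y Ey yx; rewrite -!fg //; exact: hd.
Qed.

Lemma pd_congr f g i : UC 1 f -> (forall x, E x -> f x = g x) ->
  forall x, E x -> pd E i f x = pd E i g x.
Proof.
move=> hf fg x Ex; symmetry; apply: pd_eq => //; last exact: UC_cont (UC_pd i hf).
move=> y Ey; rewrite pd_interior //; apply: (@derive_congr _ _ E°) => // z Ez.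
by rewrite fg //; exact: interior_subset.
Qed.

Lemma UC_le1 k f : UC k.+1 f -> UC 1 f.
Proof. by elim: k => // k ih /UC_leS. Qed.

Lemma UC_congr k f g : (forall x, E x -> f x = g x) -> UC k f -> UC k g.
Proof.
elim: k f g => [|k ih] f g fg h.
  by apply: UC_0; exact: within_congr fg (UC_cont h).
apply: UC_S; first exact: within_congr fg (UC_cont h).
  move=> i x Ex; apply: (derivable_congr oE Ex _ (UC_derivable (i := i) h Ex)) => y Ey.
  by rewrite fg //; exact: interior_subset.
move=> i; apply: ih (UC_pd i h) => x Ex.
by apply: pd_congr fg _ Ex; exact: UC_le1 h.
Qed.

Lemma within_add f g : {within E, continuous f} -> {within E, continuous g} ->
  {within E, continuous (fun x => f x + g x)}.
Proof. by move=> hf hg x; apply: continuousD; [exact: hf|exact: hg]. Qed.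

Lemma within_mul f g : {within E, continuous f} -> {within E, continuous g} ->
  {within E, continuous (fun x => f x * g x)}.
Proof. by move=> hf hg x; apply: continuousM; [exact: hf|exact: hg]. Qed.

Lemma within_cst (c : R) : {within E, continuous (fun=> c)}.
Proof. by move=> x; exact: cst_continuous. Qed.

Lemma within_sum (I : Type) (r : seq I) (P : pred I) (F : I -> Rn -> R) :
  (forall a, {within E, continuous (F a)}) ->
  {within E, continuous (fun x => \sum_(a <- r | P a) F a x)}.
Proof.
move=> h; elim: r => [|a r ih].
  by apply: (@within_congr (fun=> 0)) => [x _|]; [rewrite big_nil|exact: within_cst].
case Pa: (P a); last by apply: within_congr ih => x _; rewrite big_cons Pa.
by apply: within_congr (within_add (h a) ih) => x _; rewrite big_cons Pa.
Qed.

Lemma pd_cst (c : R) i x : E x -> pd E i (fun=> c) x = 0.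
Proof.
move=> Ex; apply: (@pd_eq _ (fun=> 0)) => // [y _|]; first exact: derive_cst.
exact: within_cst.
Qed.

Lemma UC_cst k (c : R) : UC k (fun=> c).
Proof.
elim: k c => [|k ih] c; first by apply: UC_0; exact: within_cst.
apply: UC_S; first exact: within_cst.
  by move=> i x _; exact: derivable_cst.
by move=> i; apply: UC_congr (ih 0) => x Ex; rewrite pd_cst.
Qed.

Lemma pd_add f g i x : UC 1 f -> UC 1 g -> E x ->
  pd E i (fun x => f x + g x) x = pd E i f x + pd E i g x.
Proof.
move=> hf hg; apply: (@pd_eq _ (fun x => pd E i f x + pd E i g x)) => [y Ey|]; last first.
  by apply: within_add; [exact: UC_cont (UC_pd i hf)|exact: UC_cont (UC_pd i hg)].
rewrite !pd_interior //.
exact: (deriveD (UC_derivable (i := i) hf Ey) (UC_derivable (i := i) hg Ey)).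
Qed.

Lemma UC_add k f g : UC k f -> UC k g -> UC k (fun x => f x + g x).
Proof.
elim: k f g => [|k ih] f g hf hg.
  by apply: UC_0; apply: within_add; [exact: UC_cont hf|exact: UC_cont hg].
apply: UC_S; first by apply: within_add; [exact: UC_cont hf|exact: UC_cont hg].
  by move=> i x Ex; apply: derivableD; [exact: UC_derivable hf Ex|exact: UC_derivable hg Ex].
move=> i; apply: UC_congr (ih _ _ (UC_pd i hf) (UC_pd i hg)) => x Ex.
by rewrite pd_add //; [exact: UC_le1 hf|exact: UC_le1 hg].
Qed.

Lemma pd_mul f g i x : UC 1 f -> UC 1 g -> E x ->
  pd E i (fun x => f x * g x) x = pd E i f x * g x + f x * pd E i g x.
Proof.
move=> hf hg.
apply: (@pd_eq _ (fun x => pd E i f x * g x + f x * pd E i g x)) => [y Ey|]; last first.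
  by apply: within_add; apply: within_mul;
    [exact: UC_cont (UC_pd i hf)|exact: UC_cont hg|exact: UC_cont hf|exact: UC_cont (UC_pd i hg)].
rewrite !pd_interior //.
have := is_deriveM (derivableP (UC_derivable (i := i) hf Ey)) (derivableP (UC_derivable (i := i) hg Ey)).
move=> h; rewrite (@derive_val _ _ _ _ _ _ _ h) addrC.
by congr (_ + _); rewrite /GRing.scale /= mulrC.
Qed.

Lemma UC_mul k f g : UC k f -> UC k g -> UC k (fun x => f x * g x).
Proof.
elim: k f g => [|k ih] f g hf hg.
  by apply: UC_0; apply: within_mul; [exact: UC_cont hf|exact: UC_cont hg].
apply: UC_S; first by apply: within_mul; [exact: UC_cont hf|exact: UC_cont hg].
  by move=> i x Ex; apply: derivableM; [exact: UC_derivable hf Ex|exact: UC_derivable hg Ex].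
move=> i; apply: UC_congr (UC_add (ih _ _ (UC_pd i hf) (UC_leS hg)) (ih _ _ (UC_leS hf) (UC_pd i hg))).
by move=> x Ex; rewrite pd_mul //; [exact: UC_le1 hf|exact: UC_le1 hg].
Qed.

Lemma UC_sum k (I : Type) (r : seq I) (P : pred I) (F : I -> Rn -> R) :
  (forall a, UC k (F a)) -> UC k (fun x => \sum_(a <- r | P a) F a x).
Proof.
move=> h; elim: r => [|a r ih].
  by apply: UC_congr (UC_cst k 0) => x _; rewrite big_nil.
case Pa: (P a); last by apply: UC_congr ih => x _; rewrite big_cons Pa.
by apply: UC_congr (UC_add (h a) ih) => x _; rewrite big_cons Pa.
Qed.

Lemma CO_UC V k f : open V -> E `<=` V -> CO V k f -> UC k f.
Proof.
move=> oV EV; elim: k f => [|k ih] f hf.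
  by apply: UC_0; apply: continuous_in_subspaceT => x; rewrite inE => /EV; exact: CO_cont hf.
have c0 : {within E, continuous f}.
  by apply: continuous_in_subspaceT => x; rewrite inE => /EV; exact: CO_cont hf.
apply: UC_S => // [i x /interior_subset/EV|i]; first exact: CO_derivable hf.
apply: UC_congr (ih _ (CO_D i hf)) => x Ex; symmetry.
apply: (@pd_eq _ (D i f)) Ex => //.
by apply: continuous_in_subspaceT => y; rewrite inE => /EV; exact: CO_cont (CO_D i hf).
Qed.

Lemma pd_CO V f i x : open V -> E `<=` V -> CO V 1 f -> E x -> pd E i f x = D i f x.
Proof.
move=> oV EV hf; apply: (@pd_eq _ (D i f)) => //.
by apply: continuous_in_subspaceT => y; rewrite inE => /EV; exact: CO_cont (CO_D i hf).
Qed.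

Lemma pd_schwarz f i j x : UC 2 f -> E x -> pd E i (pd E j f) x = pd E j (pd E i f) x.
Proof.
move=> hf; have hf1 l := UC_pd l hf.
apply: (@pd_eq _ (pd E j (pd E i f))); last exact: UC_cont (UC_pd j (hf1 i)).
move=> y Ey; rewrite (pd_interior j _ Ey).
have e l m : 'D_(basis_vec R m) (pd E l f) y = D m (D l f) y.
  by apply: (derive_congr _ oE Ey) => z Ez; rewrite pd_interior.
have hc : CO E° 2 f by exact: (@UC_CO_interior 2 f).
have h := schwarz j i oE Ey hc.
exact: etrans (e j i) (etrans h (esym (e i j))).
Qed.

End UpToBoundary.

Section BoundaryCalculus.
Variables (R : realType) (n : nat).
Local Notation Rn := 'rV[R]_n.
Local Notation e_ i := (basis_vec R i).
Local Notation D i f := (fun x => 'D_(basis_vec R i) f x).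
Implicit Types (f g phi : Rn -> R) (x y z v w p X Y : Rn) (U V : set Rn) (k : nat) (i j : 'I_n).
Variables (Omega Sigma : set Rn) (x0 : Rn) (rho : Rn -> R).
Hypothesis G : gauge Omega Sigma x0 rho.
Let E := ~` Omega.

Lemma ext_gauge x : E x <-> 1 <= rho x.
Proof.
by split=> [h|h /(gauge_in G)]; [rewrite leNgt; apply/negP => /(gauge_in G)|rewrite ltNge h].
Qed.

Lemma gauge_neq x : 0 < rho x -> (~` [set x0]) x.
Proof. by move=> h; move=> /= E0; move: h; rewrite E0 (gauge_center G) ltxx. Qed.

Lemma gauge_cont x : 0 < rho x -> {for x, continuous rho}.
Proof. by move=> /gauge_neq h; exact: CO_cont (gauge_CO G 0) h. Qed.

Lemma open_exterior (c : R) : 0 <= c -> open [set x | c < rho x].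
Proof.
move=> c0; rewrite openE => x /= cx.
have e0 : 0 < (rho x - c) / 2 by rewrite divr_gt0 // subr_gt0.
have [d d0 hd] := (cont_epsP _ _).1 (gauge_cont (le_lt_trans c0 cx)) _ e0.
apply/nbhs_ballP; exists d => // y; rewrite -ball_normE /ball_ /= distrC => /hd.
by rewrite ler_norml => /andP[+ _]; lra.
Qed.

(** A point with rho = 1 is not interior to [E], since its contractions towards x0 have rho < 1. *)
Lemma interior_gauge x : E° x <-> 1 < rho x.
Proof.
split=> [Ex|rx]; last first.
  have oU := open_exterior (@ler01 R).
  have : nbhs x [set x | 1 < rho x] by exact: open_nbhs_nbhs.
  by apply: filterS => y /= /ltW/ext_gauge.
have := interior_subset Ex; rewrite -/(E x) => /ext_gauge; rewrite le_eqVlt => /orP[/eqP r1|//].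
have xx0 : (~` [set x0]) x by apply: gauge_neq; rewrite -r1.
have n0 : 0 < `|x - x0| by rewrite normr_gt0 subr_eq0; apply/eqP.
have /nbhs_ballP[d d0 hd] := Ex.
pose m := Num.min (d / `|x - x0|) 1.
have m0 : 0 < m by rewrite lt_min ltr01 divr_gt0.
have m1 : m <= 1 by rewrite ge_min lexx orbT.
have md : m * `|x - x0| <= d by rewrite -ler_pdivlMr // ge_min lexx.
have t0 : 0 < 1 - m / 2 by lra.
have := gauge_hom G x t0; rewrite -r1 mulr1 => rr.
have : E (x0 + (1 - m / 2) *: (x - x0)).
  apply: hd; rewrite -ball_normE /ball_ /=.
  have -> : x - (x0 + (1 - m / 2) *: (x - x0)) = (m / 2) *: (x - x0).
    by apply/rowP => i; rewrite !mxE; ring.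
  rewrite normrZ gtr0_norm ?divr_gt0 // mulrAC.
  have : 0 < m * `|x - x0| by rewrite mulr_gt0.
  by move: md; lra.
by move/ext_gauge; rewrite rr; lra.
Qed.

Lemma ext_neq x : E x -> (~` [set x0]) x.
Proof. by move=> /ext_gauge h; apply: gauge_neq; apply: lt_le_trans h. Qed.

Lemma Sigma_ext x : Sigma x -> E x.
Proof. by move=> /(gauge_on G) h; apply/ext_gauge; rewrite h. Qed.

Lemma gauge_euler x : 0 < rho x -> dotp (grad rho x) (x - x0) = rho x.
Proof.
move=> rx; have xx0 := gauge_neq rx.
have dr : differentiable rho x by exact: CO_differentiable (@open_punctured R n x0) xx0 (gauge_CO G 1).
rewrite -derive_grad // derive_line.
have ht : 0 < (1 : R) by [].
pose f (h : R) := (1 + h) * rho x.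
have df : is_derive (0 : R) 1 f (rho x).
  have d1 : is_derive (0 : R) 1 (fun h : R => 1 + h) 1.
    by have := is_deriveD (is_derive_cst (1 : R) (0 : R) 1) (is_derive_id (0 : R) 1); rewrite add0r.
  by have := is_deriveM d1 (is_derive_cst (rho x) (0 : R) 1); rewrite scaler0 add0r /GRing.scale /= mulr1.
rewrite -(@derive_val _ _ _ _ _ _ _ df).
have near1 : \forall h \near (0 : R), `|h| < 1.
  by apply/nbhs_ballP; exists 1 => //= z; rewrite -ball_normE /ball_ /= sub0r normrN.
apply: near_eq_derive; near=> h.
have h1 : `|h| < 1 by near: h; exact: near1.
have h2 : 0 < 1 + h by move: h1; rewrite ltr_norml => /andP[]; lra.
rewrite /f -(gauge_hom G x h2); congr rho.
by apply/rowP => i; rewrite !mxE; ring.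
Unshelve. all: by end_near. Qed.

Lemma grad_gauge_neq0 x : 0 < rho x -> grad rho x != 0.
Proof.
move=> rx; apply/eqP => g0; move: (gauge_euler rx); rewrite g0 => h; move: rx.
by rewrite -h dotpC -[X in dotp _ X](scale0r 0) dotpZr mul0r ltxx.
Qed.

Lemma gauge_tangent p X : Sigma p -> tangent Sigma p X <-> dotp (grad rho p) X = 0.
Proof.
move=> Sp; have rp := (gauge_on G p).1 Sp.
have rp0 : 0 < rho p by rewrite rp.
have oV := @open_punctured R n x0.
split=> [[gam [g0 gS dg]]|gX].
  have dr : differentiable rho (gam 0).
    by rewrite g0; exact: CO_differentiable oV (gauge_neq rp0) (gauge_CO G 1).
  have := is_derive_comp dr dg; rewrite g0 => h.
  rewrite /dotp (eq_bigr (fun i => D i rho p * X 0 i)); last by move=> i _; rewrite gradE.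
  rewrite -(@derive_val _ _ _ _ _ _ _ h).
  apply: (@etrans _ _ ('D_(1 : R) (cst (1 : R)) (0 : R))); last exact: derive_cst.
  by apply: near_eq_derive; near=> t; rewrite /=; apply/(gauge_on G); near: t.
apply: (@tangent_level _ _ _ (~` [set x0]) (fun x => rho x + - 1)) => //.
- exact: gauge_neq.
- by apply: CO_add; [exact: oV|exact: gauge_CO G 1|exact: CO_cst].
- apply/seteqP; split=> x /=.
    by move=> [/(gauge_on G) -> h]; split=> //; rewrite subrr.
  by move=> [h /eqP]; rewrite subr_eq0 => /eqP h1; split=> //; exact/(gauge_on G).
- have -> : grad (fun x => rho x + - 1) p = grad rho p.
    apply/rowP => i; rewrite !gradE.
    have h := is_deriveD (is_derive_CO i (gauge_CO G 1) (gauge_neq rp0)) (is_derive_cst (- 1 : R) p (e_ i)).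
    by rewrite (@derive_val _ _ _ _ _ _ _ h) addr0.
  exact: grad_gauge_neq0.
- have -> : grad (fun x => rho x + - 1) p = grad rho p.
    apply/rowP => i; rewrite !gradE.
    have h := is_deriveD (is_derive_CO i (gauge_CO G 1) (gauge_neq rp0)) (is_derive_cst (- 1 : R) p (e_ i)).
    by rewrite (@derive_val _ _ _ _ _ _ _ h) addr0.
  exact: gX.
Unshelve. all: by end_near. Qed.

Lemma exterior_regular x : E x -> forall d : R, 0 < d -> exists2 y, E° y & `|y - x| < d.
Proof.
move=> Ex d d0; have rx := (ext_gauge x).1 Ex.
have K0 : 0 < `|x - x0| + 1 by rewrite ltr_wpDl.
have t0 : 0 < d / (`|x - x0| + 1) by rewrite divr_gt0.
exists (x0 + (1 + d / (`|x - x0| + 1)) *: (x - x0)).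
  apply/interior_gauge; rewrite (gauge_hom G) ?mulrDl ?mul1r; last by rewrite ltr_wpDl.
  have : 0 < d / (`|x - x0| + 1) * rho x by rewrite mulr_gt0 // (lt_le_trans ltr01).
  by lra.
have -> : x0 + (1 + d / (`|x - x0| + 1)) *: (x - x0) - x = (d / (`|x - x0| + 1)) *: (x - x0).
  by apply/rowP => i; rewrite !mxE; ring.
by rewrite normrZ gtr0_norm // mulrAC ltr_pdivrMr // ltr_pM2l // ltrDl.
Qed.

End BoundaryCalculus.

(** * Radial projection onto the boundary and one-sided derivatives *)

Section RadialProjection.
Variables (R : realType) (n : nat).
Local Notation Rn := 'rV[R]_n.
Local Notation e_ i := (basis_vec R i).
Local Notation D i f := (fun x => 'D_(basis_vec R i) f x).
Implicit Types (f g phi : Rn -> R) (x y z v w p X Y : Rn) (U V : set Rn) (k : nat) (i j : 'I_n) (t lam : R).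
Variables (Omega Sigma : set Rn) (x0 : Rn) (rho : Rn -> R).
Hypothesis G : gauge Omega Sigma x0 rho.
Let E := ~` Omega.
Let V0 : set Rn := ~` [set x0].
Let oV : open V0. Proof. exact: open_punctured. Qed.

Lemma gauge_gt0 x : V0 x -> 0 < rho x.
Proof.
move=> xx0; have [M M0 hM] := gauge_bound G.
have : 0 < M * rho x by apply: lt_le_trans (hM x); rewrite normr_gt0 subr_eq0; apply/eqP.
by rewrite pmulr_rgt0.
Qed.

(** Radial projection onto the level rho = lam. For lam > 1 the image lies in the open exterior,
    where functions that are C^1 up to the boundary are C^1 in the ordinary sense. *)
Definition shift_prj lam x : Rn := x0 + (lam / rho x) *: (x - x0).
Definition prj x : Rn := shift_prj 1 x.

Lemma gauge_shift_prj lam x : 0 < lam -> V0 x -> rho (shift_prj lam x) = lam.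
Proof.
by move=> l0 /gauge_gt0 r0; rewrite (gauge_hom G) ?divr_gt0 // divfK // gt_eqF.
Qed.

Lemma Sigma_prj x : V0 x -> Sigma (prj x).
Proof. by move=> Vx; apply/(gauge_on G); rewrite gauge_shift_prj. Qed.

Lemma Sigma_neq p : Sigma p -> V0 p.
Proof. by move=> Sp; apply: (gauge_neq G); rewrite ((gauge_on G p).1 Sp). Qed.

Lemma prj_id p : Sigma p -> prj p = p.
Proof. by move=> /(gauge_on G) r1; rewrite /prj /shift_prj r1 divr1 scale1r addrC subrK. Qed.

Lemma shift_prjE lam x j : shift_prj lam x 0 j = (1 - lam) * x0 0 j + lam * prj x 0 j.
Proof. by rewrite /prj /shift_prj !mxE; ring. Qed.

Lemma CO_prj k j : CO V0 k (fun x => prj x 0 j).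
Proof.
have h : CO V0 k (fun x => (rho x)^-1).
  apply: CO_inv => //; last exact: (gauge_CO G).
  by move=> x /gauge_gt0 r0; rewrite gt_eqF.
apply: CO_congr (CO_add oV (CO_cst k (x0 0 j) oV) (CO_mul oV h
  (CO_add oV (CO_coord k j oV) (CO_cst k (- x0 0 j) oV)))) => // x _.
by rewrite !mxE div1r.
Qed.

Lemma CO_shift_prj lam k j : CO V0 k (fun x => shift_prj lam x 0 j).
Proof.
apply: CO_congr (CO_add oV (CO_cst k ((1 - lam) * x0 0 j) oV)
  (CO_mul oV (CO_cst k lam oV) (CO_prj k j))) => // x _.
by rewrite shift_prjE.
Qed.

Lemma D_shift_prj lam i j x : V0 x ->
  D i (fun x => shift_prj lam x 0 j) x = lam * D i (fun x => prj x 0 j) x.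
Proof.
move=> Vx.
have -> : (fun x => shift_prj lam x 0 j) = fun x => (1 - lam) * x0 0 j + lam * prj x 0 j.
  by apply/funext => y; rewrite shift_prjE.
have h := isD_add (is_derive_cst ((1 - lam) * x0 0 j) x (e_ i))
  (isD_scale lam (is_derive_CO i (CO_prj 1 j) Vx)).
by rewrite (@derive_val _ _ _ _ _ _ _ h) add0r.
Qed.

Lemma D_prj p i j : Sigma p ->
  D i (fun x => prj x 0 j) p = (i == j)%:R - grad rho p 0 i * (p - x0) 0 j.
Proof.
move=> Sp; have Vp := Sigma_neq Sp; have r1 := (gauge_on G p).1 Sp.
have hr : is_derive p (e_ i) (fun x => (rho x)^-1) (- D i rho p).
  have r0 : rho p != 0 by rewrite r1 oner_neq0.
  have d := derivableP (CO_derivable (i := i) (gauge_CO G 1) Vp).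
  apply: DeriveDef; first exact: derivableV.
  by rewrite deriveV // r1 expr1n invr1 scaleN1r.
have hx : is_derive p (e_ i) (fun x : Rn => x 0 j - x0 0 j) (i == j)%:R.
  have := isD_sub (is_derive_coord j p (e_ i)) (is_derive_cst (x0 0 j) p (e_ i)).
  by rewrite basis_vecE subr0.
have h := isD_add (is_derive_cst (x0 0 j) p (e_ i)) (isD_mul hr hx).
have -> : (fun x => prj x 0 j) = fun x => x0 0 j + (rho x)^-1 * (x 0 j - x0 0 j).
  by apply/funext => y; rewrite /prj /shift_prj !mxE div1r.
by rewrite (@derive_val _ _ _ _ _ _ _ h) r1 invr1 mul1r add0r addrC mulNr gradE !mxE.
Qed.

Let triple_est (g l d A B t : R) : 0 <= t <= 1 -> `|g - A| <= t -> `|l - 1| <= t -> `|d - B| <= t ->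
  `|g * (l * d) - A * B| <= t * (2 * (`|B| + 1) + `|A| * (`|B| + 2)).
Proof.
move=> /andP[t0 t1] h1 h2 h3.
have -> : g * (l * d) - A * B = (g - A) * (l * d) + (A * ((l - 1) * d) + A * (d - B)) by ring.
have d1 : `|d| <= `|B| + 1.
  by rewrite -[d](subrK B) (le_trans (ler_normD _ _)) // addrC lerD2l (le_trans h3).
have l1 : `|l| <= 2.
  by rewrite -[l](subrK 1) (le_trans (ler_normD _ _)) // normr1; lra.
have k1 : `|(g - A) * (l * d)| <= t * (2 * (`|B| + 1)).
  by rewrite !normrM ler_pM // ler_pM.
have k2 : `|A * ((l - 1) * d)| <= `|A| * (t * (`|B| + 1)).
  by rewrite !normrM ler_wpM2l // ler_pM.
have k3 : `|A * (d - B)| <= `|A| * t by rewrite normrM ler_wpM2l.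
rewrite (le_trans (ler_normD _ _)) // (le_trans (lerD (lexx _) (ler_normD _ _))) //.
by rewrite (le_trans (lerD k1 (lerD k2 k3))) //; lra.
Qed.

Lemma shift_prj_near p f : Sigma p -> {within E, continuous f} -> forall e : R, 0 < e ->
  exists2 d : R, 0 < d & forall x lam, `|x - p| < d -> 1 <= lam < 1 + d ->
    `|f (shift_prj lam x) - f p| <= e.
Proof.
move=> Sp /withinP cf e e0.
have [d0 d00 h0] := cf p (Sigma_ext G Sp) e e0.
have [M M0 hM] := gauge_bound G.
have d02 : 0 < d0 / 2 by rewrite divr_gt0.
have [d1 d10 h1] := (cont_rVP prj p).1 (fun j => CO_cont (CO_prj 0 j) (Sigma_neq Sp)) _ d02.
have [d2 d20 h2] := open_ballP oV (Sigma_neq Sp).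
pose d := Num.min d1 (Num.min d2 (d0 / 2 / M)).
have d_0 : 0 < d by rewrite !lt_min d10 d20 !divr_gt0.
exists d => // x lam; rewrite !lt_min => /and3P[x1 x2 _] /andP[l1 l2].
have Vx : V0 x by exact: h2.
have l0 : 0 < lam by lra.
apply: h0; first by apply/(ext_gauge G); rewrite gauge_shift_prj.
have -> : shift_prj lam x - p = (prj x - prj p) + (lam - 1) *: (prj x - x0).
  by rewrite (prj_id Sp); apply/rowP => j; rewrite !mxE; ring.
rewrite (le_lt_trans (ler_normD _ _)) // normrZ ger0_norm ?subr_ge0 //.
have k1 : `|prj x - x0| <= M.
  by have := hM (prj x); rewrite gauge_shift_prj // mulr1.
have k2 : (lam - 1) * `|prj x - x0| < d0 / 2.
  apply: (@le_lt_trans _ _ ((lam - 1) * M)); first by rewrite ler_wpM2l // subr_ge0.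
  rewrite -ltr_pdivlMr //; apply: (@lt_le_trans _ _ d); first by lra.
  by rewrite !ge_min lexx !orbT.
by have := h1 x x1; move: k2; lra.
Qed.

(** [f] is controlled on one side of [Sigma] only, but [f \o prj] sees only its values on [Sigma]
    and is defined on both sides. Its differential is the chain rule with [D_prj], the projection
    along x - x0 onto the tangent space. *)
Lemma differentiable_comp_prj f p : UC E 1 f -> Sigma p ->
  differentiable (f \o prj) p /\
  forall i, D i (f \o prj) p =
    pd E i f p - grad rho p 0 i * \sum_j pd E j f p * (p - x0) 0 j.
Proof.
move=> hf Sp; have Vp := Sigma_neq Sp.
pose B i j := D i (fun x => prj x 0 j) p.
pose A j := pd E j f p.
pose a i := \sum_j A j * B i j.
suff [df dE] : differentiable (f \o prj) p /\ forall v, 'd (f \o prj) p v = \sum_i a i * v 0 i.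
  split=> // i; rewrite deriveE // dE sum_basis_vec /a.
  rewrite (eq_bigr (fun j => A j * (i == j)%:R - grad rho p 0 i * (A j * (p - x0) 0 j))).
    rewrite sumrB -mulr_sumr; congr (_ - _).
    by rewrite -[RHS](sum_basis_vec A i); apply: eq_bigr => j _; rewrite basis_vecE.
  by move=> j _; rewrite /B D_prj // mulrBr [_ * (_ * (p - x0) 0 j)]mulrCA.
apply: differentiable_est => e e0.
pose C : R := \sum_i \sum_j (2 * (`|B i j| + 1) + `|A j| * (`|B i j| + 2)).
have C0 : 0 <= C.
  by do 2![apply: sumr_ge0 => ? _]; rewrite addr_ge0 // mulr_ge0 // addr_ge0.
have C1 : 0 < C + 1 by rewrite ltr_wpDl.
have [t [t0 t1 tC]] : exists t, [/\ 0 < t, t <= 1 & t * C <= e].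
  have m0 : 0 < Num.min 1 (e / (C + 1)) by rewrite lt_min ltr01 divr_gt0.
  exists (Num.min 1 (e / (C + 1))); split=> //; first by rewrite ge_min lexx.
  apply: (@le_trans _ _ (Num.min 1 (e / (C + 1)) * (C + 1))); first by rewrite ler_pM2l // lerDl.
  by rewrite -ler_pdivlMr // ge_min lexx orbT.
have [dA dA0 hA] : exists2 d : R, 0 < d & forall j x lam, `|x - p| < d -> 1 <= lam < 1 + d ->
    `|pd E j f (shift_prj lam x) - A j| <= t.
  apply: (@fin_radius _ _ (fun j d => forall x lam, `|x - p| < d -> 1 <= lam < 1 + d ->
    `|pd E j f (shift_prj lam x) - A j| <= t)).
    move=> j d d' /andP[_ dd] h x lam xp /andP[l1 l2]; apply: h; first exact: lt_le_trans xp dd.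
    by rewrite l1 /=; lra.
  by move=> j; apply: shift_prj_near => //; exact: UC_cont (UC_pd j hf).
have [dB dB0 hB] : exists2 d : R, 0 < d & forall ij : 'I_n * 'I_n, forall x, `|x - p| < d ->
    `|D ij.1 (fun x => prj x 0 ij.2) x - B ij.1 ij.2| <= t.
  apply: (@fin_radius _ _ (fun ij d => forall x, `|x - p| < d ->
    `|D ij.1 (fun x => prj x 0 ij.2) x - B ij.1 ij.2| <= t)).
    by move=> ij d d' /andP[_ dd] h x xp; apply: h; exact: lt_le_trans xp dd.
  by move=> ij; apply: (cont_epsP _ _).1 => //; exact: CO_cont (CO_D ij.1 (CO_prj 1 ij.2)) Vp.
have [dV dV0 hV] := open_ballP oV Vp.
pose d := Num.min dA (Num.min dB (Num.min dV t)).
have d0 : 0 < d by rewrite !lt_min dA0 dB0 dV0.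
exists d => // y yd.
have near_ok (s : R) : `|s| <= 1 -> `|p + s *: y - p| < d.
  move=> s1; rewrite addrC addKr normrZ; apply: le_lt_trans yd.
  by rewrite ler_piMl.
have Vok (s : R) : `|s| <= 1 -> V0 (p + s *: y).
  by move=> /near_ok h; apply: hV; apply: lt_le_trans h _; rewrite !ge_min lexx !orbT.
(* The shifted projection stays in the open exterior, where [f] is C^1. *)
have shifted lam : 1 < lam < 1 + d ->
    `|f (shift_prj lam (p + y)) - f (shift_prj lam p) - \sum_i a i * y 0 i| <= e * `|y|.
  move=> /andP[l1 ld]; have l0 : 0 < lam by lra.
  have hF : CO V0 1 (f \o shift_prj lam).
    apply: (@CO_comp _ _ V0 E° 1 f (shift_prj lam) oV (@open_interior _ _)).
    - by move=> x Vx; apply/(interior_gauge G); rewrite gauge_shift_prj.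
    - exact: (@UC_CO_interior _ _ E 1 f).
    - by move=> j; exact: CO_shift_prj.
  have dF (s : R) : `|s| <= 1 -> differentiable (f \o shift_prj lam) (p + s *: y).
    by move=> /Vok Vx; exact: CO_differentiable oV Vx hF.
  have dF' (s : R) : `|s| <= `|1 : R| -> derivable (f \o shift_prj lam) (p + s *: y) y.
    by rewrite normr1 => /dF; exact: diff_derivable.
  have [s hs] := @line_mvt R n (f \o shift_prj lam) p y 1 dF'.
  rewrite scale1r mul1r /= => ->; rewrite normr1 in hs.
  rewrite derive_sum_coord; last exact: dF.
  rewrite -sumrB (le_trans (ler_norm_sum _ _ _)) //.
  have Vx := Vok s hs; have xd := near_ok s hs; set x := p + s *: y in Vx xd *.
  move: xd; rewrite !lt_min => /and4P[xA xB xV xt].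
  apply: (@le_trans _ _ (\sum_i (t * (\sum_j (2 * (`|B i j| + 1) + `|A j| * (`|B i j| + 2)))) * `|y|)).
    apply: ler_sum => i _; rewrite -mulrBl normrM ler_pM ?normr_coord_le //.
    have := CO_is_derive_comp i (@open_interior _ E) Vx _ (@UC_CO_interior _ _ E 1 f hf) (CO_shift_prj lam 1).
    have inE z : V0 z -> E° (shift_prj lam z).
      by move=> Vz; apply/(interior_gauge G); rewrite gauge_shift_prj.
    move=> /(_ inE) h; rewrite (@derive_val _ _ _ _ _ _ _ h) /a -sumrB.
    rewrite (le_trans (ler_norm_sum _ _ _)) // mulr_sumr; apply: ler_sum => j _.
    rewrite D_shift_prj // -(pd_interior j f (inE _ Vx)).
    apply: triple_est; first by rewrite (ltW t0).
    - by apply: hA => //; rewrite ltW //=; apply: lt_le_trans ld _; rewrite lerD2l ge_min lexx.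
    - rewrite gtr0_norm ?subr_gt0 //; have : d <= t by rewrite !ge_min lexx !orbT.
      by lra.
    - exact: (hB (i, j)).
  by rewrite -mulr_suml -mulr_sumr ler_wpM2r.
(* The estimate for the shifted projections is uniform in lam > 1, and f (shift_prj lam z) tends to
   f (prj z) as lam decreases to 1. *)
apply/ler_addgt0Pr => eta eta0.
have lim z : V0 z -> exists2 r : R, 0 < r & forall lam, 1 < lam < 1 + r ->
    `|f (shift_prj lam z) - f (prj z)| <= eta / 2.
  move=> Vz; have eta2 : 0 < eta / 2 by rewrite divr_gt0.
  have Sz := Sigma_prj Vz.
  have [r r0 hr] := shift_prj_near Sz (UC_cont hf) eta2.
  exists r => // lam /andP[l1 l2]; have l0 : 0 < lam by lra.
  have -> : shift_prj lam z = shift_prj lam (prj z).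
    rewrite /shift_prj gauge_shift_prj // /prj /shift_prj; apply/rowP => j; rewrite !mxE.
    by field; rewrite gt_eqF //; exact: gauge_gt0.
  by apply: hr; rewrite ?subrr ?normr0 // ltW.
have Vpy : V0 (p + y) by have := Vok 1; rewrite normr1 scale1r; apply.
have [r1 r10 h1] := lim _ Vpy; have [r2 r20 h2] := lim _ Vp.
pose lam := 1 + Num.min d (Num.min r1 r2) / 2.
have m0 : 0 < Num.min d (Num.min r1 r2) by rewrite lt_min d0 lt_min r10.
have lb (r : R) : Num.min d (Num.min r1 r2) <= r -> 1 < lam < 1 + r.
  by move=> h; rewrite /lam; apply/andP; split; lra.
have m1 : Num.min d (Num.min r1 r2) <= r1 by rewrite ge_min [X in _ || X]ge_min lexx ?orbT.
have k1 := h1 lam (lb _ m1).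
have m2 : Num.min d (Num.min r1 r2) <= r2 by rewrite ge_min [X in _ || X]ge_min lexx ?orbT.
have k2 := h2 lam (lb _ m2).
have m3 : Num.min d (Num.min r1 r2) <= d by rewrite ge_min lexx.
have k3 := shifted lam (lb _ m3).
rewrite /=; set u := \sum_i a i * y 0 i in k3 *.
have -> : f (prj (p + y)) - f (prj p) - u = (f (shift_prj lam (p + y)) - f (shift_prj lam p) - u)
   - ((f (shift_prj lam (p + y)) - f (prj (p + y))) - (f (shift_prj lam p) - f (prj p))) by ring.
rewrite (le_trans (ler_normB _ _)) // lerD // (le_trans (ler_normB _ _)) //.
by move: k1 k2; lra.
Qed.

(** [f \o prj] vanishes near p, so the differential of [f] is a multiple of N; as N.X = 1, the
    factor is the derivative along X. *)
Lemma pd_vanishing f p : UC E 1 f -> (forall x, Sigma x -> f x = 0) -> Sigma p ->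
  forall i, pd E i f p = grad rho p 0 i * \sum_j pd E j f p * (p - x0) 0 j.
Proof.
move=> hf f0 Sp i; have [_ h] := differentiable_comp_prj hf Sp.
apply/eqP; rewrite -subr_eq0 -h; apply/eqP.
rewrite -[RHS](derive_cst (0 : R) p (e_ i)).
apply: (derive_congr _ oV (Sigma_neq Sp)) => x Vx /=.
by rewrite f0 //; exact: Sigma_prj.
Qed.

End RadialProjection.

(** * Flux through the boundary *)

Section JetClosure.
Variables (R : realType) (n : nat) (T : Type) (P : (T -> R) -> Prop).
Hypothesis Pcst : forall c : R, P (fun=> c).
Hypothesis Padd : forall f g, P f -> P g -> P (fun t => f t + g t).
Hypothesis Pmul : forall f g, P f -> P g -> P (fun t => f t * g t).

Lemma closed_sub f g : P f -> P g -> P (fun t => f t - g t).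
Proof.
move=> hf hg; have -> : (fun t => f t - g t) = fun t => f t + -1 * g t.
  by apply/funext => t; rewrite mulN1r.
by apply: Padd => //; apply: Pmul.
Qed.

Lemma closed_sum (I : Type) (r : seq I) (F : I -> T -> R) :
  (forall i, P (F i)) -> P (fun t => \sum_(i <- r) F i t).
Proof.
move=> h; elim: r => [|a r ih].
  by have -> : (fun t => \sum_(i <- [::]) F i t) = fun=> 0 by apply/funext => t; rewrite big_nil.
have -> : (fun t => \sum_(i <- a :: r) F i t) = fun t => F a t + \sum_(i <- r) F i t.
  by apply/funext => t; rewrite big_cons.
exact: Padd.
Qed.

Lemma closed_prod (I : Type) (r : seq I) (F : I -> T -> R) :
  (forall i, P (F i)) -> P (fun t => \prod_(i <- r) F i t).
Proof.
move=> h; elim: r => [|a r ih].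
  by have -> : (fun t => \prod_(i <- [::]) F i t) = fun=> 1 by apply/funext => t; rewrite big_nil.
have -> : (fun t => \prod_(i <- a :: r) F i t) = fun t => F a t * \prod_(i <- r) F i t.
  by apply/funext => t; rewrite big_cons.
exact: Pmul.
Qed.

Variables (X : 'I_n -> T -> R) (c : R) (h : 'I_n -> 'I_n -> T -> R).
Variables (p : 'I_n -> 'I_n -> 'I_n -> T -> R) (v : T -> R) (V : 'I_n -> T -> R).
Hypotheses (PX : forall i, P (X i)) (Ph : forall i j, P (h i j)).
Hypotheses (Pp : forall a i j, P (p a i j)) (Pv : P v) (PV : forall i, P (V i)).

(** The current is a polynomial in the jets, so it belongs to any class stable under constants, sums
    and products: C^k functions, functions continuous up to the boundary, uniformly convergent
    families. *)
Lemma jcur_closed a : P (fun t => jcur (X^~ t) c (fun i j => h i j t)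
  (fun b i j => p b i j t) (v t) (V^~ t) a).
Proof.
have Pdiv j : P (fun t => jdiv (fun b i j => p b i j t) j) by apply: closed_sum.
have Ptr j : P (fun t => jtr (fun b i j => p b i j t) j) by apply: closed_sum.
have Pk i j : P (fun t => jk (X^~ t) c (fun i j => h i j t) (fun b i j => p b i j t) i j).
  by apply: Padd; [apply: closed_sum => b; apply: Pmul|apply: Pmul].
have Pw : P (fun t => jw (X^~ t) c (v t) (V^~ t)).
  by apply: Padd; [apply: closed_sum => b; apply: Pmul|apply: Pmul].
have Pl : P (fun t => jlag (fun b i j => p b i j t) (V^~ t)).
  apply: Padd; last by apply: closed_sum => j; apply: Pmul.
  apply: closed_sub; last by apply: closed_sum => j; apply: Pmul.
  apply: Padd; last by apply: Pmul => //; apply: closed_sum => j; apply: Pmul.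
  apply: closed_sub; last by apply: Pmul => //; apply: closed_sum => j; apply: Pmul.
  apply: closed_sub; last by apply: Pmul => //; do 3!apply: closed_sum => ?; apply: Pmul.
  by apply: Pmul => //; apply: closed_sum => j; apply: Pmul.
apply: closed_sub; last exact: Pmul.
apply: Padd; last by apply: Pmul => //; exact: closed_sub.
apply: Padd; last first.
  apply: Pmul; last by apply: closed_sum => i; exact: Pk.
  by apply: Padd => //; apply: closed_sub; apply: Pmul.
apply: closed_sub; last first.
  by apply: Pmul => //; do 2!apply: closed_sum => ?; apply: Pmul.
apply: closed_sum => j; apply: Pmul => //.
by apply: closed_sub => //; apply: closed_sub => //; apply: Pmul.
Qed.

End JetClosure.

(** * The conservation law in weak form, for a C^2 gauge field *)

Section WeakDivergence.
Variables (R : realType) (n : nat).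
Local Notation Rn := 'rV[R]_n.
Local Notation e_ i := (basis_vec R i).
Local Notation D i f := (fun x => 'D_(basis_vec R i) f x).
Implicit Types (f g phi eta : Rn -> R) (x y z w : Rn) (U V A : set Rn) (k : nat) (i j a b l : 'I_n).
Variables (Lam : (Rn -> R) -> R) (LamP : is_integral Lam).

Lemma CO_current U x0 c (H : 'I_n -> 'I_n -> Rn -> R) v k a : open U ->
  (forall i j, CO U k.+1 (H i j)) -> CO U k.+1 v -> CO U k (current x0 c H v a).
Proof.
move=> oU hH hv.
apply: (@jcur_closed R n Rn (CO U k) _ _ _ (fun b y => (y - x0) 0 b) c H
  (fun b i j => D b (H i j)) v (fun b => D b v)).
- by move=> r; exact: CO_cst.
- by move=> f g; exact: CO_add.
- by move=> f g; exact: CO_mul.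
- move=> i; apply: CO_congr (CO_add oU (CO_coord k i oU) (CO_cst k (- x0 0 i) oU)) => // y _.
  by rewrite !mxE.
- by move=> i j; exact: CO_leS.
- by move=> b i j; exact: CO_D.
- exact: CO_leS.
- by move=> b; exact: CO_D.
Qed.

Lemma CO_zero_ext U A k f : open U -> closed A -> A `<=` U -> CO U k f ->
  (forall x, ~ A x -> f x = 0) -> CO setT k f.
Proof.
move=> oU cA AU hf f0.
have oA : open (~` A) by exact: closed_openC.
have h : CO (~` A) k f by apply: CO_congr (CO_cst k 0 oA) => // x Ax; rewrite f0.
apply: CO_sub (CO_setU hf h) => x _.
by have [/AU|] := pselect (A x); [left|right].
Qed.

Lemma D_zero_out A f i x : closed A -> (forall x, ~ A x -> f x = 0) -> ~ A x -> D i f x = 0.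
Proof.
move=> cA f0 Ax; rewrite -[RHS](derive_cst (0 : R) x (e_ i)).
by apply: (derive_congr _ (closed_openC cA) Ax) => y Ay; rewrite f0.
Qed.

Lemma Lam_sum (F : 'I_n -> Rn -> R) : (forall i, cpt (F i)) ->
  cpt (fun x => \sum_i F i x) /\ Lam (fun x => \sum_i F i x) = \sum_i Lam (F i).
Proof.
move=> h.
have c0 : cpt (fun _ : Rn => 0 : R) by split=> [x|]; [exact: cst_continuous|exists 0%N].
have L0 : Lam (fun=> 0) = 0.
  have e0 : (fun x : Rn => 0 * 0 : R) = fun=> 0 by apply/funext => x; rewrite mul0r.
  by have := intZ LamP 0 c0; rewrite e0 mul0r.
elim: (index_enum _) => [|a r [ih1 ih2]].
  have -> : (fun x => \sum_(i <- [::]) F i x) = fun=> 0 by apply/funext => x; rewrite big_nil.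
  by rewrite big_nil.
have -> : (fun x => \sum_(i <- a :: r) F i x) = fun x => F a x + \sum_(i <- r) F i x.
  by apply/funext => x; rewrite big_cons.
by rewrite big_cons -ih2; split; [exact: cptD|exact: (intD LamP)].
Qed.

(** The gauge-transformed tensor: [H] minus the Lie derivative of the flat metric along [Y]. *)
Definition lie_sub (H : 'I_n -> 'I_n -> Rn -> R) (Y : 'I_n -> Rn -> R) i j x : R :=
  H i j x - (D i (Y j) x + D j (Y i) x).

Lemma CO_lie_sub U H Y k i j : open U -> CO U k (H i j) -> (forall j, CO U k.+1 (Y j)) ->
  CO U k (lie_sub H Y i j).
Proof.
move=> oU hH hY; apply: CO_congr (CO_add oU hH (CO_mul oU (CO_cst k (-1) oU)
  (CO_add oU (CO_D i (hY j)) (CO_D j (hY i))))) => // x _.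
by rewrite mulN1r.
Qed.

Lemma D_lie_sub U H Y b i j x : open U -> U x -> CO U 1 (H i j) -> (forall j, CO U 2 (Y j)) ->
  D b (lie_sub H Y i j) x = D b (H i j) x - (D b (D i (Y j)) x + D b (D j (Y i)) x).
Proof.
move=> oU Ux hH hY.
have h := isD_sub (is_derive_CO b hH Ux)
  (isD_add (is_derive_CO b (CO_D i (hY j)) Ux) (is_derive_CO b (CO_D j (hY i)) Ux)).
exact: (@derive_val _ _ _ _ _ _ _ h).
Qed.

Lemma D2_lie_sub U H Y a b i j x : open U -> U x -> CO U 2 (H i j) -> (forall j, CO U 3 (Y j)) ->
  D a (D b (lie_sub H Y i j)) x =
  D a (D b (H i j)) x - (D a (D b (D i (Y j))) x + D a (D b (D j (Y i))) x).
Proof.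
move=> oU Ux hH hY.
have h := isD_sub (is_derive_CO a (CO_D b hH) Ux)
  (isD_add (is_derive_CO a (CO_D b (CO_D i (hY j))) Ux) (is_derive_CO a (CO_D b (CO_D j (hY i))) Ux)).
rewrite -(@derive_val _ _ _ _ _ _ _ h).
apply: (derive_congr _ oU Ux) => y Uy.
by apply: (D_lie_sub b oU Uy); [exact: CO_leS|move=> m; exact: CO_leS].
Qed.

Variables (U : set Rn) (x0 : Rn) (H : 'I_n -> 'I_n -> Rn -> R) (v : Rn -> R).
Hypotheses (oU : open U) (hH : forall i j, CO U 2 (H i j)) (hv : CO U 2 v).
Hypotheses (Hsym : forall i j y, U y -> H i j y = H j i y).
Hypothesis E1 : forall i j x, U x -> 2^-1 * \sum_l (D l (D i (H j l)) x + D l (D j (H i l)) x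
   - D l (D l (H i j)) x - D j (D i (H l l)) x) = D i (D j v) x.
Hypothesis E2 : forall x, U x -> \sum_i D i (D i v) x = 0.
Let c : R := (n%:R - 2) / 2.

(** Gauge invariance of the linearised Ricci tensor at the flat metric: the third derivatives [t] of
    the field cancel by their symmetry in the three differentiation indices. *)
Let lie_algebra (q' q t : 'I_n -> 'I_n -> 'I_n -> 'I_n -> R) (s : R) i j :
  (forall a b m d, q' a b m d = q a b m d - (t a b m d + t a b d m)) ->
  (forall a b m d, t a b m d = t b a m d) -> (forall a b m d, t a b m d = t a m b d) ->
  2^-1 * \sum_l (q l i j l + q l j i l - q l l i j - q j i l l) = s ->
  2^-1 * \sum_l (q' l i j l + q' l j i l - q' l l i j - q' j i l l) = s.
Proof.
move=> qE s1 s2 <-; congr (_ * _); apply: eq_bigr => l _; rewrite !qE.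
have t1 : t l i j l = t j i l l by rewrite (s2 l i j) (s1 l j i) (s2 j l i).
have t2 : t l j i l = t j i l l by rewrite (s1 l j i) (s2 j l i).
have t3 : t l i l j = t l l i j by rewrite (s2 l i l).
have t4 : t l j l i = t l l j i by rewrite (s2 l j l).
by rewrite t1 t2 t3 t4; ring.
Qed.

Lemma div_current_lie Y x : (forall j, CO U 3 (Y j)) -> U x ->
  \sum_a D a (current x0 c (lie_sub H Y) v a) x = 0.
Proof.
move=> hY Ux.
apply: (@div_current R n U x x0 (lie_sub H Y) v oU Ux) => //.
- by move=> i j; exact: CO_lie_sub.
- by move=> i j y Uy; rewrite /lie_sub (Hsym _ _ Uy) [X in _ - X]addrC.
- move=> i j.
  apply: (@lie_algebra (fun a b m d => D a (D b (lie_sub H Y m d)) x)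
    (fun a b m d => D a (D b (H m d)) x) (fun a b m d => D a (D b (D m (Y d))) x) _ i j) (E1 i j Ux).
  + by move=> a b m d; exact: (D2_lie_sub a b oU Ux (hH m d) hY).
  + by move=> a b m d; exact: (schwarz b a oU Ux (CO_D m (hY d))).
  + move=> a b m d; apply: (derive_congr _ oU Ux) => y Uy.
    exact: (schwarz m b oU Uy (CO_leS (hY d))).
- exact: E2.
Qed.

Section Test.
Variables (A : set Rn) (eta : Rn -> R) (r : nat).
Hypotheses (cA : closed A) (AU : A `<=` U) (Ar : forall x, A x -> `|x| <= r%:R).
Hypotheses (heta : CO setT 1 eta) (eta0 : forall x, ~ A x -> eta x = 0).

Lemma supp_bsupp f : (forall x, ~ A x -> f x = 0) -> bsupp r f.
Proof. by move=> f0 x rx; apply: f0 => /Ar; rewrite leNgt rx. Qed.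

(** For a C^3 field the current is C^1 and divergence-free, so D eta . current is the divergence of
    eta times the current, which extends by zero to a compactly supported C^1 field. *)
Lemma weak_div_smooth Y : (forall j, CO U 3 (Y j)) ->
  Lam (fun x => \sum_a D a eta x * current x0 c (lie_sub H Y) v a x) = 0.
Proof.
move=> hY; set F := current x0 c (lie_sub H Y) v.
have hF a : CO U 1 (F a).
  by apply: CO_current => // i j; apply: CO_lie_sub.
have heF a : CO setT 1 (fun x => eta x * F a x).
  apply: (CO_zero_ext oU cA AU); last by move=> x Ax; rewrite eta0 // mul0r.
  by apply: CO_mul => //; apply: CO_sub heta.
have supp a : exists r, bsupp r (fun x => eta x * F a x).
  by exists r; apply: supp_bsupp => x Ax; rewrite eta0 // mul0r.
have -> : (fun x => \sum_a D a eta x * F a x) = fun x => \sum_a D a (fun x => eta x * F a x) x.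
  apply/funext => x; have [Ax|Ax] := pselect (A x); last first.
    rewrite !big1 // => a _; last by rewrite (D_zero_out a cA) // mul0r.
    by rewrite (D_zero_out a cA) // => y Ay; rewrite eta0 // mul0r.
  have Ux := AU Ax.
  rewrite [RHS](eq_bigr (fun a => D a eta x * F a x + eta x * D a (F a) x)); last first.
    move=> a _; have h := isD_mul (is_derive_CO a heta (I : setT x)) (is_derive_CO a (hF a) Ux).
    exact: (@derive_val _ _ _ _ _ _ _ h).
  by rewrite big_split /= -mulr_sumr div_current_lie // mulr0 addr0.
rewrite (Lam_sum (fun a => cpt_D a (heF a) (supp a))).2 big1 // => a _.
exact: (int_D LamP).
Qed.

Let comp : compact A.
Proof.
apply: (subclosed_compact cA (@compact_ball0 R n r%:R)).
by move=> x /Ar.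
Qed.

(** A sequence with its limit as one function: [Some m] indexes the m-th approximation, [None] the
    limit. [ucv] is uniform convergence on [A] to a bounded limit; the bound makes it stable under
    products, as [jcur_closed] requires. *)
Let T := (option nat * Rn)%type.
Let ucv (f : T -> R) := (exists C : R, forall x, A x -> `|f (None, x)| <= C) /\
  forall e : R, 0 < e -> exists M, forall m, (M <= m)%N -> forall x, A x ->
    `|f (Some m, x) - f (None, x)| <= e.

Let ucv_cst (u : R) : ucv (fun=> u).
Proof. by split=> [|e e0]; [exists (`|u|)|exists 0%N => m _ x _; rewrite subrr normr0 ltW]. Qed.

Let ucv_add (f g : T -> R) : ucv f -> ucv g -> ucv (fun t => f t + g t).
Proof.
move=> [[C1 h1] k1] [[C2 h2] k2]; split.
  by exists (C1 + C2) => x Ax; rewrite (le_trans (ler_normD _ _)) // lerD ?h1 ?h2.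
move=> e e0; have e20 : 0 < e / 2 by rewrite divr_gt0.
have [M1 H1] := k1 _ e20; have [M2 H2] := k2 _ e20.
exists (maxn M1 M2) => m; rewrite geq_max => /andP[m1 m2] x Ax.
rewrite opprD addrACA (le_trans (ler_normD _ _)) // [e]splitr.
by rewrite lerD ?H1 ?H2.
Qed.

Let ucv_mul (f g : T -> R) : ucv f -> ucv g -> ucv (fun t => f t * g t).
Proof.
move=> [[C1 h1] k1] [[C2 h2] k2]; split.
  by exists (C1 * C2) => x Ax; rewrite normrM ler_pM ?h1 ?h2.
move=> e e0.
pose K := `|C1| + `|C2| + 1.
have K0 : 0 < K by rewrite ltr_wpDl // addr_ge0.
have d0 : 0 < Num.min 1 (e / K) by rewrite lt_min ltr01 divr_gt0.
have d1 : Num.min 1 (e / K) <= 1 by rewrite ge_min lexx.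
have d2 : Num.min 1 (e / K) * K <= e by rewrite -ler_pdivlMr // ge_min lexx orbT.
have [M1 H1] := k1 _ d0; have [M2 H2] := k2 _ d0.
exists (maxn M1 M2) => m; rewrite geq_max => /andP[m1 m2] x Ax.
have u1 := H1 m m1 x Ax; have u2 := H2 m m2 x Ax.
have w1 := le_trans (h1 x Ax) (ler_norm C1); have w2 := le_trans (h2 x Ax) (ler_norm C2).
apply: le_trans d2; move: u1 u2 w1 w2 d0 d1; rewrite /K.
move: (f (Some m, x)) (f (None, x)) (g (Some m, x)) (g (None, x)) (Num.min _ _) => f1 f0 g1 g0 d.
move=> u1 u2 w1 w2 d0 d1.
have -> : f1 * g1 - f0 * g0 = (f1 - f0) * (g1 - g0) + ((f1 - f0) * g0 + f0 * (g1 - g0)) by ring.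
have v1 : `|(f1 - f0) * (g1 - g0)| <= d * 1 by rewrite normrM ler_pM // (le_trans u2).
have v2 : `|(f1 - f0) * g0| <= d * `|C2| by rewrite normrM ler_pM.
have v3 : `|f0 * (g1 - g0)| <= `|C1| * d by rewrite normrM ler_pM.
rewrite (le_trans (ler_normD _ _)) // (le_trans (lerD (lexx _) (ler_normD _ _))) //.
by rewrite (le_trans (lerD v1 (lerD v2 v3))) //; lra.
Qed.

Let two_est (d s t s' t' e : R) : `|s' - s| <= e -> `|t' - t| <= e ->
  `|d - (s' + t') - (d - (s + t))| <= 2 * e.
Proof. by rewrite !ler_norml => /andP[? ?] /andP[? ?]; apply/andP; split; lra. Qed.

Let sub_zero (s t : R) : t = 0 -> s - t = s.
Proof. by move=> ->; exact: subr0. Qed.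

(** The current involves only first and second derivatives of [Y], so it depends continuously on [Y]
    in C^2, uniformly on [A]. The identity for the C^3 approximations of [C2_approx] passes to the
    limit, although the limit current is merely continuous. *)
Lemma weak_div_C2 Y : (forall j, CO setT 2 (Y j)) -> (forall j, exists s, bsupp s (Y j)) ->
  Lam (fun x => \sum_a D a eta x * current x0 c (lie_sub H Y) v a x) = 0.
Proof.
move=> hY sY.
have ex (m : nat) j : exists f, [/\ CO setT 3 f,
   forall i x, `|D i f x - D i (Y j) x| <= m.+1%:R^-1
  & forall i b x, `|D b (D i f) x - D b (D i (Y j)) x| <= m.+1%:R^-1].
  have m0 : 0 < m.+1%:R^-1 :> R by rewrite invr_gt0.
  by have [f [f1 f2 f3 f4]] := C2_approx LamP (hY j) (sY j) m0; exists f.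
have /choice[y0 y0P] : forall mj : nat * 'I_n, exists f, [/\ CO setT 3 f,
   forall i x, `|D i f x - D i (Y mj.2) x| <= mj.1.+1%:R^-1
  & forall i b x, `|D b (D i f) x - D b (D i (Y mj.2)) x| <= mj.1.+1%:R^-1].
  by move=> mj; exact: ex.
pose y (m : nat) j := y0 (m, j).
have yP m j := y0P (m, j); rewrite /= in yP.
pose Ys (o : option nat) j := if o is Some m then y m j else Y j.
have small (F : T -> R) (C : R) : (exists C : R, forall x, A x -> `|F (None, x)| <= C) -> 0 <= C ->
   (forall m x, A x -> `|F (Some m, x) - F (None, x)| <= C * m.+1%:R^-1) -> ucv F.
  move=> bF C0 h; split=> // e e0.
  exists (Num.bound (C / e)) => m Mm x Ax; apply: (le_trans (h m x Ax)).
  rewrite ler_pdivrMr // mulrC -ler_pdivrMr //.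
  have := archi_boundP (divr_ge0 C0 (ltW e0)) => /ltW/le_trans; apply.
  by rewrite ler_nat leqW.
have bnd f : CO U 0 f -> exists C : R, forall x, A x -> `|f x| <= C.
  move=> hf; have [C _ hC] := cont_compact_bounded comp (fun x Ax => CO_cont hf (AU Ax)).
  by exists C.
have fixed f : CO U 0 f -> ucv (fun t => f t.2).
  move=> hf; apply: (small _ 0) => //; first exact: bnd.
  by move=> m x Ax; rewrite subrr normr0 mul0r.
have hYU j k : (k <= 2)%N -> CO U k (Y j) by move=> k2; apply: CO_le k2 _; apply: CO_sub (hY j).
have cv a : ucv (fun t => current x0 c (lie_sub H (Ys t.1)) v a t.2).
  apply: (@jcur_closed R n T ucv ucv_cst ucv_add ucv_mul (fun b t => (t.2 - x0) 0 b) c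
    (fun i j t => lie_sub H (Ys t.1) i j t.2) (fun b i j t => D b (lie_sub H (Ys t.1) i j) t.2)
    (fun t => v t.2) (fun b t => D b v t.2)).
  - move=> i; apply: (fixed (fun x => (x - x0) 0 i)).
    apply: CO_congr (CO_add oU (CO_coord 0 i oU) (CO_cst 0 (- x0 0 i) oU)) => // z _.
    by rewrite !mxE.
  - move=> i j; apply: (small _ 2) => //.
      by apply: (bnd (lie_sub H Y i j)); apply: CO_lie_sub => // [|m]; [exact: CO_le (hH i j)|exact: hYU].
    move=> m x Ax /=; rewrite /lie_sub.
    have [_ h1 _] := yP m j; have [_ h2 _] := yP m i.
    exact: two_est (h1 i x) (h2 j x).
  - move=> b i j; apply: (small _ 2) => //.
      apply: (bnd (D b (lie_sub H Y i j))); apply: CO_D; apply: CO_lie_sub => // [|m].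
        exact: CO_le (hH i j).
      exact: hYU.
    move=> m x Ax /=; have Ux := AU Ax.
    have [y1 _ h1] := yP m j; have [y2 _ h2] := yP m i.
    have y3 l : CO U 2 (y m l) by have [h _ _] := yP m l; apply: CO_sub (CO_le _ h).
    rewrite !(D_lie_sub b oU Ux) //; try exact: CO_le (hH i j); last by move=> l; exact: hYU.
    exact: two_est (h1 i b x) (h2 j b x).
  - by apply: (fixed v); exact: CO_le hv.
  - by move=> b; apply: (fixed (D b v)); exact: CO_D (CO_le _ hv).
have De0 a x : ~ A x -> D a eta x = 0 by exact: D_zero_out.
have [Ce Ce0 hCe] : exists2 C : R, 0 <= C & forall a x, `|D a eta x| <= C.
  have /choice[F hF] : forall a, exists C : R, 0 <= C /\ forall x, `|D a eta x| <= C.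
    move=> a; have [C C0 hC] := cpt_bounded (cpt_D a heta (ex_intro _ r (supp_bsupp eta0))).
    by exists C.
  exists (\sum_a F a); first by apply: sumr_ge0 => a _; exact: (hF a).1.
  move=> a x; rewrite (bigD1 a) //= (le_trans ((hF a).2 x)) // lerDl.
  by apply: sumr_ge0 => b _; exact: (hF b).1.
pose Phi (o : option nat) x := \sum_a D a eta x * current x0 c (lie_sub H (Ys o)) v a x.
have Phi0 o x : ~ A x -> Phi o x = 0.
  by move=> Ax; apply: big1 => a _; rewrite De0 // mul0r.
have hPhi o : cpt (Phi o).
  have hYo j : CO U 2 (Ys o j).
    case: o => [m|] /=; last exact: hYU.
    by have [h _ _] := yP m j; apply: CO_sub (CO_le _ h).
  suff h : CO setT 0 (Phi o).
    by split; [move=> x; exact: CO_cont h I|exists r; apply: supp_bsupp => x; exact: Phi0].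
  apply: (CO_zero_ext oU cA AU); last by move=> x; exact: Phi0.
  apply: CO_sum => // a _; apply: CO_mul => //; first exact: CO_sub (CO_D a heta).
  apply: CO_current => //; last exact: CO_le hv.
  by move=> i j; apply: CO_lie_sub => //; exact: CO_le (hH i j).
have zero m : Lam (Phi (Some m)) = 0.
  apply: weak_div_smooth => j; have [h _ _] := yP m j.
  exact: CO_sub h.
apply/eqP; rewrite -normr_le0; apply/ler_addgt0Pr => e e0; rewrite add0r.
pose K := n%:R * Ce * (3 * r.+1)%:R ^+ n + 1.
have K0 : 0 < K by rewrite ltr_wpDl // !mulr_ge0 // exprn_ge0.
have [M hM] : exists M, forall a m, (M <= m)%N -> forall x, A x ->
    `|current x0 c (lie_sub H (Ys (Some m))) v a x - current x0 c (lie_sub H (Ys None)) v a x| <= e / K.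
  have /choice[F hF] : forall a, exists M, forall m, (M <= m)%N -> forall x, A x ->
    `|current x0 c (lie_sub H (Ys (Some m))) v a x - current x0 c (lie_sub H (Ys None)) v a x| <= e / K.
    by move=> a; have [_ /(_ _ (divr_gt0 e0 K0))] := cv a.
  exists (\max_a F a) => a m Fm; apply: hF; apply: leq_trans Fm; exact: leq_bigmax.
have -> : Lam (fun x => \sum_a D a eta x * current x0 c (lie_sub H Y) v a x) =
    Lam (fun x => Phi None x - Phi (Some M) x).
  have h := Lam_sub LamP (hPhi None) (hPhi (Some M)).
  change (Lam (Phi None) = Lam (fun x => Phi None x - Phi (Some M) x)).
  have h2 : Lam (Phi None) - Lam (Phi (Some M)) = Lam (Phi None).
    exact: sub_zero (zero M).
  symmetry; exact: (etrans h h2).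
have b1 x : `|Phi None x - Phi (Some M) x| <= n%:R * Ce * (e / K).
  have [Ax|Ax] := pselect (A x); last first.
    have eK : 0 <= e / K by rewrite divr_ge0 // ltW.
    by rewrite !Phi0 // subrr normr0; apply: mulr_ge0 => //; exact: mulr_ge0.
  rewrite -sumrB (le_trans (ler_norm_sum _ _ _)) // (@le_trans _ _ (\sum_(a < n) Ce * (e / K))) //.
    by apply: ler_sum => a _; rewrite -mulrBr normrM ler_pM // distrC hM.
  by rewrite sumr_const card_ord -[_ *+ n]mulr_natl mulrA.
apply: le_trans (int_bound LamP (r := r.+1) _ _ b1 _) _ => //.
- have -> : (fun x => Phi None x - Phi (Some M) x) = fun x => Phi None x + -1 * Phi (Some M) x.
    by apply/funext => x; rewrite mulN1r.
  by apply: cptD => //; exact: cptZ.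
- apply: (bsupp_le (leqnSn r)); apply: supp_bsupp => x Ax.
  by rewrite !Phi0 // subrr.
- have -> : n%:R * Ce * (e / K) * (3 * r.+1)%:R ^+ n = e * ((K - 1) / K) by rewrite /K; ring.
  by rewrite ler_piMr ?ltW // ltr_pdivrMr // mul1r gtrBl.
Qed.

End Test.
End WeakDivergence.

(** * Step functions and thin layers *)

Section Step.
Variable R : realType.
Implicit Types (t r e : R).

(** A nondecreasing C^3 transition from 0 for t <= 0 to 1 for t >= 1; the inner truncation handles
    the left end, the outer one the right end. *)
Definition step t : R := 1 + -1 * pospow 4 (1 + -1 * pospow 4 t).
Definition dstep t : R := 16 * (pospow 3 (1 + -1 * pospow 4 t) * pospow 3 t).

Lemma is_derive_step t : is_derive t (1 : R) step (dstep t).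
Proof.
have d1 : is_derive t (1 : R) (fun t : R => 1 + -1 * pospow 4 t) (-1 * (4 * pospow 3 t)).
  have h := is_deriveD (is_derive_cst (1 : R) t (1 : R)) (is_deriveZ (-1) (is_derive_pospow 2 t)).
  by apply: (is_derive_eq h); rewrite add0r.
have d2 := is_derive_comp1 (f := fun t : R => 1 + -1 * pospow 4 t) (x := t)
  (is_derive_pospow 2 (1 + -1 * pospow 4 t)) d1.
have h := is_deriveD (is_derive_cst (1 : R) t (1 : R)) (is_deriveZ (-1) d2).
by apply: (is_derive_eq h); rewrite add0r /dstep /GRing.scale /=; ring.
Qed.

Lemma pospow_ge1 k t : 1 <= t -> 1 <= pospow k t.
Proof. by move=> t1; rewrite pospow_pos ?exprn_ege1 // (le_trans ler01). Qed.

Lemma ler_pospow k s t : s <= t -> pospow k s <= pospow k t.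
Proof.
move=> st; rewrite /pospow lerXn2r ?nnegrE //; try by rewrite le_max lexx orbT.
by rewrite ge_max; apply/andP; split; rewrite le_max ?st ?lexx ?orbT.
Qed.

Lemma step0 t : t <= 0 -> step t = 0.
Proof. by move=> t0; rewrite /step (pospow_neg 3 t0) mulr0 addr0 pospow_pos // expr1n mulr1 subrr. Qed.

Lemma step1 t : 1 <= t -> step t = 1.
Proof.
move=> t1; have h := pospow_ge1 4 t1.
by rewrite /step (pospow_neg 3) ?mulr0 ?addr0 // mulN1r subr_le0.
Qed.

Lemma ler_step s t : s <= t -> step s <= step t.
Proof.
move=> st; have h1 := ler_pospow 4 st.
have h2 : pospow 4 (1 + -1 * pospow 4 t) <= pospow 4 (1 + -1 * pospow 4 s).
  by apply: ler_pospow; lra.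
by rewrite /step; lra.
Qed.

Lemma step_ge0 t : 0 <= step t.
Proof.
have [t0|/ltW t0] := leP t 0; first by rewrite step0.
by rewrite -(step0 (lexx 0)); exact: ler_step.
Qed.

Lemma step_le1 t : step t <= 1.
Proof.
have [t1|/ltW t1] := leP 1 t; first by rewrite step1.
by rewrite -(step1 (lexx 1)); exact: ler_step.
Qed.

Lemma dstep_ge0 t : 0 <= dstep t.
Proof. by apply: mulr_ge0 => //; apply: mulr_ge0; exact: pospow_ge0. Qed.

Lemma dstep_le0 t : t <= 0 -> dstep t = 0.
Proof. by move=> t0; rewrite /dstep (pospow_neg 2 t0) !mulr0. Qed.

Lemma dstep_ge1 t : 1 <= t -> dstep t = 0.
Proof.
move=> t1; have h := pospow_ge1 4 t1.
by rewrite /dstep (pospow_neg 2) ?mul0r ?mulr0 // mulN1r subr_le0.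
Qed.

Lemma CO_step n (U : set 'rV[R]_n) k f : open U -> (k < 4)%N -> CO U k f -> CO U k (fun x => step (f x)).
Proof.
move=> oU k4 hf; apply: CO_add => //; first exact: CO_cst.
apply: CO_mul => //; first exact: CO_cst.
apply: CO_pospow => //; apply: CO_add => //; first exact: CO_cst.
by apply: CO_mul; [exact: oU|exact: CO_cst|exact: CO_pospow].
Qed.

(** The transition takes place for r between 1 + e and 1 + 2 e. Keeping it away from r = 1 makes
    products with functions given on the exterior extend by zero across [Sigma]. *)
Definition layer e r : R := step ((r - 1) / e - 1).
Definition dlayer e r : R := dstep ((r - 1) / e - 1) / e.

Lemma is_derive_layer e r : is_derive r (1 : R) (layer e) (dlayer e r).
Proof.
have h : is_derive r (1 : R) (fun r : R => (r - 1) / e - 1) (e^-1).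
  have h1 := is_deriveB (is_derive_id r (1 : R)) (is_derive_cst (1 : R) r (1 : R)).
  have h2 := is_deriveB (is_deriveZ e^-1 h1) (is_derive_cst (1 : R) r (1 : R)).
  rewrite !subr0 in h2.
  have -> : (fun r : R => (r - 1) / e - 1) = e^-1 \*: (id - cst 1) - cst 1.
    by apply/funext => s; rewrite /= [_ / e]mulrC.
  by apply: (is_derive_eq h2); rewrite /GRing.scale /= mulr1.
exact: is_derive_comp1 (is_derive_step _) h.
Qed.

Lemma layer_ge0 e r : 0 <= layer e r. Proof. exact: step_ge0. Qed.
Lemma layer_le1 e r : layer e r <= 1. Proof. exact: step_le1. Qed.

Lemma dlayer_ge0 e r : 0 < e -> 0 <= dlayer e r.
Proof. by move=> e0; rewrite divr_ge0 ?dstep_ge0 // ltW. Qed.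

Lemma layer_in e r : 0 < e -> r <= 1 + e -> layer e r = 0.
Proof. by move=> e0 h; apply: step0; rewrite subr_le0 ler_pdivrMr // mul1r; lra. Qed.

Lemma layer_out e r : 0 < e -> 1 + 2 * e <= r -> layer e r = 1.
Proof. by move=> e0 h; apply: step1; rewrite lerBrDr ler_pdivlMr //; lra. Qed.

Lemma dlayer_in e r : 0 < e -> r <= 1 + e -> dlayer e r = 0.
Proof. by move=> e0 h; rewrite /dlayer dstep_le0 ?mul0r // subr_le0 ler_pdivrMr // mul1r; lra. Qed.

Lemma dlayer_out e r : 0 < e -> 1 + 2 * e <= r -> dlayer e r = 0.
Proof. by move=> e0 h; rewrite /dlayer dstep_ge1 ?mul0r // lerBrDr ler_pdivlMr //; lra. Qed.

Lemma layer_antimono e e' r : 0 < e <= e' -> 1 <= r -> layer e' r <= layer e r.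
Proof.
move=> /andP[e0 ee] r1; apply: ler_step; rewrite lerD2r ler_wpM2l ?subr_ge0 //.
by rewrite lef_pV2 // posrE // (lt_le_trans e0).
Qed.

Lemma CO_layer n (U : set 'rV[R]_n) k e f : open U -> (k < 4)%N -> CO U k f ->
  CO U k (fun x => layer e (f x)).
Proof.
move=> oU k4 hf; apply: CO_step => //.
apply: CO_congr (CO_add oU (CO_mul oU (CO_add oU hf (CO_cst k (-1) oU)) (CO_cst k e^-1 oU))
  (CO_cst k (-1) oU)) => // x _.
Qed.

Lemma CO_dlayer n (U : set 'rV[R]_n) k e f : open U -> (k < 3)%N -> CO U k f ->
  CO U k (fun x => dlayer e (f x)).
Proof.
move=> oU k3 hf.
have h : CO U k (fun x => (f x - 1) / e - 1).
  apply: CO_congr (CO_add oU (CO_mul oU (CO_add oU hf (CO_cst k (-1) oU)) (CO_cst k e^-1 oU))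
    (CO_cst k (-1) oU)) => // x _.
apply: CO_mul => //; last exact: CO_cst.
apply: CO_mul => //; first exact: CO_cst.
apply: CO_mul => //; last exact: CO_pospow.
apply: CO_pospow => //; apply: CO_add => //; first exact: CO_cst.
by apply: CO_mul => //; [exact: CO_cst|apply: CO_pospow => //; exact: ltnW].
Qed.

End Step.

(** * Boundary values from averages over thin layers *)

Section Layer.
Variables (R : realType) (n : nat).
Local Notation Rn := 'rV[R]_n.
Local Notation e_ i := (basis_vec R i).
Local Notation D i f := (fun x => 'D_(basis_vec R i) f x).
Implicit Types (f g phi th : Rn -> R) (x y z w p X Y : Rn) (U V : set Rn) (k : nat) (i j a : 'I_n) (t r e : R).
Variables (Lam : (Rn -> R) -> R) (LamP : is_integral Lam).
Variables (Omega Sigma : set Rn) (x0 : Rn) (rho : Rn -> R).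
Hypotheses (G : gauge Omega Sigma x0 rho) (oOm : open Omega).
Let E := ~` Omega.
Let V0 : set Rn := ~` [set x0].
Let oV : open V0. Proof. exact: open_punctured. Qed.

Lemma radial_derive g x (psi : R -> R) (d : R) : differentiable g x ->
  (forall t, `|t| < 1 -> g (x0 + (1 + t) *: (x - x0)) = psi t) ->
  is_derive (0 : R) 1 psi d -> \sum_a (x - x0) 0 a * D a g x = d.
Proof.
move=> dg gpsi dpsi.
have -> : \sum_a (x - x0) 0 a * D a g x = 'D_(x - x0) g x.
  by rewrite derive_sum_coord //; apply: eq_bigr => a _; rewrite mulrC.
rewrite derive_line -(@derive_val _ _ _ _ _ _ _ dpsi).
have near1 : \forall t \near (0 : R), `|t| < 1.
  by apply/nbhs_ballP; exists 1 => //= z; rewrite -ball_normE /ball_ /= sub0r normrN.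
apply: near_eq_derive; near=> t; rewrite -gpsi; last by near: t; exact: near1.
by congr g; apply/rowP => i; rewrite !mxE; ring.
Unshelve. all: by end_near. Qed.

Definition annulus (r1 r2 : R) : set Rn := [set x | r1 <= rho x <= r2].

Lemma closed_annulus r1 r2 : 1 <= r1 -> closed (annulus r1 r2).
Proof.
move=> r11; have r10 : 0 <= r1 by lra.
have -> : annulus r1 r2 = [set x | E x /\ r1 <= rho x <= r2].
  apply/seteqP; split=> x /= => [/andP[h1 h2]|[_]//]; split; last by rewrite h1.
  by apply/(ext_gauge G); apply: le_trans h1.
rewrite -[X in closed X]setCK; apply: open_closedC; rewrite openE => x /= h.
have [Ox|Ox] := pselect (Omega x).
  by have : nbhs x Omega by [exact: open_nbhs_nbhs]; apply: filterS => y Oy [].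
have rx := (ext_gauge G x).1 Ox; have rx0 : 0 < rho x by lra.
have : rho x < r1 \/ r2 < rho x.
  have [h1|h1] := ltP (rho x) r1; first by left.
  by have [h2|h2] := ltP r2 (rho x); [right|case: h; split=> //; apply/andP].
have key (s : R) : 0 < s -> exists2 d : R, 0 < d & forall y, ball x d y -> `|rho y - rho x| <= s.
  move=> s0; have [d d0 hd] := (cont_epsP _ _).1 (gauge_cont G rx0) s s0.
  by exists d => // y; rewrite -ball_normE /ball_ /= distrC; exact: hd.
case=> hr.
- have s0 : 0 < (r1 - rho x) / 2 by rewrite divr_gt0 // subr_gt0.
  have [d d0 hd] := key _ s0; apply/nbhs_ballP; exists d => // y /hd.
  by rewrite ler_norml => /andP[_ h1] [_ /andP[h2 _]]; lra.
- have s0 : 0 < (rho x - r2) / 2 by rewrite divr_gt0 // subr_gt0.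
  have [d d0 hd] := key _ s0; apply/nbhs_ballP; exists d => // y /hd.
  by rewrite ler_norml => /andP[h1 _] [_ /andP[_ h2]]; lra.
Qed.

Lemma annulus_bounded r2 : exists r : nat, forall x, rho x <= r2 -> `|x| <= r%:R.
Proof.
have [M M0 hM] := gauge_bound G.
exists (Num.bound (`|x0| + M * `|r2|)) => x h2.
have : `|x| <= `|x0| + M * `|r2|.
  rewrite -[x](subrK x0) addrC (le_trans (ler_normD _ _)) // lerD2l (le_trans (hM x)) //.
  by rewrite ler_pM2l // (le_trans h2) // ler_norm.
move/le_trans; apply; apply/ltW/archi_boundP.
by rewrite addr_ge0 // mulr_ge0 // ltW.
Qed.

(** A radial cutoff vanishing from r = 2 on. The exponent exceeds n so that [mass], which for r <= 2
    is (2 - r)^(n+1) ((n + 2) r - n (2 - r)), is positive already at r = 1. *)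
Definition weight r : R := pospow n.+2 (2 + -1 * r).
Definition dweight r : R := - (n.+2%:R * pospow n.+1 (2 + -1 * r)).
(** Minus the divergence of weight(rho) X, as the divergence of X is n and X differentiates rho to
    rho. *)
Definition mass r : R := - (n%:R * weight r + r * dweight r).
Local Notation u := weight.
Local Notation du := dweight.
Local Notation w := mass.

Let is_derive_u r : is_derive r (1 : R) u (du r).
Proof.
have h : is_derive r (1 : R) (fun r : R => 2 + -1 * r) (-1).
  have h1 := is_deriveD (is_derive_cst (2 : R) r (1 : R)) (is_deriveZ (-1) (is_derive_id r (1 : R))).
  by apply: (is_derive_eq h1); rewrite add0r /GRing.scale /= mulr1.
have h2 := is_derive_comp1 (f := fun r : R => 2 + -1 * r) (x := r)
  (is_derive_pospow n (2 + -1 * r)) h.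
by apply: (is_derive_eq h2); rewrite mulrN1.
Qed.

Let u_out r : 2 <= r -> u r = 0.
Proof. by move=> h; rewrite /u pospow_neg // mulN1r subr_le0. Qed.

Let w_out r : 2 <= r -> w r = 0.
Proof. by move=> h; rewrite /w /du u_out // pospow_neg ?mulr0 ?oppr0 ?mulr0 ?addr0 ?oppr0 // mulN1r subr_le0. Qed.

Let wE r : r <= 2 -> w r = (2 - r) ^+ n.+1 * (n.+2%:R * r - n%:R * (2 - r)).
Proof.
move=> h; have h2 : 0 <= 2 + -1 * r by rewrite mulN1r subr_ge0.
rewrite /w /du /u !pospow_pos // exprS !mulN1r; move: ((2 - r) ^+ n.+1) => s; ring.
Qed.

Let w_pos r : 1 <= r < 2 -> 0 < w r.
Proof.
move=> /andP[r1 r2]; rewrite wE; last exact: ltW.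
rewrite mulr_gt0 ?exprn_gt0 ?subr_gt0 //.
have n0 : 0 <= n%:R :> R by [].
rewrite -addn2 natrD; nra.
Qed.

Let w_ge0 r : 1 <= r -> 0 <= w r.
Proof.
by move=> r1; have [r2|r2] := ltP r 2; [rewrite ltW // w_pos // r1|rewrite w_out].
Qed.

Let w_le r : 1 <= r -> w r <= n.+2%:R * 2.
Proof.
move=> r1; have [r2|r2] := ltP r 2; last by rewrite w_out // mulr_ge0.
rewrite wE; last exact: ltW.
have n0 : 0 <= n%:R :> R by [].
have h1 : (2 - r) ^+ n.+1 <= 1 by rewrite exprn_ile1 //; lra.
have h3 : 0 <= (2 - r) ^+ n.+1 by rewrite exprn_ge0 //; lra.
have h2 : 0 <= n.+2%:R * r - n%:R * (2 - r) by rewrite -addn2 natrD; nra.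
apply: (@le_trans _ _ (1 * (n.+2%:R * r - n%:R * (2 - r)))); first by rewrite ler_wpM2r.
by rewrite mul1r -addn2 natrD; nra.
Qed.

Section Field.
Variables (th : Rn -> R).
Hypotheses (hth : CO V0 1 th)
  (thom : forall x t, 0 < t -> V0 x -> th (x0 + t *: (x - x0)) = th x).

Definition shell_flux e x : R := dlayer e (rho x) * (rho x * u (rho x)) * th x.
Definition shell_mass e x : R := layer e (rho x) * w (rho x) * th x.

Local Notation Sf := shell_flux.
Local Notation Wf := shell_mass.

Let CO_u k : (k <= n.+1)%N -> CO V0 k (fun x => u (rho x)).
Proof.
move=> kn; apply: CO_pospow => //.
by apply: CO_add => //; [exact: CO_cst|apply: CO_mul => //; [exact: CO_cst|exact: (gauge_CO G)]].
Qed.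

Let CO_du k : (k <= n)%N -> CO V0 k (fun x => du (rho x)).
Proof.
move=> kn.
have h : CO V0 k (fun x => pospow n.+1 (2 + -1 * rho x)).
  apply: CO_pospow => //.
  by apply: CO_add => //; [exact: CO_cst|apply: CO_mul => //; [exact: CO_cst|exact: (gauge_CO G)]].
apply: (CO_congr oV _ (CO_mul oV (CO_cst k (- n.+2%:R) oV) h)) => x _.
exact: mulNr.
Qed.

Let annV : annulus 1 2 `<=` V0.
Proof. by move=> x /andP[h _]; apply: (gauge_neq G); lra. Qed.

Let not_ann x : ~ annulus 1 2 x -> rho x < 1 \/ 2 < rho x.
Proof.
move=> h; have [h1|h1] := ltP (rho x) 1; first by left.
by have [h2|h2] := ltP 2 (rho x); [right|case: h; rewrite /annulus /= h1].
Qed.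

Let cpt_ann f : CO V0 0 f -> (forall x, ~ annulus 1 2 x -> f x = 0) -> cpt f.
Proof.
move=> hf f0; have h := CO_zero_ext oV (closed_annulus (r2 := 2) (lexx 1)) annV hf f0.
split; first by move=> x; exact: CO_cont h I.
have [r hr] := annulus_bounded 2; exists r => x rx; apply: f0 => /andP[_ /hr].
by rewrite leNgt rx.
Qed.

Let Sf_out e x : 0 < e -> ~ annulus 1 2 x -> Sf e x = 0.
Proof.
move=> e0 /not_ann[h|h]; rewrite /Sf.
  by rewrite dlayer_in ?mul0r //; lra.
by rewrite u_out ?ltW // !mulr0 mul0r.
Qed.

Let Wf_out e x : 0 < e -> ~ annulus 1 2 x -> Wf e x = 0.
Proof.
move=> e0 /not_ann[h|h]; rewrite /Wf.
  by rewrite layer_in ?mul0r //; lra.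
by rewrite w_out ?ltW // !mulr0 mul0r.
Qed.

(** The flux minus the mass is the divergence of layer(rho) weight(rho) th X, because [th] is
    constant along rays. So integrals over a layer that shrinks with e are traded for bulk integrals
    that can be bounded independently of e. *)
Lemma layer_identity e : 0 < e -> [/\ cpt (Sf e), cpt (Wf e) & Lam (Sf e) = Lam (Wf e)].
Proof.
move=> e0.
have hr k : CO V0 k rho by exact: gauge_CO G k.
have cS : cpt (Sf e).
  apply: cpt_ann => [|x]; last exact: Sf_out.
  apply: CO_mul => //; last exact: CO_leS.
  apply: CO_mul => //; first exact: CO_dlayer.
  by apply: CO_mul => //; exact: CO_u.
have cW : cpt (Wf e).
  apply: cpt_ann => [|x]; last exact: Wf_out.
  apply: CO_mul => //; last exact: CO_leS.
  apply: CO_mul => //; first exact: CO_layer.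
  apply: CO_congr (CO_mul oV (CO_cst 0 (-1) oV) (CO_add oV (CO_mul oV (CO_cst 0 n%:R oV) (@CO_u 0 isT))
    (CO_mul oV (hr 0%N) (@CO_du 0 isT)))) => // x _.
  by rewrite mulN1r.
split=> //.
pose g x : R := layer e (rho x) * u (rho x) * th x.
have g_out x : ~ annulus 1 2 x -> g x = 0.
  move=> /not_ann[h|h]; rewrite /g; first by rewrite layer_in ?mul0r //; lra.
  by rewrite u_out ?ltW // !mulr0 mul0r.
have hg : CO V0 1 g.
  apply: CO_mul => //; apply: CO_mul => //; first exact: CO_layer.
  exact: CO_u.
have hX a : CO setT 1 (fun x => (x - x0) 0 a).
  apply: CO_congr (CO_add openT (CO_coord 1 a openT) (CO_cst 1 (- x0 0 a) openT)) => // [|y _].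
    exact: openT.
  by rewrite !mxE.
have cA := closed_annulus (r2 := 2) (lexx 1).
have hgT := CO_zero_ext oV cA annV hg g_out.
have hXg a : CO setT 1 (fun x => (x - x0) 0 a * g x) by apply: CO_mul => //; exact: openT.
have [r hrr] := annulus_bounded 2.
have sXg a : exists s : nat, bsupp s (fun x => (x - x0) 0 a * g x).
  exists r => x rx; rewrite g_out ?mulr0 // => /andP[_ /hrr].
  by rewrite leNgt rx.
have divE x : \sum_a D a (fun x => (x - x0) 0 a * g x) x = Sf e x - Wf e x.
  have [Ax|Ax] := pselect (annulus 1 2 x); last first.
    rewrite Sf_out // Wf_out // subrr big1 // => a _; apply: (D_zero_out a cA) => // y Ay.
    by rewrite g_out // mulr0.
  have Vx := annV Ax; have rx : 0 < rho x by move: Ax => /andP[h _]; lra.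
  have dg : differentiable g x by exact: CO_differentiable oV Vx hg.
  have dX a : is_derive x (e_ a) (fun y => (y - x0) 0 a : R) (1 : R).
    have := isD_sub (is_derive_coord a x (e_ a)) (is_derive_cst (x0 0 a) x (e_ a)).
    rewrite basis_vecE eqxx subr0; congr is_derive.
    by apply/funext => y; rewrite !mxE.
  rewrite (eq_bigr (fun a => g x + (x - x0) 0 a * D a g x)); last first.
    move=> a _; have h := isD_mul (dX a) (is_derive_CO a hg Vx).
    by rewrite (@derive_val _ _ _ _ _ _ _ h) mul1r.
  rewrite big_split /= sumr_const card_ord -mulr_natl.
  have da (s : R -> R) (ds : R) : is_derive (rho x) (1 : R) s ds ->
      is_derive (0 : R) (1 : R) (fun t : R => s ((1 + t) * rho x)) (ds * rho x).
    move=> hs; have d1 : is_derive (0 : R) (1 : R) (fun t : R => (1 + t) * rho x) (rho x).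
      have d0 : is_derive (0 : R) 1 (fun t : R => 1 + t) 1.
        by have := is_deriveD (is_derive_cst (1 : R) (0 : R) 1) (is_derive_id (0 : R) 1); rewrite add0r.
      by have := is_deriveM d0 (is_derive_cst (rho x) (0 : R) 1); rewrite scaler0 add0r /GRing.scale /= mulr1.
    apply: (is_derive_comp1 (g := s)) d1.
    by rewrite addr0 mul1r.
  have dp := is_deriveM (da _ _ (is_derive_layer e (rho x))) (da _ _ (is_derive_u (rho x))).
  have dp2 := is_deriveZ (th x) dp.
  rewrite (radial_derive dg _ dp2) => [|t t1]; last first.
    have t0 : 0 < 1 + t by move: t1; rewrite ltr_norml => /andP[]; lra.
    by rewrite /g (gauge_hom G) // thom //= /GRing.scale /= mulrC.
  by rewrite !addr0 !mul1r /g /Sf /Wf /w /GRing.scale /=; ring.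
apply/eqP; rewrite -subr_eq0 -(Lam_sub LamP) //.
have -> : (fun x => Sf e x - Wf e x) = fun x => \sum_a D a (fun x => (x - x0) 0 a * g x) x.
  by apply/funext => x; rewrite divE.
rewrite (Lam_sum LamP (fun a => cpt_D a (hXg a) (sXg a))).2 big1 // => a _.
exact: (int_D LamP).
Qed.

End Field.

Lemma cpt_dlayer (F : Rn -> R) e : {within E, continuous F} -> 0 < e ->
  cpt (fun x => dlayer e (rho x) * F x).
Proof.
move=> cF e0.
have cA : closed (annulus (1 + e) (1 + 2 * e)) by apply: closed_annulus; lra.
have AE : annulus (1 + e) (1 + 2 * e) `<=` E°.
  by move=> x /andP[h _]; apply/(interior_gauge G); lra.
have out x : ~ annulus (1 + e) (1 + 2 * e) x -> dlayer e (rho x) * F x = 0.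
  move=> h; have [k|k] := leP (rho x) (1 + e); first by rewrite dlayer_in ?mul0r.
  have [k2|k2] := leP (1 + 2 * e) (rho x); first by rewrite dlayer_out ?mul0r.
  by case: h; rewrite /annulus /= (ltW k) (ltW k2).
have hF : CO E° 0 (fun x => dlayer e (rho x) * F x).
  apply: CO_mul; first exact: open_interior.
    have h : CO V0 0 (fun x => dlayer e (rho x)) by apply: CO_dlayer => //; exact: gauge_CO G 0.
    by apply: CO_sub h => x /interior_subset; exact: (ext_neq G).
  by apply: (@UC_CO_interior _ _ E 0 F); exact: UC_0.
have h := CO_zero_ext (@open_interior _ E) cA AE hF out.
split; first by move=> x; exact: CO_cont h I.
have [r hr] := annulus_bounded (1 + 2 * e); exists r => x rx; apply: out => /andP[_ /hr].
by rewrite leNgt rx.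
Qed.

(** If F p > 0, then F is at least c th - s on thin layers, for a bump [th] around p constant along
    rays. By [layer_identity] the layer integral of [th] is bounded below by a mass independent of e
    and that of 1 is bounded above, so for small s the layer integral of F is positive. *)
Lemma layer_vanishing (F : Rn -> R) : {within E, continuous F} ->
  (forall p, Sigma p -> 0 <= F p) ->
  (forall e, 0 < e < 2^-1 -> Lam (fun x => dlayer e (rho x) * F x) = 0) ->
  forall p, Sigma p -> F p = 0.
Proof.
move=> cF F0 LF p Sp; apply: contrapT => /eqP Fp.
have Fp0 : 0 < F p by rewrite lt_neqAle eq_sym Fp F0.
have wF := (withinP _ _).1 cF.
pose c := F p / 2; have c0 : 0 < c by rewrite divr_gt0.
have [d1 d10 h1] := wF p (Sigma_ext G Sp) c c0.
pose d := Num.min d1 1.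
have d0 : 0 < d by rewrite lt_min d10 ltr01.
have dd1 : d <= d1 by rewrite ge_min lexx.
have d_1 : d <= 1 by rewrite ge_min lexx orbT.
pose th x := bump d (prj x0 rho x - p).
have th0 x : 0 <= th x by exact: bump_ge0.
have th1 x : th x <= 1.
  rewrite -[leRHS](expr1n _ 2) -(pospow_pos 2 ler01) ler_pospow //.
  rewrite (@le_trans _ _ (d ^+ 2)) //.
    by rewrite gerBl; apply: sumr_ge0 => i _; exact: sqr_ge0.
  by rewrite expr_le1 // ltW.
have hth : CO V0 1 th.
  apply: (@CO_comp _ _ V0 setT 1 (bump d) (fun x => prj x0 rho x - p) oV openT) => //; first exact: CO_bump.
  move=> j; apply: CO_congr (CO_add oV (CO_prj G 1 j) (CO_cst 1 (- p 0 j) oV)) => // x _.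
  by rewrite !mxE.
have prj_hom x t : 0 < t -> V0 x -> prj x0 rho (x0 + t *: (x - x0)) = prj x0 rho x.
  move=> t0 Vx; have r0 := gauge_gt0 G Vx.
  rewrite /prj /shift_prj (gauge_hom G) //; apply/rowP => i; rewrite !mxE; field.
  by rewrite !gt_eqF.
have thom x t : 0 < t -> V0 x -> th (x0 + t *: (x - x0)) = th x.
  by move=> t0 Vx; rewrite /th prj_hom.
have h1th : CO V0 1 (fun _ : Rn => 1 : R) by exact: CO_cst.
have I1 e (e0 : 0 < e) := layer_identity hth thom e0.
have I2 e (e0 : 0 < e) := layer_identity h1th (fun _ _ _ _ => erefl) e0.
(* [c * th] is a lower bound for [F] on Sigma, hence almost one on thin layers. *)
have onS y : Sigma y -> c * th y <= F y.
  move=> Sy; have [yd|yd] := ltP `|y - p| d.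
    have := h1 y (Sigma_ext G Sy) (lt_le_trans yd dd1); rewrite ler_norml => /andP[k1 _].
    have k2 : c * th y <= c by rewrite ler_piMr // ltW.
    by move: k1 k2; rewrite /c; lra.
  by rewrite /th (prj_id G Sy) bump_out ?mulr0 ?F0 // ltW.
have cth y : V0 y -> {for y, continuous (fun x => c * th x)}.
  by move=> Vy; apply: continuousM; [exact: cst_continuous|exact: CO_cont hth Vy].
have [M M0 hM] := gauge_bound G.
have cS : compact Sigma.
  have [r hr] := annulus_bounded 1.
  have -> : Sigma = annulus 1 1.
    apply/seteqP; split=> x /=; first by move=> /(gauge_on G) h; rewrite /annulus /= h lexx.
    by move=> /andP[k1 k2]; apply/(gauge_on G)/le_anti; rewrite k1 k2.
  apply: (subclosed_compact (closed_annulus (lexx 1)) (@compact_ball0 R n r%:R)).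
  by move=> x /andP[_ /hr].
(* Compactness of [Sigma] gives one radius of validity around all its points; a point of a thin
   shell is within that radius of its radial projection. *)
have thin (s : R) : 0 < s -> exists2 e1 : R, 0 < e1 & forall x, 1 < rho x < 1 + e1 -> c * th x - s <= F x.
  move=> s0.
  have [d2 d20 h2] : exists2 d2 : R, 0 < d2 & forall y, Sigma y ->
      forall x, E x -> `|x - y| < d2 -> c * th x - s <= F x.
    apply: (@compact_unif _ _ Sigma (fun y d2 => forall x, E x -> `|x - y| < d2 -> c * th x - s <= F x)) => //.
      by move=> y a b /andP[_ ba] h x Ex xy; apply: h => //; exact: lt_le_trans xy ba.
    move=> y Sy; have s20 : 0 < s / 2 by rewrite divr_gt0.
    have [a a0 ha] := wF y (Sigma_ext G Sy) _ s20.
    have [b b0 hb] := (cont_epsP _ _).1 (cth y (Sigma_neq G Sy)) _ s20.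
    have m0 : 0 < Num.min a b by rewrite lt_min a0.
    exists (Num.min a b / 2); first by rewrite divr_gt0.
    move=> y' yy' Sy' x Ex xy'.
    have : `|x - y| < Num.min a b.
      have -> : x - y = (x - y') + (y' - y) by rewrite addrA subrK.
      by rewrite (le_lt_trans (ler_normD _ _)) // [ltRHS]splitr ltrD.
    rewrite lt_min => /andP[xa xb].
    have := ha x Ex xa; have := hb x xb; rewrite !ler_norml => /andP[_ k1] /andP[k2 _].
    by have := onS y Sy; lra.
  exists (d2 / (M * 2)); first by rewrite divr_gt0 // mulr_gt0.
  move=> x /andP[x1 x2]; have Vx : V0 x by apply: (gauge_neq G); lra.
  have rx := gauge_gt0 G Vx.
  apply: (h2 (prj x0 rho x)); first exact: (Sigma_prj G).
    by apply/(ext_gauge G); exact: ltW.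
  have -> : x - prj x0 rho x = (rho x - 1) *: (prj x0 rho x - x0).
    by rewrite /prj /shift_prj; apply/rowP => i; rewrite !mxE; field; rewrite gt_eqF.
  rewrite normrZ gtr0_norm ?subr_gt0 //.
  have k : `|prj x0 rho x - x0| <= M.
    by have := hM (prj x0 rho x); rewrite (gauge_shift_prj G) // mulr1.
  have k2 : rho x - 1 < d2 / (M * 2) by lra.
  apply: (@le_lt_trans _ _ (d2 / (M * 2) * M)).
    by rewrite ler_pM ?subr_ge0 // ltW.
  by have -> : d2 / (M * 2) * M = d2 / 2 by [field; rewrite gt_eqF]; lra.
(* For e <= 1/8 the layer ends at or below rho = 5/4, short of the level 3/2 where the point [x1]
   witnesses a positive mass. *)
pose e8 : R := 8^-1.
have e80 : 0 < e8 by rewrite invr_gt0.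
pose c0' := Lam (shell_mass th e8).
have c0'0 : 0 < c0'.
  have [_ cW _] := I1 _ e80.
  pose x1 := x0 + (3 / 2) *: (p - x0).
  have t32 : (0 : R) < 3 / 2 by [].
  have r1 : rho x1 = 3 / 2 by rewrite (gauge_hom G) // ((gauge_on G p).1 Sp) mulr1.
  apply: (int_pos LamP (p := x1) cW) => [x|].
    have [h|h] := leP 1 (rho x); last by rewrite /shell_mass layer_in ?mul0r //; lra.
    by apply: mulr_ge0 => //; apply: mulr_ge0; [exact: layer_ge0|exact: w_ge0].
  rewrite /shell_mass r1 layer_out // ?mul1r; last by rewrite /e8; lra.
  rewrite mulr_gt0 //; first by apply: w_pos; apply/andP; split; lra.
  rewrite /x1 thom //; last exact: (Sigma_neq G).
  by rewrite /th (prj_id G Sp) subrr bump0.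
have [rr hrr] := annulus_bounded 2.
pose C1 : R := n.+2%:R * 2 * (3 * rr.+1)%:R ^+ n.
have C10 : 0 <= C1 by rewrite !mulr_ge0 // exprn_ge0.
have up e : 0 < e -> Lam (shell_mass (fun=> 1) e) <= C1.
  move=> e0; have [_ cW _] := I2 _ e0.
  apply: le_trans (ler_norm _) _; apply: (int_bound LamP) => // x.
    have [h|h] := leP 1 (rho x); last by rewrite /shell_mass layer_in ?mul0r ?normr0 ?mulr_ge0 //; lra.
    rewrite /shell_mass mulr1 ger0_norm ?mulr_ge0 ?layer_ge0 ?w_ge0 //.
    by rewrite -[leRHS]mul1r ler_pM ?layer_ge0 ?w_ge0 ?layer_le1 ?w_le.
  move=> rx; rewrite /shell_mass w_out ?mulr0 ?mul0r //.
  rewrite leNgt; apply/negP => /ltW /hrr; rewrite leNgt => /negP; apply.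
  by apply: lt_trans rx; rewrite ltr_nat.
have low e : 0 < e <= e8 -> c0' <= Lam (shell_mass th e).
  move=> /andP[e0 ee]; have [_ cW _] := I1 _ e0; have [_ cW8 _] := I1 _ e80.
  apply: (int_le LamP) => // x.
  have [h|h] := leP 1 (rho x).
    by rewrite /shell_mass !ler_wpM2r ?w_ge0 ?layer_antimono // e0.
  by rewrite /shell_mass !layer_in ?mul0r //; lra.
(* The value of [weight] at 3/2, a lower bound for it on every layer considered. *)
pose ka : R := 2^-1 ^+ n.+2.
have ka0 : 0 < ka by rewrite exprn_gt0 // invr_gt0.
have C11 : 0 < C1 + 1 by rewrite ltr_wpDl.
(* The total error is to be half of the main term. In the main term c is halved because rho times
   [weight] is at most 2 on the layers. *)
have [s [s0 sE]] : exists s : R, 0 < s /\ s / ka * (C1 + 1) = c / 2 * c0' / 2.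
  exists (ka * (c / 2) * c0' / (C1 + 1) / 2); split; last by field; rewrite !gt_eqF.
  apply: divr_gt0 => //; apply: divr_gt0 => //; apply: mulr_gt0 => //; apply: mulr_gt0 => //.
  exact: divr_gt0.
have sk : 0 < s / ka by exact: divr_gt0.
have [e1 e10 he1] := thin s s0.
pose e := Num.min e1 e8 / 4.
have m0 : 0 < Num.min e1 e8 by rewrite lt_min e10.
have m1 : Num.min e1 e8 <= e1 by rewrite ge_min lexx.
have m8 : Num.min e1 e8 <= e8 by rewrite ge_min lexx orbT.
have e0 : 0 < e by rewrite divr_gt0.
have ee1 : 2 * e < e1 by rewrite /e; lra.
have ee8 : e <= e8 by rewrite /e; lra.
have e2 : 0 < e < 2^-1 by rewrite e0 /=; move: ee8; rewrite /e8; lra.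
have [cS1 _ L1] := I1 _ e0; have [cS2 _ L2] := I2 _ e0.
have cFl := cpt_dlayer cF e0.
have main : c / 2 * Lam (shell_flux th e) - s / ka * Lam (shell_flux (fun=> 1) e) <= 0.
  rewrite -(LF e e2) -(intZ LamP (c / 2) cS1) -(intZ LamP (s / ka) cS2) -(Lam_sub LamP); try exact: cptZ.
  have cc : cpt (fun x => c / 2 * shell_flux th e x - s / ka * shell_flux (fun=> 1) e x).
    have -> : (fun x => c / 2 * shell_flux th e x - s / ka * shell_flux (fun=> 1) e x) =
      fun x => c / 2 * shell_flux th e x + - (s / ka) * shell_flux (fun=> 1) e x.
      by apply/funext => x; rewrite mulNr.
    by apply: cptD; exact: cptZ.
  apply: (int_le LamP) => // x.
  rewrite /shell_flux mulr1.
  have [k|k] := leP (rho x) (1 + e); first by rewrite dlayer_in // !mul0r !mulr0 subrr.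
  have [k2|k2] := leP (1 + 2 * e) (rho x); first by rewrite dlayer_out // !mul0r !mulr0 subrr.
  have x1 : 1 < rho x < 1 + e1 by apply/andP; split; lra.
  have Fx := he1 x x1.
  have ru : rho x <= 3 / 2 by move: ee8; rewrite /e8; lra.
  have u1 : weight (rho x) <= 1.
    by rewrite -[leRHS](expr1n _ n.+2) -(pospow_pos n.+2 ler01) ler_pospow //; lra.
  have u2 : ka <= weight (rho x).
    have h2 : (0 : R) <= 2^-1 by rewrite invr_ge0.
    by rewrite /ka -(pospow_pos n.+2 h2) ler_pospow //; lra.
  have ru2 : rho x * weight (rho x) <= 2.
    have : rho x * weight (rho x) <= 3 / 2 * weight (rho x).
      by rewrite ler_wpM2r // (le_trans (ltW ka0)).
    by move: u1; lra.
  have ru3 : ka <= rho x * weight (rho x).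
    by rewrite -[leLHS]mul1r ler_pM ?(ltW ka0) //; lra.
  have k3 : c / 2 * (rho x * weight (rho x) * th x) <= c * th x.
    have -> : c / 2 * (rho x * weight (rho x) * th x) = (c * th x) * ((rho x * weight (rho x)) / 2) by ring.
    rewrite ler_piMr //; first by apply: mulr_ge0 => //; exact: ltW.
    by rewrite ler_pdivrMr // mul1r.
  have k4 : s <= s / ka * (rho x * weight (rho x)).
    apply: (@le_trans _ _ (s / ka * ka)); first by rewrite divfK // gt_eqF.
    by rewrite ler_pM2l.
  have -> : c / 2 * (dlayer e (rho x) * (rho x * weight (rho x)) * th x) -
     s / ka * (dlayer e (rho x) * (rho x * weight (rho x))) =
     dlayer e (rho x) * (c / 2 * (rho x * weight (rho x) * th x) - s / ka * (rho x * weight (rho x))) by ring.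
  rewrite ler_wpM2l ?dlayer_ge0 //; apply: le_trans Fx; lra.
move: main; rewrite L1 L2.
have k1 := low e ltac:(by rewrite e0); have k2 := up e e0.
have k3 : c / 2 * c0' <= c / 2 * Lam (shell_mass th e) by rewrite ler_pM2l // divr_gt0.
have k4 : s / ka * Lam (shell_mass (fun=> 1) e) <= s / ka * (C1 + 1).
  by rewrite ler_pM2l //; apply: le_trans k2 _; rewrite lerDl.
have k6 : 0 < c / 2 * c0' by rewrite mulr_gt0 // divr_gt0.
by move: k3 k4 k6; rewrite sE; lra.
Qed.

End Layer.

(** * Decay of the current *)

Section Growth.
Variables (R : realType) (n : nat).
Local Notation Rn := 'rV[R]_n.
Implicit Types (f g : Rn -> R) (x y : Rn) (i j a b : 'I_n) (d s : R).
Variable E : set Rn.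

Definition growth d f := exists2 K : R, 0 <= K & forall x, E x -> `|f x| <= K * (1 + enorm x) `^ d.

Lemma enorm_ge0 x : 0 <= enorm x. Proof. exact: sqrtr_ge0. Qed.

Let pos x : 0 < 1 + enorm x. Proof. by rewrite ltr_wpDr ?enorm_ge0. Qed.

Lemma growth_add d f g : growth d f -> growth d g -> growth d (fun x => f x + g x).
Proof.
move=> [K1 K10 h1] [K2 K20 h2]; exists (K1 + K2); first exact: addr_ge0.
by move=> x Ex; rewrite mulrDl (le_trans (ler_normD _ _)) // lerD ?h1 ?h2.
Qed.

Lemma growth_mul d s f g : growth d f -> growth s g -> growth (d + s) (fun x => f x * g x).
Proof.
move=> [K1 K10 h1] [K2 K20 h2]; exists (K1 * K2); first exact: mulr_ge0.
move=> x Ex; rewrite powRD; last by apply/implyP => _; rewrite gt_eqF ?pos.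
by rewrite mulrACA normrM ler_pM ?h1 ?h2.
Qed.

Lemma growth_scale d f (c : R) : growth d f -> growth d (fun x => c * f x).
Proof.
move=> [K K0 h]; exists (`|c| * K); first exact: mulr_ge0.
by move=> x Ex; rewrite normrM -mulrA ler_wpM2l // h.
Qed.

Lemma growth_sub d f g : growth d f -> growth d g -> growth d (fun x => f x - g x).
Proof.
move=> [K1 K10 h1] [K2 K20 h2]; exists (K1 + K2); first exact: addr_ge0.
by move=> x Ex; rewrite mulrDl (le_trans (ler_normB _ _)) // lerD ?h1 ?h2.
Qed.

Lemma growth_sum d (F : 'I_n -> Rn -> R) : (forall i, growth d (F i)) ->
  growth d (fun x => \sum_i F i x).
Proof.
move=> h; elim: (index_enum _) => [|a r ih].
  by exists 0 => // x _; rewrite big_nil normr0 mul0r.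
have [K K0 hK] := growth_add (h a) ih; exists K => // x Ex.
by rewrite big_cons hK.
Qed.

Lemma growth_eq d s f : growth d f -> d = s -> growth s f.
Proof. by move=> h <-. Qed.

Lemma normr_coord_enorm x i : `|x 0 i| <= enorm x.
Proof.
rewrite -sqrtr_sqr ler_wsqrtr // (bigD1 i) //= lerDl.
by apply: sumr_ge0 => j _; exact: sqr_ge0.
Qed.

Lemma growth_coord (x0 : Rn) i : growth 1 (fun x => (x - x0) 0 i).
Proof.
exists (1 + `|x0 0 i|); first by rewrite addr_ge0.
move=> x _; rewrite powRr1 ?(ltW (pos x)) // !mxE (le_trans (ler_normB _ _)) //.
have := normr_coord_enorm x i; have := enorm_ge0 x; have := normr_ge0 (x0 0 i); nra.
Qed.

Variables (q c : R) (x0 : Rn) (h : 'I_n -> 'I_n -> Rn -> R) (p : 'I_n -> 'I_n -> 'I_n -> Rn -> R).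
Variables (v : Rn -> R) (V : 'I_n -> Rn -> R).
Hypotheses (gh : forall i j, growth (- q) (h i j)) (gp : forall a i j, growth (- 1 - q) (p a i j)).
Hypotheses (gv : growth (- q) v) (gV : forall a, growth (- 1 - q) (V a)).

(** A factor X costs one power and each derivative gains one, so the variations of h and v decay
    like h and v. Every term of the current is thus a derivative times an undifferentiated quantity
    in decay, and X times the Lagrangian has order 1 - 2 - 2 q. *)
Lemma growth_jcur a : growth (- 1 - 2 * q) (fun x => jcur (fun b => (x - x0) 0 b) c
  (fun i j => h i j x) (fun b i j => p b i j x) (v x) (fun b => V b x) a).
Proof.
pose pp x b i j := p b i j x.
have gdiv j : growth (- 1 - q) (fun x => jdiv (pp x) j).
  by apply: (@growth_sum _ (fun i x => p i i j x)) => i.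
have gtr j : growth (- 1 - q) (fun x => jtr (pp x) j).
  by apply: (@growth_sum _ (fun i x => p j i i x)) => i.
have gk i j : growth (- q) (fun x => jk (fun b => (x - x0) 0 b) c (fun i j => h i j x) (pp x) i j).
  apply: growth_add; last exact: growth_scale.
  apply: growth_sum => b; apply: growth_eq (growth_mul (growth_coord x0 b) (gp b i j)) _.
  by ring.
have gw : growth (- q) (fun x => jw (fun b => (x - x0) 0 b) c (v x) (fun b => V b x)).
  apply: growth_add; last exact: growth_scale.
  apply: growth_sum => b; apply: growth_eq (growth_mul (growth_coord x0 b) (gV b)) _.
  by ring.
have e2 : - 1 - q + (- 1 - q) = - 2 - 2 * q by ring.
have sq f g : growth (- 1 - q) f -> growth (- 1 - q) g -> growth (- 2 - 2 * q) (fun x => f x * g x).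
  by move=> hf hg; apply: growth_eq (growth_mul hf hg) e2.
have gl : growth (- 2 - 2 * q) (fun x => jlag (pp x) (fun b => V b x)).
  apply: growth_add; last by apply: growth_sum => j; exact: sq.
  apply: growth_sub; last by apply: growth_sum => j; exact: sq.
  apply: growth_add; last by apply: growth_scale; apply: growth_sum => j; exact: sq.
  apply: growth_sub; last by apply: growth_scale; apply: growth_sum => j; exact: sq.
  apply: growth_sub; last first.
    apply: growth_scale; apply: growth_sum => b; apply: growth_sum => i; apply: growth_sum => j.
    by apply: sq; exact: gp.
  by apply: growth_scale; apply: growth_sum => j; exact: sq.
have e3 : - 1 - q - q = - 1 - 2 * q by ring.
have pr f g : growth (- 1 - q) f -> growth (- q) g -> growth (- 1 - 2 * q) (fun x => f x * g x).
  by move=> hf hg; apply: growth_eq (growth_mul hf hg) e3.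
apply: growth_sub; last first.
  by apply: growth_eq (growth_mul (growth_coord x0 a) gl) _; ring.
apply: growth_add; last by apply: pr => //; exact: growth_sub.
apply: growth_add; last first.
  apply: pr; last by apply: growth_sum => i; exact: gk.
  by apply: growth_add => //; apply: growth_sub; exact: growth_scale.
apply: growth_sub; last first.
  apply: growth_scale; apply: growth_sum => i; apply: growth_sum => j.
  by apply: pr; [exact: gp|exact: gk].
apply: growth_sum => j; apply: pr => //.
by apply: growth_sub => //; apply: growth_sub => //; exact: growth_scale.
Qed.

End Growth.

(** * Cutoff functions at infinity *)

Section Cutoff.
Variables (R : realType) (n : nat).
Local Notation Rn := 'rV[R]_n.
Local Notation e_ i := (basis_vec R i).
Local Notation D i f := (fun x => 'D_(basis_vec R i) f x).
Implicit Types (f g : Rn -> R) (x y : Rn) (i j a b : 'I_n) (m : nat).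

Let sq x : R := \sum_i x 0 i * x 0 i.

Let enorm_sq x : enorm x ^+ 2 = sq x.
Proof.
rewrite sqr_sqrtr; first by apply: eq_bigr => i _; rewrite expr2.
by apply: sumr_ge0 => i _; exact: sqr_ge0.
Qed.

(** The squared Euclidean length keeps the cutoff differentiable at the origin. It equals 1 up to
    length m and 0 once the squared length reaches 2 m^2. *)
Definition cutoff m x : R := 1 + -1 * step ((m%:R ^+ 2)^-1 * sq x + -1).

Let CO_sq k : CO setT k sq.
Proof.
by apply: CO_sum => [|i _]; [exact: openT|apply: CO_mul; [exact: openT|exact/CO_coord/openT|exact/CO_coord/openT]].
Qed.

Let oT : open (setT : set Rn). Proof. exact: openT. Qed.

Lemma CO_cutoff m : CO setT 1 (cutoff m).
Proof.
apply: CO_add => //; first exact: CO_cst.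
apply: CO_mul => //; first exact: CO_cst.
apply: CO_step => //; apply: CO_add => //; last exact: CO_cst.
by apply: CO_mul => //; exact: CO_cst.
Qed.

Lemma cutoff_in m x : (0 < m)%N -> enorm x <= m%:R -> cutoff m x = 1.
Proof.
move=> m0 h; have mp : 0 < m%:R ^+ 2 :> R by rewrite exprn_gt0 // ltr0n.
rewrite /cutoff step0 ?mulr0 ?addr0 // subr_le0 mulrC ler_pdivrMr // mul1r -enorm_sq.
by rewrite lerXn2r ?nnegrE ?enorm_ge0.
Qed.

Lemma cutoff_out m x : (0 < m)%N -> (2 * m)%:R < `|x| -> cutoff m x = 0.
Proof.
move=> m0 h; have mp : 0 < m%:R ^+ 2 :> R by rewrite exprn_gt0 // ltr0n.
rewrite /cutoff step1 ?mulr1 ?subrr // lerBrDr mulrC ler_pdivlMr // -enorm_sq.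
have : (2 * m)%:R < enorm x.
  apply: lt_le_trans h _; apply: norm_rV_le; first exact: enorm_ge0.
  by move=> i; exact: normr_coord_enorm.
rewrite natrM => h2.
have m1 : 0 < m%:R :> R by rewrite ltr0n.
have : (2 * m%:R) ^+ 2 <= enorm x ^+ 2 by rewrite lerXn2r ?nnegrE ?enorm_ge0 ?mulr_ge0 // ltW.
by rewrite exprMn; lra.
Qed.

Let dstep_le (t : R) : dstep t <= 16.
Proof.
have [t0|/ltW t0] := leP t 0; first by rewrite dstep_le0.
have [t1|/ltW t1] := leP 1 t; first by rewrite dstep_ge1.
have h1 : pospow 3 t <= 1 by rewrite pospow_pos // exprn_ile1.
have h2 : pospow 3 (1 + -1 * pospow 4 t) <= 1.
  have h4 : 0 <= pospow 4 t <= 1 by rewrite pospow_ge0 pospow_pos // exprn_ile1.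
  have h5 : 0 <= 1 + -1 * pospow 4 t <= 1 by move: h4 => /andP[? ?]; apply/andP; split; lra.
  by move: h5 => /andP[? ?]; rewrite pospow_pos // exprn_ile1.
rewrite /dstep -[leRHS]mulr1 ler_pM2l //.
by rewrite -[leRHS]mulr1 ler_pM ?pospow_ge0.
Qed.

(** The constant is 16, a bound for [dstep], times 2 |x_a| / m^2 with |x_a| <= 2 m where the
    derivative does not vanish. *)
Lemma D_cutoff_bound m a x : (0 < m)%N -> `|D a (cutoff m) x| <= 64 / m%:R.
Proof.
move=> m0; have m1 : 0 < m%:R :> R by rewrite ltr0n.
have mp : 0 < m%:R ^+ 2 :> R by rewrite exprn_gt0.
have dsq : is_derive x (e_ a) sq (2 * x 0 a).
  have h := isD_sum (fun i => isD_mul (is_derive_coord i x (e_ a)) (is_derive_coord i x (e_ a))).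
  apply: (is_derive_eq h); rewrite big_split /= (eq_bigr (fun i => x 0 i * (e_ a) 0 i)); last first.
    by move=> i _; rewrite mulrC.
  by rewrite (sum_basis_vec (fun i => x 0 i)); ring.
have d1 := isD_add (isD_scale (m%:R ^+ 2)^-1 dsq) (is_derive_cst (-1 : R) x (e_ a)).
set t := (m%:R ^+ 2)^-1 * sq x + -1.
have d2 := is_derive_comp1 (f := fun x => (m%:R ^+ 2)^-1 * sq x + -1) (x := x) (is_derive_step t) d1.
have d3 := isD_add (is_derive_cst (1 : R) x (e_ a)) (isD_scale (-1) d2).
have -> : D a (cutoff m) x = dstep t * ((m%:R ^+ 2)^-1 * (2 * x 0 a)) * -1.
  by rewrite (@derive_val _ _ _ _ _ _ _ d3); ring.
rewrite normrM normrN1 mulr1 normrM ger0_norm ?dstep_ge0 //.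
have [t1|t1] := leP 1 t; first by rewrite dstep_ge1 // mul0r divr_ge0 // ltW.
have xa : `|x 0 a| <= 2 * m%:R.
  apply: le_trans (normr_coord_enorm x a) _.
  rewrite -(@ler_pXn2r _ 2) ?nnegrE ?enorm_ge0 ?mulr_ge0 // enorm_sq exprMn.
  move: t1; rewrite /t mulrC ltrBlDr ltr_pdivrMr // => h; apply: ltW.
  by apply: (lt_le_trans h); rewrite ler_pM2r //; lra.
have -> : 64 / m%:R = 16 * ((m%:R ^+ 2)^-1 * (2 * (2 * m%:R))) :> R by field; rewrite gt_eqF.
rewrite ler_pM ?dstep_ge0 //.
have mi : 0 < (m%:R ^+ 2)^-1 :> R by rewrite invr_gt0.
by rewrite normrM (gtr0_norm mi) ler_pM2l // normrM ger0_norm // ler_pM2l.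
Qed.

End Cutoff.

(** * Vanishing of the flux through every thin layer *)

Section Flux.
Variables (R : realType) (n : nat).
Local Notation Rn := 'rV[R]_n.
Local Notation e_ i := (basis_vec R i).
Local Notation D i f := (fun x => 'D_(basis_vec R i) f x).
Implicit Types (f g phi eta : Rn -> R) (x y z w : Rn) (U V A : set Rn) (k : nat) (i j a b l : 'I_n).
Variables (Lam : (Rn -> R) -> R) (LamP : is_integral Lam).
Variables (Omega Sigma : set Rn) (x0 : Rn) (rho : Rn -> R).
Hypotheses (G : gauge Omega Sigma x0 rho) (oOm : open Omega).
Let E := ~` Omega.
Let V0 : set Rn := ~` [set x0].
Let oV : open V0. Proof. exact: open_punctured. Qed.
Let oE : open E°. Proof. exact: open_interior. Qed.
Let c : R := (n%:R - 2) / 2.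

Variables (H : 'I_n -> 'I_n -> Rn -> R) (v : Rn -> R) (Z : 'I_n -> Rn -> R) (q : R).
Hypotheses (hH : forall i j, UC E 2 (H i j)) (hv : UC E 2 v) (hZ : forall j, UC E 2 (Z j)).
Hypotheses (Hsym : forall i j y, E y -> H i j y = H j i y).
Hypothesis E1 : forall i j x, E° x -> 2^-1 * \sum_l (D l (D i (H j l)) x + D l (D j (H i l)) x
   - D l (D l (H i j)) x - D j (D i (H l l)) x) = D i (D j v) x.
Hypothesis E2 : forall x, E° x -> \sum_i D i (D i v) x = 0.
Hypotheses (q00 : 0 < q) (q1 : c < q) (gh : forall i j, growth E (- q) (H i j))
  (gp : forall a i j, growth E (- 1 - q) (pd E a (H i j)))
  (gv : growth E (- q) v) (gV : forall a, growth E (- 1 - q) (pd E a v)).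

Let jcur_ext (X : 'I_n -> R) (d : R) (h h' : 'I_n -> 'I_n -> R) p p' (s : R) (W W' : 'I_n -> R) a :
  (forall i j, h i j = h' i j) -> (forall b i j, p b i j = p' b i j) -> (forall b, W b = W' b) ->
  jcur X d h p s W a = jcur X d h' p' s W' a.
Proof.
move=> e1 e2 e3.
have -> : h = h' by apply/funext => i; apply/funext => j.
have -> : p = p' by apply/funext => b; apply/funext => i; apply/funext => j.
by have -> : W = W' by apply/funext => b.
Qed.

Definition reduced i j x : R := H i j x - (pd E i (Z j) x + pd E j (Z i) x).

Definition reduced_current a x : R := jcur (fun b => (x - x0) 0 b) c (fun i j => reduced i j x)
  (fun b i j => pd E b (reduced i j) x) (v x) (fun b => pd E b v x) a.

Lemma closed_exterior (r1 : R) : 1 <= r1 -> closed [set x | r1 <= rho x].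
Proof.
move=> r11; rewrite -[X in closed X]setCK; apply: open_closedC; rewrite openE => x /= /negP; rewrite -ltNge => h.
have [Ox|Ox] := pselect (Omega x).
  have : nbhs x Omega by exact: open_nbhs_nbhs.
  by apply: filterS => y /(gauge_in G) Oy /=; apply/negP; rewrite -ltNge; lra.
have rx := (ext_gauge G x).1 Ox; have rx0 : 0 < rho x by lra.
have s0 : 0 < (r1 - rho x) / 2 by rewrite divr_gt0 // subr_gt0.
have [d d0 hd] := (cont_epsP _ _).1 (gauge_cont G rx0) _ s0.
apply/nbhs_ballP; exists d => // y; rewrite -ball_normE /ball_ /= distrC => /hd.
by rewrite ler_norml => /andP[_ h1]; apply/negP; rewrite -ltNge; lra.
Qed.

Lemma UC_reduced i j : UC E 1 (reduced i j).
Proof.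
have reg := exterior_regular G.
apply: (@UC_congr _ _ _ reg 1 (fun x => H i j x + -1 * (pd E i (Z j) x + pd E j (Z i) x))).
  by move=> x _; rewrite mulN1r.
apply: UC_add => //; first exact: UC_leS.
apply: UC_mul => //; first exact: UC_cst.
by apply: UC_add => //; exact: UC_pd.
Qed.

Let open_enorm m : open [set y : Rn | enorm y < m%:R].
Proof.
have -> : [set y : Rn | enorm y < m%:R] = (@enorm R n) @^-1` [set t : R | t < m%:R] by [].
apply: open_comp; last exact: open_lt.
move=> y _; apply: (continuous_comp (f := fun y : Rn => \sum_i y 0 i ^+ 2)).
  have h : CO setT 0 (fun y : Rn => \sum_i y 0 i * y 0 i).
    apply: CO_sum => [|i _]; first exact: openT.
    by apply: CO_mul; [exact: openT|exact/CO_coord/openT|exact/CO_coord/openT].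
  apply: (cont_congr openT I _ (CO_cont h I)) => z _.
  by apply: eq_bigr => i _; rewrite expr2.
exact: sqrt_continuous.
Qed.

Lemma within_reduced_current a : {within E, continuous (reduced_current a)}.
Proof.
have reg := exterior_regular G.
apply: (@jcur_closed R n Rn (fun f => {within E, continuous f}) _ _ _ (fun b x => (x - x0) 0 b) c
  (fun i j x => reduced i j x) (fun b i j x => pd E b (reduced i j) x) v (fun b x => pd E b v x)).
- by move=> d; exact: within_cst.
- by move=> f g; exact: within_add.
- by move=> f g; exact: within_mul.
- move=> i; apply: (@within_congr _ _ _ (fun x => x 0 i + - x0 0 i)); first by move=> x _; rewrite !mxE.
  apply: within_add; last exact: within_cst.
  by apply: continuous_subspaceT => x; exact: CO_cont (CO_coord 0 i openT) I.
- by move=> i j; exact: UC_cont (UC_reduced i j).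
- by move=> b i j; exact: UC_cont (UC_pd b (UC_reduced i j)).
- exact: UC_cont hv.
- by move=> b; exact: UC_cont (UC_pd b hv).
Qed.

Lemma within_reduced_flux :
  {within E, continuous (fun x => \sum_a grad rho x 0 a * reduced_current a x)}.
Proof.
apply: within_sum => a; apply: within_mul; last exact: within_reduced_current.
apply: continuous_in_subspaceT => x; rewrite inE => /(ext_neq G) Vx.
have -> : (fun x => grad rho x 0 a) = D a rho by apply/funext => y; rewrite gradE.
exact: CO_cont (CO_D a (gauge_CO G 1)) Vx.
Qed.

Let powR_small (C ka d : R) : 0 <= C -> 0 < ka -> 0 < d ->
  exists N : nat, forall m, (N <= m)%N -> C * (1 + m%:R) `^ (- ka) <= d.
Proof.
move=> C0 ka0 d0; pose b : R := C / d + 1.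
have b0 : 0 < b by rewrite ltr_wpDl // divr_ge0 // ltW.
exists (Num.bound (b `^ ka^-1)) => m Nm.
have m1 : b `^ ka^-1 <= 1 + m%:R.
  have := archi_boundP (powR_ge0 b ka^-1) => /ltW/le_trans; apply.
  by rewrite (@le_trans _ _ m%:R) ?ler_nat // lerDr.
have m0 : 0 < 1 + m%:R :> R by rewrite ltr_wpDr.
have h : b <= (1 + m%:R) `^ ka.
  have -> : b = (b `^ ka^-1) `^ ka by rewrite -powRrM mulVf ?gt_eqF // powRr1 // ltW.
  by apply: ge0_ler_powR => //; rewrite ?nnegrE ?powR_ge0 // ltW.
rewrite powRN ler_pdivrMr ?powR_gt0 //.
apply: le_trans (_ : d * b <= _); last by rewrite ler_pM2l.
by rewrite /b mulrDr mulr1 mulrC divfK ?gt_eqF // lerDl ltW.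
Qed.

Section Cutoffs.
Variable e : R.
Hypothesis e01 : 0 < e < 2^-1.
Let e0 : 0 < e. Proof. by case/andP: e01. Qed.

(** The gauge field is cut off on both sides: near [Sigma], so that it extends by zero to a C^2
    field on the whole space, and beyond rho = 3, so that the decaying [H] is unchanged at infinity.
    For 1 + e <= rho <= 2 it is kept; this contains the layer up to 1 + 2 e because e < 1/2. *)
Let ka x : R := layer (e / 2) (rho x) * (1 + -1 * step (rho x + -2)).
Let Y j x : R := ka x * Z j x.

Let e20 : 0 < e / 2. Proof. by rewrite divr_gt0. Qed.

Let ka_in x : 1 + e <= rho x <= 2 -> ka x = 1.
Proof.
move=> /andP[h1 h2]; rewrite /ka layer_out //; last by lra.
by rewrite step0 ?mulr0 ?addr0 ?mulr1 //; lra.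
Qed.

Let ka_out x : ~ annulus rho (1 + e / 2) 3 x -> ka x = 0.
Proof.
move=> h; have [h1|h1] := ltP (rho x) (1 + e / 2).
  by rewrite /ka layer_in ?mul0r // ltW.
have [h2|h2] := ltP 3 (rho x); last by case: h; rewrite /annulus /= h1.
by rewrite /ka step1 ?mulr1 ?subrr ?mulr0 //; lra.
Qed.

Let cA1 : closed (annulus rho (1 + e / 2) 3).
Proof. by apply: (closed_annulus G oOm); have := e20; lra. Qed.

Let A1E : annulus rho (1 + e / 2) 3 `<=` E°.
Proof. by move=> x /andP[h _]; apply/(interior_gauge G); have := e20; lra. Qed.

Let EV : E° `<=` V0.
Proof. by move=> x /interior_subset; exact: (ext_neq G). Qed.

Let CO_Y j : CO setT 2 (Y j).
Proof.
apply: (CO_zero_ext oE cA1 A1E); last by move=> x h; rewrite /Y ka_out // mul0r.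
apply: CO_mul => //; last exact: (@UC_CO_interior _ _ E 2 (Z j)).
apply: CO_sub EV _; apply: CO_mul => //; first exact: CO_layer (gauge_CO G 2).
apply: CO_add => //; first exact: CO_cst.
apply: CO_mul => //; first exact: CO_cst.
by apply: CO_step => //; apply: CO_add => //; [exact: (gauge_CO G)|exact: CO_cst].
Qed.

Let supp_Y j : exists s : nat, bsupp s (Y j).
Proof.
have [s hs] := annulus_bounded G 3; exists s => x sx; rewrite /Y ka_out ?mul0r //.
by move=> /andP[_ /hs]; rewrite leNgt sx.
Qed.

Let HO i j : CO E° 2 (H i j). Proof. exact: (@UC_CO_interior _ _ E 2). Qed.
Let vO : CO E° 2 v. Proof. exact: (@UC_CO_interior _ _ E 2). Qed.
Let ZO j : CO E° 2 (Z j). Proof. exact: (@UC_CO_interior _ _ E 2). Qed.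

Let open_shell : open [set x | 1 + e < rho x < 2].
Proof.
have -> : [set x | 1 + e < rho x < 2] = [set x | 1 + e < rho x] `&` ~` [set x | 2 <= rho x].
  by apply/seteqP; split=> x /= [] => [/andP[-> h]|-> /negP]; rewrite ?ltNge //; split=> //; apply/negP; rewrite -ltNge.
by apply: openI; [apply: (open_exterior G); have := e0; lra|apply: closed_openC; apply: closed_exterior; lra].
Qed.

Let D_Y_shell i j x : 1 + e < rho x < 2 -> D i (Y j) x = D i (Z j) x.
Proof.
move=> h; apply: (derive_congr _ open_shell h) => y /andP[y1 y2].
by rewrite /Y ka_in ?mul1r // !ltW.
Qed.

Let lie_shell i j x : 1 + e < rho x < 2 -> lie_sub H Y i j x = reduced i j x.
Proof.
move=> h; have Ex : E° x by apply/(interior_gauge G); move: h => /andP[h _]; have := e0; lra.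
by rewrite /lie_sub /reduced !D_Y_shell // !pd_interior.
Qed.

Let current_shell a x : 1 + e < rho x < 2 -> current x0 c (lie_sub H Y) v a x = reduced_current a x.
Proof.
move=> h; have Ex : E° x by apply/(interior_gauge G); move: h => /andP[h _]; have := e0; lra.
apply: jcur_ext => [i j|b i j|b]; first exact: lie_shell.
  rewrite (pd_interior b _ Ex).
  by apply: (derive_congr _ open_shell h) => y; exact: lie_shell.
by rewrite (pd_interior b _ Ex).
Qed.

Let current_far a x : 3 < rho x -> current x0 c (lie_sub H Y) v a x = current x0 c H v a x.
Proof.
move=> h.
have oF : open [set x | 3 < rho x] by apply: (open_exterior G).
have Y0 j y : 3 < rho y -> Y j y = 0.
  by move=> hy; rewrite /Y ka_out ?mul0r // => /andP[_]; rewrite leNgt hy.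
have DY0 i j y : 3 < rho y -> D i (Y j) y = 0.
  move=> hy; rewrite -[RHS](derive_cst (0 : R) y (e_ i)).
  by apply: (derive_congr _ oF hy) => z; exact: Y0.
have LH i j y : 3 < rho y -> lie_sub H Y i j y = H i j y.
  by move=> hy; rewrite /lie_sub !DY0 // addr0 subr0.
apply: jcur_ext => [i j|b i j|b //]; first exact: LH.
by apply: (derive_congr _ oF h) => y; exact: LH.
Qed.

Let eta m x : R := layer e (rho x) * cutoff m x.

Let CO_lay : CO setT 1 (fun x => layer e (rho x)).
Proof.
apply: (@CO_zero_ext _ _ V0 E 1 _ oV) => //.
- exact: open_closedC.
- by move=> x; exact: (ext_neq G).
- exact: CO_layer (gauge_CO G 1).
- by move=> x /contrapT /(gauge_in G) h; rewrite layer_in //; have := e0; lra.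
Qed.

Let identity m : (0 < m)%N ->
  Lam (fun x => \sum_a D a (eta m) x * current x0 c (lie_sub H Y) v a x) = 0.
Proof.
move=> m0; pose A := [set x | 1 + e <= rho x] `&` [set x | `|x| <= (2 * m)%:R].
have cA : closed A.
  apply: closedI; first by apply: closed_exterior; have := e0; lra.
  by apply: compact_closed; [exact: norm_hausdorff|exact: compact_ball0].
have k0 i j y : E° y -> H i j y = H j i y by move=> /interior_subset; exact: Hsym.
have k1 : A `<=` E°.
  by move=> x [h _]; apply/(interior_gauge G); move: h => /=; have := e0; lra.
have k2 x : A x -> `|x| <= (2 * m)%:R by case.
have k3 : CO setT 1 (eta m) by apply: CO_mul; [exact: openT|exact: CO_lay|exact: CO_cutoff].
have k4 x : ~ A x -> eta m x = 0.
  move=> nA; rewrite /eta; have [h|h] := leP (rho x) (1 + e); first by rewrite layer_in ?mul0r.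
  rewrite cutoff_out ?mulr0 // ltNge; apply/negP => h2; apply: nA; split=> //.
  by rewrite /= ltW.
exact: (weak_div_C2 LamP x0 oE HO vO k0 E1 E2 cA k1 k2 k3 k4 CO_Y supp_Y).
Qed.

(** The gradient of eta lives in two separate regions: the layer, where the current is that of the
    fully reduced tensor, and the far zone of the cutoff, where it is that of the original [H]. *)
Let split_flux m : (0 < m)%N -> (forall x, rho x <= 3 -> enorm x < m%:R) -> forall x,
  \sum_a D a (eta m) x * current x0 c (lie_sub H Y) v a x =
  dlayer e (rho x) * (\sum_a grad rho x 0 a * reduced_current a x) +
  \sum_a D a (cutoff m) x * current x0 c H v a x.
Proof.
move=> m0 hm x.
have cut1 y : enorm y < m%:R -> cutoff m y = 1 by move=> /ltW; exact: cutoff_in.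
have oB := @open_enorm m.
have Dcut0 a : rho x <= 3 -> D a (cutoff m) x = 0.
  move=> /hm h; rewrite -[RHS](derive_cst (1 : R) x (e_ a)).
  by apply: (derive_congr _ oB h) => y; exact: cut1.
have Deta0 a : rho x < 1 + e -> D a (eta m) x = 0.
  move=> h; apply: (@D_zero_out _ _ [set x | 1 + e <= rho x]).
  - by apply: closed_exterior; have := e0; lra.
  - by move=> y /= /negP; rewrite -ltNge => hy; rewrite /eta layer_in ?mul0r // ltW.
  - by move=> /=; apply/negP; rewrite -ltNge.
have [h|h] := ltP (rho x) (1 + e).
  rewrite dlayer_in ?(ltW h) // mul0r add0r; apply: eq_bigr => a _.
  by rewrite Deta0 // Dcut0 ?mul0r //; have /andP[_] := e01; lra.
have Vx : V0 x by apply: (gauge_neq G); have := e0; lra.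
have De a : D a (eta m) x = dlayer e (rho x) * grad rho x 0 a * cutoff m x + layer e (rho x) * D a (cutoff m) x.
  have d1 := is_derive_comp1 (is_derive_layer e (rho x)) (is_derive_CO a (gauge_CO G 1) Vx).
  have d2 := isD_mul d1 (is_derive_CO a (CO_cutoff R n m) (I : setT x)).
  by rewrite (@derive_val _ _ _ _ _ _ _ d2) gradE.
have [h2|h2] := ltP 3 (rho x).
  rewrite dlayer_out //; last by have /andP[_] := e01; lra.
  rewrite mul0r add0r; apply: eq_bigr => a _; rewrite current_far // De.
  rewrite dlayer_out ?layer_out ?mul0r ?add0r ?mul1r //; by have /andP[_] := e01; lra.
rewrite [X in _ + X]big1 ?addr0; last by move=> a _; rewrite Dcut0 // mul0r.
rewrite mulr_sumr; apply: eq_bigr => a _; rewrite De Dcut0 // mulr0 addr0 cut1 ?hm // mulr1 -mulrA.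
have [h3|h3] := leP (rho x) (1 + e); first by rewrite dlayer_in // !mul0r.
have [h4|h4] := leP (1 + 2 * e) (rho x); first by rewrite dlayer_out // !mul0r.
by rewrite current_shell // h3 /=; have /andP[_] := e01; lra.
Qed.

Let D_cutoff_in m a x : (0 < m)%N -> enorm x < m%:R -> D a (cutoff m) x = 0.
Proof.
move=> m0 h; rewrite -[RHS](derive_cst (1 : R) x (e_ a)).
by apply: (derive_congr _ (@open_enorm m) h) => y hy; rewrite cutoff_in // ltW.
Qed.

Let D_cutoff_out m a x : (0 < m)%N -> (2 * m)%:R < `|x| -> D a (cutoff m) x = 0.
Proof.
move=> m0 h; apply: (@D_zero_out _ _ [set x | `|x| <= (2 * m)%:R]).
- by apply: compact_closed; [exact: norm_hausdorff|exact: compact_ball0].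
- by move=> y /= /negP; rewrite -ltNge; exact: cutoff_out.
- by move=> /=; apply/negP; rewrite -ltNge.
Qed.

Let growth_current a : growth E (- 1 - 2 * q) (fun x => jcur (fun b => (x - x0) 0 b) c (fun i j => H i j x)
  (fun b i j => pd E b (H i j) x) (v x) (fun b => pd E b v x) a).
Proof. exact: growth_jcur. Qed.

(** The layer term is independent of m and equals minus the far term. The far term is at most a
    constant times m^(-1) m^(- 1 - 2 q) m^n, from the gradient of the cutoff, the current and the
    volume, and the total exponent n - 2 - 2 q is negative. *)
Lemma reduced_flux_zero :
  Lam (fun x => dlayer e (rho x) * (\sum_a grad rho x 0 a * reduced_current a x)) = 0.
Proof.
set f1 := fun x => _.
have cf1 : cpt f1 by exact: (cpt_dlayer G oOm within_reduced_flux e0).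
pose f2 m x := \sum_a D a (cutoff m) x * current x0 c H v a x.
have /choice[K hK] : forall a, exists K : R, 0 <= K /\ forall x, E° x ->
    `|current x0 c H v a x| <= K * (1 + enorm x) `^ (- 1 - 2 * q).
  move=> a; have [K K0 h] := growth_current a; exists K; split=> // x Ex.
  apply: le_trans (h x (interior_subset Ex)); rewrite le_eqVlt; apply/orP; left; apply/eqP.
  congr `| _ |; apply: jcur_ext => // [b i j|b]; by rewrite (pd_interior b _ Ex).
pose KK := \sum_a K a.
have KK0 : 0 <= KK by apply: sumr_ge0 => a _; exact: (hK a).1.
have [r3 hr3] := annulus_bounded G 3.
(* A sup norm of at most r3 gives a squared Euclidean length of at most n r3^2 <= (n r3)^2 <
   m3^2. *)
pose m3 := (n * r3).+1.
have big m : (m3 <= m)%N -> forall x, rho x <= 3 -> enorm x < m%:R.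
  move=> hm x /hr3 hx.
  have m1 : 0 < m%:R :> R by rewrite ltr0n; exact: leq_trans hm.
  rewrite -(@ltr_pXn2r _ 2) ?nnegrE ?enorm_ge0 //.
  rewrite sqr_sqrtr; last by apply: sumr_ge0 => i _; exact: sqr_ge0.
  apply: (@le_lt_trans _ _ (\sum_(i < n) r3%:R ^+ 2)).
    apply: ler_sum => i _; rewrite -real_normK ?num_real // lerXn2r ?nnegrE //.
    exact: le_trans (normr_coord_le x i) hx.
  rewrite sumr_const card_ord -[_ *+ n]mulr_natl -!natrX -natrM ltr_nat.
  apply: (@leq_trans (m3 ^ 2)); last by rewrite leq_exp2r.
  apply: (@leq_ltn_trans ((n * r3) ^ 2)); last by rewrite /m3 ltn_exp2r.
  rewrite expnMn leq_mul2r; apply/orP; right; rewrite -mulnn.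
  by case: (n) => // k; rewrite leq_pmulr.
have cf2 m : (m3 <= m)%N -> cpt (f2 m).
  move=> hm; have m0 : (0 < m)%N by exact: leq_trans hm.
  split; last first.
    by exists (2 * m)%N => x hx; apply: big1 => a _; rewrite D_cutoff_out ?mul0r.
  have h : CO setT 0 (f2 m); last by move=> x; exact: CO_cont h I.
  apply: (@CO_zero_ext _ _ E° [set x | 3 <= rho x] 0 _ oE).
  - by apply: closed_exterior; lra.
  - by move=> x /= h; apply/(interior_gauge G); lra.
  - apply: CO_sum => // a _; apply: CO_mul => //; first by apply: CO_sub (CO_D a (CO_cutoff R n m)).
    by apply: CO_current => //; [move=> i j; exact: CO_leS (HO i j)|exact: CO_leS vO].
  - move=> x /= /negP; rewrite -ltNge => h; apply: big1 => a _.
    by rewrite D_cutoff_in ?mul0r //; apply: big => //; exact: ltW.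
have sum0 m : (m3 <= m)%N -> Lam f1 = - Lam (f2 m).
  move=> hm; have m0 : (0 < m)%N by exact: leq_trans hm.
  have := identity m0.
  have -> : (fun x => \sum_a D a (eta m) x * current x0 c (lie_sub H Y) v a x) =
     fun x => f1 x + f2 m x by apply/funext => x; exact: (split_flux m0 (big m hm)).
  rewrite (intD LamP cf1 (cf2 m hm)) => /eqP; rewrite addr_eq0 => /eqP.
  exact.
have bound m : (m3 <= m)%N -> `|Lam f1| <= n%:R * 128 * KK * 6 ^+ n * (1 + m%:R) `^ (- (2 * q + 2 - n%:R)).
  move=> hm; have m0 : (0 < m)%N by exact: leq_trans hm.
  have m1 : 0 < m%:R :> R by rewrite ltr0n.
  have m11 : 1 <= m%:R :> R by rewrite ler1n.
  have M0 : 0 < 1 + m%:R :> R by rewrite ltr_wpDr.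
  rewrite (sum0 m hm) normrN.
  have q0 : - 1 - 2 * q <= 0 by move: q00; lra.
  pose B := n%:R * (64 / m%:R * (KK * (1 + m%:R) `^ (- 1 - 2 * q))).
  have b2 x : `|f2 m x| <= B.
    have B0 : 0 <= B by rewrite !mulr_ge0 ?powR_ge0 // invr_ge0.
    have [h|h] := ltP (enorm x) m%:R.
      by rewrite /f2 big1 ?normr0 // => a _; rewrite D_cutoff_in ?mul0r.
    have Ex : E° x.
      apply/(interior_gauge G); rewrite ltNge; apply/negP => h2.
      by have := big m hm x; rewrite ltNge h => /(_ ltac:(lra)).
    rewrite (le_trans (ler_norm_sum _ _ _)) //.
    apply: (@le_trans _ _ (\sum_(a < n) 64 / m%:R * (KK * (1 + m%:R) `^ (- 1 - 2 * q)))).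
      apply: ler_sum => a _; rewrite normrM ler_pM ?D_cutoff_bound //.
      apply: le_trans ((hK a).2 x Ex) _; rewrite ler_pM ?powR_ge0 ?(hK a).1 //.
        by rewrite /KK (bigD1 a) //= lerDl; apply: sumr_ge0 => b _; exact: (hK b).1.
      rewrite -[- 1 - 2 * q]opprK powRN [leRHS]powRN lef_pV2 ?posrE ?powR_gt0 //; last first.
        by apply: lt_le_trans M0 _; rewrite lerD2l.
      apply: ge0_ler_powR; rewrite ?nnegrE ?oppr_ge0 // ?(ltW M0) ?lerD2l //.
      by apply: le_trans (ltW M0) _; rewrite lerD2l.
    by rewrite sumr_const card_ord -[_ *+ n]mulr_natl.
  have s2 : bsupp (2 * m) (f2 m).
    by move=> x hx; apply: big1 => a _; rewrite D_cutoff_out ?mul0r.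
  have m20 : (0 < 2 * m)%N by rewrite muln_gt0.
  apply: le_trans (int_bound LamP (cf2 m hm) m20 b2 s2) _.
  have k1 : 64 / m%:R <= 128 / (1 + m%:R) :> R.
    by rewrite ler_pdivrMr // mulrAC ler_pdivlMr //; lra.
  have k2 : (3 * (2 * m))%:R ^+ n <= 6 ^+ n * (1 + m%:R) ^+ n :> R.
    rewrite -exprMn lerXn2r ?nnegrE ?mulr_ge0 ?(ltW M0) // mulnA natrM ler_pM2l // lerDr //.
  have pE : (1 + m%:R) `^ (- (2 * q + 2 - n%:R)) =
      (1 + m%:R)^-1 * (1 + m%:R) `^ (- 1 - 2 * q) * (1 + m%:R) ^+ n :> R.
    rewrite -powR_mulrn ?(ltW M0) // -[X in X * _ * _]powR_inv1 ?(ltW M0) //.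
    have P (s t : R) : (1 + m%:R) `^ (s + t) = (1 + m%:R) `^ s * (1 + m%:R) `^ t.
      by apply: powRD; apply/implyP => _; rewrite gt_eqF.
    rewrite -!P.
    by congr (_ `^ _); ring.
  rewrite pE /B.
  have p0 : 0 <= KK * (1 + m%:R) `^ (- 1 - 2 * q) by rewrite mulr_ge0 ?powR_ge0.
  apply: (@le_trans _ _ (n%:R * (128 / (1 + m%:R) * (KK * (1 + m%:R) `^ (- 1 - 2 * q))) *
     (6 ^+ n * (1 + m%:R) ^+ n))).
    rewrite ler_pM ?exprn_ge0 // ?mulr_ge0 ?invr_ge0 ?powR_ge0 //.
    by rewrite ler_wpM2l // ler_wpM2r.
  by rewrite le_eqVlt; apply/orP; left; apply/eqP; ring.
apply/eqP; rewrite -normr_le0; apply/ler_addgt0Pr => d d0; rewrite add0r.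
have C0 : 0 <= n%:R * 128 * KK * 6 ^+ n by rewrite !mulr_ge0 // exprn_ge0.
have ka0 : 0 < 2 * q + 2 - n%:R by move: q1; rewrite /c; lra.
have [N hN] := powR_small C0 ka0 d0.
exact: le_trans (bound (maxn N m3) (leq_maxr _ _)) (hN _ (leq_maxl _ _)).
Qed.

End Cutoffs.
End Flux.

(** * The boundary-adapted gauge *)

Section FluxAlgebra.
Variables (R : realType) (n : nat).
Implicit Types (i j a b : 'I_n).
Variables (N X V : 'I_n -> R) (m : 'I_n -> 'I_n -> R) (c v : R).
Hypotheses (msym : forall i j, m i j = m j i) (XN : \sum_b X b * N b = 1).
Let D j := \sum_i N i * m i j.
Let t := \sum_i m i i.
Let A := \sum_a N a * N a.
Let M2 := \sum_i \sum_j m i j * m i j.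
Let DD := \sum_j D j * D j.
Hypothesis trace : A * t = \sum_j N j * D j.

(** With h = 0 and dh = N (x) m, the relation N.X = 1 makes the variation [jk] equal to [m]. The
    terms with v carry the factor A t - N.D, which is zero by [trace]; those with the gradient V
    outside [jw] cancel against the Lagrangian, whose coefficient is N.X = 1. *)
Lemma flux_value :
  \sum_a N a * jcur X c (fun _ _ => 0) (fun b i j => N b * m i j) v V a =
  - (4^-1 * (A * M2 + A * (t * t) - 2 * DD)).
Proof.
pose DN := \sum_j D j * N j; pose DV := \sum_j V j * D j; pose VN := \sum_j V j * N j.
have trace' : A * t = DN by rewrite trace; apply: eq_bigr => j _; rewrite mulrC.
have Ediv j : jdiv (fun b i j => N b * m i j) j = D j by [].
have Etr a : jtr (fun b i j => N b * m i j) a = N a * t by rewrite /jtr -mulr_sumr.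
have Ek i j : jk X c (fun _ _ => 0) (fun b i j => N b * m i j) i j = m i j.
  rewrite /jk mulr0 addr0 (eq_bigr (fun b => X b * N b * m i j)) => [|b _]; last by rewrite mulrA.
  by rewrite -mulr_suml XN mul1r.
have Elag : jlag (fun b i j => N b * m i j) V =
    2^-1 * DD - 4^-1 * (A * M2) - 2^-1 * (DN * t) + 4^-1 * (A * (t * t)) - DV + VN * t.
  rewrite /jlag; congr (_ - _ - _ + _ - _ + _).
  - congr (_ * _); rewrite /A mulr_suml; apply: eq_bigr => a _.
    rewrite /M2 mulr_sumr; apply: eq_bigr => i _; rewrite mulr_sumr; apply: eq_bigr => j _.
    by ring.
  - by congr (_ * _); rewrite mulr_suml; apply: eq_bigr => j _; rewrite Etr Ediv; ring.
  - by congr (_ * _); rewrite mulr_suml; apply: eq_bigr => j _; rewrite Etr; ring.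
  - by rewrite mulr_suml; apply: eq_bigr => j _; rewrite Etr; ring.
set lag := jlag _ _ in Elag.
have term a : N a * jcur X c (fun _ _ => 0) (fun b i j => N b * m i j) v V a =
   N a * (\sum_j (D j - 2^-1 * (N j * t) - V j) * m a j)
   + N a * N a * (- (2^-1 * M2) + 2^-1 * (t * t) + t * jw X c v V)
   - D a * N a * (2^-1 * t + jw X c v V) + V a * N a * t - X a * N a * lag.
  rewrite /jcur -/lag.
  have -> : \sum_j (jdiv (fun b i j => N b * m i j) j - 2^-1 * jtr (fun b i j => N b * m i j) j - V j) *
      jk X c (fun _ _ => 0) (fun b i j => N b * m i j) a j =
      \sum_j (D j - 2^-1 * (N j * t) - V j) * m a j.
    by apply: eq_bigr => j _; rewrite Ek Etr.
  have -> : \sum_i \sum_j N a * m i j * jk X c (fun _ _ => 0) (fun b i j => N b * m i j) i j = N a * M2.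
    rewrite /M2 mulr_sumr; apply: eq_bigr => i _; rewrite mulr_sumr; apply: eq_bigr => j _.
    by rewrite Ek mulrA.
  have -> : \sum_i jk X c (fun _ _ => 0) (fun b i j => N b * m i j) i i = t.
    by apply: eq_bigr => i _; rewrite Ek.
  by rewrite Etr Ediv; ring.
rewrite (eq_bigr _ (fun a _ => term a)) sumrB big_split sumrB big_split /=.
rewrite -!mulr_suml XN mul1r Elag -/A -/DN -/VN.
have -> : \sum_i N i * (\sum_j (D j - 2^-1 * (N j * t) - V j) * m i j) = DD - 2^-1 * (DN * t) - DV.
  rewrite (eq_bigr (fun i => \sum_j (D j - 2^-1 * (N j * t) - V j) * (N i * m i j))); last first.
    by move=> i _; rewrite mulr_sumr; apply: eq_bigr => j _; ring.
  rewrite exchange_big /= (eq_bigr (fun j => (D j * D j - 2^-1 * (D j * N j * t)) - V j * D j)); last first.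
    by move=> j _; rewrite -mulr_sumr -/(D j); ring.
  by rewrite !sumrB -mulr_sumr -mulr_suml.
by rewrite -trace'; field.
Qed.

Let sum_sq (p al r be : 'I_n -> R) :
  \sum_i \sum_j (m i j - (p i * al j + r i * be j)) ^+ 2 =
  M2 - 2 * (\sum_i p i * \sum_j m i j * al j) - 2 * (\sum_i r i * \sum_j m i j * be j)
  + (\sum_i p i * p i) * (\sum_j al j * al j) + 2 * ((\sum_i p i * r i) * (\sum_j al j * be j))
  + (\sum_i r i * r i) * (\sum_j be j * be j).
Proof.
rewrite !mulr_suml !mulr_sumr /M2 -!sumrB -!big_split /=; apply: eq_bigr => i _.
rewrite !mulr_sumr -!sumrB -!big_split /=; apply: eq_bigr => j _.
by ring.
Qed.

Hypothesis A0 : 0 < A.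

(** The matrix inside the square is P m P for the orthogonal projection P along N. Its squared norm
    is M2 - 2 DD / A + s^2 / A^2, and [trace] says t = s / A. *)
Lemma flux_square : A * M2 + A * (t * t) - 2 * DD =
  A * \sum_i \sum_j (m i j - (N i * (D j / A - (\sum_j N j * D j) / A ^+ 2 * N j) + D i * (N j / A))) ^+ 2.
Proof.
set s := \sum_j N j * D j.
have A1 : A != 0 by rewrite gt_eqF.
have st : t = s / A by rewrite /s -trace [A * t]mulrC mulfK.
have mN i : \sum_j m i j * N j = D i.
  by apply: eq_bigr => j _; rewrite msym mulrC.
pose mD i := \sum_j m i j * D j.
have NmD : \sum_i N i * mD i = DD.
  rewrite /mD (eq_bigr (fun i => \sum_j D j * (N i * m i j))); last first.
    by move=> i _; rewrite mulr_sumr; apply: eq_bigr => j _; ring.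
  by rewrite exchange_big /=; apply: eq_bigr => j _; rewrite -mulr_sumr.
rewrite sum_sq.
have -> : \sum_i N i * (\sum_j m i j * (D j / A - s / A ^+ 2 * N j)) = DD / A - s * s / A ^+ 2.
  rewrite (eq_bigr (fun i => N i * mD i / A - s / A ^+ 2 * (N i * D i))); last first.
    move=> i _; rewrite (eq_bigr (fun j => m i j * D j / A - s / A ^+ 2 * (m i j * N j))); last first.
      by move=> j _; ring.
    by rewrite sumrB -mulr_suml -mulr_sumr mN -/(mD i); ring.
  by rewrite sumrB -mulr_suml -mulr_sumr NmD -/s; ring.
have -> : \sum_i D i * (\sum_j m i j * (N j / A)) = DD / A.
  rewrite /DD mulr_suml; apply: eq_bigr => i _.
  rewrite (eq_bigr (fun j => m i j * N j / A)); last by move=> j _; rewrite mulrA.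
  by rewrite -mulr_suml mN mulrA.
have -> : \sum_j (D j / A - s / A ^+ 2 * N j) * (D j / A - s / A ^+ 2 * N j) =
    DD / A ^+ 2 - s * s / A ^+ 3.
  rewrite (eq_bigr (fun j => D j * D j / A ^+ 2 - 2 * s / A ^+ 3 * (N j * D j) +
     (s / A ^+ 2) ^+ 2 * (N j * N j))); last by move=> j _; field.
  by rewrite big_split sumrB /= -mulr_suml -!mulr_sumr -/DD -/s -/A; field.
have -> : \sum_j (D j / A - s / A ^+ 2 * N j) * (N j / A) = 0.
  rewrite (eq_bigr (fun j => N j * D j / A ^+ 2 - s / A ^+ 3 * (N j * N j))); last by move=> j _; field.
  by rewrite sumrB -mulr_suml -mulr_sumr -/s -/A; field.
have -> : \sum_j N j / A * (N j / A) = A^-1.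
  rewrite (eq_bigr (fun j => N j * N j / A ^+ 2)); last by move=> j _; field.
  by rewrite -mulr_suml -/A; field.
by rewrite st -/A -/DD -/s; field.
Qed.

Lemma flux_nonneg : 0 <= A * M2 + A * (t * t) - 2 * DD.
Proof.
rewrite flux_square mulr_ge0 ?(ltW A0) //.
by apply: sumr_ge0 => i _; apply: sumr_ge0 => j _; exact: sqr_ge0.
Qed.

Lemma flux_eq0 (x y : 'I_n -> R) : A * M2 + A * (t * t) - 2 * DD = 0 ->
  \sum_i N i * x i = 0 -> \sum_i N i * y i = 0 -> \sum_i \sum_j x i * m i j * y j = 0.
Proof.
rewrite flux_square => /eqP; rewrite mulf_eq0 (gt_eqF A0) /=.
set s := \sum_j N j * D j => h0 Nx Ny.
have h i j : m i j = N i * (D j / A - s / A ^+ 2 * N j) + D i * (N j / A).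
  apply/eqP; rewrite -subr_eq0 -sqrf_eq0.
  move: h0; rewrite psumr_eq0 => [/allP/(_ i (mem_index_enum _))/=|k _]; last first.
    by apply: sumr_ge0 => l _; exact: sqr_ge0.
  by rewrite psumr_eq0 => [/allP/(_ j (mem_index_enum _))|l _]; last exact: sqr_ge0.
rewrite (eq_bigr (fun i => N i * x i * (\sum_j (D j / A - s / A ^+ 2 * N j) * y j) + 0)).
  by rewrite big_split /= sumr_const mul0rn addr0 -mulr_suml Nx mul0r.
move=> i _; rewrite (eq_bigr (fun j => N i * x i * ((D j / A - s / A ^+ 2 * N j) * y j) +
  x i * D i / A * (N j * y j))); last by move=> j _; rewrite h; ring.
by rewrite big_split /= -!mulr_sumr Ny mulr0.
Qed.

End FluxAlgebra.

(** * Reduction to a tensor vanishing on the boundary *)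

Section GaugeFixing.
Variables (R : realType) (n : nat).
Local Notation Rn := 'rV[R]_n.
Local Notation e_ i := (basis_vec R i).
Local Notation D i f := (fun x => 'D_(basis_vec R i) f x).
Implicit Types (f g phi eta : Rn -> R) (x y z w p X Y : Rn) (U V A : set Rn) (i j k a b l : 'I_n).
Variables (Omega Sigma : set Rn) (x0 : Rn) (rho : Rn -> R).
Hypotheses (G : gauge Omega Sigma x0 rho) (oOm : open Omega).
Let E := ~` Omega.
Let V0 : set Rn := ~` [set x0].
Let oV : open V0. Proof. exact: open_punctured. Qed.
Let reg := exterior_regular G.
Let EV : E `<=` V0. Proof. by move=> x; exact: (ext_neq G). Qed.

Variables (H : 'I_n -> 'I_n -> Rn -> R).
Hypotheses (hH : forall i j, UC E 2 (H i j)).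
Hypotheses (Hsym : forall i j y, E y -> H i j y = H j i y).
Hypothesis Htan : forall p X Y, Sigma p -> dotp (grad rho p) X = 0 -> dotp (grad rho p) Y = 0 ->
  \sum_k \sum_l X 0 k * H k l p * Y 0 l = 0.

(* The solution of [N_i W_j + N_j W_i = H i j] on [Sigma] when [H] has no tangential
   part, since [N.X = 1] there. *)
Definition gauge_W j x : R := \sum_k H j k x * (x - x0) 0 k
  + - 2^-1 * (\sum_k \sum_l H k l x * ((x - x0) 0 k * (x - x0) 0 l)) * D j rho x.
Definition gauge_Z j x : R := (rho x + -1) * gauge_W j x.

Let UCX (s : nat) j : UC E s (fun x => (x - x0) 0 j).
Proof.
apply: (CO_UC reg oV EV).
apply: CO_congr (CO_add oV (CO_coord s j oV) (CO_cst s (- x0 0 j) oV)) => // x _.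
by rewrite !mxE.
Qed.

Let UCN (s : nat) j : UC E s (D j rho).
Proof. by apply: (CO_UC reg oV EV); apply: CO_D; exact: gauge_CO G s.+1. Qed.

Lemma UC_gauge_W j : UC E 2 (gauge_W j).
Proof.
apply: (UC_add reg).
  by apply: (UC_sum reg) => k; apply: (UC_mul reg) => //; exact: UCX.
apply: (UC_mul reg); last exact: UCN.
apply: (UC_mul reg); first exact: (UC_cst reg).
apply: (UC_sum reg) => k; apply: (UC_sum reg) => l; apply: (UC_mul reg) => //.
by apply: (UC_mul reg); exact: UCX.
Qed.

Let UCr (s : nat) : UC E s (fun x => rho x + -1).
Proof.
by apply: (UC_add reg); [apply: (CO_UC reg oV EV); exact: gauge_CO G s|exact: (UC_cst reg)].
Qed.

Lemma pd_defining i x : E x -> pd E i (fun x => rho x + -1) x = D i rho x.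
Proof.
move=> Ex; rewrite (pd_add reg) //; last exact: (UC_cst reg).
  rewrite (pd_cst reg) // addr0 (pd_CO reg i oV EV) //; exact: gauge_CO G 1.
by apply: (CO_UC reg oV EV); exact: gauge_CO G 1.
Qed.

Lemma UC_gauge_Z j : UC E 2 (gauge_Z j).
Proof. by apply: (UC_mul reg); [exact: UCr|exact: UC_gauge_W]. Qed.

Lemma pd_gauge_Z i j x : E x ->
  pd E i (gauge_Z j) x = D i rho x * gauge_W j x + (rho x + -1) * pd E i (gauge_W j) x.
Proof.
move=> Ex; rewrite (pd_mul reg) //; first by rewrite pd_defining.
by apply: UC_leS; exact: UC_gauge_W.
Qed.

Let drop_defining (s t u : R) : u = 1 -> s + (u + -1) * t = s.
Proof. by move=> ->; rewrite subrr mul0r addr0. Qed.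

(** On [Sigma] the factor rho - 1 vanishes and the gradient of Z is N (x) W, so the claim is H = N
    (x) W + W (x) N. *)
Lemma reduced_Sigma i j p : Sigma p -> reduced Omega H gauge_Z i j p = 0.
Proof.
move=> Sp; have Ep := Sigma_ext G Sp; have rp := (gauge_on G p).1 Sp.
have dZ a l : pd E a (gauge_Z l) p = D a rho p * gauge_W l p.
  exact: etrans (pd_gauge_Z a l Ep) (drop_defining _ _ rp).
rewrite /reduced (dZ i j) (dZ j i).
have XN : dotp (grad rho p) (p - x0) = 1 by rewrite (gauge_euler G) // rp.
(* The projection of basis vectors onto the tangent space along X, not along N. Expanding H(tau_i,
   tau_j) = 0 gives H_ij in terms of the contractions of H with X, and N.X = 1 produces exactly
   [gauge_W]. *)
pose tau l := e_ l - D l rho p *: (p - x0).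
have tauN l : dotp (grad rho p) (tau l) = 0.
  rewrite /tau dotpBr dotpZr XN mulr1 /dotp (sum_basis_vec (fun j => grad rho p 0 j)) gradE.
  exact: subrr.
have := Htan Sp (tauN i) (tauN j).
have tauE l m : tau l 0 m = (e_ l) 0 m - D l rho p * (p - x0) 0 m by rewrite !mxE.
pose HX k := \sum_l H k l p * (p - x0) 0 l.
pose HXX := \sum_k \sum_l H k l p * ((p - x0) 0 k * (p - x0) 0 l).
have e1 k : \sum_l H k l p * tau j 0 l = H k j p - D j rho p * HX k.
  rewrite (eq_bigr (fun l => H k l p * (e_ j) 0 l - D j rho p * (H k l p * (p - x0) 0 l))); last first.
    by move=> l _; rewrite tauE; ring.
  by rewrite sumrB -mulr_sumr (sum_basis_vec (fun l => H k l p)).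
have e2 : \sum_k (p - x0) 0 k * HX k = HXX.
  apply: eq_bigr => k _; rewrite /HX mulr_sumr; apply: eq_bigr => l _; ring.
have e3 : \sum_k (p - x0) 0 k * H k j p = HX j.
  by apply: eq_bigr => k _; rewrite Hsym // mulrC.
rewrite (eq_bigr (fun k => tau i 0 k * (H k j p - D j rho p * HX k))); last first.
  by move=> k _; rewrite -e1 mulr_sumr; apply: eq_bigr => l _; rewrite mulrA.
rewrite (eq_bigr (fun k => (H k j p - D j rho p * HX k) * (e_ i) 0 k -
   D i rho p * ((p - x0) 0 k * H k j p) + D i rho p * D j rho p * ((p - x0) 0 k * HX k))); last first.
  by move=> k _; rewrite tauE; ring.
rewrite big_split sumrB /= -!mulr_sumr e2 e3 (sum_basis_vec (fun k => H k j p - D j rho p * HX k)) => <-.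
by rewrite /gauge_W -/(HX i) -/(HX j) -/HXX; field.
Qed.

(** The derivative of the reduced tensor along X; by [pd_vanishing] it determines the whole first
    derivative on [Sigma]. *)
Definition gauge_m i j p : R := \sum_b pd E b (reduced Omega H gauge_Z i j) p * (p - x0) 0 b.

Let UCred i j : UC E 1 (reduced Omega H gauge_Z i j).
Proof. exact: (UC_reduced G hH UC_gauge_Z). Qed.

Lemma pd_reduced b i j p : Sigma p ->
  pd E b (reduced Omega H gauge_Z i j) p = grad rho p 0 b * gauge_m i j p.
Proof. by move=> Sp; apply: (pd_vanishing G) => // x; exact: reduced_Sigma. Qed.

Lemma gauge_m_sym i j p : Sigma p -> gauge_m i j p = gauge_m j i p.
Proof.
move=> Sp.
have pE b : pd E b (reduced Omega H gauge_Z i j) p = pd E b (reduced Omega H gauge_Z j i) p.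
  apply: (pd_congr reg b (UCred i j)); last exact: (Sigma_ext G).
  by move=> x Ex; exact: (congr2 (fun s t : R => s - t) (Hsym i j Ex) (addrC _ _)).
by rewrite /gauge_m; apply: eq_bigr => b _; exact: (congr1 (fun z : R => z * _) (pE b)).
Qed.

Variables (Lam : (Rn -> R) -> R) (LamP : is_integral Lam).
Variables (v : Rn -> R) (q : R).
Hypothesis hv : UC E 2 v.
Hypothesis E1 : forall i j x, E° x -> 2^-1 * \sum_l (D l (D i (H j l)) x + D l (D j (H i l)) x
   - D l (D l (H i j)) x - D j (D i (H l l)) x) = D i (D j v) x.
Hypothesis E2 : forall x, E° x -> \sum_i D i (D i v) x = 0.
Hypotheses (q00 : 0 < q) (q1 : (n%:R - 2) / 2 < q) (gh : forall i j, growth E (- q) (H i j))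
  (gp : forall a i j, growth E (- 1 - q) (pd E a (H i j)))
  (gv : growth E (- q) v) (gV : forall a, growth E (- 1 - q) (pd E a v)).
Hypothesis trace : forall p, Sigma p -> dotp (grad rho p) (grad rho p) * (\sum_i gauge_m i i p) =
  \sum_j grad rho p 0 j * \sum_i grad rho p 0 i * gauge_m i j p.

(** The negated flux density is continuous up to the boundary, has zero layer averages, and on
    [Sigma] is a quarter of the nonnegative form of [flux_square]. So it vanishes there by
    [layer_vanishing], and [flux_eq0] reads off the tangential components. *)
Theorem tangential_m_zero p X Y : Sigma p -> dotp (grad rho p) X = 0 -> dotp (grad rho p) Y = 0 ->
  \sum_i \sum_j X 0 i * gauge_m i j p * Y 0 j = 0.
Proof.
move=> Sp NX NY.
pose F x := -1 * (\sum_a grad rho x 0 a * reduced_current Omega x0 H v gauge_Z a x).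
pose Q x := dotp (grad rho x) (grad rho x) * (\sum_i \sum_j gauge_m i j x * gauge_m i j x) +
  dotp (grad rho x) (grad rho x) * ((\sum_i gauge_m i i x) * (\sum_i gauge_m i i x)) -
  2 * \sum_j (\sum_i grad rho x 0 i * gauge_m i j x) * (\sum_i grad rho x 0 i * gauge_m i j x).
have A0 x : Sigma x -> 0 < \sum_a grad rho x 0 a * grad rho x 0 a.
  by move=> /(gauge_on G) r1; apply: dotp_gt0; apply: (grad_gauge_neq0 G); rewrite r1.
have XN x : Sigma x -> \sum_b (x - x0) 0 b * grad rho x 0 b = 1.
  move=> /(gauge_on G) r1; rewrite -r1 -(gauge_euler G) ?r1 //.
  by apply: eq_bigr => b _; rewrite mulrC.
have FQ x : Sigma x -> F x = 4^-1 * Q x.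
  move=> Sx; have sym i j := gauge_m_sym i j Sx.
  rewrite /F /reduced_current.
  have -> : (fun i j => reduced Omega H gauge_Z i j x) = fun _ _ => 0.
    by apply/funext => i; apply/funext => j; exact: reduced_Sigma.
  have -> : (fun b i j => pd E b (reduced Omega H gauge_Z i j) x) =
      fun b i j => grad rho x 0 b * gauge_m i j x.
    by apply/funext => b; apply/funext => i; apply/funext => j; exact: pd_reduced.
  by rewrite (flux_value _ _ _ sym (XN x Sx) (trace Sx)) mulN1r opprK.
have F0 x : Sigma x -> F x = 0.
  apply: (layer_vanishing LamP G oOm).
  - apply: within_mul; first exact: within_cst.
    exact: (within_reduced_flux G hH hv UC_gauge_Z).
  - move=> y Sy; rewrite FQ // mulr_ge0 //.
    exact: (flux_nonneg (N := fun a => grad rho y 0 a) (m := fun i j => gauge_m i j y)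
      (fun i j => gauge_m_sym i j Sy) (trace Sy) (A0 y Sy)).
  - move=> e e01; have e0 : 0 < e by case/andP: e01.
    have h := reduced_flux_zero LamP G oOm hH hv UC_gauge_Z Hsym E1 E2 q00 q1 gh gp gv gV e01.
    have cf := cpt_dlayer G oOm (within_reduced_flux G hH hv UC_gauge_Z) e0.
    have := intZ LamP (-1) cf; rewrite h mulr0 => <-; congr Lam.
    by apply/funext => y; rewrite /F mulrCA.
apply: (flux_eq0 (N := fun a => grad rho p 0 a) (m := fun i j => gauge_m i j p)
  (fun i j => gauge_m_sym i j Sp) (trace Sp) (A0 p Sp) (x := fun i => X 0 i) (y := fun i => Y 0 i) _ NX NY).
have := F0 p Sp; rewrite FQ // => /eqP; rewrite mulf_eq0 invr_eq0 pnatr_eq0 /= => /eqP.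
exact.
Qed.

End GaugeFixing.

(** * Variation of the second fundamental form and of the mean curvature *)

Section MetricAlgebra.
Variables (R : realType) (n : nat).
Local Notation Rn := 'rV[R]_n.
Implicit Types (X Y N : Rn) (g M : 'M[R]_n) (i j k : 'I_n).

Lemma dotpE X Y : dotp X Y = (X *m Y^T) 0 0.
Proof. by rewrite mxE; apply: eq_bigr => i _; rewrite mxE. Qed.

Lemma formE M X Y : Defs.form M X Y = dotp (X *m M) Y.
Proof. by rewrite dotpE. Qed.

Lemma form_sum M X Y : Defs.form M X Y = \sum_i \sum_j X 0 i * M i j * Y 0 j.
Proof.
rewrite formE /dotp exchange_big; apply: eq_bigr => j _; rewrite mxE mulr_suml.
by apply: eq_bigr => i _.
Qed.

Lemma dotpZl (c : R) X Y : dotp (c *: X) Y = c * dotp X Y.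
Proof. by rewrite dotpC dotpZr dotpC. Qed.

Lemma dotpDl X Y Z : dotp (X + Y) Z = dotp X Z + dotp Y Z.
Proof. by rewrite dotpC dotpDr dotpC [dotp Z Y]dotpC. Qed.

Definition posdef g := forall X, X != 0 -> 0 < Defs.form g X X.

Lemma posdef_unit g : posdef g -> g \in unitmx.
Proof.
move=> pg; rewrite -row_free_unit; apply: inj_row_free => X Xg.
apply/eqP; apply: contraT => /pg; rewrite formE Xg.
by rewrite -[X in dotp X _](scale0r (0 : Rn)) dotpZl mul0r ltxx.
Qed.

Lemma near_id_posdef M (s B : R) : (forall i j, `|M i j| <= B) -> 0 <= B ->
  `|s| * (n%:R * B) <= 2^-1 -> posdef (1%:M + s *: M).
Proof.
move=> hM B0 hs X X0; have X1 := dotp_gt0 X0.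
have -> : Defs.form (1%:M + s *: M) X X = dotp X X + s * \sum_i \sum_j X 0 i * M i j * X 0 j.
  rewrite formE mulmxDr mulmx1 dotpDl -form_sum formE; congr (_ + _).
  by rewrite -scalemxAr dotpZl.
have b : `|\sum_i \sum_j X 0 i * M i j * X 0 j| <= n%:R * B * dotp X X.
  apply: (@le_trans _ _ (\sum_i \sum_j B * ((X 0 i * X 0 i + X 0 j * X 0 j) / 2))).
    rewrite (le_trans (ler_norm_sum _ _ _)) //; apply: ler_sum => i _.
    rewrite (le_trans (ler_norm_sum _ _ _)) //; apply: ler_sum => j _.
    have -> : X 0 i * M i j * X 0 j = M i j * (X 0 i * X 0 j) by ring.
    rewrite normrM ler_pM // ler_norml.
    have := sqr_ge0 (X 0 i + X 0 j); have := sqr_ge0 (X 0 i - X 0 j).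
    by move=> ? ?; apply/andP; split; nra.
  have -> : \sum_i \sum_j B * ((X 0 i * X 0 i + X 0 j * X 0 j) / 2) =
     \sum_i (n%:R * (B / 2 * (X 0 i * X 0 i)) + B / 2 * dotp X X).
    apply: eq_bigr => i _.
    rewrite (eq_bigr (fun j => B / 2 * (X 0 i * X 0 i) + B / 2 * (X 0 j * X 0 j))); last first.
      by move=> j _; ring.
    by rewrite big_split /= sumr_const card_ord -[_ *+ n]mulr_natl -mulr_sumr.
  rewrite big_split /= sumr_const card_ord -[_ *+ n]mulr_natl -!mulr_sumr -/(dotp X X).
  by rewrite le_eqVlt; apply/orP; left; apply/eqP; field.
have c : `|s * \sum_i \sum_j X 0 i * M i j * X 0 j| <= 2^-1 * dotp X X.
  rewrite normrM; apply: (@le_trans _ _ (`|s| * (n%:R * B * dotp X X))); first by rewrite ler_wpM2l.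
  by rewrite mulrA ler_wpM2r // ltW.
by move: c; rewrite ler_norml => /andP[+ _]; lra.
Qed.

Variables (g : 'M[R]_n) (N : Rn).
Hypotheses (pg : posdef g) (gT : g^T = g) (N0 : N != 0).

(** The vector dual to the covector [N] under [g]; [conormal_scale] is the inverse of its length, so
    [metric_normal] is the unit normal of ker N on the side where N is positive. *)
Definition conormal_dual : Rn := N *m invmx g.
Definition conormal_scale : R := (Num.sqrt (dotp conormal_dual N))^-1.
Definition metric_normal : Rn := conormal_scale *: conormal_dual.

Lemma conormal_dualK : conormal_dual *m g = N.
Proof. by rewrite -mulmxA mulVmx ?mulmx1 // posdef_unit. Qed.

Lemma conormal_gt0 : 0 < dotp conormal_dual N.
Proof.
have u0 : conormal_dual != 0.
  by apply: contraNneq N0 => u0; rewrite -conormal_dualK u0 mul0mx.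
by have := pg u0; rewrite formE conormal_dualK dotpC.
Qed.

Lemma conormal_scale_gt0 : 0 < conormal_scale.
Proof. by rewrite invr_gt0 sqrtr_gt0 conormal_gt0. Qed.

Lemma conormal_scaleK : conormal_scale ^+ 2 * dotp conormal_dual N = 1.
Proof.
by rewrite exprVn sqr_sqrtr ?ltW ?conormal_gt0 // mulVf // gt_eqF // conormal_gt0.
Qed.

Lemma metric_normalK : metric_normal *m g = conormal_scale *: N.
Proof. by rewrite -scalemxAl conormal_dualK. Qed.

Lemma form_metric_normal X : Defs.form g metric_normal X = conormal_scale * dotp N X.
Proof. by rewrite formE metric_normalK dotpZl. Qed.

Lemma metric_normal_unit : Defs.form g metric_normal metric_normal = 1.
Proof.
rewrite form_metric_normal dotpZr mulrA -expr2 dotpC; exact: conormal_scaleK.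
Qed.

(** The covector of [N'] kills ker N, so it is a multiple of N. The normalisation fixes the square
    of the factor and the last hypothesis its sign. *)
Lemma metric_normal_unique N' : Defs.form g N' N' = 1 ->
  (forall X, dotp N X = 0 -> Defs.form g N' X = 0) -> 0 <= dotp N N' -> N' = metric_normal.
Proof.
move=> h1 h2 h3.
have NN := dotp_gt0 N0.
pose lam := dotp (N' *m g) N / dotp N N.
have E : N' *m g = lam *: N.
  apply/eqP; rewrite -subr_eq0; apply/eqP/dotp_eq0.
  set w := N' *m g - lam *: N.
  have Nw : dotp N w = 0.
    by rewrite dotpBr dotpZr /lam divfK ?gt_eqF // dotpC subrr.
  have := h2 _ Nw; rewrite formE => k.
  by rewrite {1}/w dotpC dotpBr dotpZr dotpC k dotpC Nw mulr0 subrr.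
have E2 : N' = lam *: conormal_dual.
  by rewrite /conormal_dual scalemxAl -E mulmxK // posdef_unit.
have lam2 : lam ^+ 2 * dotp conormal_dual N = 1.
  have k : dotp N N' = lam * dotp conormal_dual N by rewrite {1}E2 dotpZr dotpC.
  by rewrite -h1 formE E dotpZl k expr2 mulrA.
have lam0 : 0 <= lam.
  by move: h3; rewrite E2 dotpZr dotpC pmulr_lge0 // conormal_gt0.
rewrite E2 /metric_normal; congr (_ *: _).
apply/eqP; rewrite -(@eqrXn2 _ 2) //; last exact/ltW/conormal_scale_gt0.
have k : dotp conormal_dual N != 0 by rewrite gt_eqF // conormal_gt0.
by apply/eqP/(mulIf k); rewrite lam2 conormal_scaleK.
Qed.

End MetricAlgebra.

(** * The unit normal of a metric along a level set *)

Section Normals.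
Variables (R : realType) (n : nat).
Local Notation Rn := 'rV[R]_n.
Local Notation e_ i := (basis_vec R i).
Local Notation D i f := (fun x => 'D_(basis_vec R i) f x).
Implicit Types (f : Rn -> R) (x y z w p X Y : Rn) (i j k a b l : 'I_n) (s t : R).
Variables (Omega Sigma : set Rn) (x0 : Rn) (rho : Rn -> R).
Hypothesis G : gauge Omega Sigma x0 rho.
Let E := ~` Omega.
Let V0 : set Rn := ~` [set x0].
Let oV : open V0. Proof. exact: open_punctured. Qed.
Let reg := exterior_regular G.

Lemma gauge_side p X : Sigma p ->
  (0 < dotp (grad rho p) X -> \forall t \near (0 : R)^'+, ~ Omega (p + t *: X)) /\
  (dotp (grad rho p) X < 0 -> \forall t \near (0 : R)^'+, Omega (p + t *: X)).
Proof.
move=> Sp; have rp := (gauge_on G p).1 Sp; have Vp := Sigma_neq G Sp.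
set d := dotp _ _.
have key : d != 0 -> \forall t \near (0 : R)^'+, 0 < t /\ `|rho (p + t *: X) - 1 - t * d| <= t * (`|d| / 2).
  move=> d0; have d1 : 0 < `|d| by rewrite normr_gt0.
  have K0 : 0 < `|X| + 1 by rewrite ltr_wpDl.
  have e0 : 0 < `|d| / 2 / (`|X| + 1) by rewrite !divr_gt0.
  have [r r0 [rU hr]] := strict_diff oV Vp (gauge_CO G 1) e0.
  have r1 : 0 < r / (`|X| + 1) by rewrite divr_gt0.
  near=> t; have t0 : 0 < t by near: t; exact: nbhs_right_gt.
  have tr : t < r / (`|X| + 1) by near: t; exact: nbhs_right_lt.
  split=> //.
  have tX : `|t *: X| <= t * (`|X| + 1) by rewrite normrZ gtr0_norm // ler_pM2l // lerDl.
  have := hr p (t *: X); rewrite subrr normr0 [_ + _ - p]addrC addKr rp dotpZr => /(_ r0).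
  move=> /(_ (le_lt_trans tX _)); rewrite -ltr_pdivlMr // => /(_ tr) h.
  apply: (le_trans h); have -> : t * (`|d| / 2) = `|d| / 2 / (`|X| + 1) * (t * (`|X| + 1)).
    by field; rewrite gt_eqF.
  by rewrite ler_pM2l.
split=> d0.
- have d1 : d != 0 by rewrite gt_eqF.
  apply: filterS (key d1) => t [t0]; rewrite (gtr0_norm d0) ler_norml => /andP[h _].
  move=> /(gauge_in G) h2; have : 0 < t * d by rewrite mulr_gt0.
  by move: h h2; rewrite mulrA; lra.
- have d1 : d != 0 by rewrite lt_eqF.
  apply: filterS (key d1) => t [t0]; rewrite (ltr0_norm d0) ler_norml => /andP[_ h].
  apply/(gauge_in G); have : t * d < 0 by rewrite pmulr_rlt0.
  by move: h; rewrite mulrA mulrN; lra.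
Unshelve. all: by end_near. Qed.

Variables (g : Rn -> 'M[R]_n).

(** The clause that the normal leaves Omega decides the sign: by [gauge_side] a vector on which d
    rho is negative points into Omega. *)
Lemma unit_normal_metric p : Sigma p -> posdef (g p) -> (g p)^T = g p ->
  unit_normal Omega Sigma g p = metric_normal (g p) (grad rho p).
Proof.
move=> Sp pg gT; have rp := (gauge_on G p).1 Sp.
have N0 : grad rho p != 0 by apply: (grad_gauge_neq0 G); rewrite rp.
have [side1 _] := gauge_side (metric_normal (g p) (grad rho p)) Sp.
have U : is_unit_normal Omega Sigma g p (metric_normal (g p) (grad rho p)).
  split; first exact: metric_normal_unit.
  - by move=> X /(gauge_tangent G X Sp) h; rewrite form_metric_normal // h mulr0.
  - apply: side1; rewrite dotpZr mulr_gt0 ?conormal_scale_gt0 //.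
    by rewrite dotpC; exact: conormal_gt0.
have : is_unit_normal Omega Sigma g p (unit_normal Omega Sigma g p).
  by apply: (@xgetPex _ 0); exists (metric_normal (g p) (grad rho p)).
move=> [h1 h2 h3]; apply: metric_normal_unique => //.
  by move=> X NX; apply: h2; exact/(gauge_tangent G X Sp).
rewrite leNgt; apply/negP => neg.
have [_ /(_ neg) side2] := gauge_side (unit_normal Omega Sigma g p) Sp.
by have [t [k1 k2]] := filter_ex (filterI h3 side2).
Qed.

End Normals.

Section DifferentiableMetric.
Variables (R : realType) (n : nat) (V : normedModType R).
Local Notation Rn := 'rV[R]_n.
Implicit Types (M : V -> 'M[R]_n) (W : V -> Rn) (p : V) (i j k : 'I_n).

Lemma near_differentiable (f f' : V -> R) p : (\forall y \near p, f y = f' y) ->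
  differentiable f p -> differentiable f' p.
Proof.
move=> ff' df.
have key : f' \o shift p = cst (f' p) + 'd f p +o_ 0 id.
  apply/eqaddoP => e e0; have /diff_locally/eqaddoP/(_ e e0) h := df.
  have h2 : \forall y \near (0 : V), f (y + p) = f' (y + p).
    by have := ff'; rewrite (near_shift 0) /= subr0.
  apply: filterS2 h h2 => y h3 h4.
  move: h3; rewrite /cst /= !fctE /= h4.
  by rewrite (nbhs_singleton ff').
have dE := diff_unique (diff_continuous df) key.
by apply/diff_locallyP; rewrite dE; split=> //; exact: diff_continuous df.
Qed.

Lemma differentiable_det (m : nat) (M : V -> 'M[R]_m) p :
  (forall i j : 'I_m, differentiable (fun y => M y i j) p) -> differentiable (fun y => \det (M y)) p.
Proof.
move=> dM; pose P (f : V -> R) := differentiable f p.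
have Pcst c : P (fun=> c) by exact: differentiable_cst.
have Padd f g : P f -> P g -> P (fun y => f y + g y) by exact: differentiableD.
have Pmul f g : P f -> P g -> P (fun y => f y * g y) by exact: differentiableM.
rewrite /determinant; apply: (closed_sum Pcst Padd) => s; apply: (Pmul) => //.
by apply: (closed_prod Pcst Pmul) => i; exact: dM.
Qed.

(** Cramer's rule: entries of the inverse are quotients of polynomials in the entries. *)
Lemma differentiable_invmx M p i j : (forall a b, differentiable (fun y => M y a b) p) ->
  (\forall y \near p, M y \in unitmx) -> differentiable (fun y => invmx (M y) i j) p.
Proof.
move=> dM uM.
have d0 : \det (M p) != 0 by rewrite -unitfE -unitmxE; exact: nbhs_singleton uM.
apply: (@near_differentiable (fun y => (\det (M y))^-1 * \adj (M y) i j)).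
  by apply: filterS uM => y uy; rewrite /invmx uy [in RHS]mxE.
apply: differentiableM; first by apply: differentiableV => //; exact: differentiable_det.
have -> : (fun y => \adj (M y) i j) = fun y => (-1) ^+ (j + i) * \det (row' j (col' i (M y))).
  by apply/funext => y; rewrite mxE.
apply: differentiableM; first exact: differentiable_cst.
apply: differentiable_det => a b.
have -> : (fun y => row' j (col' i (M y)) a b) = fun y => M y (lift j a) (lift i b).
  by apply/funext => y; rewrite !mxE.
exact: dM.
Qed.

Lemma differentiable_rV W p : (forall i, differentiable (fun y => W y 0 i) p) ->
  differentiable W p.
Proof.
move=> dW.
have -> : W = \sum_i (fun y => W y 0 i *: basis_vec R i).
  by apply/funext => y; rewrite {1}(row_sum_basis (W y)) fct_sumE.
by apply: differentiable_sum => i; exact: differentiableZl.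
Qed.

(** The domain is any normed space because this is applied twice: to points near p for a fixed
    metric, and to the parameter s at a fixed point. *)
Lemma differentiable_conormal M W p :
  (forall a b, differentiable (fun y => M y a b) p) ->
  (forall a, differentiable (fun y => W y 0 a) p) ->
  (\forall y \near p, posdef (M y)) -> W p != 0 ->
  [/\ forall i, differentiable (fun y => conormal_dual (M y) (W y) 0 i) p,
      differentiable (fun y => dotp (conormal_dual (M y) (W y)) (W y)) p,
      differentiable (fun y => conormal_scale (M y) (W y)) p &
      forall i, differentiable (fun y => metric_normal (M y) (W y) 0 i) p].
Proof.
move=> dM dW pM W0; pose P (f : V -> R) := differentiable f p.
have Pcst c : P (fun=> c) by exact: differentiable_cst.
have Padd f g : P f -> P g -> P (fun y => f y + g y) by exact: differentiableD.
have Pmul f g : P f -> P g -> P (fun y => f y * g y) by exact: differentiableM.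
have du i : P (fun y => conormal_dual (M y) (W y) 0 i).
  have -> : (fun y => conormal_dual (M y) (W y) 0 i) = fun y => \sum_k W y 0 k * invmx (M y) k i.
    by apply/funext => y; rewrite mxE.
  apply: (closed_sum Pcst Padd) => k; apply: Pmul; first exact: dW.
  apply: differentiable_invmx => //; apply: filterS pM => y; exact: posdef_unit.
have dd : P (fun y => dotp (conormal_dual (M y) (W y)) (W y)).
  by apply: (closed_sum Pcst Padd) => k; apply: Pmul; [exact: du|exact: dW].
have u0 := conormal_gt0 (nbhs_singleton pM) W0.
have ds : P (fun y => conormal_scale (M y) (W y)).
  apply: differentiableV; last by rewrite gt_eqF // sqrtr_gt0.
  apply: (@differentiable_comp _ _ _ _ (fun y => dotp (conormal_dual (M y) (W y)) (W y)) Num.sqrt) => //.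
  by apply/derivable1_diffP; case: (is_derive1_sqrt u0).
split=> // i; have -> : (fun y => metric_normal (M y) (W y) 0 i) =
    fun y => conormal_scale (M y) (W y) * conormal_dual (M y) (W y) 0 i.
  by apply/funext => y; rewrite mxE.
exact: Pmul.
Qed.

End DifferentiableMetric.

Section TripleSums.
Variables (R : realType) (n : nat).
Implicit Types (i j k : 'I_n) (V X Y : 'I_n -> R).

Lemma exchange_big3 (F : 'I_n -> 'I_n -> 'I_n -> R) :
  \sum_k \sum_i \sum_j F k i j = \sum_i \sum_j \sum_k F k i j.
Proof. by rewrite exchange_big; apply: eq_bigr => i _; rewrite exchange_big. Qed.

Lemma sum_lie V X Y (A : 'I_n -> 'I_n -> 'I_n -> R) (d g : 'I_n -> 'I_n -> R) :
  (forall i j, g i j = g j i) ->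
  \sum_i \sum_j X i * (\sum_k (V k * A k i j + d i k * g k j + d j k * g i k)) * Y j =
  \sum_k V k * (\sum_i \sum_j X i * Y j * A k i j) +
  \sum_k \sum_j (\sum_i X i * d i k) * g k j * Y j +
  \sum_k \sum_j (\sum_i Y i * d i k) * g k j * X j.
Proof.
move=> gs.
have -> : \sum_k V k * (\sum_i \sum_j X i * Y j * A k i j) =
    \sum_i \sum_j \sum_k V k * (X i * Y j * A k i j).
  rewrite -exchange_big3; apply: eq_bigr => k _; rewrite mulr_sumr.
  by apply: eq_bigr => i _; rewrite mulr_sumr.
have e (X' Y' : 'I_n -> R) : \sum_k \sum_j (\sum_i X' i * d i k) * g k j * Y' j =
    \sum_i \sum_j \sum_k X' i * d i k * g k j * Y' j.
  rewrite -exchange_big3; apply: eq_bigr => k _; rewrite exchange_big /=.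
  by apply: eq_bigr => j _; rewrite !mulr_suml.
rewrite !e [X in _ = _ + X]exchange_big /= -!big_split; apply: eq_bigr => i _ /=.
rewrite -!big_split; apply: eq_bigr => j _ /=.
rewrite -!big_split mulr_sumr mulr_suml; apply: eq_bigr => k _ /=.
by rewrite [g i k]gs; ring.
Qed.

Lemma sum_dsecond V X Y (A : 'I_n -> 'I_n -> 'I_n -> R) :
  \sum_k V k * (\sum_i \sum_j X i * Y j * (A k i j - A i k j - A j k i)) =
  \sum_k V k * (\sum_i \sum_j X i * Y j * A k i j)
  - \sum_k \sum_j V k * (\sum_i A i k j * X i) * Y j
  - \sum_k \sum_j V k * (\sum_i A i k j * Y i) * X j.
Proof.
rewrite -!sumrB; apply: eq_bigr => k _.
have e (X' Y' : 'I_n -> R) : \sum_j V k * (\sum_i A i k j * X' i) * Y' j =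
    V k * \sum_i \sum_j X' i * Y' j * A i k j.
  rewrite exchange_big mulr_sumr; apply: eq_bigr => j _.
  by rewrite -mulrA mulr_suml; congr (_ * _); apply: eq_bigr => i _; ring.
rewrite !e [X in _ = _ - _ * X]exchange_big /= -!mulrBr; congr (_ * _).
rewrite -!sumrB; apply: eq_bigr => i _; rewrite -!sumrB; apply: eq_bigr => j _; ring.
Qed.

(** The symmetrised covariant derivative of a vector field is the Lie derivative of the metric: on
    exchanging i and j, the Christoffel terms cancel except for the derivative of g along V. *)
Lemma lie_split (r : R) V (A : 'I_n -> 'I_n -> 'I_n -> R) (d g : 'I_n -> 'I_n -> R) i j :
  (forall k i j, A k i j = A k j i) -> (forall i j, g i j = g j i) ->
  (\sum_k d i k * g k j + r / 2 * \sum_l V l * (A i l j + A l i j - A j i l)) +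
  (\sum_k d j k * g k i + r / 2 * \sum_l V l * (A j l i + A l j i - A i j l)) =
  \sum_k (V k * (r * A k i j) + d i k * g k j + d j k * g i k).
Proof.
move=> As gs; rewrite !mulr_sumr -!big_split /=; apply: eq_bigr => k _.
by rewrite (As i k j) (As j k i) [g i k]gs (As k j i); field.
Qed.

Lemma christoffel_scale (r c u v w : R) : c * (r * u + r * v - r * w) = r * (c * (u + v - w)).
Proof. by ring. Qed.

End TripleSums.

Section TraceAlgebra.
Variables (R : realType) (n : nat) (N : 'rV[R]_n).
Hypothesis N0 : N != 0.
Implicit Types (i j k a l : 'I_n) (X Y : 'rV[R]_n) (M g : 'M[R]_n).

Definition tangent_proj : 'M[R]_n := 1%:M - (dotp N N)^-1 *: (N^T *m N).

Lemma tangent_projE i j : tangent_proj i j = (i == j)%:R - N 0 i * N 0 j / dotp N N.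
Proof. by rewrite !mxE big_ord1 !mxE mulrC. Qed.

Let NN : N *m N^T = (dotp N N)%:M.
Proof. by rewrite [LHS]mx11_scalar -dotpE. Qed.

Let NN0 : dotp N N != 0. Proof. by rewrite gt_eqF // dotp_gt0. Qed.

Lemma tangent_projN : N *m tangent_proj = 0.
Proof.
rewrite /tangent_proj mulmxBr mulmx1 -scalemxAr mulmxA NN mul_scalar_mx scalerA mulVf //.
by rewrite scale1r subrr.
Qed.

Lemma tangent_proj_sym i j : tangent_proj i j = tangent_proj j i.
Proof. by rewrite !tangent_projE eq_sym [N 0 i * _]mulrC. Qed.

Lemma tangent_proj_idem : tangent_proj *m tangent_proj = tangent_proj.
Proof.
rewrite {1}/tangent_proj mulmxBl mul1mx -scalemxAl -mulmxA tangent_projN mulmx0 scaler0.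
by rewrite subr0.
Qed.

Lemma dotp_tangent_proj a : dotp N (row a tangent_proj) = 0.
Proof.
have := congr1 (fun M : 'rV[R]_n => M 0 a) tangent_projN.
rewrite [X in X = _ -> _]mxE [X in _ = X -> _]mxE => e; rewrite -[RHS]e; apply: eq_bigr => j _.
by rewrite mxE tangent_proj_sym.
Qed.

(** The rows of the projection replace an orthonormal frame of the tangent space: as the projection
    is symmetric and idempotent, they sum to the same trace. *)
Lemma sum_tangent_proj M :
  \sum_a Defs.form M (row a tangent_proj) (row a tangent_proj) =
  \sum_i \sum_j tangent_proj i j * M i j.
Proof.
set P := tangent_proj.
transitivity (\sum_a \sum_i \sum_j P a i * M i j * P a j).
  apply: eq_bigr => a _; rewrite form_sum; apply: eq_bigr => i _; apply: eq_bigr => j _.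
  by rewrite !(mxE _ _ _ i) !(mxE _ _ _ j).
rewrite (exchange_big3 (fun a i j => P a i * M i j * P a j)).
apply: eq_bigr => i _; apply: eq_bigr => j _.
have -> : P i j = \sum_a P i a * P a j by rewrite /P -{1}tangent_proj_idem mxE.
rewrite mulr_suml; apply: eq_bigr => a _.
have e : P a i = P i a := tangent_proj_sym a i.
by rewrite e; ring.
Qed.

(** Let Q be the left side and P the projection. Q kills N, so Q P = Q; and V g is a multiple of N,
    so Q g P = P. Agreement of g with the Euclidean metric on tangent vectors is P g P = P. Hence Q
    = Q P = Q P g P = Q g P = P. *)
Lemma induced_inverse g (V : 'rV[R]_n) (mu : R) : g \in unitmx -> g^T = g ->
  V *m g = mu *: N -> mu * dotp V N = 1 -> V = mu *: (N *m invmx g) ->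
  (forall X Y, dotp N X = 0 -> dotp N Y = 0 -> Defs.form g X Y = dotp X Y) ->
  invmx g - V^T *m V = tangent_proj.
Proof.
move=> ug gT Vg VN VE gP; set Q := _ - _; set P := tangent_proj.
have iT : (invmx g)^T = invmx g by rewrite trmx_inv gT.
have VTE : V^T = mu *: (invmx g *m N^T) by rewrite VE linearZ /= trmx_mul iT.
have VN1 : V *m N^T = (dotp V N)%:M by rewrite [LHS]mx11_scalar -dotpE.
have QN : Q *m N^T = 0.
  rewrite /Q mulmxBl -mulmxA VN1 mul_mx_scalar VTE scalerA mulrC VN scale1r.
  by rewrite subrr.
have QP : Q *m P = Q.
  by rewrite /P /tangent_proj mulmxBr mulmx1 -scalemxAr mulmxA QN mul0mx scaler0 subr0.
have QgP : Q *m g *m P = P.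
  rewrite /Q mulmxBl mulVmx // -mulmxA Vg mulmxBl mul1mx -mulmxA -scalemxAl tangent_projN.
  by rewrite scaler0 mulmx0 subr0.
have PgP : P *m g *m P = P.
  rewrite -[RHS]tangent_proj_idem -/P; apply/matrixP => a b.
  have rE (M : 'M[R]_n) : (M *m P) a b = dotp (row a M) (row b P).
    rewrite mxE; apply: eq_bigr => j _; rewrite [row a M 0 j]mxE [row b P 0 j]mxE.
    by rewrite /P tangent_proj_sym.
  rewrite !rE row_mul -formE; apply: gP; exact: dotp_tangent_proj.
by rewrite -QP -{1}PgP !mulmxA QP QgP.
Qed.

Lemma sum_symmetrize (Q L T : 'I_n -> 'I_n -> R) : (forall i j, Q i j = Q j i) ->
  (forall i j, L i j + L j i = T i j) ->
  \sum_i \sum_j Q i j * L i j = 2^-1 * \sum_i \sum_j Q i j * T i j.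
Proof.
move=> Qs LT; set S := LHS.
have e : \sum_i \sum_j Q i j * T i j = S + S.
  rewrite {1}/S /S [X in _ = _ + X]exchange_big -big_split; apply: eq_bigr => i _ /=.
  by rewrite -big_split; apply: eq_bigr => j _ /=; rewrite -LT [Q j i]Qs; ring.
by rewrite e; field.
Qed.

End TraceAlgebra.

Section MetricVariation.
Variables (R : realType) (n : nat).
Implicit Types (i j k : 'I_n) (s : R).

Lemma ebar_varE (h : 'rV[R]_n -> 'M[R]_n) s y i j : ebar_var h s y i j = (i == j)%:R + s * h y i j.
Proof. by rewrite !mxE. Qed.

Lemma near_posdef (E : set 'rV[R]_n) (h : 'rV[R]_n -> 'M[R]_n) p :
  (forall i j, {within E, continuous (fun y => h y i j)}) -> E p -> exists2 s0 : R, 0 < s0 &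
  forall s, `|s| < s0 -> \forall y \near p, E y -> posdef (ebar_var h s y).
Proof.
move=> ch Ep.
pose B : R := \sum_(ij : 'I_n * 'I_n) `|h p ij.1 ij.2| + 1.
have B0 : 0 <= B by rewrite addr_ge0 // sumr_ge0.
have [d d0 hd] := @fin_radius R ('I_n * 'I_n)%type
  (fun ij (d : R) => forall y, E y -> `|y - p| < d -> `|h y ij.1 ij.2 - h p ij.1 ij.2| <= 1)
  (fun ij d d' dd hd y Ey yp => hd y Ey (lt_le_trans yp (andP dd).2))
  (fun ij => (withinP _ _).1 (ch ij.1 ij.2) p Ep 1 ltr01).
have nB : 0 < n%:R * B + 1 by rewrite ltr_wpDl // mulr_ge0.
exists (2^-1 / (n%:R * B + 1)); first by rewrite divr_gt0.
move=> s hs; apply/nbhs_ballP; exists d => // y; rewrite -ball_normE /ball_ /= distrC => yp Ey.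
apply: (@near_id_posdef _ _ _ _ B) => //.
  move=> i j; have := hd (i, j) y Ey yp; rewrite /= => h1.
  have h2 : `|h p i j| <= \sum_(ij : 'I_n * 'I_n) `|h p ij.1 ij.2|.
    by rewrite (bigD1 (i, j)) //= lerDl sumr_ge0.
  rewrite -[h y i j](subrK (h p i j)) (le_trans (ler_normD _ _)) //.
  by rewrite addrC; apply: lerD.
move: hs; rewrite ltr_pdivlMr // => /ltW; apply: le_trans.
by rewrite ler_wpM2l // lerDl.
Qed.

End MetricVariation.

(** * Normal, second fundamental form and mean curvature along 1 + s h *)

Section NormalVariation.
Variables (R : realType) (n : nat).
Local Notation Rn := 'rV[R]_n.
Local Notation e_ i := (basis_vec R i).
Local Notation D i f := (fun x => 'D_(basis_vec R i) f x).
Implicit Types (f : Rn -> R) (x y z X Y : Rn) (i j k a b l : 'I_n) (s t : R).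
Variables (Omega Sigma : set Rn) (x0 : Rn) (rho : Rn -> R).
Hypothesis G : gauge Omega Sigma x0 rho.
Let E := ~` Omega.
Let V0 : set Rn := ~` [set x0].
Let oV : open V0. Proof. exact: open_punctured. Qed.
Let reg := exterior_regular G.
Let EV : E `<=` V0. Proof. by move=> x; exact: (ext_neq G). Qed.
Local Notation prj := (prj x0 rho).

Variables (h : Rn -> 'M[R]_n) (p : Rn).
Hypotheses (hh : forall i j, UC E 1 (fun y => h y i j)).
Hypotheses (hsym : forall y, E y -> (h y)^T = h y).
Hypothesis Sp : Sigma p.
Let N : Rn := grad rho p.
Let Ep : E p. Proof. exact: (Sigma_ext G). Qed.
Let N0 : N != 0.
Proof. by apply: (grad_gauge_neq0 G); rewrite ((gauge_on G p).1 Sp). Qed.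
Local Notation g s := (ebar_var h s).

Let near_pos : exists2 s0 : R, 0 < s0 &
  forall s, `|s| < s0 -> \forall y \near p, E y -> posdef (g s y).
Proof. by apply: near_posdef => // i j; exact: UC_cont (hh i j). Qed.

Lemma ebar_var_sym s y : E y -> (g s y)^T = g s y.
Proof. by move=> Ey; rewrite /ebar_var linearD /= linearZ /= hsym // trmx1. Qed.

Lemma continuous_prj : {for p, continuous prj}.
Proof.
apply: differentiable_continuous; apply: differentiable_rV => i.
by apply: CO_differentiable oV (Sigma_neq G Sp) (CO_prj G 1 i).
Qed.

Lemma near_prj (A : set Rn) : (\forall y \near p, E y -> A y) -> \forall y \near p, A (prj y).
Proof.
move=> hA.
have h1 : \forall y \near p, E (prj y) -> A (prj y).
  have cp : prj @ p --> prj p := continuous_prj.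
  by rewrite (prj_id G Sp) in cp; exact: (cp [set y | E y -> A y] hA).
have h2 : \forall y \near p, V0 y.
  by apply: open_nbhs_nbhs; split; [exact: oV|exact: (Sigma_neq G Sp)].
apply: filterS2 h1 h2 => y k Vy; apply: k; apply: (Sigma_ext G); exact: (Sigma_prj G).
Qed.

(** In the formula of [differentiable_comp_prj] the correction is a multiple of N.X, which is zero
    for tangent X. *)
Lemma is_derive_tangential f X : UC E 1 f -> dotp N X = 0 ->
  is_derive p X (fun y => f (prj y)) (\sum_i pd E i f p * X 0 i).
Proof.
move=> hf NX; have [df dE] := differentiable_comp_prj G hf Sp.
apply: DeriveDef; first exact: diff_derivable.
rewrite (derive_sum_coord X df).
under eq_bigr do rewrite dE mulrBl.
rewrite big_split /= sumrN -[RHS]subr0; congr (_ - _).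
set c := \sum_j pd _ _ _ _ * _.
have -> : \sum_i grad rho p 0 i * c * X 0 i = c * dotp N X.
  by rewrite /dotp mulr_sumr; apply: eq_bigr => i _; ring.
by rewrite NX mulr0.
Qed.

Lemma is_derive_prj X : dotp N X = 0 -> is_derive p X prj X.
Proof.
move=> NX; have -> : X = \row_j X 0 j by apply/rowP => j; rewrite mxE.
apply: is_derive_rV => j; apply: DeriveDef.
  by apply: diff_derivable; exact: CO_differentiable oV (Sigma_neq G Sp) (CO_prj G 1 j).
rewrite -[in LHS](_ : X = \row_j X 0 j); last by apply/rowP => k; rewrite mxE.
rewrite derive_sum_coord; last exact: CO_differentiable oV (Sigma_neq G Sp) (CO_prj G 1 j).
under eq_bigr do rewrite (D_prj G) // mulrBl.
rewrite big_split /= sumrN.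
have -> : \sum_i grad rho p 0 i * (p - x0) 0 j * X 0 i = (p - x0) 0 j * dotp N X.
  by rewrite /dotp mulr_sumr; apply: eq_bigr => i _; ring.
rewrite NX mulr0 subr0 (bigD1 j) //= eqxx mul1r big1 ?addr0 // => i ij.
by rewrite (negbTE ij) mul0r.
Qed.

Let UCN i : UC E 1 (fun y => grad rho y 0 i).
Proof.
apply: (@UC_congr _ _ _ reg 1 (D i rho)); first by move=> y _; rewrite gradE.
by apply: (CO_UC reg oV EV); apply: CO_D; exact: (gauge_CO G 2).
Qed.

Section FixedParameter.
Variable s : R.
Hypothesis pos : \forall y \near p, E y -> posdef (g s y).
Let Vp := normal_ext Omega Sigma (g s) p.

Let posp : posdef (g s p). Proof. exact: (nbhs_singleton pos). Qed.

Let pos_prj : \forall y \near p, posdef (g s (prj y)).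
Proof. exact: (near_prj (A := fun y => posdef (g s y))). Qed.

Let conormal_diff :=
  @differentiable_conormal R n Rn (fun y => g s (prj y)) (fun y => grad rho (prj y)) p.

Lemma differentiable_entry a b : differentiable (fun y => g s (prj y) a b) p.
Proof.
have -> : (fun y => g s (prj y) a b) = (fun y => (a == b)%:R + s * h (prj y) a b).
  by apply/funext => y; rewrite ebar_varE.
apply: differentiableD; first exact: differentiable_cst.
apply: differentiableM; first exact: differentiable_cst.
by have [] := differentiable_comp_prj G (hh a b) Sp.
Qed.

Lemma differentiable_grad_prj a : differentiable (fun y => grad rho (prj y) 0 a) p.
Proof. by have [] := differentiable_comp_prj G (UCN a) Sp. Qed.

Let cd : _ := conormal_diff differentiable_entry differentiable_grad_prj pos_prj.

(** [normal_ext] is a choice with default 0, so an admissible extension must be exhibited: the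
    normal field composed with [prj]. The extension actually chosen is known only on [Sigma], hence
    is used through its composition with [prj] and through derivatives in tangent directions. *)
Lemma normal_ext_spec : differentiable Vp p /\
  \forall y \near p, Vp (prj y) = metric_normal (g s (prj y)) (grad rho (prj y)).
Proof.
have N0' : grad rho (prj p) != 0 by rewrite (prj_id G).
have [_ _ _ dV] := cd N0'.
pose W y := metric_normal (g s (prj y)) (grad rho (prj y)).
have unE : \forall y \near p, Sigma y -> unit_normal Omega Sigma (g s) y = metric_normal (g s y) (grad rho y).
  apply: filterS pos => y ps Sy; have Ey := Sigma_ext G Sy.
  by apply: (unit_normal_metric G) => //; [exact: ps|exact: ebar_var_sym].
have : [set V : Rn -> Rn | differentiable V p /\
    \forall x \near p, Sigma x -> V x = unit_normal Omega Sigma (g s) x] Vp.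
  apply: (@xgetPex _ (fun=> 0)); exists W; split; first exact: differentiable_rV.
  apply: filterS unE => y e Sy; rewrite e // /W (prj_id G Sy) //.
move=> /= [d1 d2]; split=> //.
have hS : \forall y \near p, Sigma (prj y).
  have h2 : \forall y \near p, V0 y.
    by apply: open_nbhs_nbhs; split; [exact: oV|exact: (Sigma_neq G Sp)].
  by apply: filterS h2 => y; exact: (Sigma_prj G).
have h3 : \forall y \near p, Sigma (prj y) ->
    Vp (prj y) = metric_normal (g s (prj y)) (grad rho (prj y)).
  apply: (near_prj (A := fun y => Sigma y -> Vp y = metric_normal (g s y) (grad rho y))).
  apply: filterS2 d2 unE => y e1 e2 _ Sy.
  by rewrite e1 // e2.
by apply: filterS2 hS h3 => y k; apply.
Qed.

Lemma normal_extE : Vp p = metric_normal (g s p) N.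
Proof. by have [_ /nbhs_singleton] := normal_ext_spec; rewrite (prj_id G). Qed.

Lemma derive_coord (V : Rn -> Rn) y X k : differentiable V y ->
  'D_X (fun z => V z 0 k) y = 'D_X V y 0 k.
Proof. by move=> dV; rewrite derive_mx ?mxE //; exact: diff_derivable. Qed.

Lemma differentiable_row_coord (V : Rn -> Rn) y k : differentiable V y ->
  differentiable (fun z => V z 0 k) y.
Proof.
by move=> dV; apply: (@differentiable_comp _ _ _ _ V (fun M : Rn => M 0 k)) => //; exact: differentiable_coord.
Qed.

Definition dnormal X k : R := \sum_i X 0 i * 'D_(e_ i) Vp p 0 k.
Definition gauge_hess X Y : R := \sum_j (\sum_i D i (D j rho) p * X 0 i) * Y 0 j.

Lemma is_derive_normal X k : dotp N X = 0 -> is_derive p X (fun y => Vp (prj y) 0 k) (dnormal X k).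
Proof.
move=> NX; have [dV _] := normal_ext_spec.
have df : differentiable (fun y => Vp y 0 k) (prj p).
  by rewrite (prj_id G) //; exact: differentiable_row_coord.
apply: (is_derive_eq (is_derive_comp df (is_derive_prj NX))).
by apply: eq_bigr => i _; rewrite (prj_id G) // derive_coord // mulrC.
Qed.

(* Differentiate [V g = mu N] along [X] and pair with [Y]; the derivative of [mu]
   drops out because [Y] is tangent. *)
Lemma weingarten X Y : dotp N X = 0 -> dotp N Y = 0 ->
  \sum_k \sum_j dnormal X k * g s p k j * Y 0 j =
  conormal_scale (g s p) N * gauge_hess X Y -
  s * \sum_k \sum_j Vp p 0 k * (\sum_i pd E i (fun y => h y k j) p * X 0 i) * Y 0 j.
Proof.
move=> NX NY; have N0' : grad rho (prj p) != 0 by rewrite (prj_id G).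
have [_ _ dmu _] := cd N0'.
pose mu y := conormal_scale (g s (prj y)) (grad rho (prj y)).
pose F1 y := \sum_k \sum_j (Vp (prj y) 0 k * g s (prj y) k j) * Y 0 j.
pose F2 y := mu y * \sum_j grad rho (prj y) 0 j * Y 0 j.
have F12 : \forall y \near p, F1 y = F2 y.
  have [_ hV] := normal_ext_spec; apply: filterS2 hV pos_prj => y e ps.
  rewrite /F1 e; transitivity (Defs.form (g s (prj y)) (metric_normal (g s (prj y)) (grad rho (prj y))) Y).
    by rewrite form_sum.
  by rewrite form_metric_normal.
pose dg X k j := s * \sum_i pd E i (fun y => h y k j) p * X 0 i.
have d1 : is_derive p X F1 (\sum_k \sum_j (dnormal X k * g s p k j + Vp p 0 k * dg X k j) * Y 0 j).
  apply: isD_sum => k; apply: isD_sum => j.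
  have h1 := is_derive_normal k NX.
  have h2 : is_derive p X (fun y => g s (prj y) k j) (0 + dg X k j).
    have -> : (fun y => g s (prj y) k j) = (fun y => (k == j)%:R + s * h (prj y) k j).
      by apply/funext => y; rewrite ebar_varE.
    exact: isD_add (is_derive_cst _ _ _) (isD_scale s (is_derive_tangential (hh k j) NX)).
  have h3 := isD_mul (isD_mul h1 h2) (is_derive_cst (Y 0 j) p X).
  by apply: (is_derive_eq h3); rewrite (prj_id G) // /cst /=; ring.
have d2 : is_derive p X F2 ('D_X mu p * 0 + conormal_scale (g s p) N * gauge_hess X Y).
  have hm : is_derive p X mu ('D_X mu p) by apply: derivableP; exact: diff_derivable.
  have hN : is_derive p X (fun y => \sum_j grad rho (prj y) 0 j * Y 0 j) (gauge_hess X Y).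
    apply: isD_sum => j.
    have := isD_mul (is_derive_tangential (UCN j) NX) (is_derive_cst (Y 0 j) p X).
    move=> h3; apply: (is_derive_eq h3); rewrite mulr0 addr0; congr (_ * _).
    apply: eq_bigr => i _; congr (_ * _).
    rewrite -(pd_CO reg i oV EV (CO_D j (gauge_CO G 2)) Ep).
    by apply: (pd_congr reg i (UCN j)) => // y _; rewrite gradE.
  have := isD_mul hm hN; move=> h3; apply: (is_derive_eq h3).
  rewrite /mu (prj_id G) //; congr (_ * _ + _); exact: NY.
have := near_eq_derive X F12; rewrite (@derive_val _ _ _ _ _ _ _ d1) (@derive_val _ _ _ _ _ _ _ d2).
rewrite mulr0 add0r => <-; rewrite mulr_sumr -sumrB; apply: eq_bigr => k _.
by rewrite mulr_sumr -sumrB; apply: eq_bigr => j _; rewrite /dg; ring.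
Qed.

Lemma gauge_hess_sym X Y : gauge_hess X Y = gauge_hess Y X.
Proof.
rewrite /gauge_hess; under eq_bigr do rewrite mulr_suml.
rewrite exchange_big; apply: eq_bigr => i _; rewrite mulr_suml; apply: eq_bigr => j _.
by rewrite (schwarz i j oV (Sigma_neq G Sp) (gauge_CO G 2)); ring.
Qed.

Lemma pd_entry k i j : pd E k (fun y => g s y i j) p = s * pd E k (fun y => h y i j) p.
Proof.
have hs : UC E 1 (fun y => s * h y i j) by apply: (UC_mul reg) => //; exact: (UC_cst reg).
transitivity (pd E k (fun y => (i == j)%:R + s * h y i j) p).
  apply: (pd_congr reg k) Ep; last by move=> y _; rewrite ebar_varE.
  apply: (@UC_congr _ _ _ reg 1 (fun y => (i == j)%:R + s * h y i j)) => [y _|].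
    by rewrite ebar_varE.
  by apply: (UC_add reg) => //; exact: (UC_cst reg).
have c1 := UC_cst reg 1 ((i == j)%:R : R); have c2 := UC_cst reg 1 s.
have e1 := pd_add reg k c1 hs Ep; have e2 := pd_mul reg k c2 (hh i j) Ep.
have z1 := pd_cst reg ((i == j)%:R : R) k Ep; have z2 := pd_cst reg s k Ep.
apply: etrans e1 _; apply: etrans (congr2 (fun u v : R => u + v) z1 e2) _.
by rewrite add0r; apply: etrans (congr1 (fun u : R => u * _ + _) z2) _; rewrite mul0r add0r.
Qed.

Lemma pd_hsym k i j : pd E k (fun y => h y i j) p = pd E k (fun y => h y j i) p.
Proof.
by apply: (pd_congr reg k (hh i j)) Ep => y Ey; rewrite -[in LHS]hsym // mxE.
Qed.

Definition dsecond k X Y : R := \sum_i \sum_j X 0 i * Y 0 j *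
  (pd E k (fun y => h y i j) p - pd E i (fun y => h y k j) p - pd E j (fun y => h y k i) p).

(** The Lie derivative contains the derivatives of the normal along X and along Y; [weingarten]
    replaces both by the Hessian of rho and first derivatives of h, so the choice of extension
    disappears. *)
Lemma second_ffE X Y : dotp N X = 0 -> dotp N Y = 0 ->
  second_ff Omega Sigma (g s) p X Y =
  conormal_scale (g s p) N * gauge_hess X Y +
  s / 2 * \sum_k metric_normal (g s p) N 0 k * dsecond k X Y.
Proof.
move=> NX NY; rewrite -normal_extE -/Vp /second_ff form_sum.
have T1 := weingarten NX NY; have T2 := weingarten NY NX.
rewrite gauge_hess_sym in T2.
pose Q := \sum_k Vp p 0 k * \sum_i \sum_j X 0 i * Y 0 j * pd E k (fun y => h y i j) p.
pose TX := \sum_k \sum_j dnormal X k * g s p k j * Y 0 j.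
pose TY := \sum_k \sum_j dnormal Y k * g s p k j * X 0 j.
have e1 : \sum_i \sum_j X 0 i * lie (~` Omega) Vp (g s) p i j * Y 0 j = s * Q + TX + TY.
  have gsym i j : g s p i j = g s p j i by rewrite -[in LHS](ebar_var_sym s Ep) mxE.
  have := @sum_lie R n (Vp p 0) (X 0) (Y 0) (fun k i j => s * pd E k (fun y => h y i j) p)
    (fun i k => 'D_(e_ i) Vp p 0 k) (g s p) gsym.
  rewrite -/TX -/TY => e; apply: etrans (etrans e _).
    apply: eq_bigr => i _; apply: eq_bigr => j _; congr (_ * _ * _); rewrite mxE.
    by apply: eq_bigr => k _; rewrite pd_entry.
  congr (_ + _ + _); rewrite mulr_sumr; apply: eq_bigr => k _.
  rewrite mulrCA; congr (_ * _); rewrite mulr_sumr; apply: eq_bigr => i _.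
  by rewrite mulr_sumr; apply: eq_bigr => j _; rewrite mulrCA.
have e2 : \sum_k Vp p 0 k * dsecond k X Y = Q
  - \sum_k \sum_j Vp p 0 k * (\sum_i pd E i (fun y => h y k j) p * X 0 i) * Y 0 j
  - \sum_k \sum_j Vp p 0 k * (\sum_i pd E i (fun y => h y k j) p * Y 0 i) * X 0 j.
  exact: (@sum_dsecond R n (Vp p 0) (X 0) (Y 0) (fun k i j => pd E k (fun y => h y i j) p)).
by rewrite e1 e2 /TX /TY T1 T2; field.
Qed.

Lemma nabla_lower i j : \sum_k g s p j k * nabla E (g s) Vp i k p =
  \sum_k 'D_(e_ i) Vp p 0 k * g s p k j + s / 2 * \sum_l Vp p 0 l *
    (pd E i (fun y => h y l j) p + pd E l (fun y => h y i j) p - pd E j (fun y => h y i l) p).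
Proof.
have gsym a b : g s p a b = g s p b a by rewrite -[in LHS](ebar_var_sym s Ep) mxE.
have [B BE] : exists B : 'I_n -> 'I_n -> R, forall l m, B l m =
    pd E i (fun y => h y l m) p + pd E l (fun y => h y i m) p - pd E m (fun y => h y i l) p.
  by exists (fun l m => pd E i (fun y => h y l m) p + pd E l (fun y => h y i m) p
    - pd E m (fun y => h y i l) p).
have cE k l : christoffel E (g s) k i l p = s / 2 * \sum_m invmx (g s p) k m * B l m.
  rewrite [s / 2]mulrC -mulrA /christoffel; congr (_ * _).
  rewrite mulr_sumr; apply: eq_bigr => m _.
  apply: etrans (congr1 (fun z : R => invmx (g s p) k m * z) (congr2 (fun u v : R => u - v)
    (congr2 (fun u v : R => u + v) (pd_entry i l m) (pd_entry l i m)) (pd_entry m i l))) _.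
  exact: etrans (christoffel_scale _ _ _ _ _) (congr1 (fun z : R => s * (_ * z)) (esym (BE l m))).
have inv_ l : \sum_k g s p j k * (\sum_m invmx (g s p) k m * B l m) = B l j.
  transitivity (\sum_m (g s p *m invmx (g s p)) j m * B l m).
    under eq_bigr do rewrite mulr_sumr.
    rewrite exchange_big; apply: eq_bigr => m _; rewrite mxE mulr_suml.
    by apply: eq_bigr => k _; rewrite mulrA.
  rewrite mulmxV ?posdef_unit // (bigD1 j) //= mxE eqxx mul1r big1 ?addr0 // => m mj.
  by rewrite mxE eq_sym (negbTE mj) mul0r.
under eq_bigr do rewrite /nabla mulrDr.
rewrite big_split /=; congr (_ + _).
  by apply: eq_bigr => k _; rewrite gsym mulrC.
under eq_bigr do rewrite mulr_sumr.
rewrite exchange_big mulr_sumr; apply: eq_bigr => l _.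
apply: etrans _ (congr1 (fun z : R => _ * (_ * z)) (BE l j)).
rewrite -(inv_ l) !mulr_sumr; apply: eq_bigr => k _.
by rewrite cE; ring.
Qed.

(* As [h] has no tangential part, the inverse of the induced metric is the Euclidean
   projection for every [s]. *)
Lemma mean_curvE :
  (forall X Y, dotp N X = 0 -> dotp N Y = 0 -> Defs.form (h p) X Y = 0) ->
  mean_curv Omega Sigma (g s) p = \sum_a second_ff Omega Sigma (g s) p
    (row a (tangent_proj N)) (row a (tangent_proj N)).
Proof.
move=> hP; set P := tangent_proj N.
have gT := ebar_var_sym s Ep; have ug := posdef_unit posp.
have gsym a b : g s p a b = g s p b a by rewrite -[in LHS]gT mxE.
pose V := Vp p; pose Q := invmx (g s p) - V^T *m V.
have QP : Q = P.
  apply: (@induced_inverse _ _ _ N0 (g s p) V (conormal_scale (g s p) N)) => //.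
  - by rewrite /V normal_extE metric_normalK.
  - rewrite /V normal_extE dotpZl mulrA -expr2; exact: conormal_scaleK.
  - by rewrite /V normal_extE.
  move=> X Y NX NY; rewrite formE /ebar_var mulmxDr mulmx1 -scalemxAr dotpDl dotpZl.
  by rewrite -formE hP // mulr0 addr0.
have Qs i j : P i j = P j i := tangent_proj_sym N i j.
pose L i j := \sum_k g s p j k * nabla E (g s) Vp i k p.
transitivity (\sum_i \sum_j P i j * L i j).
  apply: eq_bigr => i _; apply: eq_bigr => j _; rewrite mulr_sumr; apply: eq_bigr => k _.
  by rewrite -QP /Q !mxE big_ord1 !mxE mulrA.
have LT i j : L i j + L j i = lie E Vp (g s) p i j.
  apply: etrans (congr2 (fun u v : R => u + v) (nabla_lower i j) (nabla_lower j i)) _.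
  apply: etrans (@lie_split R n s (Vp p 0) (fun k i j => pd E k (fun y => h y i j) p)
    (fun i k => 'D_(e_ i) Vp p 0 k) (g s p) i j pd_hsym gsym) _.
  apply: etrans _ (esym (mxE _ _ _ _)); apply: eq_bigr => k _.
  exact: (congr1 (fun z : R => Vp p 0 k * z + _ + _) (esym (pd_entry k i j))).
rewrite (sum_symmetrize Qs LT) -sum_tangent_proj // mulr_sumr.
by apply: eq_bigr => a _.
Qed.

End FixedParameter.

Let A := dotp N N.
Let A0 : 0 < A. Proof. exact: dotp_gt0. Qed.
Let mu0 := conormal_scale 1%:M N.
Let hNN := Defs.form (h p) N N.

Let g0 : g 0 p = 1%:M.
Proof. by rewrite /ebar_var scale0r addr0. Qed.

Let cd1 : conormal_dual 1%:M N = N.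
Proof. by rewrite /conormal_dual invmx1 mulmx1. Qed.

Lemma near_param (Q : R -> Prop) :
  (forall s, (\forall y \near p, E y -> posdef (g s y)) -> Q s) -> \forall s \near (0 : R), Q s.
Proof.
move=> hQ; have [s0 s00 hs] := near_pos.
apply/nbhs_ballP; exists s0 => // s; rewrite -ball_normE /ball_ /= sub0r normrN => /hs.
exact: hQ.
Qed.

(** With u = N g^{-1}, the relation N = u + s u h gives u.N = A - s psi(s) and psi(0) = h(N, N).
    Differentiating mu^2 (u.N) = 1 at s = 0 then gives the derivative of the scale mu, without
    differentiating the inverse matrix explicitly. *)
Lemma conormal_param :
  [/\ forall i, differentiable (fun s => conormal_dual (g s p) N 0 i) (0 : R),
      is_derive (0 : R) 1 (fun s => conormal_scale (g s p) N) (mu0 * (hNN / (2 * A))) &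
      forall i, differentiable (fun s => metric_normal (g s p) N 0 i) (0 : R)].
Proof.
have pp : \forall s \near (0 : R), posdef (g s p).
  by apply: near_param => s /nbhs_singleton; exact.
have dg a b : differentiable (fun s => g s p a b) (0 : R).
  have -> : (fun s => g s p a b) = (fun s => (a == b)%:R + s * h p a b).
    by apply/funext => s; rewrite ebar_varE.
  by apply: differentiableD; [exact: differentiable_cst|apply: differentiableM => //; exact: differentiable_cst].
have dN a : differentiable (fun s : R => N 0 a) (0 : R) by exact: differentiable_cst.
have [du dd dm dV] := @differentiable_conormal R n R (fun s => g s p) (fun=> N) 0 dg dN pp N0.
split=> //.
pose psi s := \sum_i \sum_j conormal_dual (g s p) N 0 i * h p i j * N 0 j.
have dpsi : differentiable psi (0 : R).
  apply: (@closed_sum _ _ (fun f : R -> R => differentiable f (0 : R))) => [c|f1 f2|i].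
  - exact: differentiable_cst.
  - exact: differentiableD.
  apply: (@closed_sum _ _ (fun f : R -> R => differentiable f (0 : R))) => [c|f1 f2|j].
  - exact: differentiable_cst.
  - exact: differentiableD.
  by apply: differentiableM => //; apply: differentiableM => //; exact: differentiable_cst.
have psi0 : psi 0 = hNN by rewrite /psi g0 cd1 -form_sum.
pose phi s := dotp (conormal_dual (g s p) N) N.
have phiE : \forall s \near (0 : R), A - s * psi s = phi s.
  apply: filterS pp => s ps; have e := conormal_dualK N ps.
  rewrite /A -{1}e /ebar_var mulmxDr mulmx1 -scalemxAr dotpDl dotpZl.
  by rewrite /psi -form_sum formE addrK.
have dpsi1 : is_derive (0 : R) 1 psi ('D_1 psi 0) by apply: derivableP; exact: diff_derivable.
have dphi : is_derive (0 : R) 1 phi (- hNN).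
  have h1 := isD_sub (is_derive_cst A (0 : R) 1) (isD_mul (is_derive_id (0 : R) 1) dpsi1).
  apply: near_eq_is_derive phiE _; apply: (is_derive_eq h1).
  by rewrite psi0 mul1r mul0r addr0 sub0r.
pose mu s := conormal_scale (g s p) N.
have dmu : is_derive (0 : R) 1 mu ('D_1 mu 0) by apply: derivableP; exact: diff_derivable.
have mu1 : \forall s \near (0 : R), mu s * mu s * phi s = 1.
  by apply: filterS pp => s ps; have := conormal_scaleK ps N0; rewrite expr2.
have := @near_eq_derive R R R _ _ 0 1 mu1; rewrite derive_cst.
rewrite (@derive_val _ _ _ _ _ _ _ (isD_mul (isD_mul dmu dmu) dphi)).
have -> : mu 0 = mu0 by rewrite /mu g0.
have -> : phi 0 = A by rewrite /phi g0 cd1.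
have mu00 : 0 < mu0 by rewrite /mu0 -g0; apply: conormal_scale_gt0 => //; exact: (nbhs_singleton pp).
move=> e; apply: (is_derive_eq dmu).
apply: (mulfI (lt0r_neq0 mu00)).
have A1 : A != 0 by rewrite gt_eqF.
have -> : mu0 * (mu0 * (hNN / (2 * A))) = (mu0 * mu0 * hNN) / (2 * A) by field.
apply/eqP; rewrite eq_sym; apply/eqP; apply: (canLR (mulfK _)); first by rewrite mulf_neq0.
by move: e; lra.
Qed.

Definition second_ff_var X Y : R :=
  mu0 * (hNN / (2 * A) * gauge_hess X Y + 2^-1 * \sum_k N 0 k * dsecond k X Y).

Lemma is_derive_second_ff X Y : dotp N X = 0 -> dotp N Y = 0 ->
  is_derive (0 : R) 1 (fun s => second_ff Omega Sigma (g s) p X Y) (second_ff_var X Y).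
Proof.
move=> NX NY; have [_ dmu dV] := conormal_param.
have key : \forall s \near (0 : R),
  conormal_scale (g s p) N * gauge_hess X Y +
  s * (2^-1 * \sum_k metric_normal (g s p) N 0 k * dsecond k X Y) =
  second_ff Omega Sigma (g s) p X Y.
  by apply: near_param => s ps; rewrite second_ffE //; ring.
pose S s := 2^-1 * \sum_k metric_normal (g s p) N 0 k * dsecond k X Y.
have dS : differentiable S (0 : R).
  apply: differentiableM; first exact: differentiable_cst.
  apply: (@closed_sum _ _ (fun f : R -> R => differentiable f (0 : R))) => [c|f1 f2|k].
  - exact: differentiable_cst.
  - exact: differentiableD.
  by apply: differentiableM => //; exact: differentiable_cst.
have dS1 : is_derive (0 : R) 1 S ('D_1 S 0) by apply: derivableP; exact: diff_derivable.
have h1 := isD_add (isD_mul dmu (is_derive_cst (gauge_hess X Y) (0 : R) 1))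
  (isD_mul (is_derive_id (0 : R) 1) dS1).
apply: near_eq_is_derive key _; apply: (is_derive_eq h1).
rewrite mulr0 addr0 mul1r mul0r addr0 /second_ff_var mulrDr; congr (_ + _); first exact: esym (mulrA _ _ _).
rewrite /S mulrCA; congr (_ * _); rewrite mulr_sumr; apply: eq_bigr => k _.
by rewrite /metric_normal g0 cd1 mxE mulrA.
Qed.

Lemma DA_second_ff X Y : dotp N X = 0 -> dotp N Y = 0 ->
  DA Omega Sigma h p X Y = second_ff_var X Y.
Proof.
by move=> NX NY; rewrite /DA derive1E; exact: (@derive_val _ _ _ _ _ _ _ (is_derive_second_ff NX NY)).
Qed.

Lemma DH_second_ff :
  (forall X Y, dotp N X = 0 -> dotp N Y = 0 -> Defs.form (h p) X Y = 0) ->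
  DH Omega Sigma h p =
  \sum_a second_ff_var (row a (tangent_proj N)) (row a (tangent_proj N)).
Proof.
move=> hP; rewrite /DH derive1E.
have key : \forall s \near (0 : R), \sum_a second_ff Omega Sigma (g s) p
    (row a (tangent_proj N)) (row a (tangent_proj N)) = mean_curv Omega Sigma (g s) p.
  by apply: near_param => s ps; rewrite mean_curvE.
have d := isD_sum (fun a => is_derive_second_ff (dotp_tangent_proj N0 a) (dotp_tangent_proj N0 a)).
exact: (@derive_val _ _ _ _ _ _ _ (near_eq_is_derive key d)).
Qed.

End NormalVariation.

Section JetAlgebra.
Variables (R : realType) (n : nat) (N X Y : 'rV[R]_n).
Variables (m : 'I_n -> 'I_n -> R) (P dh : 'I_n -> 'I_n -> 'I_n -> R).
Hypotheses (NX : dotp N X = 0) (NY : dotp N Y = 0).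
Hypothesis Ps : forall k i j, P k i j = P i k j.
Hypothesis dhE : forall k i j, dh k i j = N 0 k * m i j + P k i j + P k j i.
Implicit Types (i j k : 'I_n).

(** Here [P k i j] is the second derivative of the gauge field, symmetric in k and i. Terms with N
    paired with X or Y drop out, and the symmetries leave only the Hessian of the normal component
    of the field. *)
Lemma normal_dsecond :
  \sum_k N 0 k * (\sum_i \sum_j X 0 i * Y 0 j * (dh k i j - dh i k j - dh j k i)) =
  dotp N N * (\sum_i \sum_j X 0 i * m i j * Y 0 j)
  - 2 * \sum_k N 0 k * (\sum_i \sum_j X 0 i * Y 0 j * P i j k).
Proof.
rewrite /dotp mulr_suml mulr_sumr -sumrB; apply: eq_bigr => k _.
have e : \sum_i \sum_j X 0 i * Y 0 j * (dh k i j - dh i k j - dh j k i) =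
    N 0 k * (\sum_i \sum_j X 0 i * m i j * Y 0 j)
    - dotp N X * (\sum_j Y 0 j * m k j) - dotp N Y * (\sum_i X 0 i * m k i)
    - 2 * (\sum_i \sum_j X 0 i * Y 0 j * P i j k).
  have -> : dotp N X * (\sum_j Y 0 j * m k j) = \sum_i \sum_j N 0 i * X 0 i * (Y 0 j * m k j).
    by rewrite /dotp mulr_suml; apply: eq_bigr => i _; rewrite mulr_sumr.
  have -> : dotp N Y * (\sum_i X 0 i * m k i) = \sum_i \sum_j N 0 j * Y 0 j * (X 0 i * m k i).
    by rewrite mulr_sumr; apply: eq_bigr => i _; rewrite mulr_suml.
  rewrite !mulr_sumr -!sumrB; apply: eq_bigr => i _.
  rewrite !mulr_sumr -!sumrB; apply: eq_bigr => j _.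
  by rewrite !dhE (Ps k i j) (Ps k j i) (Ps j i k); ring.
by rewrite e NX NY !mul0r !subr0 mulrBr; ring.
Qed.

Lemma hess_contract (d : 'I_n -> 'I_n -> R) (a : 'I_n -> R) (w : R) :
  \sum_i \sum_j X 0 i * Y 0 j * (d i j * w + N 0 j * a i + N 0 i * a j) =
  (\sum_j (\sum_i d i j * X 0 i) * Y 0 j) * w.
Proof.
have e1 : \sum_i \sum_j N 0 j * Y 0 j * (X 0 i * a i) = 0.
  transitivity (dotp N Y * \sum_i X 0 i * a i); last by rewrite NY mul0r.
  rewrite mulr_sumr; by apply: eq_bigr => i _; rewrite /dotp mulr_suml.
have e2 : \sum_i \sum_j N 0 i * X 0 i * (Y 0 j * a j) = 0.
  transitivity (dotp N X * \sum_j Y 0 j * a j); last by rewrite NX mul0r.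
  rewrite mulr_suml; by apply: eq_bigr => i _; rewrite mulr_sumr.
transitivity (\sum_i \sum_j d i j * X 0 i * Y 0 j * w +
    \sum_i \sum_j N 0 j * Y 0 j * (X 0 i * a i) + \sum_i \sum_j N 0 i * X 0 i * (Y 0 j * a j)).
  rewrite -!big_split; apply: eq_bigr => i _ /=; rewrite -!big_split; apply: eq_bigr => j _ /=.
  by ring.
rewrite e1 e2 !addr0 exchange_big mulr_suml; apply: eq_bigr => j _.
by rewrite !mulr_suml.
Qed.

End JetAlgebra.

Section GaugeVariation.
Variables (R : realType) (n : nat).
Local Notation Rn := 'rV[R]_n.
Local Notation e_ i := (basis_vec R i).
Local Notation D i f := (fun x => 'D_(basis_vec R i) f x).
Implicit Types (f : Rn -> R) (x y p X Y : Rn) (i j k a b l : 'I_n).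
Variables (Omega Sigma : set Rn) (x0 : Rn) (rho : Rn -> R).
Hypotheses (G : gauge Omega Sigma x0 rho) (oOm : open Omega).
Let E := ~` Omega.
Let V0 : set Rn := ~` [set x0].
Let oV : open V0. Proof. exact: open_punctured. Qed.
Let reg := exterior_regular G.
Let EV : E `<=` V0. Proof. by move=> x; exact: (ext_neq G). Qed.

Variables (h : Rn -> 'M[R]_n).
Hypotheses (hh : forall i j, UC E 2 (fun y => h y i j)).
Hypotheses (hsym : forall y, E y -> (h y)^T = h y).
Hypothesis htan : forall p X Y, Sigma p -> dotp (grad rho p) X = 0 -> dotp (grad rho p) Y = 0 ->
  Defs.form (h p) X Y = 0.
Let H i j y := h y i j.
Let hh1 i j : UC E 1 (fun y => h y i j). Proof. exact: UC_leS. Qed.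
Let Hsym i j y : E y -> H i j y = H j i y.
Proof. by move=> Ey; rewrite /H -[in LHS]hsym // mxE. Qed.
Let Htan p X Y : Sigma p -> dotp (grad rho p) X = 0 -> dotp (grad rho p) Y = 0 ->
  \sum_k \sum_l X 0 k * H k l p * Y 0 l = 0.
Proof. by move=> Sp NX NY; rewrite -form_sum; exact: htan. Qed.
Let UCW := UC_gauge_W G hh.
Let UCZ := UC_gauge_Z G hh.
Local Notation W := (gauge_W x0 rho H).
Local Notation Z := (gauge_Z x0 rho H).
Local Notation m i j p := (gauge_m Omega x0 rho H i j p).

Let drop (u : R) (r s t w : R) : u = 1 -> r + s + (t + (u + -1) * w) = r + s + t.
Proof. by move=> ->; rewrite subrr mul0r addr0. Qed.

(** Of the second derivative of (rho - 1) W only the terms in which rho - 1 is differentiated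
    survive on [Sigma]. *)
Lemma pd_pd_gauge_Z i j k p : Sigma p -> pd E i (pd E j (Z k)) p =
  D i (D j rho) p * W k p + grad rho p 0 j * pd E i (W k) p + grad rho p 0 i * pd E j (W k) p.
Proof.
rewrite !gradE.
move=> Sp; have Ep := Sigma_ext G Sp; have rp := (gauge_on G p).1 Sp.
have c1 : UC E 1 (D j rho) by apply: (CO_UC reg oV EV); apply: CO_D; exact: (gauge_CO G 2).
have c2 : UC E 1 (W k) := UC_leS (UCW k).
have c3 : UC E 1 (fun x => rho x + -1).
  apply: (UC_add reg); last exact: (UC_cst reg).
  by apply: (CO_UC reg oV EV); exact: gauge_CO G 1.
have c4 : UC E 1 (pd E j (W k)) := UC_pd j (UCW k).
apply: etrans (pd_congr reg i (UC_pd j (UCZ k)) (fun x Ex => pd_gauge_Z G hh j k Ex) Ep) _.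
apply: etrans (pd_add reg i (UC_mul reg c1 c2) (UC_mul reg c3 c4) Ep) _.
apply: etrans (congr2 (fun u v : R => u + v) (pd_mul reg i c1 c2 Ep) (pd_mul reg i c3 c4 Ep)) _.
have e1 : pd E i (D j rho) p = D i (D j rho) p := pd_CO reg i oV EV (CO_D j (gauge_CO G 2)) Ep.
have e2 := pd_defining G i Ep.
apply: etrans (drop _ _ _ _ rp) _.
exact: (congr2 (fun u v : R => u * W k p + D j rho p * pd E i (W k) p + v * pd E j (W k) p) e1 e2).
Qed.

Lemma hess_gauge_Z k p X Y : Sigma p -> dotp (grad rho p) X = 0 -> dotp (grad rho p) Y = 0 ->
  \sum_i \sum_j X 0 i * Y 0 j * pd E i (pd E j (Z k)) p = gauge_hess rho p X Y * W k p.
Proof.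
move=> Sp NX NY.
apply: etrans _ (hess_contract NX NY (fun i j => D i (D j rho) p) (fun i => pd E i (W k) p) (W k p)).
apply: eq_bigr => i _; apply: eq_bigr => j _.
exact: (congr1 (fun z : R => X 0 i * Y 0 j * z) (pd_pd_gauge_Z i j k Sp)).
Qed.

Lemma tensor_Sigma i j p : Sigma p -> h p i j = grad rho p 0 i * W j p + grad rho p 0 j * W i p.
Proof.
move=> Sp; have Ep := Sigma_ext G Sp; have rp := (gauge_on G p).1 Sp.
have dZ a l : pd E a (Z l) p = grad rho p 0 a * W l p.
  apply: etrans (pd_gauge_Z G hh a l Ep) _; rewrite gradE.
  by rewrite rp subrr mul0r addr0.
have := reduced_Sigma G hh Hsym Htan i j Sp; move=> /eqP; rewrite subr_eq0 => /eqP e.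
exact: etrans e (congr2 (fun u v : R => u + v) (dZ i j) (dZ j i)).
Qed.

Lemma pd_tensor k i j p : Sigma p -> pd E k (fun y => h y i j) p =
  grad rho p 0 k * m i j p + pd E k (pd E i (Z j)) p + pd E k (pd E j (Z i)) p.
Proof.
move=> Sp; have Ep := Sigma_ext G Sp.
have cZ a l : UC E 1 (pd E a (Z l)) := UC_pd a (UCZ l).
have cR := UC_reduced G hh UCZ i j.
have e : pd E k (fun y => h y i j) p =
    pd E k (fun y => reduced Omega H Z i j y + (pd E i (Z j) y + pd E j (Z i) y)) p.
  by apply: (pd_congr reg k (hh1 i j)) Ep => y _; rewrite /reduced subrK.
apply: etrans e _; apply: etrans (pd_add reg k cR (UC_add reg (cZ i j) (cZ j i)) Ep) _.
apply: etrans (congr2 (fun u v : R => u + v) (pd_reduced G hh Hsym Htan k i j Sp)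
  (pd_add reg k (cZ i j) (cZ j i) Ep)) _.
exact: addrA.
Qed.

Let scale_cancel (mu A NW hN r M : R) : A != 0 -> hN = 2 * A * NW ->
  mu * (hN / (2 * A) * r + 2^-1 * (A * M - 2 * (r * NW))) = mu * A / 2 * M.
Proof. by move=> A0 ->; field. Qed.

Let pairing (a b u w : R) : a * (a * w + b * u) * b = a * a * (b * w) + b * b * (a * u).
Proof. by ring. Qed.

Let sum_pairing (a w : 'I_n -> R) :
  \sum_i \sum_j (a i * a i * (a j * w j) + a j * a j * (a i * w i)) =
  2 * (\sum_k a k * a k) * \sum_k a k * w k.
Proof.
under eq_bigr do rewrite big_split -mulr_sumr -mulr_suml /=.
by rewrite big_split -mulr_suml -mulr_sumr /=; ring.
Qed.

(** The gauge field vanishes on [Sigma], so it does not affect the variation of A. Concretely, h(N,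
    N) = 2 A (N.W) makes the rescaling of the normal equal and opposite to the contribution of the
    second derivatives of Z, both being multiples of the Hessian of rho on X and Y. *)
Lemma second_ff_var_gauge p X Y : Sigma p -> dotp (grad rho p) X = 0 -> dotp (grad rho p) Y = 0 ->
  second_ff_var Omega rho h p X Y =
  conormal_scale 1%:M (grad rho p) * dotp (grad rho p) (grad rho p) / 2 *
  \sum_i \sum_j X 0 i * m i j p * Y 0 j.
Proof.
move=> Sp NX NY; set N := grad rho p; have Ep := Sigma_ext G Sp.
have N0 : N != 0 by apply: (grad_gauge_neq0 G); rewrite ((gauge_on G p).1 Sp).
have A0 : dotp N N != 0 by rewrite gt_eqF // dotp_gt0.
have e1 : Defs.form (h p) N N = 2 * dotp N N * \sum_k N 0 k * W k p.
  rewrite form_sum; transitivity (\sum_i \sum_j (N 0 i * N 0 i * (N 0 j * W j p) +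
      N 0 j * N 0 j * (N 0 i * W i p))).
    apply: eq_bigr => i _; apply: eq_bigr => j _.
    exact: etrans (congr1 (fun z : R => N 0 i * z * N 0 j) (tensor_Sigma i j Sp)) (pairing _ _ _ _).
  exact: sum_pairing (fun k => N 0 k) (fun k => W k p).
have e2 := @normal_dsecond R n N X Y (fun i j => m i j p) (fun k i j => pd E k (pd E i (Z j)) p)
  (fun k i j => pd E k (fun y => h y i j) p) NX NY
  (fun k i j => pd_schwarz reg k i (UCZ j) Ep) (fun k i j => pd_tensor k i j Sp).
have e3 : \sum_k N 0 k * (\sum_i \sum_j X 0 i * Y 0 j * pd E i (pd E j (Z k)) p) =
    gauge_hess rho p X Y * \sum_k N 0 k * W k p.
  rewrite mulr_sumr; apply: eq_bigr => k _.
  by apply: etrans (congr1 (fun z : R => N 0 k * z) (hess_gauge_Z k Sp NX NY)) _; rewrite mulrCA.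
apply: etrans _ (scale_cancel _ _ _ A0 e1); congr (_ * (_ + _ * _)).
exact: etrans e2 (congr1 (fun z : R => _ - 2 * z) e3).
Qed.

Hypothesis hDH : forall p, Sigma p -> DH Omega Sigma h p = 0.

(** DH is a nonzero multiple of the trace of m against the tangential projection, that is of tr m -
    m(N, N) / |N|^2. *)
Lemma gauge_trace p : Sigma p -> dotp (grad rho p) (grad rho p) * (\sum_i m i i p) =
  \sum_j grad rho p 0 j * \sum_i grad rho p 0 i * m i j p.
Proof.
move=> Sp; set N := grad rho p.
have N0 : N != 0 by apply: (grad_gauge_neq0 G); rewrite ((gauge_on G p).1 Sp).
have A0 : dotp N N != 0 by rewrite gt_eqF // dotp_gt0.
have pid : posdef (1%:M : 'M[R]_n).
  by move=> X X0; rewrite formE mulmx1 dotp_gt0.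
have mu0 : conormal_scale 1%:M N != 0 by rewrite gt_eqF // conormal_scale_gt0.
have := hDH Sp.
rewrite (DH_second_ff G hh1 hsym Sp) -/N; last by move=> X Y; exact: htan.
pose M : 'M[R]_n := \matrix_(i, j) m i j p.
rewrite (eq_bigr (fun a => conormal_scale 1%:M N * dotp N N / 2 *
  Defs.form M (row a (tangent_proj N)) (row a (tangent_proj N)))); last first.
  move=> a _; rewrite second_ff_var_gauge //; try exact: dotp_tangent_proj.
  congr (_ * _); rewrite form_sum; apply: eq_bigr => i _; apply: eq_bigr => j _.
  by rewrite [M i j]mxE.
rewrite -mulr_sumr sum_tangent_proj // => /eqP.
rewrite !mulf_eq0 (negbTE mu0) (negbTE A0) invr_eq0 pnatr_eq0 /= => /eqP e.
have e1 : \sum_i \sum_j (tangent_proj N) i j * M i j =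
    \sum_i m i i p - (dotp N N)^-1 * \sum_j N 0 j * \sum_i N 0 i * m i j p.
  transitivity (\sum_i \sum_j ((i == j)%:R * m i j p - (dotp N N)^-1 * (N 0 j * (N 0 i * m i j p)))).
    by apply: eq_bigr => i _; apply: eq_bigr => j _; rewrite tangent_projE [M i j]mxE; ring.
  under eq_bigr do rewrite sumrB -mulr_sumr.
  rewrite sumrB -mulr_sumr; congr (_ - _ * _).
    apply: eq_bigr => i _; rewrite (bigD1 i) //= eqxx mul1r big1 ?addr0 // => j ji.
    by rewrite eq_sym (negbTE ji) mul0r.
  rewrite exchange_big; apply: eq_bigr => j _; by rewrite mulr_sumr.
move: e; rewrite e1 => /eqP; rewrite subr_eq0 => /eqP ->.
by rewrite mulVKf.
Qed.

Variables (Lam : (Rn -> R) -> R) (LamP : is_integral Lam).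
Variables (v : Rn -> R) (q : R).
Hypothesis hv : UC E 2 v.
Hypothesis E1 : forall i j x, E° x -> 2^-1 * \sum_l (D l (D i (H j l)) x + D l (D j (H i l)) x
   - D l (D l (H i j)) x - D j (D i (H l l)) x) = D i (D j v) x.
Hypothesis E2 : forall x, E° x -> \sum_i D i (D i v) x = 0.
Hypotheses (q00 : 0 < q) (q1 : (n%:R - 2) / 2 < q) (gh : forall i j, growth E (- q) (H i j))
  (gp : forall a i j, growth E (- 1 - q) (pd E a (H i j)))
  (gv : growth E (- q) v) (gV : forall a, growth E (- 1 - q) (pd E a v)).

Theorem DA_zero p X Y : Sigma p -> tangent Sigma p X -> tangent Sigma p Y ->
  DA Omega Sigma h p X Y = 0.
Proof.
move=> Sp /(gauge_tangent G _ Sp) NX /(gauge_tangent G _ Sp) NY.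
rewrite (DA_second_ff G hh1 hsym Sp) // second_ff_var_gauge //.
rewrite (tangential_m_zero G oOm hh Hsym Htan LamP hv E1 E2 q00 q1 gh gp gv gV gauge_trace Sp NX NY).
by rewrite mulr0.
Qed.

End GaugeVariation.

(** * Linearised Ricci curvature *)

Section RicciVariation.
Variables (R : realType) (n : nat).
Local Notation Rn := 'rV[R]_n.
Local Notation e_ i := (basis_vec R i).
Local Notation D i f := (fun x => 'D_(basis_vec R i) f x).
Implicit Types (x y : Rn) (i j k a b c l : 'I_n) (s : R).
Variables (E : set Rn) (h : Rn -> 'M[R]_n).
Let H i j y := h y i j.
Hypothesis hE : forall i j, UC E 2 (H i j).
Let U := E°.
Let oU : open U. Proof. exact: open_interior. Qed.
Let hU i j : CO U 2 (H i j). Proof. exact: UC_CO_interior. Qed.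
Local Notation g s := (ebar_var h s).

Let K i j l y := D i (H j l) y + D j (H i l) y - D l (H i j) y.
Let gam s k i j y := 2^-1 * \sum_l invmx (g s y) k l * K i j l y.

Lemma CO_K i j l : CO U 1 (K i j l).
Proof.
have m1 : CO U 1 (fun=> -1 : R) := CO_cst 1 (-1) oU.
apply: CO_congr (CO_add oU (CO_add oU (CO_D i (hU j l)) (CO_D j (hU i l)))
  (CO_mul oU m1 (CO_D l (hU i j)))) => // y _.
by rewrite /K mulN1r.
Qed.

Lemma pd_entry_interior s a i j y : U y -> pd E a (fun z => g s z i j) y = s * D a (H i j) y.
Proof.
move=> Uy; apply: etrans (pd_interior a _ Uy) _.
have -> : (fun z => g s z i j) = (fun z => (i == j)%:R + s * H i j z).
  by apply/funext => z; rewrite ebar_varE.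
have d := isD_add (is_derive_cst ((i == j)%:R : R) y (e_ a)) (isD_scale s (is_derive_CO a (hU i j) Uy)).
by rewrite (@derive_val _ _ _ _ _ _ _ d) add0r.
Qed.

Lemma christoffel_interior s k i j y : U y -> christoffel E (g s) k i j y = s * gam s k i j y.
Proof.
move=> Uy; rewrite /christoffel /gam mulrCA; congr (_ * _).
rewrite mulr_sumr; apply: eq_bigr => l _.
apply: etrans (congr1 (fun z : R => invmx (g s y) k l * z) (congr2 (fun u v : R => u - v)
  (congr2 (fun u v : R => u + v) (pd_entry_interior s i j l Uy) (pd_entry_interior s j i l Uy))
  (pd_entry_interior s l i j Uy))) _.
exact: christoffel_scale.
Qed.

Variables (x : Rn) (Ux : U x).
Let dinv s a k l : R := - (s * \sum_b \sum_c invmx (g s x) k b * D a (H b c) x * invmx (g s x) c l).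
Let dgam s a k i j : R := 2^-1 * \sum_l (dinv s a k l * K i j l x + invmx (g s x) k l * D a (K i j l) x).
Let Ric s i j : R := \sum_k (dgam s k k i j - dgam s j k i k) + s * \sum_k \sum_l
  (gam s k k l x * gam s l i j x - gam s k j l x * gam s l i k x).

Section FixedParameter.
Variable s : R.
Hypothesis pos : \forall y \near x, E y -> posdef (g s y).

Let unit_near : \forall y \near x, g s y \in unitmx.
Proof.
have h1 : \forall y \near x, U y by apply: open_nbhs_nbhs; split.
by apply: filterS2 pos h1 => y k /interior_subset/k; exact: posdef_unit.
Qed.

Let dentry a b : differentiable (fun y => g s y a b) x.
Proof.
have -> : (fun z => g s z a b) = (fun z => (a == b)%:R + s * H a b z).
  by apply/funext => z; rewrite ebar_varE.
apply: differentiableD; first exact: differentiable_cst.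
apply: differentiableM; first exact: differentiable_cst.
exact: CO_differentiable oU Ux (hU a b).
Qed.

(** Differentiate g^{-1} g = 1 entry by entry and solve for the derivative of the inverse. *)
Lemma is_derive_inverse a k l : is_derive x (e_ a) (fun y => invmx (g s y) k l) (dinv s a k l).
Proof.
pose J k l := 'D_(e_ a) (fun y => invmx (g s y) k l) x.
have dJ b c : is_derive x (e_ a) (fun y => invmx (g s y) b c) (J b c).
  by apply: derivableP; apply: diff_derivable; exact: differentiable_invmx.
have e b c : \sum_d (J b d * g s x d c + invmx (g s x) b d * (s * D a (H d c) x)) = 0.
  have dg d : is_derive x (e_ a) (fun y => g s y d c) (0 + s * D a (H d c) x).
    have -> : (fun z => g s z d c) = (fun z => (d == c)%:R + s * H d c z).
      by apply/funext => z; rewrite ebar_varE.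
    exact: isD_add (is_derive_cst ((d == c)%:R : R) x (e_ a)) (isD_scale s (is_derive_CO a (hU d c) Ux)).
  have d1 := isD_sum (fun d => isD_mul (dJ b d) (dg d)).
  have near1 : \forall y \near x, \sum_d invmx (g s y) b d * g s y d c = (b == c)%:R.
    apply: filterS unit_near => y uy; transitivity ((invmx (g s y) *m g s y) b c).
      by rewrite mxE.
    by rewrite mulVmx // mxE.
  have := near_eq_derive (e_ a) near1; rewrite derive_cst (@derive_val _ _ _ _ _ _ _ d1) => e0.
  by apply: etrans e0; apply: eq_bigr => d _; rewrite add0r.
pose JM : 'M[R]_n := \matrix_(i, j) J i j; pose DM : 'M[R]_n := \matrix_(i, j) D a (H i j) x.
have eM : JM *m g s x = - (s *: (invmx (g s x) *m DM)).
  apply/eqP; rewrite -addr_eq0; apply/eqP/matrixP => b c; rewrite mxE [RHS]mxE -[RHS](e b c).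
  rewrite big_split /=; congr (_ + _); first by rewrite mxE; apply: eq_bigr => d _; rewrite mxE.
  rewrite mxE [(invmx _ *m _) b c]mxE mulr_sumr; apply: eq_bigr => d _.
  by rewrite [DM d c]mxE mulrCA.
have ux : g s x \in unitmx := nbhs_singleton unit_near.
have JE : JM = - (s *: (invmx (g s x) *m DM *m invmx (g s x))).
  by rewrite -[JM](mulmxK ux) eM mulNmx -scalemxAl.
apply: (is_derive_eq (dJ k l)); have -> : J k l = JM k l by rewrite mxE.
rewrite JE mxE; congr (- _); rewrite mxE; congr (_ * _); rewrite mxE exchange_big.
apply: eq_bigr => c _; rewrite mxE mulr_suml; apply: eq_bigr => b _.
by rewrite [DM b c]mxE.
Qed.

Lemma derive_christoffel a k i j : pd E a (christoffel E (g s) k i j) x = s * dgam s a k i j.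
Proof.
apply: etrans (pd_interior a _ Ux) _.
have d : is_derive x (e_ a) (fun y => s * gam s k i j y) (s * dgam s a k i j).
  apply: isD_scale; apply: isD_scale; apply: isD_sum => l.
  exact: isD_mul (is_derive_inverse a k l) (is_derive_CO a (CO_K i j l) Ux).
rewrite -(@derive_val _ _ _ _ _ _ _ d).
by apply: (derive_congr _ oU Ux) => y Uy; exact: christoffel_interior.
Qed.

Let sub_eq (u v u' v' : R) : u = u' -> v = v' -> u - v = u' - v'.
Proof. by move=> -> ->. Qed.

(** Every Christoffel symbol of 1 + s h carries a factor s because the flat metric is constant.
    Factoring it out leaves [Ric], for which differentiability at s = 0 suffices. *)
Lemma ricci_interior i j : ricci E (g s) i j x = s * Ric s i j.
Proof.
rewrite /ricci /Ric mulrDr; congr (_ + _).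
  rewrite mulr_sumr; apply: eq_bigr => k _; rewrite mulrBr.
  by apply: sub_eq; exact: derive_christoffel.
rewrite !mulr_sumr; apply: eq_bigr => k _; rewrite !mulr_sumr; apply: eq_bigr => l _.
have quad (u v w z : R) : (s * u) * (s * v) - (s * w) * (s * z) = s * (s * (u * v - w * z)).
  by ring.
apply: etrans _ (quad _ _ _ _).
exact: (congr2 (fun u v : R => u - v)
  (congr2 (fun u v : R => u * v) (christoffel_interior s k k l Ux) (christoffel_interior s l i j Ux))
  (congr2 (fun u v : R => u * v) (christoffel_interior s k j l Ux) (christoffel_interior s l i k Ux))).
Qed.

End FixedParameter.

Let near_pos : exists2 s0 : R, 0 < s0 &
  forall s, `|s| < s0 -> \forall y \near x, E y -> posdef (g s y).
Proof.
by apply: near_posdef; [move=> i j; exact: UC_cont (hE i j)|exact: interior_subset].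
Qed.

Lemma differentiable_Ric i j : differentiable (fun s => Ric s i j) (0 : R).
Proof.
pose P (f : R -> R) := differentiable f (0 : R).
have Pcst (c : R) : P (fun=> c) by exact: differentiable_cst.
have Padd f1 f2 : P f1 -> P f2 -> P (fun s => f1 s + f2 s) by exact: differentiableD.
have Pmul f1 f2 : P f1 -> P f2 -> P (fun s => f1 s * f2 s) by exact: differentiableM.
have Psub f1 f2 : P f1 -> P f2 -> P (fun s => f1 s - f2 s) by exact: differentiableB.
have Ps : P (fun s => s) by apply/derivable1_diffP; exact: derivable_id.
have Pinv k l : P (fun s => invmx (g s x) k l).
  apply: differentiable_invmx => [a b|].
    have -> : (fun s => g s x a b) = (fun s => (a == b)%:R + s * h x a b).
      by apply/funext => s; rewrite ebar_varE.
    by apply: Padd => //; apply: Pmul.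
  have [s0 s00 hs] := near_pos; apply/nbhs_ballP; exists s0 => // s.
  rewrite -ball_normE /ball_ /= sub0r normrN => /hs/nbhs_singleton/(_ (interior_subset Ux)).
  exact: posdef_unit.
have Pdinv a k l : P (fun s => dinv s a k l).
  apply: differentiableN; apply: (Pmul) => //.
  by apply: (closed_sum Pcst Padd) => b; apply: (closed_sum Pcst Padd) => c; apply: (Pmul) => //; apply: (Pmul).
have Pgam k a b : P (fun s => gam s k a b x).
  by apply: (Pmul) => //; apply: (closed_sum Pcst Padd) => l; apply: (Pmul).
have Pdgam a k b c : P (fun s => dgam s a k b c).
  by apply: (Pmul) => //; apply: (closed_sum Pcst Padd) => l; apply: (Padd); apply: (Pmul).
apply: (Padd); first by apply: (closed_sum Pcst Padd) => k; apply: (Psub).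
apply: (Pmul) => //; apply: (closed_sum Pcst Padd) => k; apply: (closed_sum Pcst Padd) => l.
by apply: (Psub); apply: (Pmul).
Qed.

(** The derivative of s Ric(s) at 0 is Ric(0). There the quadratic terms and the derivative of the
    inverse metric still carry a factor s, so only second derivatives of h remain. *)
Lemma DRic_interior i j : DRic E h i j x =
  2^-1 * \sum_l (D l (D i (H j l)) x + D l (D j (H i l)) x - D l (D l (H i j)) x - D j (D i (H l l)) x).
Proof.
rewrite /DRic derive1E.
have near_ric : \forall s \near (0 : R), s * Ric s i j = ricci E (g s) i j x.
  have [s0 s00 hs] := near_pos; apply/nbhs_ballP; exists s0 => // s.
  by rewrite -ball_normE /ball_ /= sub0r normrN => /hs/ricci_interior.
have dR : is_derive (0 : R) 1 (fun s => Ric s i j) ('D_1 (fun s => Ric s i j) 0).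
  by apply: derivableP; apply: diff_derivable; exact: differentiable_Ric.
have d := near_eq_is_derive near_ric (isD_mul (is_derive_id (0 : R) 1) dR).
apply: etrans (@derive_val _ _ _ _ _ _ _ d) _.
rewrite mul1r mul0r addr0 /Ric mul0r addr0.
have g0 : invmx (g 0 x) = 1%:M by rewrite /ebar_var scale0r addr0 invmx1.
have dg a k b c : dgam 0 a k b c = 2^-1 * D a (K b c k) x.
  rewrite /dgam; congr (_ * _); rewrite (bigD1 k) //= /dinv !mul0r oppr0 mul0r add0r g0 mxE eqxx mul1r.
  by rewrite big1 ?addr0 // => l lk; rewrite mul0r oppr0 mul0r add0r mxE eq_sym (negbTE lk) mul0r.
have DK a b c l : D a (K b c l) x = D a (D b (H c l)) x + D a (D c (H b l)) x - D a (D l (H b c)) x.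
  have dd b' c' l' := is_derive_CO a (CO_D b' (hU c' l')) Ux.
  exact: (@derive_val _ _ _ _ _ _ _ (isD_sub (isD_add (dd b c l) (dd c b l)) (dd l b c))).
rewrite mulr_sumr; apply: eq_bigr => k _.
apply: etrans (congr2 (fun u v : R => u - v) (dg k k i j) (dg j k i k)) _.
have alg (u v w z r : R) : 2^-1 * (u + v - w) - 2^-1 * (z + r - r) = 2^-1 * (u + v - w - z).
  by ring.
exact: etrans (congr2 (fun u v : R => 2^-1 * u - 2^-1 * v) (DK k i j k) (DK j i k k)) (alg _ _ _ _ _).
Qed.

Lemma hess_interior v i j : UC E 2 v -> hess E v i j x = D i (D j v) x.
Proof.
move=> hv; apply: etrans (pd_interior i _ Ux) _.
by apply: (derive_congr _ oU Ux) => y Uy; exact: pd_interior.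
Qed.

Lemma laplace_interior v : UC E 2 v -> laplace E v x = \sum_i D i (D i v) x.
Proof. by move=> hv; apply: eq_bigr => i _; exact: hess_interior. Qed.

End RicciVariation.

(** * Decay of Hoelder functions *)

Section HolderDecay.
Variables (R : realType) (n : nat).
Local Notation Rn := 'rV[R]_n.
Implicit Types (E : set Rn) (f : Rn -> R) (x y : Rn) (i a : 'I_n).

Definition multi0 k : multi_index n k := [ffun=> ord0].
Definition multi1 k a : multi_index n k.+1 := [ffun i => inord (i == a)].

Lemma mi_order0 k : mi_order (multi0 k) = 0%N.
Proof. by rewrite /mi_order big1 // => i _; rewrite ffunE. Qed.

Lemma multi1E k a i : multi1 k a i = (i == a) :> nat.
Proof. by rewrite ffunE inordK //; case: eqP. Qed.

Lemma mi_order1 k a : mi_order (multi1 k a) = 1%N.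
Proof.
rewrite /mi_order (bigD1 a) //= multi1E eqxx big1 // => i ia.
by rewrite multi1E (negbTE ia).
Qed.

Lemma pdI0 E k f : pdI E (multi0 k) f = f.
Proof. by rewrite /pdI; elim: (enum _) => //= i s ->; rewrite ffunE. Qed.

Lemma pdI1 E k a f : pdI E (multi1 k a) f = pd E a f.
Proof.
rewrite /pdI; have := enum_uniq 'I_n; have := mem_enum 'I_n a.
have key (s : seq 'I_n) : uniq s ->
    foldr (fun i u => iter (multi1 k a i) (pd E i) u) f s = if a \in s then pd E a f else f.
  elim: s => //= i s ih /andP[si us]; rewrite ih // multi1E inE eq_sym.
  by case: eqP => [->|_] /=; rewrite ?(negbTE si).
by move=> am us; rewrite key // am.
Qed.

Lemma enorm_basis (t : R) i : enorm (t *: basis_vec R i) = `|t|.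
Proof.
rewrite /enorm (bigD1 i) //= big1 ?addr0 => [|j ji].
  by rewrite mxE basis_vecE eqxx mulr1 sqrtr_sqr.
by rewrite mxE basis_vecE eq_sym (negbTE ji) mulr0 expr0n.
Qed.

Variable E : set Rn.
Hypothesis far : exists z : Rn * Rn, [/\ E z.1, E z.2 & 0 < enorm (z.1 - z.2) <= enorm z.1 / 2].

(** By [far] each supremum in the norm is over a nonempty set of nonnegative numbers, so all
    summands are nonnegative and finiteness of the sum bounds each of them. *)
Lemma holder_growth k (alpha s : R) f (I : multi_index n k) : holder_space E k alpha s f ->
  (mi_order I <= k)%N -> growth E (- ((mi_order I)%:R + s)) (pdI E I f).
Proof.
move=> [_ fin] Ik; have [z0 [Ez1 Ez2 z012]] := far.
pose S1 (J : multi_index n k) := ereal_sup [set ((1 + enorm x) `^ ((mi_order J)%:R + s)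
  * `|pdI E J f x|)%R%:E | x in E].
have S10 J : (0 <= S1 J)%E.
  apply: (@le_trans _ _ ((1 + enorm z0.1) `^ ((mi_order J)%:R + s) * `|pdI E J f z0.1|)%R%:E).
    by rewrite lee_fin mulr_ge0 // powR_ge0.
  by apply: ereal_sup_ubound; exists z0.1.
have fin1 : (S1 I < +oo)%E.
  apply: le_lt_trans fin; rewrite /holder_norm.
  apply: (@le_trans _ _ (\sum_(J : multi_index n k | (mi_order J <= k)%N) S1 J)%E).
    by rewrite (bigD1 I) //= leeDl // sume_ge0.
  rewrite leeDl // sume_ge0 // => J _.
  apply: le_trans _ (ereal_sup_ubound _); last by exists z0.
  by rewrite lee_fin mulr_ge0 ?powR_ge0 // divr_ge0 // powR_ge0.
have fin2 : S1 I \is a fin_num by rewrite ge0_fin_numE.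
exists (fine (S1 I)); first exact: fine_ge0.
move=> x Ex; have px : 0 < (1 + enorm x) `^ ((mi_order I)%:R + s).
  by rewrite powR_gt0 // ltr_wpDr // enorm_ge0.
rewrite powRN -[_ * _^-1]/(_ / _) ler_pdivlMr // mulrC -lee_fin fineK //.
by apply: ereal_sup_ubound; exists x.
Qed.

Lemma holder_growth0 (alpha s : R) f : holder_space E 2 alpha s f -> growth E (- s) f.
Proof.
move=> hf; have := holder_growth (I := multi0 2) hf; rewrite mi_order0 pdI0 add0r; exact.
Qed.

Lemma holder_growth1 (alpha s : R) f a : holder_space E 2 alpha s f ->
  growth E (- 1 - s) (pd E a f).
Proof.
move=> hf; have := holder_growth (I := multi1 1 a) hf; rewrite mi_order1 pdI1 opprD; exact.
Qed.

End HolderDecay.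

(* Without such a pair the second supremum in [holder_norm] would be taken over the
   empty set, and the norm would be -oo whatever the first sum is. *)
Lemma exterior_far (R : realType) (n : nat) (Omega : set 'rV[R]_n) (i : 'I_n) :
  bounded_set Omega -> exists z : 'rV[R]_n * 'rV[R]_n,
    [/\ (~` Omega) z.1, (~` Omega) z.2 & 0 < enorm (z.1 - z.2) <= enorm z.1 / 2].
Proof.
move=> [M [_ hM]].
pose t := `|M| + 2.
have Mt : M < t - 1 by rewrite /t; have := ler_norm M; lra.
have t2 : 2 <= t by rewrite /t lerDr.
have out (u : R) : t <= u -> (~` Omega) (u *: basis_vec R i).
  move=> tu Ou; have : `|u *: basis_vec R i| <= t - 1 := hM _ Mt _ Ou.
  apply/negP; rewrite -ltNge.
  have := normr_coord_le (u *: basis_vec R i) i.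
  rewrite mxE basis_vecE eqxx mulr1; apply: lt_le_trans.
  by rewrite gtr0_norm; lra.
exists (t *: basis_vec R i, (t + 1) *: basis_vec R i); split; [exact: out|by apply: out; lra|].
by rewrite -scalerBl !enorm_basis opprD addNKr normrN1 ltr01 /= ger0_norm; lra.
Qed.

Theorem corollary8 (R : realType) (n : nat) (alpha q : R)
    (Omega Sigma : set 'rV[R]_n) :
  (3 <= n)%N ->
  0 < alpha < 1 ->
  (n%:R - 2) / 2 < q < n%:R - 2 ->
  open Omega ->
  bounded_set Omega ->
  Sigma = frontier Omega ->
  Sigma = frontier (closure Omega) ->
  smooth_hypersurface Sigma ->
  connected Sigma ->
  star_shaped Omega Sigma ->
  static_regular Omega Sigma alpha q.
Proof.
move=> n3 _ /andP[q1 _] oOm bOm SE _ smS _ [x0 star] E h v hsym hh hv dric lap htan dH.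
move=> p X Y Sp TX TY.
(* This is where n >= 3 enters: it makes (n - 2) / 2 positive. *)
have q0 : 0 < q.
  by apply: lt_trans q1; rewrite divr_gt0 // subr_gt0 ltr_nat.
have Sigma0 : Sigma !=set0 by exists p.
have [rho G] : exists rho, gauge Omega Sigma x0 rho.
  apply: gauge_exists => // x Sx; rewrite -(form_ebar x); exact: star.
have [Lam LamP] := integral_exists R n.
have far := exterior_far (Ordinal (ltnW (ltnW n3))) bOm.
have hUC i j : UC (~` Omega) 2 (fun y => h y i j) := Ck_UC (hh i j).1.1.
have vUC : UC (~` Omega) 2 v := Ck_UC hv.1.1.
apply: (DA_zero G oOm hUC hsym _ dH LamP vUC _ _ q0 q1 _ _ _ _ Sp TX TY).
- move=> y Z W Sy NZ NW; apply: htan => //; exact/(gauge_tangent G _ Sy).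
- move=> i j x Ex; rewrite -(DRic_interior hUC Ex) -(hess_interior Ex _ _ vUC).
  by apply/eqP; rewrite -subr_eq0; apply/eqP; apply: dric; exact: interior_subset.
- by move=> x Ex; rewrite -(laplace_interior Ex vUC); apply: lap; exact: interior_subset.
- by move=> i j; exact: (holder_growth0 far (hh i j)).
- by move=> a i j; exact: (holder_growth1 far a (hh i j)).
- exact: (holder_growth0 far hv).
- by move=> a; exact: (holder_growth1 far a hv).
Qed.
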